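(* Assume $\mathfrak g_{\mathbb C}^{ss}$ is simple and $(\mu+\mu^* )(E_{ss})=1$. Then the irreducible real Lie algebra Hodge representations with Hodge numbers $\mathbf h_\phi=(1,a,a,1)$, $a$ a positive integer, are precisely those given by the following tuples $(\mathfrak g_{\mathbb C}^{ss},E_{ss},\mu,c)$: (1) $(\mathfrak{sl}(r+1,\mathbb C),A^1,\omega_1,\frac{r+3}{2(r+1)})$, $r\ge1$, with $\mathbf h_\phi=(1,r,r,1)=(1,r,0,0)+(0,0,r,1)$ and $\mathfrak g_{\mathbb R}^{ss}=\mathfrak{su}(1,r)$. It is complex with respect to $\mathfrak g_{\mathbb R}$; with respect to $\mathfrak g_{\mathbb R}^{ss}$ it is real when $r=1$ and complex otherwise. (2) $(\mathfrak{sl}(r+1,\mathbb C),A^r,\omega_r,\frac{r+3}{2(r+1)})$, $r\ge1$, with $\mathbf h_\phi=(1,r,r,1)$ and $\mathfrak g_{\mathbb R}^{ss}=\mathfrak{su}(r,1)$. It is complex with respect to $\mathfrak g_{\mathbb R}$; with respect to $\mathfrak g_{\mathbb R}^{ss}$ it is real when $r=1$ and complex otherwise.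
   Context: **Hodge representations.** A real Lie group Hodge representation $(G,\rho,\phi)$ of weight $n$ consists of a reductive $\mathbb R$-algebraic group $G$, a faithful representation $\rho:G\to\mathrm{Aut}(V_{\mathbb R},Q)$ on a finite-dimensional real vector space with a non-degenerate bilinear form $Q$, $Q(u,v)=(-1)^nQ(v,u)$, and a non-constant homomorphism $\phi:S^1\to G$ of real algebraic groups such that $\rho\phi(-1)=(-1)^n$ and, writing $V_{\mathbb C}=\bigoplus_{p+q=n}V^{p,q}$ with $V^{p,q}=\{v:\rho\phi(z)v=z^{p-q}v\ \forall z\in S^1\}$, one has $Q(V^{p,q},V^{r,s})=0$ unless $q=r,p=s$, and $Q(v,\rho\phi(i)\bar v)>0$ for $v\neq0$ (the polarization condition). The corresponding real Lie algebra Hodge representation is $(\mathfrak g_{\mathbb R},E,V_{\mathbb R})$, where $\mathfrak g_{\mathbb R}=\mathrm{Lie}(G)$ and $E=L_\phi/(4\pi i)\in i\mathfrak g_{\mathbb R}$, $L_\phi$ being the derivative of $t\mapsto\phi(e^{2\pi i t})$ at $0$; $E$ acts on $V^{p,q}$ as $(p-q)/2$. It is irreducible if $V_{\mathbb R}$ is an irreducible $\mathfrak g_{\mathbb R}$-representation. Let $V_l$ be the $l$-eigenspace of $E$ on $V_{\mathbb C}$. Hodge numbers $\mathbf h_\phi=(1,a,a,1)$ (''level 3, CY 3-fold type'') means $V_{\mathbb C}=V_{3/2}\oplus V_{1/2}\oplus V_{-1/2}\oplus V_{-3/2}$ with summands of dimensions $1,a,a,1$. **Tuples.** Let $\mathfrak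 g_{\mathbb C}=\mathfrak g_{\mathbb R}\otimes\mathbb C=\mathfrak g_{\mathbb C}^{ss}\oplus\mathfrak z$ (semisimple part plus center) and $E=E_{ss}+E'$ accordingly. Fix a Cartan subalgebra containing $E$ and simple roots $\alpha_1,\dots,\alpha_r$ of $\mathfrak g^{ss}_{\mathbb C}$ (Bourbaki labelling), with fundamental weights $\omega_i$ and dual basis $A^i$, $\alpha_j(A^i)=\delta_{ij}$. Throughout it is assumed that $\alpha_i(E_{ss})\in\{0,1\}$ for all $i$. For $V_{\mathbb R}$ irreducible there is an irreducible $\mathfrak g_{\mathbb C}$-representation $U$, with highest weight $\mu$ on $\mathfrak g_{\mathbb C}^{ss}$ (and $\mu^*$ the highest weight of $U^*$), such that $V_{\mathbb C}=U$ with $U\cong U^*$ ($U$ is *real* ), or $V_{\mathbb C}=U\oplus U^*$ with $U\not\cong U^*$ ($U$ is *complex* ), or $V_{\mathbb C}=U\oplus U^*$ with $U\cong U^*$ ($U$ is *quaternionic* ). The type ''with respect to $\mathfrak g_{\mathbb R}$'' uses $U$ as a $\mathfrak g_{\mathbb C}$-representation and ''with respect to $\mathfrak g_{\mathbb R}^{ss}$'' uses it as a $\mathfrak g_{\mathbb C}^{ss}$-representation. $E'$ acts on $U$ as a scalar $c\in\mathbb Q$ and on $U^*$ as $-c$; $c=0$ when $U$ is real or quaternionic with respect to $\mathfrak g_{\mathbb R}$, and $c=\frac32-\mu(E_{ss})$ when $U$ is complex (this normalizes the choice between $U$ and $U^*$). If $c\ne0$ then $\mathfrak g_{\mathbb R}=\mathfrak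 g_{\mathbb R}^{ss}\oplus\mathbb R$, otherwise $\mathfrak g_{\mathbb R}=\mathfrak g_{\mathbb R}^{ss}$. The real form $\mathfrak g_{\mathbb R}^{ss}$ of $\mathfrak g_{\mathbb C}^{ss}$ is the one whose maximal compact subalgebra has complexification the sum of the even eigenspaces of $\mathrm{ad}\,E_{ss}$. The data $(\mathfrak g_{\mathbb C}^{ss},E_{ss},\mu,c)$ is the tuple giving the Hodge representation. An expression $\mathbf h_\phi=(\cdot)+(\cdot)$ records the contributions of $U$ and $U^*$. *)

(* Defs.v *)
From HB Require Import structures.
From mathcomp Require Import all_boot all_order all_algebra.
From mathcomp Require Import all_classical all_reals all_analysis.
From mathcomp Require Import complex.
From mathcomp Require mpoly.

Set Implicit Arguments.
Unset Strict Implicit.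
Unset Printing Implicit Defensive.

Import Order.TTheory GRing.Theory Num.Theory.
Import numFieldNormedType.Exports.

Local Open Scope classical_set_scope.
Local Open Scope ring_scope.
Local Open Scope complex_scope.

(** * Lie subalgebras of matrix algebras *)

Definition lie (K : pzRingType) (m : nat) (X Y : 'M[K]_m) : 'M[K]_m :=
  X *m Y - Y *m X.

(* For a reductive Lie algebra, [derived g] is the semisimple part. *)
Definition derived (K : fieldType) (m : nat) (g : {vspace 'M[K]_m}) :
    {vspace 'M[K]_m} :=
  <<[seq lie X Y | X <- vbasis g, Y <- vbasis g]>>%VS.

Definition lie_center (K : fieldType) (m : nat) (g : {vspace 'M[K]_m}) :
    {vspace 'M[K]_m} :=
  (g :&: \bigcap_(X <- vbasis g) lker (linfun (lie X)))%VS.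

Definition simple_lie (K : fieldType) (m : nat) (g : {vspace 'M[K]_m}) : Prop :=
  (exists X Y, [/\ X \in g, Y \in g & lie X Y <> 0]) /\
  forall I : {vspace 'M[K]_m}, (I <= g)%VS ->
    (forall X Y, X \in g -> Y \in I -> lie X Y \in I) ->
    I = 0%VS \/ I = g.

Definition lie_iso (K : fieldType) (m n : nat)
    (g : {vspace 'M[K]_m}) (k : {vspace 'M[K]_n}) : Prop :=
  exists f : 'Hom('M[K]_m, 'M[K]_n),
    [/\ forall X Y, X \in g -> Y \in g -> f (lie X Y) = lie (f X) (f Y),
        (g :&: lker f = 0)%VS & (f @: g = k)%VS].

Definition sl (K : fieldType) (n : nat) : {vspace 'M[K]_n} :=
  lker (linfun (mxtrace : 'M[K]_n -> K^o)).

(** * Cartan subalgebras, simple roots, Bourbaki labelling *)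

Definition ad_diagonalizable (K : fieldType) (m : nat)
    (g : {vspace 'M[K]_m}) (X : 'M[K]_m) : Prop :=
  exists b : seq 'M[K]_m, basis_of g b /\
    forall Y, Y \in b -> exists a : K, lie X Y = a *: Y.

Definition toral (K : fieldType) (m : nat) (g h : {vspace 'M[K]_m}) : Prop :=
  [/\ (h <= g)%VS,
      forall X Y, X \in h -> Y \in h -> lie X Y = 0 &
      forall X, X \in h -> ad_diagonalizable g X].

(* Used for reductive Lie algebras over an algebraically closed field of
   characteristic 0. *)
Definition cartan_subalgebra (K : fieldType) (m : nat)
    (g h : {vspace 'M[K]_m}) : Prop :=
  toral g h /\
  forall h' : {vspace 'M[K]_m}, (h <= h')%VS -> toral g h' -> h' = h.

Definition dual (K : fieldType) (m : nat) (h : {vspace 'M[K]_m}) :=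
  'Hom(subvs_of h, K^o).

Definition root_space (K : fieldType) (m : nat) (s h : {vspace 'M[K]_m})
    (a : dual h) (X : 'M[K]_m) : Prop :=
  X \in s /\ forall H : subvs_of h, lie (vsval H) X = (a H : K) *: X.

Definition is_root (K : fieldType) (m : nat) (s h : {vspace 'M[K]_m})
    (a : dual h) : Prop :=
  a <> 0 /\ exists X, X <> 0 /\ root_space s a X.

Definition simple_roots (K : fieldType) (m : nat) (s h : {vspace 'M[K]_m})
    (l : nat) (alpha : l.-tuple (dual h)) : Prop :=
  [/\ forall i, is_root s (tnth alpha i),
      basis_of fullv alpha &
      forall b : dual h, is_root s b ->
        exists k : 'I_l -> nat,
          b = \sum_i tnth alpha i *+ k i \/
          b = - \sum_i tnth alpha i *+ k i].

Definition is_coroot (K : fieldType) (m : nat) (s h : {vspace 'M[K]_m})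
    (a : dual h) (H : subvs_of h) : Prop :=
  a H = 2%:R /\
  exists X Y, [/\ root_space s a X, root_space s (- a) Y & vsval H = lie X Y].

Inductive dynkin :=
  | TypeA of nat | TypeB of nat | TypeC of nat | TypeD of nat
  | TypeE of nat | TypeF4 | TypeG2.

Definition dynkin_valid (X : dynkin) : bool :=
  match X with
  | TypeA l => 1 <= l
  | TypeB l => 2 <= l
  | TypeC l => 3 <= l
  | TypeD l => 4 <= l
  | TypeE l => 6 <= l <= 8
  | TypeF4 | TypeG2 => true
  end%N.

Definition dynkin_rank (X : dynkin) : nat :=
  match X with
  | TypeA l | TypeB l | TypeC l | TypeD l | TypeE l => l
  | TypeF4 => 4
  | TypeG2 => 2
  end.

(* Edges {i, j} with i < j; nodes are numbered from 1, as in Bourbaki. *)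
Definition dynkin_edge (X : dynkin) (i j : nat) : bool :=
  match X with
  | TypeD l => ((j == i.+1) && (j < l)) || ((i.+2 == l) && (j == l))
  | TypeE _ => [|| (i == 1) && (j == 3), (i == 2) && (j == 4) |
                   (3 <= i) && (j == i.+1)]
  | _ => j == i.+1
  end%N.

(* Squared length of the i-th simple root, short roots having length 1. *)
Definition dynkin_length (X : dynkin) (i : nat) : nat :=
  match X with
  | TypeB l => if i == l then 1 else 2
  | TypeC l => if i == l then 2 else 1
  | TypeF4 => if i <= 2 then 2 else 1
  | TypeG2 => if i == 1 then 1 else 3
  | _ => 1
  end%N.

(* The Cartan integer n(alpha_i, alpha_j) = alpha_i(alpha_j^vee); for adjacent
   nodes it is -1 if alpha_i is at most as long as alpha_j, and otherwise
   minus the ratio of the squared lengths. *)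
Definition cartan_integer (X : dynkin) (i j : nat) : int :=
  if i == j then 2%:Z
  else if dynkin_edge X (minn i j) (maxn i j) then
    - (maxn 1 (dynkin_length X i %/ dynkin_length X j))%:Z
  else 0.

(* The i-th component of the tuples is the simple root (coroot) with Bourbaki
   label i + 1. *)
Definition bourbaki_labelling (K : fieldType) (m : nat)
    (h : {vspace 'M[K]_m}) (l : nat)
    (alpha : l.-tuple (dual h)) (alphav : l.-tuple (subvs_of h)) : Prop :=
  exists X : dynkin,
    [/\ dynkin_valid X, dynkin_rank X = l &
        forall i j : 'I_l,
          tnth alpha i (tnth alphav j) = (cartan_integer X i.+1 j.+1)%:~R].

(* H = A^k, with 1 <= k <= l *)
Definition is_dual_basis_elt (K : fieldType) (m : nat)
    (h : {vspace 'M[K]_m}) (l : nat)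
    (alpha : l.-tuple (dual h)) (k : nat) (H : subvs_of h) : Prop :=
  forall j : 'I_l, tnth alpha j H = (j.+1 == k)%:R.

(* mu = omega_k, with 1 <= k <= l *)
Definition is_fundamental_weight (K : fieldType) (m : nat)
    (h : {vspace 'M[K]_m}) (l : nat)
    (alphav : l.-tuple (subvs_of h)) (k : nat) (mu : dual h) : Prop :=
  forall j : 'I_l, mu (tnth alphav j) = (j.+1 == k)%:R.

(** * Representations on column vectors *)

(* Representations of g are matrix-valued functions of which only the
   restriction to g is relevant. *)
Definition is_rep (K : fieldType) (m d : nat) (g : {vspace 'M[K]_m})
    (rho : 'M[K]_m -> 'M[K]_d) : Prop :=
  (forall (a : K) X Y, X \in g -> Y \in g -> rho (a *: X + Y) = a *: rho X + rho Y)
  /\ (forall X Y, X \in g -> Y \in g -> rho (lie X Y) = lie (rho X) (rho Y)).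

Definition irreducible_rep (K : fieldType) (m d : nat) (g : {vspace 'M[K]_m})
    (rho : 'M[K]_m -> 'M[K]_d) : Prop :=
  (0 < d)%N /\
  forall W : {vspace 'cV[K]_d},
    (forall X w, X \in g -> w \in W -> rho X *m w \in W) ->
    W = 0%VS \/ W = fullv.

Definition dual_rep (K : fieldType) (m d : nat) (rho : 'M[K]_m -> 'M[K]_d) :
    'M[K]_m -> 'M[K]_d :=
  fun X => - (rho X)^T.

Definition sum_rep (K : fieldType) (m d e : nat)
    (rho : 'M[K]_m -> 'M[K]_d) (rho' : 'M[K]_m -> 'M[K]_e) :
    'M[K]_m -> 'M[K]_(d + e) :=
  fun X => block_mx (rho X) 0 0 (rho' X).

Definition rep_iso (K : fieldType) (m d e : nat) (g : {vspace 'M[K]_m})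
    (rho : 'M[K]_m -> 'M[K]_d) (rho' : 'M[K]_m -> 'M[K]_e) : Prop :=
  exists (P : 'M[K]_(e, d)) (P' : 'M[K]_(d, e)),
    [/\ P *m P' = 1%:M, P' *m P = 1%:M &
        forall X, X \in g -> P *m rho X = rho' X *m P].

Definition is_highest_weight (K : fieldType) (m d : nat)
    (s h : {vspace 'M[K]_m}) (l : nat) (alpha : l.-tuple (dual h))
    (rho : 'M[K]_m -> 'M[K]_d) (mu : dual h) : Prop :=
  exists v : 'cV[K]_d,
    [/\ v <> 0,
        forall H : subvs_of h, rho (vsval H) *m v = (mu H : K) *: v &
        forall i X, root_space s (tnth alpha i) X -> rho X *m v = 0].

(** * Complexification and the type of a representation *)

Definition mxC (R : realType) (m n : nat) (A : 'M[R]_(m, n)) :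
    'M[R[i]]_(m, n) :=
  map_mx (real_complex R) A.

Definition mx_conj (R : realType) (m n : nat) (A : 'M[R[i]]_(m, n)) :
    'M[R[i]]_(m, n) :=
  map_mx Num.conj A.

Definition complexify (R : realType) (m : nat) (g : {vspace 'M[R]_m}) :
    {vspace 'M[R[i]]_m} :=
  <<[seq mxC X | X <- vbasis g]>>%VS.

(* X + i Y |-> sigma X + i sigma Y *)
Definition complexify_rep (R : realType) (m d : nat)
    (sigma : 'M[R]_m -> 'M[R]_d) : 'M[R[i]]_m -> 'M[R[i]]_d :=
  fun Z => mxC (sigma (map_mx (@complex.Re R) Z))
           + ('i%C : R[i]) *: mxC (sigma (map_mx (@complex.Im R) Z)).

Inductive rep_type := RealType | ComplexType | QuaternionicType.

Definition has_type (R : realType) (m e d : nat) (g : {vspace 'M[R]_m})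
    (sigma : 'M[R]_m -> 'M[R]_e) (rho : 'M[R[i]]_m -> 'M[R[i]]_d)
    (tau : rep_type) : Prop :=
  let gC := complexify g in
  let VC := complexify_rep sigma in
  match tau with
  | RealType => rep_iso gC VC rho /\ rep_iso gC rho (dual_rep rho)
  | ComplexType =>
      rep_iso gC VC (sum_rep rho (dual_rep rho)) /\ ~ rep_iso gC rho (dual_rep rho)
  | QuaternionicType =>
      rep_iso gC VC (sum_rep rho (dual_rep rho)) /\ rep_iso gC rho (dual_rep rho)
  end.

Definition has_type_wrt (R : realType) (m d : nat) (g : {vspace 'M[R]_m})
    (rho : 'M[R[i]]_m -> 'M[R[i]]_d) (tau : rep_type) : Prop :=
  exists (e : nat) (sigma : 'M[R]_m -> 'M[R]_e),
    [/\ is_rep g sigma, irreducible_rep g sigma & has_type g sigma rho tau].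

(** * su(p, q) *)

Definition su_form (R : realType) (p q : nat) : 'M[R[i]]_(p + q) :=
  block_mx 1%:M 0 0 (- 1%:M).

Definition in_su (R : realType) (p q : nat) (X : 'M[R[i]]_(p + q)) : Prop :=
  (mx_conj X)^T *m su_form R p q + su_form R p q *m X = 0 /\ \tr X = 0.

(* Isomorphism of real Lie algebras of g with su(p, q). *)
Definition iso_su (R : realType) (m : nat) (g : {vspace 'M[R]_m})
    (p q : nat) : Prop :=
  exists f : 'M[R]_m -> 'M[R[i]]_(p + q),
    [/\ forall (a : R) X Y, X \in g -> Y \in g ->
          f (a *: X + Y) = a%:C *: f X + f Y,
        forall X Y, X \in g -> Y \in g -> f (lie X Y) = lie (f X) (f Y),
        forall X, X \in g -> f X = 0 -> X = 0 &
        forall Z, in_su Z <-> exists2 X, X \in g & f X = Z].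

(** * Hodge representations *)

(* Real linear algebraic groups are Zariski closed subgroups of GL_m(R). *)
Definition algebraic_group (R : realType) (m : nat) (G : set 'M[R]_m) : Prop :=
  [/\ exists S : set (mpoly.mpoly (m * m) R),
        forall g, G g <->
          g \in unitmx /\
          forall p, S p -> mpoly.meval (fun k => mxvec g 0 k) p = 0,
      G 1%:M,
      forall g h, G g -> G h -> G (g *m h) &
      forall g, G g -> G (invmx g)].

(* The unipotent radical is trivial; in characteristic 0, unipotent groups are
   connected. *)
Definition reductive_group (R : realType) (m : nat) (G : set 'M[R]_m) : Prop :=
  algebraic_group G /\
  forall N : set 'M[R]_m,
    algebraic_group N -> N `<=` G ->
    (forall g n, G g -> N n -> N (g *m n *m invmx g)) ->
    (forall n, N n -> exists k, iter k (mulmx (n - 1%:M)) 1%:M = 0) ->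
    N = [set 1%:M].

(* Velocities at the identity of the curves in G. *)
Definition lie_algebra_of (R : realType) (m : nat) (G : set 'M[R]_m)
    (X : 'M[R]_m) : Prop :=
  exists gamma : R -> 'M[R]_m,
    [/\ forall t, G (gamma t), gamma 0 = 1%:M &
        forall i j, is_derive (0 : R) 1 (fun t => gamma t i j) (X i j)].

(* The circle group is {z : R[i] | |z| = 1}; phi matters only there. *)
Definition circle_hom (R : realType) (m : nat) (G : set 'M[R]_m)
    (phi : R[i] -> 'M[R]_m) : Prop :=
  [/\ forall z, `|z| = 1 -> G (phi z),
      forall z w, `|z| = 1 -> `|w| = 1 -> phi (z * w) = phi z *m phi w &
      forall i j, exists P : {poly {poly R}},
        forall z, `|z| = 1 -> phi z i j = P.[(complex.Im z)%:P].[complex.Re z]].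

(* The complex bilinear extension of (u, v) |-> u^T Q v. *)
Definition bilin (R : realType) (m : nat) (Q : 'M[R]_m) (u v : 'cV[R[i]]_m) :
    R[i] :=
  (u^T *m mxC Q *m v) 0 0.

Definition hodge_piece (R : realType) (m : nat) (phi : R[i] -> 'M[R]_m)
    (p q : int) (v : 'cV[R[i]]_m) : Prop :=
  forall z : R[i], `|z| = 1 -> mxC (phi z) *m v = z ^ (p - q) *: v.

(* Since rho is faithful, G is identified with its image in GL(V_R), where
   V_R = R^m. *)
Record group_hodge_rep (R : realType) (m : nat) (n : int) (Q : 'M[R]_m)
    (G : set 'M[R]_m) (phi : R[i] -> 'M[R]_m) : Prop := GroupHodgeRep {
  ghr_reductive : reductive_group G;
  ghr_nondegenerate : Q \in unitmx;
  ghr_parity : Q = (-1) ^ n *: Q^T;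
  ghr_isometry : forall g, G g -> g^T *m Q *m g = Q;
  ghr_hom : circle_hom G phi;
  ghr_nonconstant :
    exists z w : R[i], [/\ `|z| = 1, `|w| = 1 & phi z <> phi w];
  ghr_weight : phi (-1) = ((-1) ^ n)%:M;
  ghr_decomposition : forall v : 'cV[R[i]]_m,
    exists (s : seq int) (w : int -> 'cV[R[i]]_m),
      (forall p, hodge_piece phi p (n - p) (w p)) /\ v = \sum_(p <- s) w p;
  ghr_orthogonality : forall (p q r s : int) (u v : 'cV[R[i]]_m),
    p + q = n -> r + s = n -> hodge_piece phi p q u -> hodge_piece phi r s v ->
    ~ (q = r /\ p = s) -> bilin Q u v = 0;
  ghr_positivity : forall v : 'cV[R[i]]_m, v <> 0 ->
    0 < bilin Q v (mxC (phi 'i%C) *m mx_conj v)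
}.

(* L_phi / (4 pi i), L_phi being the derivative at 0 of t |-> phi(e^(2 pi i t)) *)
Definition is_grading_element (R : realType) (m : nat) (phi : R[i] -> 'M[R]_m)
    (E : 'M[R[i]]_m) : Prop :=
  exists L : 'M[R]_m,
    (forall i j, is_derive (0 : R) 1
       (fun t => phi (cos (2%:R * pi * t) +i* sin (2%:R * pi * t)) i j) (L i j))
    /\ E = (4%:R * (pi : R)%:C * 'i%C)^-1 *: mxC L.

Definition lie_hodge_rep (R : realType) (m : nat) (g : {vspace 'M[R]_m})
    (E : 'M[R[i]]_m) : Prop :=
  exists (n : int) (Q : 'M[R]_m) (G : set 'M[R]_m) (phi : R[i] -> 'M[R]_m),
    [/\ group_hodge_rep n Q G phi,
        forall X, X \in g <-> lie_algebra_of G X &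
        is_grading_element phi E].

(* V = V_{3/2} + V_{1/2} + V_{-1/2} + V_{-3/2} with summands of dimensions
   a, b, c, d, where V_l is the l-eigenspace of M on column vectors. *)
Definition hodge_numbers (F : fieldType) (d : nat) (M : 'M[F]_d)
    (h0 h1 h2 h3 : nat) : Prop :=
  let V (x : F) := eigenspace M^T x in
  [/\ \rank (V (3%:R / 2%:R)) = h0, \rank (V (1 / 2%:R)) = h1,
      \rank (V (- (1 / 2%:R))) = h2, \rank (V (- (3%:R / 2%:R))) = h3 &
      (V (3%:R / 2%:R) + V (1 / 2%:R) + V (- (1 / 2%:R))
         + V (- (3%:R / 2%:R)) :=: 1%:M)%MS].

(* An irreducible Lie algebra Hodge representation (g_R, E, V_R = R^m), with the
   choices its tuple depends on. *)
Record hodge_datum (R : realType) := HodgeDatum {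
  hd_m : nat;
  hd_g : {vspace 'M[R]_hd_m};
  hd_E : 'M[R[i]]_hd_m;
  hd_hodge : lie_hodge_rep hd_g hd_E;
  hd_irreducible : irreducible_rep hd_g id;

  hd_t : {vspace 'M[R[i]]_hd_m};
  hd_cartan : cartan_subalgebra (complexify hd_g) hd_t;
  hd_E_cartan : hd_E \in hd_t;

  (* g_C^ss and its Cartan subalgebra *)
  hd_ss := derived (complexify hd_g);
  hd_h := (hd_t :&: hd_ss)%VS;

  hd_Ess : subvs_of hd_h;
  hd_E' : 'M[R[i]]_hd_m;
  hd_E'_center : hd_E' \in lie_center (complexify hd_g);
  hd_E_split : hd_E = vsval hd_Ess + hd_E';

  hd_rank : nat;
  hd_alpha : hd_rank.-tuple (dual hd_h);
  hd_alphav : hd_rank.-tuple (subvs_of hd_h);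
  hd_simple_roots : simple_roots hd_ss hd_alpha;
  hd_coroots : forall i, is_coroot hd_ss (tnth hd_alpha i) (tnth hd_alphav i);
  hd_bourbaki : bourbaki_labelling hd_alpha hd_alphav;
  hd_alpha_Ess : forall i,
    tnth hd_alpha i hd_Ess = 0 \/ tnth hd_alpha i hd_Ess = 1;

  (* the representation U of g_C and its type with respect to g_R *)
  hd_d : nat;
  hd_U : 'M[R[i]]_hd_m -> 'M[R[i]]_hd_d;
  hd_U_rep : is_rep (complexify hd_g) hd_U;
  hd_U_irreducible : irreducible_rep (complexify hd_g) hd_U;
  hd_tau : rep_type;
  hd_U_type : has_type hd_g id hd_U hd_tau;

  hd_mu : dual hd_h;
  hd_mu_star : dual hd_h;
  hd_mu_highest : is_highest_weight hd_ss hd_alpha hd_U hd_mu;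
  hd_mu_star_highest : is_highest_weight hd_ss hd_alpha (dual_rep hd_U) hd_mu_star;

  hd_c : rat;
  hd_E'_U : hd_U hd_E' = (ratr hd_c)%:M;
  hd_c_normalized :
    match hd_tau with
    | ComplexType => ratr hd_c = 3%:R / 2%:R - (hd_mu hd_Ess : R[i])
    | _ => hd_c = 0
    end;
  (* g_R = g_R^ss + R if c <> 0, and g_R = g_R^ss otherwise *)
  hd_center : \dim (lie_center hd_g) = (hd_c != 0)
}.

Arguments hd_U {R} h _ : rename.

(* The tuple is (sl(r+1, C), A^k, omega_k, (r+3)/(2(r+1))). *)
Definition has_sl_tuple (R : realType) (D : hodge_datum R) (r k : nat) : Prop :=
  [/\ lie_iso (hd_ss D) (sl R[i] r.+1),
      is_dual_basis_elt (hd_alpha D) k (hd_Ess D),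
      is_fundamental_weight (hd_alphav D) k (hd_mu D) &
      hd_c D = (r + 3)%:R / (2 * (r + 1))%:R].

(* The assertions on types common to the two families: complex with respect to
   g_R; with respect to g_R^ss, real if r = 1 and complex otherwise. *)
Definition sl_tuple_types (R : realType) (D : hodge_datum R) (r : nat) : Prop :=
  has_type (hd_g D) id (hd_U D) ComplexType /\
  has_type_wrt (derived (hd_g D)) (hd_U D)
    (if r == 1%N then RealType else ComplexType).

(* The assumptions: g_C^ss is simple, and mu + mu^* takes the
   value 1 at E_ss. *)
Definition simple_level_one (R : realType) (D : hodge_datum R) : Prop :=
  simple_lie (hd_ss D) /\ (hd_mu D + hd_mu_star D) (hd_Ess D) = 1.

(* Main.v *)
Require Import Defs.
From HB Require Import structures.
From mathcomp Require Import all_boot all_order all_algebra.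
From mathcomp Require Import all_classical all_reals all_analysis.
From mathcomp Require Import complex.
From mathcomp Require Import ring lra zify.

(** Write [M] for the action of the grading element [E] on [U].

    Spectrum.  [U] is generated from a highest weight vector by lowering
    operators, and each of them lowers the eigenvalue of [E] by a natural number
    because the simple roots take the values 0 and 1 on [E_ss].  So the
    eigenvalues of [M] lie in [mu(E_ss) + c - N], and those of [E] on the dual of
    [U] lie in [mu_star(E_ss) - c - N] ([hw_spectrum]).  If [U] is real or
    quaternionic then [c = 0] and [U] is self-dual, so the two top eigenvalues
    coincide; as they add up to 1 they are 1/2, and 3/2 does not occur
    ([noncomplex_nul]).  If [U] is complex the normalization of [c] makes the two
    top eigenvalues 3/2 and -1/2, so 3/2 and 1/2 are the only eigenvalues of [M]
    ([two_step]).  Hence the Hodge numbers are (1,a,a,1) exactly when the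
    3/2-eigenspace of [M] is a line, that is, when [M = 1/2 + v xi] with
    [xi v = 1].

    From the line to the tuple ([tuple_of_line]).  Brackets of this rank one
    operator with the irreducible image of [g_C] produce all traceless matrices
    ([sl_image]); as [g_C^ss] is simple it is isomorphic to [sl(d)].  In a basis
    that diagonalizes the Cartan subalgebra the roots are differences
    [e_i - e_j] of diagonal entries, and [E_ss] is, up to a scalar summand, the
    projection on one coordinate [i0].  A simple root takes the value 1 on
    [E_ss] if it is some [e_i0 - e_j], and no simple root is an [e_i - e_i0];
    then the node of the root that starts at [i0] is an end of the diagram,
    which has type A ([chain_end]).

    From the tuple to the line ([line_of_tuple]).  The simple root vectors of
    negative degree 0 kill the highest weight vector [v], because [mu] vanishes
    on their coroots.  So [v] and the vectors [Y v] with [[E, Y] = - Y] span a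
    submodule, hence [U], and the 3/2-eigenspace is the line of [v].

    The real form ([iso_su_model]).  The polarization restricted to [U] gives a
    Hermitian form, invariant under [g_R], that is positive on the line of [v]
    and negative on the 1/2-eigenspace.  So [g_R^ss] lies in a copy of
    [su(1, r)], and it is all of it since its complexification is [sl(r+1)].

    Types.  For [r > 1] the eigenvalues of [E_ss] on [U] and on its dual are four
    different numbers, so a subspace stable under [g_R^ss] splits accordingly
    and is stable under the centre; this gives irreducibility
    ([derived_irreducible]) and [U] is not self-dual.  For [r = 1] a Cayley
    transform turns [su(1,1)] into [sl(2, R)] ([ss_type_real]).

    Existence ([unitary_datum]).  The group [U(1, r)] acting on [R^(2(r+1))],
    with [z |-> diag(z^3, z, ..., z)], realizes the first tuple, and the second
    one after reversing the labelling of the simple roots. *)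

Set Implicit Arguments.
Unset Strict Implicit.
Unset Printing Implicit Defensive.

Import Order.TTheory GRing.Theory Num.Theory.

Local Open Scope ring_scope.

(** * Linear predicates and sums of eigenvectors *)

Section LinearPredicates.
Variables (K : fieldType) (V : lmodType K).
Implicit Types (P Q : V -> Prop).

(** Subspaces are handled as predicates: most submodules below are described
    by properties, and [vspace_of_pred] turns them into spaces when a
    dimension is needed. *)
Definition lin_pred P := P 0 /\ forall a x y, P x -> P y -> P (a *: x + y).

Lemma lin_predD P x y : lin_pred P -> P x -> P y -> P (x + y).
Proof. by case=> _ h px py; rewrite -[x]scale1r; apply: h. Qed.

Lemma lin_predZ P a x : lin_pred P -> P x -> P (a *: x).
Proof. by case=> h0 h px; rewrite -[_ *: _]addr0; apply: h. Qed.

Lemma lin_predN P x : lin_pred P -> P x -> P (- x).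
Proof. by move=> hP px; rewrite -scaleN1r; apply: lin_predZ. Qed.

Lemma lin_predB P x y : lin_pred P -> P x -> P y -> P (x - y).
Proof. by move=> hP px py; apply: lin_predD => //; apply: lin_predN. Qed.

Lemma lin_pred_sum P (I : Type) (r : seq I) (C : pred I) (F : I -> V) :
  lin_pred P -> (forall i, C i -> P (F i)) -> P (\sum_(i <- r | C i) F i).
Proof.
move=> hP hF; apply: (big_ind P) => //; first by case: hP.
by move=> x y; apply: lin_predD.
Qed.

(** The additive span. When [Q] is closed under scaling it is the linear
    span, without coefficients to carry along. *)
Inductive aspan Q : V -> Prop :=
| aspan0 : aspan Q 0
| aspanD x y : Q x -> aspan Q y -> aspan Q (x + y).

Lemma aspan_add Q x y : aspan Q x -> aspan Q y -> aspan Q (x + y).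
Proof.
by elim=> [|u v qu _ IH] hy; rewrite ?add0r // -addrA; apply: aspanD; auto.
Qed.

Lemma aspan1 Q x : Q x -> aspan Q x.
Proof. by move=> qx; rewrite -[x]addr0; apply: aspanD => //; apply: aspan0. Qed.

Lemma aspan_bind Q Q' x :
  (forall y, Q y -> aspan Q' y) -> aspan Q x -> aspan Q' x.
Proof.
move=> h; elim=> [|u v qu _ IH]; first exact: aspan0.
by apply: aspan_add => //; apply: h.
Qed.

Lemma aspan_mono Q Q' x : (forall y, Q y -> Q' y) -> aspan Q x -> aspan Q' x.
Proof. by move=> h; apply: aspan_bind => y /h /aspan1. Qed.

Lemma aspan_lin Q :
  (forall a x, Q x -> Q (a *: x)) -> lin_pred (aspan Q).
Proof.
move=> hZ; split=> [|a x y hx hy]; first exact: aspan0.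
apply: aspan_add => //; elim: hx => [|u v qu _ IH].
  by rewrite scaler0; apply: aspan0.
by rewrite scalerDr; apply: aspanD => //; apply: hZ.
Qed.

Lemma aspan_sub P Q x :
  lin_pred P -> (forall y, Q y -> P y) -> aspan Q x -> P x.
Proof.
move=> hP h; elim=> [|u v qu _ IH]; first by case: hP.
by apply: lin_predD => //; apply: h.
Qed.

Definition eigv (f : V -> V) (x : V) := exists a, f x = a *: x.

(** The usual elimination: if [x] is a sum of eigenvectors for different
    eigenvalues, [f x - lam b x] has one component less, and the other
    components are scaled by nonzero factors. *)
Lemma eigen_components (I : eqType) (lam : I -> K) P (f : {linear V -> V})
    (s : seq I) (x : I -> V) :
  lin_pred P -> (forall y, P y -> P (f y)) -> uniq [seq lam i | i <- s] ->
  (forall i, i \in s -> f (x i) = lam i *: x i) ->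
  P (\sum_(i <- s) x i) -> forall i, i \in s -> P (x i).
Proof.
move=> hP hf; elim: s x => [//|b s IH] x /= /andP[bs us] hx hsum.
have hs a : a \in s -> P (x a).
  move=> as_.
  have h := IH (fun a => (lam a - lam b) *: x a) us.
  have ab : lam a - lam b != 0.
    by rewrite subr_eq0; apply: contraNneq bs => <-; apply: map_f.
  have -> : x a = (lam a - lam b)^-1 *: ((lam a - lam b) *: x a).
    by rewrite scalerA mulVf ?scale1r.
  apply: lin_predZ => //; apply: h => // [c cs|].
    by rewrite linearZ /= hx ?inE ?cs ?orbT // !scalerA mulrC.
  have -> : \sum_(a <- s) (lam a - lam b) *: x a =
      f (\sum_(a <- b :: s) x a) - lam b *: \sum_(a <- b :: s) x a.
    rewrite linear_sum scaler_sumr -sumrB big_cons /= hx ?mem_head // subrr add0r.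
    rewrite [LHS]big_seq [RHS]big_seq; apply: eq_bigr => c cs.
    by rewrite hx ?inE ?cs ?orbT // scalerBl.
  by apply: lin_predB => //; [apply: hf|apply: lin_predZ].
move=> a; rewrite inE => /orP[/eqP->|]; last exact: hs.
have -> : x b = \sum_(a <- b :: s) x a - \sum_(a <- s) x a.
  by rewrite big_cons addrK.
apply: lin_predB => //; rewrite big_seq; apply: lin_pred_sum => //.
Qed.

Lemma aspan_eig_sum Q (f : {linear V -> V}) y :
  lin_pred Q ->
  aspan (fun x => Q x /\ eigv f x) y ->
  exists (s : seq K) (x : K -> V),
    [/\ uniq s, forall a, Q (x a) /\ f (x a) = a *: x a & y = \sum_(a <- s) x a].
Proof.
move=> hQ; elim=> [|u v [qu [a fu]] _ [s [x [us hx ->]]]].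
  exists [::], (fun=> 0); split=> //; rewrite ?big_nil // => a.
  by rewrite linear0 scaler0; split=> //; case: hQ.
pose x' b := if b == a then u + (if a \in s then x b else 0) else x b.
have hx' b : Q (x' b) /\ f (x' b) = b *: x' b.
  rewrite /x'; case: eqP => [->|//].
  case: ifP => _; last by rewrite addr0.
  split; first by apply: lin_predD => //; case: (hx a).
  by rewrite linearD /= fu (hx a).2 scalerDr.
have hother r : a \notin r -> \sum_(b <- r) x' b = \sum_(b <- r) x b.
  move=> ar; rewrite [LHS]big_seq [RHS]big_seq; apply: eq_bigr => b br.
  by rewrite /x'; case: eqP br => // ->; rewrite (negPf ar).
case: (boolP (a \in s)) => as_.
  exists s, x'; split=> //.
  rewrite (perm_big _ (perm_to_rem as_)) [RHS](perm_big _ (perm_to_rem as_)) /=.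
  rewrite !big_cons hother ?mem_rem_uniq ?inE ?eqxx //.
  by rewrite /x' eqxx as_ addrA.
exists (a :: s), x'; split=> //=; first by rewrite as_.
by rewrite big_cons hother // /x' eqxx (negPf as_) addr0.
Qed.

Lemma aspan_eig_stable P (f : {linear V -> V}) y :
  lin_pred P -> (forall x, P x -> P (f x)) -> P y ->
  aspan (eigv f) y -> aspan (fun x => P x /\ eigv f x) y.
Proof.
move=> hP hf py hy.
have [||s [x [us hx yE]]] := @aspan_eig_sum (fun=> True) f y; first by split.
  by apply: aspan_mono hy.
have {hx}hx a : f (x a) = a *: x a by case: (hx a).
have hxP : forall a, a \in s -> P (x a).
  by apply: (eigen_components (lam := id) (f := f)) => //; rewrite ?map_id // -yE.
rewrite yE; elim: s {us yE} hxP => [|a s IH] hxP; rewrite ?big_nil ?big_cons.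
  exact: aspan0.
apply: aspanD; first by split; [apply: hxP; rewrite mem_head|exists a].
by apply: IH => b bs; apply: hxP; rewrite inE bs orbT.
Qed.

(** Induction on the family: an eigenspace of the first operator is stable
    under the others, which commute with it. *)
Lemma joint_aspan (I : eqType) (f : I -> {linear V -> V}) (r : seq I) P :
  lin_pred P -> (forall i x, i \in r -> P x -> P (f i x)) ->
  (forall i j x, i \in r -> j \in r -> P x -> f i (f j x) = f j (f i x)) ->
  (forall i x, i \in r -> P x -> aspan (eigv (f i)) x) ->
  forall x, P x -> aspan (fun x => P x /\ forall i, i \in r -> eigv (f i) x) x.
Proof.
elim: r P => [|i r IH] P hP hf hc hd x px.
  by apply: aspan1; split.
have [||s [y [us hy ->]]] := @aspan_eig_sum P (f i) x.
- exact: hP.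
- apply: aspan_eig_stable => //; first by move=> z; apply: hf; rewrite mem_head.
  by apply: hd; rewrite ?mem_head.
have ir j : j \in r -> j \in i :: r by rewrite inE orbC => ->.
elim: s {us} => [|a s IHs]; rewrite ?big_nil ?big_cons; first exact: aspan0.
apply: aspan_add IHs.
pose P' z := P z /\ f i z = a *: z.
have : aspan (fun z => P' z /\ forall j, j \in r -> eigv (f j) z) (y a).
  apply: IH => //.
  - split; first by split; [case: hP|rewrite linear0 scaler0].
    move=> c u v [pu fu] [pv fv]; split; first by case: hP => _; apply.
    by rewrite linearP fu fv scalerDr !scalerA mulrC.
  - move=> j z jr [pz fz]; split; first by apply: hf; rewrite ?ir.
    by rewrite (hc i j z (mem_head _ _) (ir _ jr) pz) fz linearZ.
  - by move=> j k z jr kr [pz _]; apply: hc; rewrite ?ir.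
  - by move=> j z jr [pz _]; apply: hd; rewrite ?ir.
apply: aspan_mono => z [[pz fz] hz]; split=> // j; rewrite inE.
by case/orP => [/eqP->|/hz //]; exists a.
Qed.

End LinearPredicates.

Section VectPredicates.
Variables (K : fieldType) (V : vectType K).

(** A maximal subspace inside [P] is all of [P]; it is reached by adding
    vectors one at a time. *)
Lemma vspace_of_pred (P : V -> Prop) :
  lin_pred P -> exists W : {vspace V}, forall x, x \in W <-> P x.
Proof.
move=> hP.
suff H n (W : {vspace V}) : (forall x, x \in W -> P x) ->
    (\dim {:V} - \dim W <= n)%N -> exists W : {vspace V}, forall x, x \in W <-> P x.
  apply: (H _ 0%VS _ (leqnn _)) => x.
  by rewrite memv0 => /eqP->; case: hP.
elim: n W => [|n IH] W hW hn.
  have hf : W = fullv.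
    apply/eqP; rewrite eqEdim subvf /=.
    by move: hn; rewrite leqn0 subn_eq0.
  by exists W => x; split; [apply: hW|rewrite hf memvf].
case: (pselect (forall x, P x -> x \in W)) => [h|/existsNP[x /not_implyP[px xW]]].
  by exists W => x; split; [apply: hW|apply: h].
apply: (IH (<[x]> + W)%VS).
  move=> z /memv_addP[u /vlineP[k ->]] [w wW ->].
  by case: hP => _; apply=> //; apply: hW.
have : (\dim W < \dim (<[x]> + W))%N.
  rewrite ltn_neqAle dimvS ?addvSr // andbT.
  apply/negP => /eqP heq; apply: xW.
  have /eqP -> : W == (<[x]> + W)%VS by rewrite eqEdim addvSr heq leqnn.
  by rewrite -[x in x \in _]addr0 memv_add ?memv_line ?mem0v.
have : (\dim (<[x]> + W) <= \dim {:V})%N by rewrite dimvS ?subvf.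
lia.
Qed.

Lemma memv_lin (W : {vspace V}) : lin_pred (fun x => x \in W).
Proof. by split=> [|a x y]; [exact: mem0v|move=> *; rewrite memvD ?memvZ]. Qed.

Lemma span_ind (P : V -> Prop) (X : seq V) x :
  lin_pred P -> (forall y, y \in X -> P y) -> x \in <<X>>%VS -> P x.
Proof.
move=> hP hs; have [W hW] := vspace_of_pred hP.
have /subvP h : (<<X>> <= W)%VS by apply/span_subvP => y /hs /hW.
by move/h/hW.
Qed.

Lemma vbasis_ind (P : V -> Prop) (W : {vspace V}) x :
  lin_pred P -> (forall y, y \in vbasis W -> P y) -> x \in W -> P x.
Proof. by move=> hP hs; rewrite -(span_basis (vbasisP W)); apply: span_ind. Qed.

Lemma free_subseq (X : seq V) :
  exists b : seq V, [/\ free b, <<b>>%VS = <<X>>%VS & {subset b <= X}].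
Proof.
elim: X => [|x X [b [fb sb bs]]]; first by exists [::]; rewrite nil_free.
case: (boolP (x \in <<X>>%VS)) => xs.
  exists b; split=> //; last by move=> y /bs; rewrite inE orbC => ->.
  by rewrite sb span_cons; apply/esym/addv_idPr; rewrite -memvE.
exists (x :: b); split; first by rewrite free_cons sb xs.
  by rewrite !span_cons sb.
by move=> y; rewrite !inE => /orP[->//|/bs->]; rewrite orbT.
Qed.

Lemma basis_of_aspan (W : {vspace V}) (Q : V -> Prop) :
  (forall x, x \in W -> aspan (fun y => y \in W /\ Q y) x) ->
  exists b : seq V, basis_of W b /\ forall y, y \in b -> Q y.
Proof.
move=> h.
have [s [hs1 hs2]] : exists X : seq V, (W <= <<X>>)%VS /\
    forall y, y \in X -> y \in W /\ Q y.
  have : forall x, x \in (vbasis W : seq V) -> x \in W by move=> x /vbasis_mem.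
  suff H (B : seq V) : (forall x, x \in B -> x \in W) -> exists X : seq V,
      (<<B>> <= <<X>>)%VS /\ forall y, y \in X -> y \in W /\ Q y.
    by move/H; rewrite (span_basis (vbasisP W)).
  elim: B => [|x B IH] hr.
    by exists [::]; rewrite span_nil sub0v.
  have [|s [hs1 hs2]] := IH; first by move=> y yr; apply: hr; rewrite inE yr orbT.
  have [s' [xs' hs']] : exists X, x \in <<X>>%VS /\
     forall y, y \in X -> y \in W /\ Q y.
    elim: (h x (hr x (mem_head _ _))) => [|u v qu _ [s' [vs' hs']]].
      by exists [::]; rewrite mem0v.
    exists (u :: s'); split; first by rewrite span_cons memv_add ?memv_line.
    by move=> y; rewrite inE => /orP[/eqP->//|/hs'].
  exists (s' ++ s); split; first by rewrite span_cons span_cat addvS // -memvE.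
  by move=> y; rewrite mem_cat => /orP[/hs'|/hs2].
have [b [fb sb bs]] := free_subseq s.
exists b; split; last by move=> y /bs /hs2 [].
rewrite basisEfree fb sb /=; apply/andP; split.
  by apply/span_subvP => y /hs2 [].
rewrite (leq_trans (dimvS hs1)) // -sb.
by move: fb; rewrite /free => /eqP->.
Qed.

End VectPredicates.

(** * Matrix Lie algebras *)

Section Lie.
Variables (K : fieldType) (m : nat).
Implicit Types (X Y Z : 'M[K]_m) (g : {vspace 'M[K]_m}).

Lemma lie_linear X : linear (lie X).
Proof.
move=> a Y Z; rewrite /lie mulmxDr mulmxDl -scalemxAr -scalemxAl.
by rewrite scalerBr opprD addrACA.
Qed.

HB.instance Definition _ X :=
  GRing.isLinear.Build K 'M[K]_m 'M[K]_m *:%R (lie X) (lie_linear X).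

Lemma lieC X Y : lie X Y = - lie Y X.
Proof. by rewrite /lie opprB. Qed.

Lemma lieDr X Y Z : lie X (Y + Z) = lie X Y + lie X Z.
Proof. exact: linearD. Qed.
Lemma lieZr X a Y : lie X (a *: Y) = a *: lie X Y.
Proof. exact: linearZ. Qed.
Lemma lieDl X Y Z : lie (X + Y) Z = lie X Z + lie Y Z.
Proof. by rewrite !(lieC _ Z) lieDr opprD. Qed.
Lemma lieZl X a Y : lie (a *: X) Y = a *: lie X Y.
Proof. by rewrite !(lieC _ Y) lieZr scalerN. Qed.
Lemma lie0r X : lie X 0 = 0.
Proof. exact: linear0. Qed.
Lemma lie0l X : lie 0 X = 0.
Proof. by rewrite lieC lie0r oppr0. Qed.
Lemma lie_jacobi X Y Z : lie X (lie Y Z) = lie (lie X Y) Z + lie Y (lie X Z).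
Proof.
rewrite /lie !(mulmxBl, mulmxBr) !mulmxA !opprB !addrA.
by apply/matrixP => i j; rewrite !mxE; ring.
Qed.

Definition lie_closed g := forall X Y, X \in g -> Y \in g -> lie X Y \in g.

Lemma in_derived g X Y : X \in g -> Y \in g -> lie X Y \in derived g.
Proof.
move=> Xg Yg; apply: (vbasis_ind (W := g) (P := fun Y => lie X Y \in _)) Yg.
  split=> [|a u v]; rewrite ?lie0r ?mem0v // lieDr lieZr => *.
  by rewrite memvD ?memvZ.
move=> Y' Yb.
apply: (vbasis_ind (W := g) (P := fun X => lie X Y' \in _)) Xg.
  split=> [|a u v]; rewrite ?lie0l ?mem0v // lieDl lieZl => *.
  by rewrite memvD ?memvZ.
by move=> X' Xb; rewrite memv_span //; apply/allpairsP; exists (X', Y').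
Qed.

Lemma derived_ind g (P : 'M[K]_m -> Prop) : lin_pred P ->
  (forall X Y, X \in g -> Y \in g -> P (lie X Y)) ->
  forall Z, Z \in derived g -> P Z.
Proof.
move=> hP h Z; apply: span_ind => // Y /allpairsP[[X' Y'] /= [hX hY ->]].
by apply: h; rewrite ?vbasis_mem.
Qed.

Lemma derived_sub g : lie_closed g -> (derived g <= g)%VS.
Proof.
move=> hg; apply/subvP; apply: derived_ind => //; exact: memv_lin.
Qed.

Lemma ad_diag_aspan g X Y : ad_diagonalizable g X -> Y \in g ->
  aspan (fun Z => Z \in g /\ eigv (lie X) Z) Y.
Proof.
case=> b [bb hb]; rewrite -(span_basis bb); apply: span_ind => [|Z Zb].
  apply: aspan_lin => a Z [Zg [c hc]].
  split; first by rewrite memvZ.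
  by exists c; rewrite lieZr hc !scalerA mulrC.
apply: aspan1; split; first by rewrite (span_basis bb) (basis_mem bb).
exact: hb.
Qed.

Lemma aspan_ad_diag g X :
  (forall Y, Y \in g -> aspan (fun Z => Z \in g /\ eigv (lie X) Z) Y) ->
  ad_diagonalizable g X.
Proof. by case/basis_of_aspan => b [bb hb]; exists b. Qed.

End Lie.

(** * Representations of sl(2) *)

Section EigenIndependence.
Variables (K : fieldType) (V : vectType K).

(** Eigenvectors for different eigenvalues are independent, so an infinite
    sequence of them contains 0. *)
Lemma eig_many (f : {linear V -> V}) (a : nat -> K) (x : nat -> V) :
  injective a -> (forall k, f (x k) = a k *: x k) -> exists k, x k = 0.
Proof.
move=> aI hx; apply: contrapT => /forallNP h0.
pose n := (\dim {:V}).+1.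
suff : free [tuple x i | i < n].
  rewrite /free size_tuple => /eqP hd.
  by have := dimvS (subvf <<[tuple x i | i < n]>>%VS); rewrite hd ltnn.
apply/freeP => c hc i.
suff : c i *: x i = 0.
  by move=> /eqP; rewrite scaler_eq0 => /orP[/eqP//|/eqP/h0].
apply: (@eigen_components K V 'I_n (fun i => a i) (fun x => x = 0) f
  (index_enum 'I_n) (fun i => c i *: x i)); rewrite ?mem_index_enum //.
- by split=> // b u v -> ->; rewrite scaler0 addr0.
- by move=> y ->; rewrite linear0.
- by rewrite map_inj_uniq ?index_enum_uniq // => j k /aI /val_inj.
- by move=> j _; rewrite linearZ /= hx !scalerA mulrC.
- rewrite -[RHS]hc; apply: eq_bigr => j _.
  by rewrite -tnth_nth tnth_mktuple.
Qed.

End EigenIndependence.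

Section SL2.
Variables (K : numFieldType) (V : vectType K) (e f h : {linear V -> V}).
Hypothesis he : forall x, h (e x) = e (h x) + 2%:R *: e x.
Hypothesis hf : forall x, h (f x) = f (h x) - 2%:R *: f x.
Hypothesis hef : forall x, e (f x) - f (e x) = h x.

Lemma sl2_iter_e m x N : h x = m *: x -> h (iter N e x) = (m + (2 * N)%:R) *: iter N e x.
Proof.
move=> hx; elim: N => [|N IH] /=; first by rewrite addr0.
rewrite he IH linearZ /= -scalerDl; congr (_ *: _).
by rewrite -addrA -natrD; congr (_ + _%:R); lia.
Qed.

Lemma sl2_iter_f m x N : h x = m *: x -> h (iter N f x) = (m - (2 * N)%:R) *: iter N f x.
Proof.
move=> hx; elim: N => [|N IH] /=; first by rewrite subr0.
rewrite hf IH linearZ /= -scalerBl; congr (_ *: _).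
by rewrite -addrA -opprD -natrD; congr (_ - _%:R); lia.
Qed.

Lemma sl2_e_nilp m x : h x = m *: x -> exists N, iter N e x = 0.
Proof.
move=> hx; apply: (@eig_many K V h (fun N => m + (2 * N)%:R)).
  by move=> i j /addrI /eqP; rewrite eqr_nat eqn_pmul2l // => /eqP.
by move=> k; apply: sl2_iter_e.
Qed.

Lemma sl2_f_nilp m x : h x = m *: x -> exists N, iter N f x = 0.
Proof.
move=> hx; apply: (@eig_many K V h (fun N => m - (2 * N)%:R)).
  by move=> i j /addrI /oppr_inj /eqP; rewrite eqr_nat eqn_pmul2l // => /eqP.
by move=> k; apply: sl2_iter_f.
Qed.

(** This is the commutator of [e^(N+1)] and [f] on a weight vector. *)
Lemma sl2_iter_ef m x N : h x = m *: x ->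
  iter N.+1 e (f x) = f (iter N.+1 e x) + (N.+1%:R * (m + N%:R)) *: iter N e x.
Proof.
move=> hx; elim: N => [|N IH].
  by rewrite /= -[LHS](subrK (f (e x))) hef hx addrC mul1r addr0.
rewrite iterS IH linearD linearZ /= -[e (f _)](subrK (f (e (e (iter N e x))))) hef.
rewrite -[e (iter N e x)]/(iter N.+1 e x) (sl2_iter_e _ hx).
rewrite addrAC -scalerDl addrC; congr (_ + _ *: _).
rewrite !natrM -!natr1; ring.
Qed.

(** If [e^(N+1) x = 0] then [e f x - (N+1)(m+N) x] is killed by [e^N], so it
    is in the image by induction, and so is [x] because the coefficient is
    not 0. The predicates [P] and [P'] keep track of the weight spaces of the
    other commuting operators. *)
Lemma sl2_surj (P P' : V -> Prop) m x :
  lin_pred P -> lin_pred P' -> (forall y, P y -> P' (f y)) ->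
  (forall y, P' y -> P (e y)) -> (forall y, P y -> h y = m *: y) ->
  0 < m -> P x -> exists y, P' y /\ x = e y.
Proof.
move=> hP hP' hfP heP hm m0 px; have [N] := sl2_e_nilp (hm _ px).
elim: N x px => [|N IH] x px hN.
  by exists 0; split; [case: hP'|rewrite linear0 -[x]/(iter 0 e x)].
pose c := N.+1%:R * (m + N%:R).
have c0 : c != 0 by rewrite mulf_neq0 ?pnatr_eq0 // gt_eqF ?ltr_wpDr ?ler0n.
have [||y [py xE]] := IH (e (f x) - c *: x).
- by apply: lin_predB => //; [apply/heP/hfP|apply: lin_predZ].
- have iterlin u v : iter N e (u - c *: v) = iter N e u - c *: iter N e v.
    by elim: (N) => //= k ->; rewrite linearB linearZ.
  by rewrite iterlin -iterSr (sl2_iter_ef N (hm _ px)) hN linear0 add0r subrr.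
exists (c^-1 *: (f x - y)); split.
  by apply: lin_predZ => //; apply: lin_predB => //; apply: hfP.
by rewrite linearZ linearB /= -xE opprB addrC subrK scalerA mulVf ?scale1r.
Qed.

(** Let [k+1] be the first exponent with [f^(k+1) u = 0]; applying [e] gives
    [(k+1)(n-k) f^k u = 0], hence [n = k]. *)
Lemma sl2_hw n u : u != 0 -> e u = 0 -> h u = n *: u -> exists k : nat, n = k%:R.
Proof.
move=> u0 eu hu.
have ef k : e (iter k.+1 f u) = (k.+1%:R * (n - k%:R)) *: iter k f u.
  elim: k => [|k IH].
    by rewrite /= -[LHS](subrK (f (e u))) hef hu eu linear0 addr0 mul1r subr0.
  rewrite iterS -[LHS](subrK (f (e (iter k.+1 f u)))) hef IH linearZ /=.
  rewrite -[f (iter k f u)]/(iter k.+1 f u) (sl2_iter_f _ hu) -scalerDl.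
  congr (_ *: _); rewrite !natrM -!natr1; ring.
have ex : exists N, iter N f u == 0.
  by have [N /eqP] := sl2_f_nilp hu; exists N.
case: (ex_minnP ex) => -[|k] /eqP hk hmin; first by move: u0; rewrite (hk : u = 0) eqxx.
exists k; have := ef k; rewrite hk linear0 => /esym/eqP.
rewrite scaler_eq0 mulf_eq0 pnatr_eq0 /= subr_eq0 => /orP[/eqP//|h0].
by have := hmin _ h0; rewrite ltnn.
Qed.

(** Raise [u] to a highest weight vector. *)
Lemma sl2_int lam u : u != 0 -> h u = lam *: u -> exists z : int, lam = z%:~R.
Proof.
move=> u0 hu.
have ex : exists N, iter N e u == 0.
  by have [N /eqP] := sl2_e_nilp hu; exists N.
case: (ex_minnP ex) => -[|k] /eqP hk hmin; first by move: u0; rewrite (hk : u = 0) eqxx.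
have [||j hj] := @sl2_hw (lam + (2 * k)%:R) (iter k e u) _ hk.
- by apply/negP => /hmin; rewrite ltnn.
- exact: sl2_iter_e.
exists (j%:Z - (2 * k)%:Z); rewrite intrB -!pmulrn -hj; ring.
Qed.

End SL2.

(** * Functionals and simultaneous diagonalization *)

Section LinearAux.
Variable K : fieldType.

Definition mk_linear (U V : lmodType K) (f : U -> V) (hf : linear f) :
    {linear U -> V} := HB.pack f (GRing.isLinear.Build K U V *:%R f hf).

(** Project along [W] and take a coordinate. *)
Lemma functional_off n (W : {vspace 'cV[K]_n}) : W <> fullv ->
  exists u : 'cV[K]_n, u <> 0 /\ forall w, w \in W -> w^T *m u = 0.
Proof.
move=> hW.
have [x xW] : exists x, x \notin W.
  apply: contrapT => /forallNP h; apply: hW; apply/vspaceP => x.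
  by rewrite memvf; apply/negPn/negP/h.
pose p := projv W.
have px : x - p x != 0.
  by rewrite subr_eq0; apply: contraNneq xW => ->; apply: memv_proj.
have [i hi] : exists i, (x - p x) i 0 != 0.
  apply/existsP; apply: contraNT px; rewrite negb_exists => /forallP h.
  by apply/eqP/colP => i; rewrite (eqP (negbNE (h i))) mxE.
have lin : linear (fun y : 'cV[K]_n => (y - p y) i 0 : K^o).
  by move=> a y z; rewrite linearP !mxE /GRing.scale /=; ring.
pose psi := mk_linear lin.
pose u := \col_j psi (delta_mx j 0).
have uE w : (w^T *m u) 0 0 = psi w.
  rewrite mxE [in RHS](matrix_sum_delta w) linear_sum; apply: eq_bigr => j _.
  by rewrite big_ord1 linearZ !mxE.
exists u; split=> [u0|w wW].
  by move: hi; rewrite -[(x - p x) i 0]/(psi x) -uE u0 mulmx0 mxE eqxx.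
apply/matrixP => a b; rewrite !ord1 uE mxE /= projv_id // subrr mxE //.
Qed.

Lemma functional_of (h' : vectType K) p q (g : {linear h' -> 'M[K]_(p, q)})
    (u : 'M[K]_(p, q)) : u <> 0 -> (forall H, exists a, g H = a *: u) ->
  exists lam : 'Hom(h', K^o), forall H, g H = (lam H : K) *: u.
Proof.
move=> /eqP u0 hg.
have [[i j] hij] : exists ij : 'I_p * 'I_q, u ij.1 ij.2 != 0.
  apply/existsP; apply: contraNT u0; rewrite negb_exists => /forallP h.
  by apply/eqP/matrixP => i j; rewrite (eqP (negbNE (h (i, j)))) mxE.
have lin : linear (fun H => g H i j / u i j : K^o).
  by move=> a y z; rewrite linearP !mxE /GRing.scale /=; ring.
exists (linfun (mk_linear lin)) => H; rewrite lfunE /=.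
by have [a ->] := hg H; rewrite mxE mulfK.
Qed.

(** A basis of joint eigenvectors, put in the columns of [B]. *)
Lemma codiag_basis n (I : Type) (C : I -> Prop) (M : I -> 'M[K]_n) :
  (forall u : 'cV[K]_n, aspan (fun u => forall i, C i -> eigv (mulmx (M i)) u) u) ->
  exists B : 'M[K]_n, B \in unitmx /\
    forall i, C i -> exists D : 'rV[K]_n, M i *m B = B *m diag_mx D.
Proof.
move=> h.
have [|b [bb hb]] := @basis_of_aspan K _ (fullv : {vspace 'cV[K]_n})
    (fun u => forall i, C i -> eigv (mulmx (M i)) u).
  by move=> x _; apply: aspan_mono (h x) => y hy; rewrite memvf.
have sb : size b = n.
  have := size_basis (X := in_tuple b) bb.
  have -> : \dim (fullv : {vspace 'cV[K]_n}) = n; last by move=> <-.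
    by rewrite dimvf [LHS]dim_matrix; apply: muln1.
pose bt : n.-tuple 'cV[K]_n := Tuple (introT eqP sb).
have {}bb : basis_of fullv bt by [].
pose B := \matrix_(i < n, j < n) bt`_j i 0.
have BE (x : 'cV[K]_(n)) : B *m x = \sum_j x j 0 *: bt`_j.
  apply/colP => i; rewrite mxE summxE; apply: eq_bigr => j _.
  by rewrite !mxE mulrC.
have BC : B *m \matrix_(j, i) coord bt j (delta_mx i 0) = 1%:M.
  apply/row_matrixP => i; apply/rowP => j.
  set C' := \matrix_(_, _) _.
  have : B *m col j C' = delta_mx j 0.
    rewrite BE [RHS](coord_basis bb (memvf _)).
    by apply: eq_bigr => k _; rewrite !mxE.
  rewrite colE mulmxA -colE => /colP/(_ i); rewrite !mxE => ->.
  by rewrite eqxx andbT.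
exists B; split; first by have [] := mulmx1_unit BC.
move=> i Ci.
have hbj (j : 'I_(n)) : exists a, M i *m bt`_j = a *: bt`_j.
  by apply: hb => //; apply: mem_nth; rewrite sb.
have [D hD] := boolp.choice hbj.
exists (\row_j D j); apply/matrixP => k j.
have := hD j => /colP/(_ k); rewrite !mxE => E.
rewrite (eq_bigr (fun l => M i k l * bt`_j l 0)) ?E; last first.
  by move=> l _; rewrite !mxE.
rewrite (bigD1 j) //= !mxE eqxx mulr1n big1 ?addr0 1?mulrC // => l lj.
by rewrite !mxE (negPf lj) mulr0n mulr0.
Qed.

End LinearAux.

(** * Representations and toral subalgebras *)

Section Reps.
Variables (K : fieldType) (m : nat) (L : {vspace 'M[K]_m}).
Hypothesis clL : lie_closed L.

Section OneRep.
Variables (d : nat) (rho : 'M[K]_m -> 'M[K]_d).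
Hypothesis hrho : is_rep L rho.

Lemma rep0 : rho 0 = 0.
Proof.
have := hrho.1 (-1) 0 0 (mem0v _) (mem0v _).
by rewrite scaler0 addr0 scaleN1r addNr.
Qed.
Lemma repD X Y : X \in L -> Y \in L -> rho (X + Y) = rho X + rho Y.
Proof. by move=> hX hY; have := hrho.1 1 X Y hX hY; rewrite !scale1r. Qed.
Lemma repZ a X : X \in L -> rho (a *: X) = a *: rho X.
Proof. by move=> hX; have := hrho.1 a X 0 hX (mem0v _); rewrite rep0 !addr0. Qed.
Lemma repN X : X \in L -> rho (- X) = - rho X.
Proof. by move=> hX; rewrite -!scaleN1r repZ. Qed.
Lemma repB X Y : X \in L -> Y \in L -> rho (X - Y) = rho X - rho Y.
Proof. by move=> hX hY; rewrite repD ?repN ?memvN. Qed.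
Lemma rep_lie X Y : X \in L -> Y \in L -> rho (lie X Y) = lie (rho X) (rho Y).
Proof. exact: hrho.2. Qed.

Lemma rep_lie_act X Y (u : 'cV[K]_d) : X \in L -> Y \in L ->
  rho X *m (rho Y *m u) = rho Y *m (rho X *m u) + rho (lie X Y) *m u.
Proof. by move=> hX hY; rewrite rep_lie // /lie mulmxBl !mulmxA addrC subrK. Qed.

Lemma rep_act_lin (P : 'cV[K]_d -> Prop) u :
  lin_pred P -> lin_pred (fun X => X \in L /\ P (rho X *m u)).
Proof.
move=> hP; split; first by rewrite mem0v rep0 mul0mx; split=> //; case: hP.
move=> a X Y [hX pX] [hY pY]; split; first by rewrite memvD ?memvZ.
by rewrite hrho.1 // mulmxDl -scalemxAl; case: hP => _; apply.
Qed.

Lemma dual_rep_is_rep : is_rep L (dual_rep rho).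
Proof.
split=> [a X Y hX hY|X Y hX hY]; rewrite /dual_rep.
  by rewrite hrho.1 // linearP opprD scalerN.
rewrite hrho.2 // /lie linearB /= !trmx_mul !(mulmxN, mulNmx) !opprK.
by rewrite opprB.
Qed.

(** The orthogonal of a submodule of the dual is a submodule. *)
Lemma irreducible_dual : irreducible_rep L rho -> irreducible_rep L (dual_rep rho).
Proof.
case=> d0 hirr; split=> // W hW.
case: (boolp.pselect (W = fullv)) => [->|hWf]; first by right.
left; have [u [u0 hu]] := functional_off hWf.
have [W' hW'] := @vspace_of_pred K _ (fun x : 'cV[K]_d => forall w, w \in W -> w^T *m x = 0)
   (conj (fun w _ => mulmx0 _ _) (fun a x y hx hy w wW =>
     etrans (linearP _ a x y) (etrans (congr2 (fun p q => a *: p + q) (hx w wW) (hy w wW))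
       (etrans (addr0 _) (scaler0 _ _))))).
have [] := hirr W'.
- move=> X x hX /hW' hx; apply/hW' => w wW.
  have := hx _ (hW X w hX wW).
  rewrite /dual_rep mulNmx linearN /= trmx_mul trmxK mulNmx -mulmxA => /eqP.
  by rewrite oppr_eq0 => /eqP.
- by move=> W'0; case: u0; apply/eqP; rewrite -memv0 -W'0; apply/hW'.
move=> W'f; apply/vspaceP => w; rewrite memv0; apply/idP/eqP => [wW|->]; last exact: mem0v.
apply/colP => i.
have /hW'/(_ w wW) : delta_mx i 0 \in W' by rewrite W'f memvf.
by move/matrixP => /(_ 0 0); rewrite -colE !mxE.
Qed.

End OneRep.

End Reps.

Section ToralReps.
Variables (K : numClosedFieldType) (m : nat) (L : {vspace 'M[K]_m}).
Hypothesis clL : lie_closed L.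
Variables (d : nat) (rho : 'M[K]_m -> 'M[K]_d).
Hypothesis hrho : is_rep L rho.
Hypothesis irr : irreducible_rep L rho.

(** Irreducibility in the form in which it is used: a nonzero linear property
    that is stable under the action holds for all vectors. *)
Lemma submodule_full (P : 'cV[K]_d -> Prop) v :
  lin_pred P -> (forall X w, X \in L -> P w -> P (rho X *m w)) ->
  v <> 0 -> P v -> forall w, P w.
Proof.
move=> hP hL v0 Pv w.
have [W hW] := vspace_of_pred hP.
have [|W0|Wf] := irr.2 W; first by move=> X u hX /hW hu; apply/hW/hL.
  by case: v0; apply/eqP; rewrite -memv0 -W0; apply/hW.
by apply/hW; rewrite Wf memvf.
Qed.

Lemma eigenvector_exists (M : 'M[K]_d) : exists (a : K) (u : 'cV[K]_d), u <> 0 /\ M *m u = a *: u.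
Proof.
have [a /eigenvalueP [v hv v0]] := eigenvalue_closed M^T irr.1.
exists a, v^T; split.
  by move/(congr1 trmx); rewrite trmxK linear0; apply/eqP.
by rewrite -[M]trmxK -trmx_mul hv linearZ.
Qed.

(** Sums of eigenvectors of [rho T] form a submodule: an eigenvector of [ad
    T] maps eigenvectors of [rho T] to eigenvectors. It is not 0 because the
    field is algebraically closed. *)
Lemma ad_diag_rep T : T \in L -> ad_diagonalizable L T ->
  forall u : 'cV[K]_d, aspan (eigv (mulmx (rho T))) u.
Proof.
move=> hT hd; have [a [v [v0 hv]]] := eigenvector_exists (rho T).
apply: (submodule_full (v := v)) => //; last by apply: aspan1; exists a.
  by apply: aspan_lin => b x [c hx]; exists c; rewrite linearZ /= hx !scalerA mulrC.
move=> X w hX; elim=> [|x y [b hx] _ IH]; first by rewrite mulmx0; apply: aspan0.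
rewrite mulmxDr; apply: aspan_add => //.
pose P Z := Z \in L /\ aspan (eigv (mulmx (rho T))) (rho Z *m x).
suff : P X by case.
apply: (aspan_sub (P := P) _ _ (ad_diag_aspan hd hX)).
  apply: rep_act_lin => //; apply: aspan_lin => c z [c' hz].
  by exists c'; rewrite linearZ /= hz !scalerA mulrC.
move=> Z [hZ [c hc]]; split=> //; apply: aspan1; exists (b + c).
rewrite (rep_lie_act hrho) // hx hc (repZ hrho) // -scalemxAr -scalemxAl.
by rewrite scalerDl.
Qed.

Lemma toral_rep (t : {vspace 'M[K]_m}) : toral L t ->
  forall u : 'cV[K]_d, aspan (fun u => forall T, T \in t -> eigv (mulmx (rho T)) u) u.
Proof.
case=> /subvP tL tab td u.
have H := @joint_aspan K _ 'M[K]_m (fun T => @mulmx K d d 1 (rho T))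
  (vbasis t : seq _)
  (fun=> True).
apply: aspan_mono (H _ _ _ _ u I) => {u} [u [_ hu]||||].
- move=> T hT.
  suff : T \in L /\ eigv (mulmx (rho T)) u by case.
  apply: (vbasis_ind (P := fun T => T \in L /\ eigv (mulmx (rho T)) u)) hT => [|S hS]; last by split; [apply/tL/vbasis_mem|apply: hu].
  apply: (rep_act_lin hrho (P := fun w => exists a, w = a *: u)).
  split=> [|a x y [b ->] [c ->]]; first by exists 0; rewrite scale0r.
  by exists (a * b + c); rewrite scalerDl scalerA.
- by [].
- by [].
- move=> T T' x /vbasis_mem hT /vbasis_mem hT' _.
  by rewrite /= (rep_lie_act hrho) ?tL // tab // (rep0 hrho) mul0mx addr0.
- by move=> T x /vbasis_mem hT _; apply: ad_diag_rep; [apply: tL|apply: td].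
Qed.

End ToralReps.

(** * Root decomposition *)

Section WeightDecomposition.
Variables (K : fieldType) (m : nat) (L t : {vspace 'M[K]_m}).
Hypothesis clL : lie_closed L.
Hypothesis tor : toral L t.

Lemma toral_sub T : T \in t -> T \in L.
Proof. by case: tor => /subvP h _ _; apply: h. Qed.

Lemma toral_decomp X : X \in L ->
  aspan (fun Y => Y \in L /\ forall T, T \in t -> eigv (lie T) Y) X.
Proof.
case: tor => _ tab td hX.
have H := @joint_aspan K _ 'M[K]_m (fun T => lie T) (vbasis t : seq _)
  (fun X => X \in L).
apply: aspan_mono (H _ _ _ _ X hX) => {X hX} [X [hX hu]||||].
- split=> // T hT.
  apply: (vbasis_ind (P := fun T => eigv (lie T) X)) hT => //.
  split=> [|a T1 T2 [b h1] [c h2]]; first by exists 0; rewrite lie0l scale0r.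
  by exists (a * b + c); rewrite lieDl lieZl h1 h2 scalerDl scalerA.
- exact: memv_lin.
- by move=> T X /vbasis_mem hT hX; apply: clL => //; apply: toral_sub.
- move=> T T' x /vbasis_mem hT /vbasis_mem hT' _.
  by rewrite /= (lie_jacobi T T' x) (tab T T') // lie0l add0r.
- move=> T x /vbasis_mem hT hx.
  by apply: aspan_mono (ad_diag_aspan (td T hT) hx) => y [].
Qed.

Let ss := derived L.
Let h := (t :&: ss)%VS.

Lemma root_space_lin s (a : dual h) : lin_pred (root_space s a).
Proof.
split=> [|c X Y [hX eX] [hY eY]]; first by split=> [|H]; rewrite ?mem0v ?lie0r ?scaler0.
split=> [|H]; first by rewrite memvD ?memvZ.
by rewrite lieDr lieZr eX eY scalerDr !scalerA mulrC.
Qed.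

Lemma hmem_t (H : subvs_of h) : vsval H \in t.
Proof. by have := subvsP H; rewrite memv_cap => /andP[]. Qed.

Lemma hmem_ss (H : subvs_of h) : vsval H \in ss.
Proof. by have := subvsP H; rewrite memv_cap => /andP[]. Qed.

Lemma ss_sub X : X \in ss -> X \in L.
Proof. by move: (derived_sub clL) => /subvP; apply. Qed.

Lemma ss_ideal X Y : X \in L -> Y \in L -> lie X Y \in ss.
Proof. exact: in_derived. Qed.

Lemma hmem_L (H : subvs_of h) : vsval H \in L.
Proof. exact/ss_sub/hmem_ss. Qed.

(** An eigenvector for a nonzero functional is a bracket with an element of
    the Cartan subalgebra, so it lies in the derived algebra. *)
Lemma weight_decomp X : X \in L ->
  aspan (fun Y => Y \in L /\ ((forall H : subvs_of h, lie (vsval H) Y = 0) \/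
     exists a : dual h, [/\ a <> 0, Y <> 0 & root_space ss a Y])) X.
Proof.
move=> hX; apply: aspan_mono (toral_decomp hX) => Y [hY hw]; split=> //.
case: (eqVneq Y 0) => [->|/eqP Y0]; first by left=> H; rewrite lie0r.
have lin : linear (fun H : subvs_of h => lie (vsval H) Y).
  by move=> a H H'; rewrite linearP lieDl lieZl.
have [|a ha] := functional_of (g := mk_linear lin) Y0.
  by move=> H; apply: hw; apply: hmem_t.
have {}ha (H : subvs_of h) : lie (vsval H) Y = (a H : K) *: Y by apply: ha.
case: (boolp.pselect (a = 0)) => [a0|a0].
  by left=> H; rewrite ha a0 zero_lfunE scale0r.
right; exists a; split=> //; split=> //.
have [H aH] : exists H, a H != 0.
  apply: contrapT => /forallNP h0; apply: a0; apply/lfunP => H.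
  by rewrite zero_lfunE; apply/eqP/negPn/negP/h0.
have -> : Y = (a H : K)^-1 *: lie (vsval H) Y by rewrite ha scalerA mulVf ?scale1r.
by rewrite memvZ //; apply: ss_ideal => //; apply: hmem_L.
Qed.

Section Simple.
Variables (l : nat) (alpha : l.-tuple (dual h)).
Definition comb (k : 'I_l -> nat) : dual h := \sum_i tnth alpha i *+ k i.

Lemma combE k H : comb k H = \sum_i tnth alpha i H *+ k i :> K.
Proof.
rewrite /comb sum_lfunE; apply: eq_bigr => i _.
by elim: (k i) => [|n IH]; rewrite ?mulr0n ?zero_lfunE // !mulrS add_lfunE IH.
Qed.

Lemma simple_decomp X : simple_roots ss alpha -> X \in L ->
  aspan (fun Y => Y \in L /\ ((forall H : subvs_of h, lie (vsval H) Y = 0) \/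
     exists k, comb k <> 0 /\
       (root_space ss (comb k) Y \/ root_space ss (- comb k) Y))) X.
Proof.
case=> _ _ hr hX; apply: aspan_mono (weight_decomp hX) => Y [hY hw]; split=> //.
case: hw => [|[a [a0 Y0 ra]]]; [by left|right].
have [|k hk] := hr a; first by split=> //; exists Y.
exists k; case: hk => hk; rewrite -/(comb k) in hk; rewrite -?hk; last first.
  split; first by move=> k0; apply: a0; rewrite hk k0 oppr0.
  by right.
by split; [|left].
Qed.

End Simple.
End WeightDecomposition.

(** * The trace form and generation by simple root vectors *)

Section TraceForm.
Variables (K : numClosedFieldType) (m : nat).
Implicit Types (X Y Z T B : 'M[K]_m) (D : 'rV[K]_m).

Lemma lie_trace X Y Z : \tr (lie X Y *m Z) = \tr (X *m lie Y Z).
Proof.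
rewrite /lie mulmxBl mulmxBr !raddfB /= -!mulmxA; congr (_ - _).
by rewrite mxtrace_mulC mulmxA.
Qed.

Lemma diag_colsP B D T : T *m B = B *m diag_mx D <->
  forall j, T *m col j B = D 0 j *: col j B.
Proof.
split=> [h j|h].
  rewrite colE mulmxA h; apply/colP => i.
  by rewrite -!colE mul_mx_diag !mxE mulrC.
apply/matrixP => i j; have := h j => /colP/(_ i).
rewrite colE mulmxA -!colE mul_mx_diag !mxE => ->.
by rewrite mulrC.
Qed.

Lemma trace_diag B D D' T T' : B \in unitmx ->
  T *m B = B *m diag_mx D -> T' *m B = B *m diag_mx D' ->
  \tr (T *m T') = \sum_j D 0 j * D' 0 j.
Proof.
move=> uB hT hT'.
have -> : T *m T' = B *m (diag_mx D *m diag_mx D') *m invmx B.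
  apply: (canRL (mulmxK uB)).
  by rewrite -mulmxA hT' !mulmxA hT.
rewrite mxtrace_mulC mulKmx // /mxtrace; apply: eq_bigr => j _.
by rewrite mul_diag_mx !mxE eqxx mulr1n.
Qed.

Lemma real_sq_gt0 D : (forall j, D 0 j \is Num.real) -> D <> 0 ->
  0 < \sum_j D 0 j * D 0 j.
Proof.
move=> hr /eqP D0.
have [j hj] : exists j, D 0 j != 0.
  apply/existsP; apply: contraNT D0; rewrite negb_exists => /forallP h.
  by apply/eqP/rowP => j; rewrite (eqP (negbNE (h j))) mxE.
have ge0 i : 0 <= D 0 i * D 0 i by rewrite -expr2 real_exprn_even_ge0.
rewrite (bigD1 j) //= ltr_wpDr ?sumr_ge0 //.
by rewrite lt_def ge0 mulf_neq0.
Qed.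

Lemma diag_neq0 B D T : B \in unitmx -> T *m B = B *m diag_mx D -> T <> 0 -> D <> 0.
Proof.
move=> uB hT T0 D0; apply: T0.
by rewrite -[T](mulmxK uB) hT D0 linear0 mulmx0 mul0mx.
Qed.

End TraceForm.

Section Generation.
Variables (K : numClosedFieldType) (m : nat) (L t : {vspace 'M[K]_m}).
Hypothesis clL : lie_closed L.
Let ss := derived L.
Let h := (t :&: ss)%VS.
Hypothesis hV : forall u : 'cV[K]_m,
  aspan (fun u => forall T, T \in t -> eigv (mulmx T) u) u.
Variables (l : nat) (alpha : l.-tuple (dual h)) (alphav : l.-tuple (subvs_of h)).
Hypothesis hco : forall i, is_coroot ss (tnth alpha i) (tnth alphav i).
Hypothesis hint : forall i j, exists z : int, tnth alpha i (tnth alphav j) = z%:~R.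

Lemma root_space_lie (a b : dual h) X Y : root_space ss a X -> root_space ss b Y ->
  root_space ss (a + b) (lie X Y).
Proof.
case=> hX eX [hY eY]; split=> [|H].
  by apply: in_derived; apply: (ss_sub clL).
by rewrite lie_jacobi eX eY lieZl lieZr -scalerDl add_lfunE.
Qed.

(** For the trace form each [b_i = tr(X_i Y_i)] is positive, because a coroot
    acts with integer eigenvalues. If [T = sum_i (k_i / b_i) H_i], the form
    represents the functional [sum_i k_i alpha_i] by [T], so this functional
    takes the value [tr(T^2) > 0] on [T], and one of the terms is positive. *)
Lemma pos_pairing k : comb alpha k <> 0 ->
  exists i, (0 < k i)%N /\ 0 < (comb alpha k (tnth alphav i) : K).
Proof.
move=> k0.
have hXY i : exists XY : 'M[K]_m * 'M[K]_m,
   [/\ root_space ss (tnth alpha i) XY.1, root_space ss (- tnth alpha i) XY.2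
     & vsval (tnth alphav i) = lie XY.1 XY.2].
  by have [_ [X [Y hh]]] := hco i; exists (X, Y).
have [XY hXY'] := boolp.choice hXY.
pose X i := (XY i).1; pose Y i := (XY i).2.
pose b i := \tr (X i *m Y i).
have trH i (H : subvs_of h) : \tr (vsval (tnth alphav i) *m vsval H) = (tnth alpha i H : K) * b i.
  have [_ [_ eY] ->] := hXY' i.
  rewrite lie_trace lieC eY opp_lfunE scaleNr opprK -scalemxAr linearZ //.
have [B [uB hB]] := codiag_basis (C := fun T => T \in t) (M := id) hV.
have eB j T : T \in t -> eigv (mulmx T) (col j B).
  by move=> /hB [D /diag_colsP hD]; exists (D 0 j).
have colB0 j : col j B != 0.
  apply/eqP => c0; move: (uB); rewrite -unitmx_tr => uBt.
  have := mulmxK uBt (delta_mx 0 j : 'rV_m).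
  rewrite -rowE -tr_col c0 linear0 mul0mx => /matrixP/(_ 0 j).
  by rewrite !mxE !eqxx => /esym /eqP; rewrite oner_eq0.
have hz i j : exists z : int, vsval (tnth alphav i) *m col j B = z%:~R *: col j B.
  have [a2 _] := hco i; have [[_ eX] [_ eY] hH] := hXY' i.
  have [lam hlam] : eigv (mulmx (vsval (tnth alphav i))) (col j B).
    by apply: eB; apply: hmem_t.
  have hact (A C : 'M[K]_m) (x : 'cV_m) : A *m (C *m x) = C *m (A *m x) + lie A C *m x.
    by rewrite /lie mulmxBl !mulmxA addrC subrK.
  have [|||z hz] := @sl2_int K _ (@mulmx K m m 1 (X i)) (@mulmx K m m 1 (Y i))
     (@mulmx K m m 1 (vsval (tnth alphav i))) _ _ _ lam (col j B) (colB0 j) hlam.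
  - by move=> x; rewrite /= hact eX a2 scalemxAl.
  - by move=> x; rewrite /= hact eY opp_lfunE a2 scaleNr mulNmx scalemxAl.
  - by move=> x; rewrite /= hact addrC addKr hH.
  by exists z; rewrite -hz.
have [z hz'] : exists z : 'I_l -> 'I_m -> int, forall i j,
    vsval (tnth alphav i) *m col j B = (z i j)%:~R *: col j B.
  have hz2 i : exists f : 'I_m -> int, forall j,
    vsval (tnth alphav i) *m col j B = (f j)%:~R *: col j B.
    by have [f hf] := boolp.choice (hz i); exists f.
  by have [z h'] := boolp.choice hz2; exists z.
pose D i : 'rV[K]_m := \row_j (z i j)%:~R.
have hD i : vsval (tnth alphav i) *m B = B *m diag_mx (D i).
  by apply/diag_colsP => j; rewrite mxE.
have Dr i j : D i 0 j \is Num.real by rewrite mxE realz.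
have b0 i : 0 < b i.
  have [a2 _] := hco i.
  have : 0 < 2%:R * b i.
    rewrite -a2 -trH (trace_diag uB (hD i) (hD i)); apply: real_sq_gt0 => //.
    apply: (diag_neq0 uB (hD i)) => H0.
    move: a2; rewrite (_ : tnth alphav i = 0) ?linear0.
      by move/esym/eqP; rewrite pnatr_eq0.
    exact: val_inj.
  by rewrite pmulr_rgt0 ?ltr0n.
pose c i := (k i)%:R / b i.
have c_ge0 i : 0 <= c i by rewrite divr_ge0 ?ler0n // ltW.
pose T := \sum_i c i *: tnth alphav i.
have trT H : \tr (vsval T *m vsval H) = comb alpha k H.
  rewrite combE /T linear_sum mulmx_suml linear_sum; apply: eq_bigr => i _.
  rewrite linearZ -scalemxAl linearZ /= trH /c -[RHS]mulr_natl.
  by rewrite [_ * b i]mulrC mulrA divfK ?gt_eqF.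
have : 0 < (comb alpha k T : K).
  rewrite -trT.
  pose DT := \sum_i c i *: D i.
  have hDT : vsval T *m B = B *m diag_mx DT.
    have -> : vsval T = \sum_i c i *: vsval (tnth alphav i).
      by rewrite /T linear_sum; apply: eq_bigr => i _; rewrite linearZ.
    rewrite mulmx_suml /DT [diag_mx _]linear_sum mulmx_sumr; apply: eq_bigr => i _.
    by rewrite linearZ -scalemxAl hD -scalemxAr.
  rewrite (trace_diag uB hDT hDT); apply: real_sq_gt0.
    move=> j; rewrite /DT summxE rpred_sum // => i _.
    by rewrite mxE rpredM // ger0_real.
  apply: (diag_neq0 uB hDT) => T0; apply: k0; apply/lfunP => H.
  by rewrite zero_lfunE -[LHS]trT T0 mul0mx linear0.
rewrite /T linear_sum => hpos; apply: contrapT => /forallNP hn.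
have hr i : (comb alpha k (tnth alphav i) : K) \is Num.real.
  rewrite combE; apply: rpred_sum => j _; rewrite rpredMn //.
  by have [u ->] := hint j i; apply: realz.
have : \sum_i (c i *: (comb alpha k (tnth alphav i) : K^o) : K) <= 0.
  apply: sumr_le0 => i _; rewrite /GRing.scale /=.
  case: (posnP (k i)) => [ki0|kip]; first by rewrite /c ki0 !mul0r.
  rewrite mulr_ge0_le0 // real_leNgt ?real0 //; apply/negP => hp.
  by apply: (hn i).
rewrite (eq_bigr (fun i => comb alpha k (c i *: tnth alphav i))) => [hle|i _].
  by have := lt_le_trans hpos hle; rewrite ltxx.
by rewrite linearZ.
Qed.

(** If [beta = sum_i k_i alpha_i] pairs positively with the coroot of
    [alpha_i], then a root vector of [beta] is a bracket of [X_i] with a root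
    vector of [beta - alpha_i], by [sl2_surj]; so induction on the height
    applies. *)
Lemma generated_by_simple d (rho : 'M[K]_m -> 'M[K]_d) (v : 'cV[K]_d) k X :
  is_rep L rho ->
  (forall i, (0 < k i)%N -> forall Y, root_space ss (tnth alpha i) Y -> rho Y *m v = 0) ->
  comb alpha k <> 0 -> root_space ss (comb alpha k) X -> rho X *m v = 0.
Proof.
move=> hrho; have [n] := ubnP (\sum_i k i).
elim: n k X => // n IH k X hn hv k0 hX.
have [i [ki hpos]] := pos_pairing k0.
pose k' j := (k j - (j == i))%N.
have kk' : comb alpha k = tnth alpha i + comb alpha k'.
  rewrite /comb (bigD1 i) //= [in RHS](bigD1 i) //= addrA; congr (_ + _).
    by rewrite /k' eqxx -mulrS -subSn // subn1.
  by apply: eq_bigr => j ji; rewrite /k' (negPf ji) subn0.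
case: (boolp.pselect (comb alpha k' = 0)) => [k'0|k'0].
  by apply: (hv i ki); rewrite -[tnth alpha i]addr0 -k'0 -kk'.
have [a2 [Xi [Yi [rX rY hH]]]] := hco i.
have [_ eX] := rX; have [_ eY] := rY.
have sl2 := @sl2_surj K _ (lie Xi) (lie Yi) (lie (vsval (tnth alphav i))).
have [|||||||||Z [rZ XE]] := sl2 _ _ (root_space ss (comb alpha k))
   (root_space ss (comb alpha k')) (comb alpha k (tnth alphav i)) X => //.
- by move=> Z; rewrite /= lie_jacobi eX a2 lieZl addrC.
- by move=> Z; rewrite /= lie_jacobi -hH addrK.
- exact: root_space_lin.
- exact: root_space_lin.
- move=> Z rZ; have := root_space_lie rY rZ.
  by rewrite kk' addrA addNr add0r.
- by move=> Z rZ; have := root_space_lie rX rZ; rewrite -kk'.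
- by move=> Z [_ eZ]; rewrite /= eZ.
have sL := ss_sub clL.
rewrite XE (rep_lie hrho) ?sL ?rX.1 ?rZ.1 // /lie mulmxBl -!mulmxA.
rewrite (hv i ki Xi rX) mulmx0 subr0 (IH k' Z _ _ k'0 rZ) ?mulmx0 //.
  rewrite -ltnS; apply: leq_trans hn; rewrite ltnS [X in (_ < X)%N](bigD1 i) //= (bigD1 i) //=.
  rewrite /k' eqxx subn1 -addSn prednK // leq_add2l.
  by apply: leq_sum => j _; rewrite leq_subr.
by move=> j hj; apply: hv; apply: leq_trans hj (leq_subr _ _).
Qed.

End Generation.

(** * The spectrum of the grading element on a highest weight representation *)

Section HighestWeight.
Variables (K : numClosedFieldType) (m : nat) (L t : {vspace 'M[K]_m}).
Hypothesis clL : lie_closed L.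
Hypothesis tor : toral L t.
Let ss := derived L.
Let h := (t :&: ss)%VS.
Hypothesis hV : forall u : 'cV[K]_m,
  aspan (fun u => forall T, T \in t -> eigv (mulmx T) u) u.
Variables (l : nat) (alpha : l.-tuple (dual h)) (alphav : l.-tuple (subvs_of h)).
Hypothesis hsimple : simple_roots ss alpha.
Hypothesis hco : forall i, is_coroot ss (tnth alpha i) (tnth alphav i).
Hypothesis hint : forall i j, exists z : int, tnth alpha i (tnth alphav j) = z%:~R.

Section OneRep.
Variables (d : nat) (rho : 'M[K]_m -> 'M[K]_d) (mu : dual h).
Hypothesis hrho : is_rep L rho.
Hypothesis irr : irreducible_rep L rho.

(** Unlike in [is_highest_weight], all positive root vectors kill the vector. *)
Definition highest_vector (v : 'cV[K]_d) :=
  (forall H : subvs_of h, rho (vsval H) *m v = (mu H : K) *: v) /\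
  forall k X, comb alpha k <> 0 -> root_space ss (comb alpha k) X -> rho X *m v = 0.

Lemma highest_vectorP : is_highest_weight ss alpha rho mu ->
  exists v, v <> 0 /\ highest_vector v.
Proof.
case=> v [v0 hv he]; exists v; split=> //; split=> // k X k0 hX.
by apply: (generated_by_simple clL hV hco hint hrho _ k0 hX) => i _ Y; apply: he.
Qed.

(** The smallest subspace that contains the highest weight vectors and is
    stable under negative root vectors is a submodule, so it is everything;
    and a negative root vector lowers the eigenvalue of [E] by the number of
    simple roots [alpha_i] with [alpha_i(E_ss) = 1] that it involves. *)
Lemma hw_spectrum (Ess : subvs_of h) (E' : 'M[K]_m) (c : K) :
  (forall i, tnth alpha i Ess = 0 \/ tnth alpha i Ess = 1) ->
  E' \in L -> (forall X, X \in L -> lie E' X = 0) -> rho E' = c%:M ->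
  is_highest_weight ss alpha rho mu ->
  forall u : 'cV[K]_d, aspan (fun w => exists k : nat,
    rho (vsval Ess + E') *m w = ((mu Ess : K) + c - k%:R) *: w) u.
Proof.
move=> hE01 hE' hE'c rE' /highest_vectorP [v [v0 hv]].
have sL := ss_sub clL.
pose low Y := exists k, comb alpha k <> 0 /\ root_space ss (- comb alpha k) Y.
(* The smallest subspace with these two closure properties. *)
pose W w := forall P : 'cV[K]_d -> Prop, lin_pred P ->
  (forall u, highest_vector u -> P u) ->
  (forall Y u, low Y -> P u -> P (rho Y *m u)) -> P w.
have Wlin : lin_pred W.
  split=> [|a x y hx hy] P hP h1 h2; first by case: hP.
  by case: (hP) => _; apply; [apply: hx|apply: hy].
have Whv u : highest_vector u -> W u by move=> hu P _ h1 _; apply: h1.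
have Wlow Y u : low Y -> W u -> W (rho Y *m u).
  by move=> hY hu P hP h1 h2; apply: (h2 Y u hY); apply: hu.
have lowL Y : low Y -> Y \in L by case=> k [_ [hY _]]; apply: sL.
have WL w : W w -> W w /\ forall Z, Z \in L -> W (rho Z *m w).
  move/(_ (fun w => W w /\ forall Z, Z \in L -> W (rho Z *m w))); apply.
  - split=> [|a x y [hx1 hx2] [hy1 hy2]].
      split; first by case: Wlin.
      by move=> Z _; rewrite mulmx0; case: Wlin.
    split; first by case: Wlin => _; apply.
    move=> Z hZ; rewrite mulmxDr -scalemxAr.
    by case: Wlin => _; apply; [apply: hx2|apply: hy2].
  - move=> u hu; split; first exact: Whv.
    move=> Z hZ.
    suff : Z \in L /\ W (rho Z *m u) by case.
    apply: (aspan_sub (P := fun Z => Z \in L /\ W (rho Z *m u)) _ _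
              (simple_decomp clL tor hsimple hZ)).
      exact: rep_act_lin.
    move=> {hZ}Z [hZ hw]; split=> //.
    case: hw => [hZ0|[k [k0 [hk|hk]]]].
    + apply: Whv; case: hu => h1 h2; split=> [H|k X k0 hX].
        rewrite (rep_lie_act hrho) ?(hmem_L clL) // hZ0 (rep0 hrho) mul0mx addr0.
        by rewrite h1 linearZ.
      have XL : X \in L := sL _ hX.1.
      rewrite (rep_lie_act hrho) // (h2 k X k0 hX) mulmx0 add0r.
      apply: (h2 k) => //; split; first exact: ss_ideal.
      move=> H; rewrite lie_jacobi hX.2 hZ0 lie0r addr0 lieZl //.
    + by rewrite (hu.2 k) //; case: Wlin.
    + by apply: Wlow; [exists k|apply: Whv].
  - move=> Y u hY [hu1 hu2]; split; first exact: Wlow.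
    move=> Z hZ; have YL := lowL Y hY; rewrite (rep_lie_act hrho) //.
    apply: (lin_predD (P := W)) => //; first by apply: Wlow => //; apply: hu2.
    by apply: hu2; apply: clL.
have Wall := submodule_full irr Wlin (fun X w hX hw => (WL w hw).2 X hX) v0 (Whv v hv).
move=> u; apply: (Wall u).
- by apply: aspan_lin => a x [k hx]; exists k; rewrite -scalemxAr hx !scalerA mulrC.
- move=> w [hw _]; apply: aspan1; exists 0%N.
  by rewrite (repD hrho) ?(hmem_L clL) // mulmxDl hw rE' mul_scalar_mx -scalerDl subr0.
move=> Y w hY; elim=> [|x y [k hx] _ IH]; first by rewrite mulmx0; apply: aspan0.
rewrite mulmxDr; apply: aspan_add => //; apply: aspan1.
have [k' [k'0 rY]] := hY.
pose n := (\sum_i if (tnth alpha i Ess : K) == 1%R then k' i else 0)%N.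
have hn : comb alpha k' Ess = n%:R :> K.
  rewrite combE /n natr_sum; apply: eq_bigr => i _.
  case: (hE01 i) => ->; first by rewrite eq_sym oner_eq0 mul0rn.
  by rewrite eqxx.
exists (k + n)%N.
have YL := lowL Y hY; have EL : vsval Ess + E' \in L by rewrite memvD ?(hmem_L clL).
rewrite (rep_lie_act hrho) // hx lieDl hE'c // addr0 rY.2 opp_lfunE hn (repZ hrho) //.
by rewrite -scalemxAr -scalemxAl -scalerDl natrD opprD addrA.
Qed.

End OneRep.
End HighestWeight.

(** * Two eigenvalues and rank one operators *)

Section TwoStep.
Variables (K : numClosedFieldType) (d : nat).
Implicit Types (M : 'M[K]_d).

(** An eigenvalue [x - k] on the space is [- (1 - x - j)] on the dual for
    some [j], so [k + j = 1]. *)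
Lemma two_step_of M (x : K) :
  (forall u : 'cV[K]_d, aspan (fun w => exists k : nat, M *m w = (x - k%:R) *: w) u) ->
  (forall u : 'cV[K]_d, aspan (fun w => exists k : nat,
     (- M^T) *m w = (1 - x - k%:R) *: w) u) ->
  (M - x%:M) *m (M - (x - 1)%:M) = 0.
Proof.
move=> h1 h2.
have key (w : 'cV[K]_d) k : M *m w = (x - k%:R) *: w -> w = 0 \/ (k <= 1)%N.
  move=> hw; case: (leqP k 1) => hk; [by right|left].
  apply/colP => i; rewrite mxE.
  suff : forall xi : 'cV[K]_d, xi^T *m w = 0.
    by move=> /(_ (delta_mx i 0)) /matrixP/(_ 0 0); rewrite trmx_delta -rowE !mxE.
  move=> xi; elim: (h2 xi) => [|y z [k' hy] _ IH]; first by rewrite trmx0 mul0mx.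
  rewrite linearD /= mulmxDl IH addr0.
  have : y^T *m M *m w = (x - 1 + k'%:R) *: (y^T *m w).
    rewrite -[M]trmxK -trmx_mul -[M^T]opprK mulNmx hy -scaleNr opprB opprB.
    by rewrite linearZ /= -scalemxAl; congr (_ *: _); ring.
  rewrite -mulmxA hw -scalemxAr => /eqP; rewrite -subr_eq0 -scalerBl scaler_eq0.
  case/orP => [|/eqP //].
  have -> : x - k%:R - (x - 1 + k'%:R) = 1 - (k + k')%:R :> K by rewrite natrD; ring.
  by rewrite subr_eq0 eq_sym pnatr_eq1; lia.
suff H (u : 'cV[K]_d) : (M - x%:M) *m (M - (x - 1)%:M) *m u = 0.
  by apply/matrixP => a b; have := H (delta_mx b 0); rewrite -colE => /matrixP/(_ a 0); rewrite mxE => ->; rewrite !mxE.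
elim: (h1 u) => [|y z [k hy] _ IH]; first by rewrite mulmx0.
rewrite mulmxDr IH addr0; case: (key y k hy) => [->|hk]; first by rewrite mulmx0.
have hm c : (M - c%:M) *m y = (x - k%:R - c) *: y.
  by rewrite mulmxBl hy mul_scalar_mx -scalerBl.
rewrite -mulmxA hm -scalemxAr hm scalerA.
case: k hk {hy hm} => [|[|]] // _; first by rewrite subr0 subrr mulr0 scale0r.
by rewrite subrr mul0r scale0r.
Qed.

Lemma rank1_factor M : \rank M = 1%N -> exists (v : 'cV[K]_d) (xi : 'rV[K]_d), M = v *m xi.
Proof.
move=> r; have := mulmx_base M; move: (col_base M) (row_base M); rewrite r.
by move=> v xi <-; exists v, xi.
Qed.

End TwoStep.

(** * Irreducible algebras that contain a rank one projection *)

Section SlImage.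
Variables (K : numClosedFieldType) (m : nat) (L : {vspace 'M[K]_m}).
Hypothesis clL : lie_closed L.

Let ss := derived L.

Definition rep_image d (rho : 'M[K]_m -> 'M[K]_d) (A : 'M[K]_d) :=
  exists X, X \in ss /\ rho X = A.

Lemma rep_image_lin d (rho : 'M[K]_m -> 'M[K]_d) :
  is_rep L rho -> lin_pred (rep_image rho).
Proof.
move=> hr; split; first by exists 0; rewrite mem0v (rep0 hr).
move=> a A B [X [hX <-]] [Y [hY <-]]; exists (a *: X + Y).
by rewrite memvD ?memvZ // hr.1 // (ss_sub clL).
Qed.

Lemma rep_image_lie d (rho : 'M[K]_m -> 'M[K]_d) X A :
  is_rep L rho -> X \in L -> rep_image rho A -> rep_image rho (lie (rho X) A).
Proof.
move=> hr hX [Y [hY <-]]; exists (lie X Y).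
have hYL := ss_sub clL hY.
by rewrite in_derived // (rep_lie hr).
Qed.

(** With [p = v xi] an idempotent, [ad p] splits matrices in degrees 1, 0 and
    -1, and the projections on the degrees [1] and [-1] are polynomials in
    [ad p]. So the image contains [(1 - p) rho(Z) p] for all [Z]. The vectors
    [u] in the kernel of [xi] with [u xi] in the image, together with [v],
    span a submodule. *)
Lemma rank1_image_half d (rho : 'M[K]_m -> 'M[K]_d) E (s e : K)
    (v : 'cV[K]_d) (xi : 'rV[K]_d) :
  is_rep L rho -> irreducible_rep L rho -> E \in L ->
  rho E = s%:M + e *: (v *m xi) -> e != 0 -> xi *m v = 1%:M ->
  forall u : 'cV[K]_d, xi *m u = 0 -> rep_image rho (u *m xi).
Proof.
move=> hr irr hE rE e0 xv.
have Rlin := rep_image_lin hr.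
have lieE N : lie (rho E) N = e *: (v *m xi *m N - N *m v *m xi).
  rewrite rE lieDl lieZl /lie !mulmxA scalar_mxC subrr add0r //.
have R1 Z : Z \in L -> rep_image rho (v *m xi *m rho Z - rho Z *m v *m xi).
  move=> hZ; rewrite -[X in rep_image rho X]scale1r -(mulVf e0) -scalerA -lieE.
  apply: lin_predZ => //; exists (lie E Z); rewrite in_derived //.
  by rewrite (rep_lie hr).
have v0 : v <> 0.
  by move=> v0; move: xv; rewrite v0 mulmx0 => /matrixP/(_ 0 0)/eqP; rewrite !mxE eq_sym oner_eq0.
(* With [p = v xi], the square of [ad p] minus [ad p] maps [rho Z] to twice
   [(1 - p) rho(Z) p]. *)
have R21 Z : Z \in L -> rep_image rho ((rho Z *m v - v *m (xi *m rho Z *m v)) *m xi).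
  move=> hZ; have hE1 := R1 Z hZ.
  have := rep_image_lie hr hE hE1; rewrite lieE => h2.
  have {}h2 := lin_predZ e^-1 Rlin h2; rewrite scalerA mulVf // scale1r in h2.
  have := lin_predZ 2%:R^-1 Rlin (lin_predB Rlin h2 hE1).
  congr (rep_image rho _).
  rewrite !mulmxBr !mulmxBl !mulmxA.
  have vxv p (A : 'M[K]_(p, d)) : A *m v *m xi *m v = A *m v by rewrite -2!mulmxA xv mulmx1.
  have vx1 : v *m xi *m v = v by rewrite -mulmxA xv mulmx1.
  rewrite vx1 !vxv.
  set a := v *m xi *m rho Z; set b := rho Z *m v *m xi; set c := a *m v *m xi.
  rewrite (_ : _ - _ = 2%:R *: (b - c)); last first.
    by apply/matrixP => i j; rewrite !mxE; ring.
  by rewrite scalerA mulVf ?pnatr_eq0 // scale1r.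
pose U1 u := xi *m u = 0 /\ rep_image rho (u *m xi).
have U1lin : lin_pred U1.
  split; first by split; rewrite ?mulmx0 ?mul0mx //; case: Rlin.
  move=> a x y [hx1 hx2] [hy1 hy2]; split.
    by rewrite mulmxDr -scalemxAr hx1 hy1 scaler0 addr0.
  by rewrite mulmxDl -scalemxAl; case: Rlin => _; apply.
have U121 Z : Z \in L -> U1 (rho Z *m v - v *m (xi *m rho Z *m v)).
  move=> hZ; split; last exact: R21.
  by rewrite mulmxBr !mulmxA xv mul1mx subrr.
pose P w := exists (a : K) u, U1 u /\ w = a *: v + u.
have Plin : lin_pred P.
  split; first by exists 0, 0; rewrite scale0r addr0; split=> //; case: U1lin.
  move=> c x y [a [u [hu ->]]] [b [u' [hu' ->]]].
  exists (c * a + b), (c *: u + u'); split; first by case: U1lin => _; apply.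
  by rewrite scalerDr scalerA scalerDl addrACA.
have mx11 (A : 'M[K]_1) (w : 'cV[K]_d) : w *m A = A 0 0 *: w.
  by rewrite [A]mx11_scalar mul_mx_scalar mxE eqxx.
have Pall w : P w.
  apply: (submodule_full irr Plin _ v0); last first.
    by exists 1, 0; rewrite scale1r addr0; split=> //; case: U1lin.
  move=> Z _ hZ [a [u [hu ->]]]; rewrite mulmxDr -scalemxAr.
  apply: (lin_predD Plin).
    apply: (lin_predZ _ Plin).
    exists ((xi *m rho Z *m v) 0 0), (rho Z *m v - v *m (xi *m rho Z *m v)).
    by split; [apply: U121|rewrite mx11 addrC subrK].
  have [hu1 [X [hX hXu]]] := hu.
  have hXL := ss_sub clL hX.
  have hZX : lie Z X \in L by apply: clL.
  have := U121 _ hZX; rewrite (rep_lie hr) // hXu /lie.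
  set w' := (X in U1 X) => hw'.
  exists ((xi *m rho Z *m u) 0 0), (w' + (xi *m rho Z *m v) 0 0 *: u).
  split; first by apply: (lin_predD U1lin) => //; apply: (lin_predZ _ U1lin).
  rewrite -!mx11 /w' !(mulmxBl, mulmxBr) !mulmxA.
  have ux p (A : 'M[K]_(p, 1)) : A *m xi *m v = A by rewrite -mulmxA xv mulmx1.
  rewrite !ux -(mulmxA _ xi u) hu1 mulmx0 !mul0mx subr0.
  by apply/matrixP => i j; rewrite !mxE; ring.
move=> u hu; have [a [u' [[hu' hR] uE]]] := Pall u.
have a0 : a = 0.
  move: hu; rewrite uE mulmxDr -scalemxAr xv hu' addr0 => /matrixP/(_ 0 0).
  by rewrite !mxE mulr1.
by rewrite uE a0 scale0r add0r.
Qed.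

(** By [rank1_image_half] for [rho] and for its dual, the image contains [u
    xi] for [u] in [ker xi] and [v eta] for [eta] with [eta v = 0]. Their
    brackets produce the remaining traceless matrices. *)
Lemma sl_image d (rho : 'M[K]_m -> 'M[K]_d) E (s : K)
    (v : 'cV[K]_d) (xi : 'rV[K]_d) :
  is_rep L rho -> irreducible_rep L rho -> E \in L ->
  rho E = s%:M + v *m xi -> xi *m v = 1%:M ->
  forall A, \tr A = 0 -> rep_image rho A.
Proof.
move=> hr irr hE rE xv.
have Rlin := rep_image_lin hr.
have h1 : forall u : 'cV[K]_d, xi *m u = 0 -> rep_image rho (u *m xi).
  by apply: (rank1_image_half hr irr hE (s := s) (e := 1)) xv; rewrite ?scale1r ?oner_neq0.
have h2 : forall eta : 'rV[K]_d, eta *m v = 0 -> rep_image rho (v *m eta).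
  move=> eta hv.
  have [||||X [hX XE]] := @rank1_image_half d (dual_rep rho) E (- s) (-1) xi^T v^T
    (dual_rep_is_rep hr) (irreducible_dual irr) hE _ _ _ eta^T.
  - rewrite /dual_rep rE linearD /= tr_scalar_mx trmx_mul opprD scaleN1r.
    by congr (_ + _); apply/matrixP => i j; rewrite !mxE mulNrn.
  - by rewrite oppr_eq0 oner_neq0.
  - by rewrite -trmx_mul xv trmx1.
  - by rewrite -trmx_mul hv trmx0.
  rewrite -[v *m eta]opprK; apply: (lin_predN Rlin); exists X; split=> //.
  have := congr1 trmx XE; rewrite /dual_rep linearN /= trmxK trmx_mul !trmxK => <-.
  by rewrite opprK.
have mx11 (A : 'M[K]_1) (w : 'cV[K]_d) (q : 'rV[K]_d): w *m A *m q = A 0 0 *: (w *m q).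
  by rewrite [A]mx11_scalar mul_mx_scalar mxE eqxx -scalemxAl.
have hrank1 (p : 'cV[K]_d) (q : 'rV[K]_d) :
    rep_image rho (p *m q - \tr (p *m q) *: (v *m xi)).
  (* The components of [p] in [ker xi] and of [q] in the annihilator of [v]. *)
  pose u := p - v *m (xi *m p); pose eta := q - q *m v *m xi.
  have hu : xi *m u = 0 by rewrite mulmxBr !mulmxA xv mul1mx subrr.
  have he : eta *m v = 0 by rewrite mulmxBl -[q *m v *m xi *m v]mulmxA xv mulmx1 subrr.
  have [X [hX hXE]] := h1 u hu; have [Y [hY hYE]] := h2 eta he.
  have hXL := ss_sub clL hX; have hYL := ss_sub clL hY.
  have h3 : rep_image rho (lie (rho X) (rho Y)).
    by exists (lie X Y); rewrite in_derived // (rep_lie hr).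
  rewrite hXE hYE in h3.
  have h4 := lin_predZ ((xi *m p) 0 0) Rlin (h2 eta he).
  have h5 := lin_predZ ((q *m v) 0 0) Rlin (h1 u hu).
  have := lin_predD Rlin h3 (lin_predD Rlin h4 h5).
  congr (rep_image rho _).
  have trE : \tr (p *m q) = (q *m p) 0 0.
    by rewrite mxtrace_mulC /mxtrace big_ord1.
  rewrite trE /lie -!mx11.
  have xv' k (A : 'M[K]_(k, 1)) : A *m xi *m v = A by rewrite -mulmxA xv mulmx1.
  have cm : v *m q *m v *m xi *m p = v *m xi *m p *m q *m v.
    have : q *m v *m (xi *m p) = xi *m p *m (q *m v).
      rewrite [q *m v]mx11_scalar [xi *m p]mx11_scalar.
      by rewrite -!scalar_mxM mulrC.
    by move/(congr1 (mulmx v)); rewrite !mulmxA.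
  rewrite /u /eta !(mulmxBl, mulmxBr) !mulmxA !xv' cm.
  by apply/matrixP => i j; rewrite !mxE; ring.
move=> A trA; rewrite -[A]subr0 -(scale0r (v *m xi)) -trA.
rewrite [A in X in rep_image rho X]matrix_sum_delta.
have lin : lin_pred (fun B => rep_image rho (B - \tr B *: (v *m xi))).
  split; first by rewrite linear0 scale0r subr0; case: Rlin.
  move=> a B C hB hC; have := lin_predD Rlin (lin_predZ a Rlin hB) hC.
  congr (rep_image rho _).
  by rewrite linearP /= scalerBr scalerDl scalerA opprD addrACA.
apply: (lin_pred_sum _ lin) => i _; apply: (lin_pred_sum _ lin) => j _.
apply: (lin_predZ _ lin).
by rewrite -(mul_delta_mx (0 : 'I_1) i j); apply: hrank1.
Qed.

Lemma lie_iso_sl d (rho : 'M[K]_m -> 'M[K]_d) :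
  is_rep L rho -> (forall X, X \in ss -> rho X = 0 -> X = 0) ->
  (forall A, \tr A = 0 -> rep_image rho A) -> lie_iso ss (sl K d).
Proof.
move=> hr hinj him.
have sL := ss_sub clL.
have lin : linear (fun X => rho (projv ss X)).
  by move=> a X Y; rewrite linearP hr.1 // sL ?memv_proj.
pose f := linfun (mk_linear lin).
have fE X : X \in ss -> f X = rho X.
  by move=> hX; rewrite /f lfunE /= projv_id.
have trE X : X \in ss -> \tr (rho X) = 0.
  move=> hX; suff : X \in L /\ \tr (rho X) = 0 by case.
  apply: (derived_ind (g := L) (P := fun X => X \in L /\ \tr (rho X) = 0)) hX.
    split; first by rewrite mem0v (rep0 hr) linear0.
    move=> a Y Z [hY tY] [hZ tZ]; rewrite memvD ?memvZ // hr.1 //.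
    by rewrite linearP /= tY tZ mulr0 addr0.
  move=> Y Z hY hZ; rewrite clL // (rep_lie hr) // /lie linearB /= mxtrace_mulC.
  by rewrite subrr.
exists f; split.
- move=> X Y hX hY; have hXL := sL X hX; have hYL := sL Y hY.
  by rewrite !fE ?(rep_lie hr) // in_derived.
- apply/vspaceP => X; rewrite memv_cap memv_ker memv0.
  apply/andP/eqP => [[hX /eqP]|->]; last by rewrite mem0v linear0.
  by rewrite fE //; apply: hinj.
apply/vspaceP => A; rewrite memv_ker lfunE /=; apply/memv_imgP/eqP => [[X hX ->]|/him].
  by rewrite fE // trE.
by case=> X [hX <-]; exists X => //; rewrite fE.
Qed.

End SlImage.

(** * Dynkin diagrams of pairs of indices *)

Section DynkinCombinatorics.

(** The Cartan integer of [e_i - e_j] and [e_k - e_l]. *)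
Definition pairing n (a b : 'I_n * 'I_n) : int :=
  (a.1 == b.1)%:R - (a.1 == b.2)%:R - (a.2 == b.1)%:R + (a.2 == b.2)%:R.

Lemma pairing_neighbour n (a b : 'I_n * 'I_n) : a.1 != a.2 -> b.1 != b.2 ->
  pairing a b = -1 -> a.1 = b.2 \/ a.2 = b.1.
Proof.
rewrite /pairing => ha hb; case: (eqVneq a.1 b.2) => [|_]; first by left.
case: (eqVneq a.2 b.1) => [|_]; first by right.
by case: (_ == _) => //; case: (_ == _).
Qed.

Lemma pairing_same1 n (a b : 'I_n * 'I_n) : a.1 != a.2 -> b.1 != b.2 ->
  a.1 = b.1 -> 0 < pairing a b.
Proof.
rewrite /pairing => ha hb e; rewrite e eqxx (negPf hb) -e eq_sym (negPf ha).
by case: (_ == _).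
Qed.

Lemma pairing_same2 n (a b : 'I_n * 'I_n) : a.1 != a.2 -> b.1 != b.2 ->
  a.2 = b.2 -> 0 < pairing a b.
Proof.
rewrite /pairing => ha hb e; rewrite e eqxx [b.2 == _]eq_sym (negPf hb) -e (negPf ha).
by case: (_ == _).
Qed.

Lemma pairingC n (a b : 'I_n * 'I_n) : pairing a b = pairing b a.
Proof.
rewrite /pairing [b.1 == a.1]eq_sym [b.2 == a.2]eq_sym [b.1 == a.2]eq_sym [b.2 == a.1]eq_sym.
by congr (_ + _); rewrite addrAC.
Qed.

Lemma cartan_integer_lt (X : Defs.dynkin) i j : (i < j)%N ->
  cartan_integer X i j = (if dynkin_edge X i j then
    - (maxn 1 (dynkin_length X i %/ dynkin_length X j))%:Z else 0) /\
  cartan_integer X j i = (if dynkin_edge X i j then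
    - (maxn 1 (dynkin_length X j %/ dynkin_length X i))%:Z else 0).
Proof.
move=> ij; rewrite /cartan_integer [j == i]eq_sym (ltn_eqF ij).
by rewrite [minn j i]minnC [maxn j i]maxnC (minn_idPl (ltnW ij)) (maxn_idPr (ltnW ij)).
Qed.

(** Two simple roots [e_i - e_j] that are adjacent with Cartan integer -1
    share an index in opposite positions. So the Cartan matrix is symmetric,
    which excludes the types B, C, F and G, and a node with three pairwise
    non-adjacent neighbours would force two of these to share an index in the
    same position, which excludes D and E. In type A an inner node [e_i0 -
    e_j] has two neighbours; neither can end at [i0], so both start at [j],
    and their pairing would be positive. *)
Lemma chain_end (l n : nat) (ij : 'I_l -> 'I_n * 'I_n) (X : Defs.dynkin) (i0 : 'I_n) :
  (forall p, (ij p).1 != (ij p).2) ->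
  dynkin_valid X -> dynkin_rank X = l ->
  (forall p q : 'I_l, cartan_integer X p.+1 q.+1 = pairing (ij p) (ij q)) ->
  (forall p, (ij p).2 != i0) -> (exists p, (ij p).1 = i0) ->
  exists k, (k = 1%N \/ k = l) /\ forall p, ((ij p).1 == i0) = (p.+1 == k).
Proof.
move=> hne hval hrk hC hj0 [p0 hp0].
have off p q : p != q -> pairing (ij p) (ij q) <= 0.
  move=> pq; rewrite -hC /cartan_integer eqSS (negPf pq : (p == q :> nat) = false).
  by case: ifP.
have uniq0 p : ((ij p).1 == i0) = (p == p0).
  apply/eqP/eqP => [hp|->//]; apply/eqP; apply: contraTT isT => /off.
  by rewrite leNgt pairing_same1 // hp hp0.
have sym a b : (0 < a <= l)%N -> (0 < b <= l)%N ->
    cartan_integer X a b = cartan_integer X b a.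
  case: a => // a; case: b => // b ha hb.
  have := hC (Ordinal (ha : (a < l)%N)) (Ordinal (hb : (b < l)%N)).
  by rewrite pairingC -hC.
have triv a b c d : (0 < a <= l)%N -> (0 < b <= l)%N -> (0 < c <= l)%N -> (0 < d <= l)%N ->
    cartan_integer X b a = -1 -> cartan_integer X c a = -1 -> cartan_integer X d a = -1 ->
    cartan_integer X b c = 0 -> cartan_integer X b d = 0 -> cartan_integer X c d = 0 -> False.
  case: a => // a; case: b => // b; case: c => // c; case: d => // d ha hb hc hd.
  pose oa : 'I_l := Ordinal ha; pose ob : 'I_l := Ordinal hb.
  pose oc : 'I_l := Ordinal hc; pose od : 'I_l := Ordinal hd.
  move: (hC ob oa) (hC oc oa) (hC od oa) (hC ob oc) (hC ob od) (hC oc od) => /=.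
  move=> -> -> -> -> -> -> /pairing_neighbour-/(_ (hne _) (hne _)) eb.
  move=> /pairing_neighbour-/(_ (hne _) (hne _)) ec.
  move=> /pairing_neighbour-/(_ (hne _) (hne _)) ed.
  have s1 x y : (ij x).1 = (ij y).1 -> pairing (ij x) (ij y) = 0 -> False.
    by move=> e h0; have := pairing_same1 (hne x) (hne y) e; rewrite h0.
  have s2 x y : (ij x).2 = (ij y).2 -> pairing (ij x) (ij y) = 0 -> False.
    by move=> e h0; have := pairing_same2 (hne x) (hne y) e; rewrite h0.
  move=> bc bd cd.
  case: eb ec ed => eb [] ec [] ed;
    by [apply: s1 bc; congruence|apply: s2 bc; congruence
       |apply: s1 bd; congruence|apply: s2 bd; congruence
       |apply: s1 cd; congruence|apply: s2 cd; congruence].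
exists p0.+1; split; last by move=> p; rewrite uniq0.
case: X hval hrk hC sym triv => [n'|n'|n'|n'|n'||] /= hval hrk hC sym triv.
- subst n'; case: (boolp.pselect (p0.+1 = 1%N)) => [|h1]; [by left|right].
  apply/eqP; rewrite eqn_leq ltn_ord /= leqNgt; apply/negP => h2.
  have p1 : (0 < p0)%N by lia.
  have pa : (p0.-1 < l)%N by lia.
  pose a := Ordinal pa; pose b := Ordinal h2.
  have eN (q : 'I_l) : cartan_integer (TypeA l) q.+1 p0.+1 = -1 -> (ij q).1 = (ij p0).2.
    rewrite hC => /pairing_neighbour-/(_ (hne _) (hne _)) [//|e2].
    by have := hj0 q; rewrite e2 hp0 eqxx.
  have ea : (ij a).1 = (ij p0).2.
    apply: eN; rewrite /= prednK //.
    by rewrite (cartan_integer_lt _ (ltnSn p0)).1 /= eqxx.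
  have eb : (ij b).1 = (ij p0).2.
    by apply: eN; rewrite (cartan_integer_lt _ (ltnSn p0.+1)).2 /= eqxx.
  have ab : a != b by rewrite -val_eqE /=; lia.
  by have := off _ _ ab; rewrite leNgt pairing_same1 // ea eb.
- case: n' hval hrk hC sym triv => [|[|n']] // _ hrk _ sym _; subst l.
  have := sym n'.+1 n'.+2; rewrite (cartan_integer_lt _ (ltnSn n'.+1)).1.
  rewrite (cartan_integer_lt _ (ltnSn n'.+1)).2 /= !eqxx (ltn_eqF (ltnSn n'.+1)) /=.
  by rewrite leqnn ltnW //= => /(_ isT isT).
- case: n' hval hrk hC sym triv => [|[|[|n']]] // _ hrk _ sym _; subst l.
  have := sym n'.+2 n'.+3; rewrite (cartan_integer_lt _ (ltnSn n'.+2)).1.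
  rewrite (cartan_integer_lt _ (ltnSn n'.+2)).2 /= !eqxx (ltn_eqF (ltnSn n'.+2)) /=.
  by rewrite leqnn ltnW //= => /(_ isT isT).
(* In type D_l the node l - 2 has the neighbours l - 3, l - 1 and l. *)
- case: n' hval hrk hC sym triv => [|[|[|[|n']]]] // _ hrk _ _ triv; subst l.
  exfalso; apply: (triv n'.+2 n'.+1 n'.+3 n'.+4).
  + lia. + lia. + lia. + lia.
  + have [-> _] := @cartan_integer_lt (TypeD n'.+4) n'.+1 n'.+2 ltac:(lia).
    by rewrite /=; case: ifP => //; lia.
  + have [_ ->] := @cartan_integer_lt (TypeD n'.+4) n'.+2 n'.+3 ltac:(lia).
    by rewrite /=; case: ifP => //; lia.
  + have [_ ->] := @cartan_integer_lt (TypeD n'.+4) n'.+2 n'.+4 ltac:(lia).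
    by rewrite /=; case: ifP => //; lia.
  + have [-> _] := @cartan_integer_lt (TypeD n'.+4) n'.+1 n'.+3 ltac:(lia).
    by rewrite /=; case: ifP => //; lia.
  + have [-> _] := @cartan_integer_lt (TypeD n'.+4) n'.+1 n'.+4 ltac:(lia).
    by rewrite /=; case: ifP => //; lia.
  + have [-> _] := @cartan_integer_lt (TypeD n'.+4) n'.+3 n'.+4 ltac:(lia).
    by rewrite /=; case: ifP => //; lia.
(* In type E the node 4 has the neighbours 2, 3 and 5. *)
- exfalso; apply: (triv 4%N 2%N 3%N 5%N) => //; lia.
- by subst l; have := sym 2%N 3%N isT isT.
- by subst l; have := sym 1%N 2%N isT isT.
Qed.

End DynkinCombinatorics.

(** * Centres, and the dimension and irreducibility of sl(n) *)

Section Center.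
Variables (K : fieldType) (m : nat) (L : {vspace 'M[K]_m}).

Lemma centerP Z : Z \in lie_center L <-> Z \in L /\ forall X, X \in L -> lie Z X = 0.
Proof.
rewrite /lie_center memv_cap; split=> [/andP[hZ hc]|[hZ hc]].
  split=> // X; apply: (vbasis_ind (P := fun X => lie Z X = 0)).
    by split=> [|a Y Y' e1 e2]; rewrite ?lie0r // lieDr lieZr e1 e2 scaler0 addr0.
  move=> Y hY; rewrite lieC; apply/eqP; rewrite oppr_eq0.
  suff : Z \in lker (linfun (lie Y)) by rewrite memv_ker lfunE.
  move: hc; rewrite (big_rem Y) //= memv_cap; by case/andP.
rewrite hZ /=.
have : forall Y, Y \in (vbasis L : seq _) -> Y \in L by move=> Y /vbasis_mem.
elim: (vbasis L : seq _) => [|Y s IH] hs.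
  by rewrite big_nil memvf.
rewrite big_cons memv_cap IH ?andbT; last by move=> Y' hY'; apply: hs; rewrite inE hY' orbT.
by rewrite memv_ker lfunE /= lieC hc ?oppr0 // hs ?mem_head.
Qed.

End Center.

Section SlDimension.
Variables (K : fieldType).

Lemma dim_lker_form (V : vectType K) (f : 'Hom(V, K^o)) : f <> 0 ->
  \dim (lker f) = (\dim {:V}).-1.
Proof.
move=> f0; have := limg_ker_dim f fullv; rewrite capfv => <-.
have -> : limg f = fullv.
  apply/eqP; rewrite eqEdim subvf /= dimvf /=.
  have -> : dim K^o = 1%N by [].
  rewrite lt0n dimv_eq0; apply/negP => /eqP h0; apply: f0; apply/lfunP => x.
  by apply/eqP; rewrite zero_lfunE -memv0 -h0 memv_img ?memvf.
have -> : \dim (fullv : {vspace K^o}) = 1%N by rewrite dimvf.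
by rewrite addn1.
Qed.

Lemma dim_sl n : \dim (sl K n.+1) = (n.+1 * n.+1).-1.
Proof.
rewrite /sl dim_lker_form ?dimvf ?dim_matrix //.
move/lfunP/(_ (delta_mx 0 0)); rewrite zero_lfunE lfunE /= => /eqP.
by rewrite -(mul_delta_mx (0 : 'I_1)) mxtrace_mulC mul_delta_mx /mxtrace big_ord1 !mxE oner_eq0.
Qed.

Lemma lie_iso_dim m n (g : {vspace 'M[K]_m}) (k : {vspace 'M[K]_n}) :
  lie_iso g k -> \dim g = \dim k.
Proof. by case=> f [_ h0 <-]; rewrite limg_dim_eq. Qed.

Lemma lie_iso_sl_inj m (g : {vspace 'M[K]_m}) n n' :
  lie_iso g (sl K n.+1) -> lie_iso g (sl K n'.+1) -> n = n'.
Proof.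
move=> /lie_iso_dim h /lie_iso_dim; rewrite h !dim_sl.
nia.
Qed.

(** A matrix unit sends a vector with a nonzero coordinate to a basis vector. *)
Lemma sl_irreducible m (g : {vspace 'M[K]_m}) n (F : 'M[K]_m -> 'M[K]_n) :
  (0 < n)%N -> (forall A, \tr A = 0 -> exists X, X \in g /\ F X = A) ->
  irreducible_rep g F.
Proof.
move=> n0 him; split=> // W hW.
case: (eqVneq W 0%VS) => [->|W0]; [by left|right].
have hdelta (i j : 'I_n) (w : 'cV[K]_n) : i != j -> w \in W -> w j 0 *: delta_mx i 0 \in W.
  move=> ij hw; have [|X [hX XE]] := him (delta_mx i j).
    rewrite /mxtrace big1 // => k _; rewrite mxE.
    by case: eqP => //= ->; rewrite (negPf ij).
  have := hW X w hX hw; rewrite XE.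
  suff -> : delta_mx i j *m w = w j 0 *: delta_mx i 0 by [].
  apply/colP => k; rewrite !mxE (bigD1 j) //= big1 => [|p pj]; rewrite !mxE.
    by rewrite addr0 eqxx !andbT mulrC.
  by rewrite (negPf pj) andbF mul0r.
have {}hdelta (i j : 'I_n) (w : 'cV[K]_n) : i != j -> w \in W -> w j 0 != 0 ->
    (delta_mx i 0 : 'cV[K]_n) \in W.
  move=> ij hw wj; have := hdelta i j w ij hw.
  by move/(memvZ (w j 0)^-1); rewrite scalerA mulVf // scale1r.
pose w := vpick W.
have hw : w \in W := memv_pick W.
have w0 : w != 0 by rewrite vpick0.
have [j wj] : exists j, w j 0 != 0.
  apply/existsP; apply: contraNT w0; rewrite negb_exists => /forallP h.
  by apply/eqP/colP => i; rewrite (eqP (negbNE (h i))) mxE.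
have hall i : (delta_mx i 0 : 'cV[K]_n) \in W.
  case: (eqVneq i j) => [->|ij]; last exact: (hdelta i j w).
  case: (boolP [exists k, k != j]) => [/existsP[k kj]|].
    apply: (hdelta j k (delta_mx k 0)); first by rewrite eq_sym.
      exact: (hdelta k j w).
    by rewrite mxE !eqxx oner_eq0.
  rewrite negb_exists => /forallP hk.
  have wE : w = w j 0 *: delta_mx j 0.
    apply/colP => k; have /eqP -> := negbNE (hk k).
    by rewrite !mxE !eqxx mulr1.
  have := memvZ (w j 0)^-1 hw; rewrite {2}wE scalerA mulVf // scale1r //.
apply/vspaceP => x; rewrite memvf (matrix_sum_delta x); apply: memv_suml => i _.
by rewrite big_ord1 memvZ.
Qed.

End SlDimension.

(** * Diagonalizing a Cartan subalgebra *)

Section CartanDiagonal.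
Variables (K : numClosedFieldType) (m : nat) (L t : {vspace 'M[K]_m}).
Hypothesis clL : lie_closed L.
Hypothesis cart : cartan_subalgebra L t.
Let ss := derived L.
Let h := (t :&: ss)%VS.
Hypothesis hred : forall X, X \in L -> exists S Z,
  [/\ S \in ss, Z \in lie_center L & X = S + Z].

Let tor : toral L t := cart.1.

Lemma center_zero_eig Z X : Z \in lie_center L -> X \in L -> lie Z X = 0.
Proof. by move/centerP => [_]; apply. Qed.

(** Maximality: [h2] plus the centre is toral and contains the Cartan
    subalgebra. *)
Lemma enlarge_toral (h2 : {vspace 'M[K]_m}) :
  (h2 <= ss)%VS -> (h <= h2)%VS ->
  (forall X Y, X \in h2 -> Y \in h2 -> lie X Y = 0) ->
  (forall X Y, X \in h2 -> Y \in ss -> aspan (fun Z => Z \in ss /\ eigv (lie X) Z) Y) ->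
  h2 = h /\ (lie_center L <= t)%VS.
Proof.
move=> /subvP hss /subvP hh hab hd.
have sL := ss_sub clL.
have tor2 : toral L (h2 + lie_center L)%VS.
  split.
  - apply/subvP => X /memv_addP[Y /hss /sL hY [Z /centerP[hZ _] ->]].
    by rewrite memvD.
  - move=> X X' /memv_addP[Y hY [Z hZ ->]] /memv_addP[Y' hY' [Z' hZ' ->]].
    have hYL := sL _ (hss _ hY); have hYL' := sL _ (hss _ hY').
    have hZL := (centerP _ _).1 hZ; have hZL' := (centerP _ _).1 hZ'.
    rewrite lieDl !lieDr hab // (lieC Y Z') (hZL'.2 _ hYL) (hZL.2 _ hYL') (hZL.2 _ hZL'.1).
    by rewrite oppr0 !addr0.
  move=> X /memv_addP[Y hY [Z hZ ->]]; apply: aspan_ad_diag => W.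
  case/hred => [S [Z' [hS hZ' ->]]]; apply: aspan_add; last first.
    apply: aspan1; have [hZ'L hZ'c] := (centerP _ _).1 hZ'.
    split=> //; exists 0; rewrite scale0r lieDl lieC hZ'c ?(sL _ (hss _ hY)) //.
    by rewrite (center_zero_eig hZ) // oppr0 addr0.
  apply: aspan_mono (hd Y S hY hS) => T [hT [a ha]]; split; first exact: sL.
  by exists a; rewrite lieDl ha (center_zero_eig hZ) ?addr0 //; apply: sL.
have ct : (lie_center L <= t)%VS.
  suff <- : (t + lie_center L)%VS = t by rewrite addvSr.
  have [tL tab td] := tor.
  apply: cart.2; first exact: addvSl.
  split.
  - rewrite subv_add tL /=; apply/subvP => Z; by case/centerP.
  - move=> X X' /memv_addP[T hT [Z hZ ->]] /memv_addP[T' hT' [Z' hZ' ->]].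
    have hTL := toral_sub tor hT; have hTL' := toral_sub tor hT'.
    have hZL := (centerP _ _).1 hZ; have hZL' := (centerP _ _).1 hZ'.
    rewrite lieDl !lieDr tab // (lieC T Z') (hZL'.2 _ hTL) (hZL.2 _ hTL') (hZL.2 _ hZL'.1).
    by rewrite oppr0 !addr0.
  move=> X /memv_addP[T hT [Z hZ ->]]; apply: aspan_ad_diag => W hW.
  apply: aspan_mono (ad_diag_aspan (td T hT) hW) => Y [hY [a ha]]; split=> //.
  by exists a; rewrite lieDl ha (center_zero_eig hZ) ?addr0.
have t2 : (t <= h2 + lie_center L)%VS.
  apply/subvP => T hT; have := toral_sub tor hT.
  case/hred => S [Z [hS hZ TE]]; rewrite TE memv_add //; apply: hh.
  rewrite memv_cap hS andbT (_ : S = T - Z); last by rewrite TE addrK.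
  by rewrite memvB //; apply: (subvP ct).
have tE := cart.2 _ t2 tor2.
split=> //; apply/eqP; rewrite eqEsubv; apply/andP; split; last by apply/subvP.
by rewrite subv_cap -[X in (_ <= X)%VS && _]tE addvSl /=; apply/subvP.
Qed.

Section Diagonal.
Variables (n : nat) (F : 'M[K]_m -> 'M[K]_n).
Hypothesis n0 : (0 < n)%N.
Hypothesis rF : is_rep ss F.
Hypothesis Finj : forall X, X \in ss -> F X = 0 -> X = 0.
Hypothesis Fim : forall A, \tr A = 0 -> exists X, X \in ss /\ F X = A.

Lemma ss_closed : lie_closed ss.
Proof. by move=> X Y hX hY; apply: in_derived; apply: (ss_sub clL). Qed.

Lemma toral_h : toral ss h.
Proof.
have [tL tab td] := tor; split; first exact: capvSr.
  by move=> X Y; rewrite !memv_cap => /andP[hX _] /andP[hY _]; apply: tab.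
move=> X; rewrite memv_cap => /andP[hX hXs]; apply: aspan_ad_diag => Y hY.
have hYL := ss_sub clL hY.
apply: (aspan_eig_stable (P := fun Y => Y \in ss) (f := lie X)) => //.
- exact: memv_lin.
- by move=> Z hZ; apply: ss_closed.
by apply: aspan_mono (ad_diag_aspan (td X hX) hYL) => Z [].
Qed.

Lemma lie_diag (D : 'rV[K]_n) (A : 'M[K]_n) i j :
  lie (diag_mx D) A i j = (D 0 i - D 0 j) * A i j.
Proof. by rewrite /lie mul_diag_mx mul_mx_diag !mxE; ring. Qed.

(** The Cartan subalgebra is diagonalizable in the faithful representation
    [F], and all elements that are diagonal in the same basis form a toral
    subalgebra; so maximality applies. *)
Lemma cartan_diagonal : exists B : 'M[K]_n, B \in unitmx /\
  (forall X, X \in h <-> X \in ss /\ exists D, F X *m B = B *m diag_mx D) /\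
  (lie_center L <= t)%VS.
Proof.
have irrF : irreducible_rep ss F := sl_irreducible n0 Fim.
have [B [uB hB]] := codiag_basis (toral_rep rF irrF toral_h).
exists B; split=> //.
pose P X := X \in ss /\ exists D, F X *m B = B *m diag_mx D.
have Plin : lin_pred P.
  split; first by split; [rewrite mem0v|exists 0; rewrite (rep0 rF) linear0 mul0mx mulmx0].
  move=> a X Y [hX [D1 h1]] [hY [D2 h2]]; split; first by rewrite memvD ?memvZ.
  exists (a *: D1 + D2); rewrite rF.1 // mulmxDl -scalemxAl h1 h2.
  by rewrite linearP /= mulmxDr -scalemxAr.
have [h2 hh2] := vspace_of_pred Plin.
pose G A := invmx B *m A *m B.
have GE X D : F X *m B = B *m diag_mx D -> F X = B *m diag_mx D *m invmx B.
  by move=> <-; rewrite mulmxK.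
have [||||h2E hct] := @enlarge_toral h2.
- by apply/subvP => X /hh2 [].
- apply/subvP => X hX; apply/hh2; split; first by move: hX; rewrite memv_cap => /andP[].
  exact: hB.
- move=> X Y /hh2 [hX [D1 h1]] /hh2 [hY [D2 e2]].
  apply: Finj; first exact: ss_closed.
  rewrite rF.2 // (GE _ _ h1) (GE _ _ e2) /lie !mulmxA !mulmxKV //.
  rewrite -!(mulmxA B) -mulmxBr -mulmxBl.
  suff -> : diag_mx D1 *m diag_mx D2 - diag_mx D2 *m diag_mx D1 = 0.
    by rewrite mul0mx mulmx0.
  by rewrite diag_mxC subrr.
- move=> X Y /hh2 [hX [D e]] hY.
  have hall (A : 'M[K]_n) : aspan (eigv (lie (F X))) A.
    have -> : A = B *m (invmx B *m A *m B) *m invmx B.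
      by rewrite !mulmxA mulmxV // mul1mx mulmxK.
    have lin : lin_pred (fun C => aspan (eigv (lie (F X))) (B *m C *m invmx B)).
      have lin0 : lin_pred (aspan (eigv (lie (F X)))).
        by apply: aspan_lin => a x [c hc]; exists c; rewrite lieZr hc !scalerA mulrC.
      split; first by rewrite mulmx0 mul0mx; case: lin0.
      move=> a C1 C2 e1 e2; rewrite mulmxDr mulmxDl -scalemxAr -scalemxAl.
      by case: lin0 => _; apply.
    rewrite [invmx B *m A *m B]matrix_sum_delta.
    apply: (lin_pred_sum _ lin) => i _; apply: (lin_pred_sum _ lin) => j _.
    apply: (lin_predZ _ lin); apply: aspan1; exists (D 0 i - D 0 j).
    rewrite (GE _ _ e) /lie !mulmxA !mulmxKV // -!(mulmxA B) -mulmxBr -mulmxBl.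
    rewrite scalemxAr scalemxAl; congr (B *m (_ *m invmx B)).
    apply/matrixP => p q; rewrite -[_ - _]/(lie _ _) lie_diag !mxE.
    case: (eqVneq p i) => [->|]; case: (eqVneq q j) => [->|] //=; rewrite ?mulr0 //.
  pose PF A := exists Z, Z \in ss /\ F Z = A.
  have PFlin : lin_pred PF.
    split; first by exists 0; rewrite mem0v (rep0 rF).
    move=> a A1 A2 [Z1 [hZ1 <-]] [Z2 [hZ2 <-]]; exists (a *: Z1 + Z2).
    by rewrite memvD ?memvZ // rF.1.
  have H : aspan (fun A => PF A /\ eigv (lie (F X)) A) (F Y).
    apply: (aspan_eig_stable (P := PF) (f := lie (F X))) => //; last by exists Y.
    by move=> A [Z [hZ <-]]; exists (lie X Z); rewrite ss_closed // rF.2.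
  pose Q A := forall Y, Y \in ss -> F Y = A ->
    aspan (fun Z => Z \in ss /\ eigv (lie X) Z) Y.
  suff : PF (F Y) /\ Q (F Y) by case=> _; apply.
  elim: H => [|A1 A2 [[Z [hZ ZE]] [c hc]] _ [[Z2 [hZ2 ZE2]] IH]].
    split; first by case: PFlin.
    by move=> Z hZ /Finj -> //; apply: aspan0.
  split; first by apply: (lin_predD PFlin); [exists Z|exists Z2].
  move=> Y' hY' Y'E.
  have -> : Y' = Z + Z2.
    apply/eqP; rewrite -subr_eq0; apply/eqP/Finj; first by rewrite memvB ?memvD.
    by rewrite (repB rF) ?memvD // (repD rF) // Y'E ZE ZE2 subrr.
  apply: aspan_add; last by apply: IH.
  apply: aspan1; split=> //; exists c.
  apply/eqP; rewrite -subr_eq0; apply/eqP/Finj.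
    by rewrite memvB ?memvZ // ss_closed.
  by rewrite (repB rF) ?memvZ ?ss_closed // rF.2 // ZE hc (repZ rF) // ZE subrr.
split=> // X; rewrite -h2E; exact: hh2.
Qed.

End Diagonal.
End CartanDiagonal.

(** * Roots and coroots of traceless matrices *)

Section DiagonalModel.
Variables (K : numClosedFieldType) (m n : nat) (s h : {vspace 'M[K]_m}).
Hypothesis hs : (h <= s)%VS.
Variable G : 'M[K]_m -> 'M[K]_n.
Hypothesis rG : is_rep s G.
Hypothesis Ginj : forall X, X \in s -> G X = 0 -> X = 0.
Hypothesis Gtr : forall X, X \in s -> \tr (G X) = 0.
Hypothesis Gim : forall A, \tr A = 0 -> exists X, X \in s /\ G X = A.
Hypothesis Gh : forall X, X \in h <-> X \in s /\ exists D, G X = diag_mx D.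

Definition wt (i : 'I_n) (H : subvs_of h) : K := G (vsval H) i i.

Lemma vsval_s (H : subvs_of h) : vsval H \in s.
Proof. exact: (subvP hs _ (subvsP H)). Qed.

Lemma G_wt (H : subvs_of h) : G (vsval H) = diag_mx (\row_i wt i H).
Proof.
have [_ [D hD]] := (Gh _).1 (subvsP H).
rewrite [LHS]hD; congr diag_mx; apply/rowP => i.
by rewrite mxE /wt hD mxE eqxx mulr1n.
Qed.

Lemma wt_linear i : linear (wt i : subvs_of h -> K^o).
Proof.
by move=> a H H'; rewrite /wt linearP (rG.1 _ _ _ (vsval_s H) (vsval_s H')) !mxE.
Qed.

Lemma G_lie_entry (H : subvs_of h) X i j : X \in s ->
  G (lie (vsval H) X) i j = (wt i H - wt j H) * G X i j.
Proof.
move=> hX; rewrite rG.2 ?vsval_s // G_wt /lie mul_diag_mx mul_mx_diag !mxE.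
by rewrite mulrBl [_ * wt j H]mulrC.
Qed.

(** An element with entries 1 and -1 at two places separates the weights, and
    is the coroot of [e_i - e_j]. *)
Lemma test_element i j : i != j -> exists H : subvs_of h,
  forall k, wt k H = (k == i)%:R - (k == j)%:R.
Proof.
move=> ij; pose D : 'rV[K]_n := \row_k ((k == i)%:R - (k == j)%:R).
have [|X [hX XE]] := Gim (A := diag_mx D).
  rewrite mxtrace_diag /D; under eq_bigr do rewrite mxE.
  rewrite sumrB; apply/eqP; rewrite subr_eq0; apply/eqP.
  have e1 (p : 'I_n) : \sum_(k < n) (k == p)%:R = 1 :> K.
    by rewrite (bigD1 p) //= eqxx big1 ?addr0 // => k /negPf->.
  by rewrite !e1.
have hXh : X \in h by apply/Gh; split=> //; exists D.
exists (Subvs hXh) => k; rewrite /wt /= XE !mxE eqxx mulr1n //.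
Qed.

Lemma two_neq0 : (2%:R : K) != 0. Proof. by rewrite pnatr_eq0. Qed.

Lemma centralizer_cartan X : X \in s ->
  (forall H : subvs_of h, lie (vsval H) X = 0) -> X \in h.
Proof.
move=> hX hc; apply/Gh; split=> //; exists (\row_i G X i i).
apply/matrixP => i j; rewrite !mxE; case: (eqVneq i j) => [->|ij]; first by rewrite mulr1n.
have [H hH] := test_element ij.
have := G_lie_entry H i j hX; rewrite hc (rep0 rG) mxE !hH !eqxx (negPf ij).
rewrite [j == i]eq_sym (negPf ij) => /esym/eqP; rewrite subr0 sub0r opprK.
by rewrite mulf_eq0 -[true%:R + true%:R]/(2%:R) (negPf two_neq0) => /eqP.
Qed.

Lemma weight_pair_inj i j p q : i != j ->
  (forall H, wt p H - wt q H = wt i H - wt j H) -> p = i /\ q = j.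
Proof.
move=> ij hpq; have [H hH] := test_element ij.
have e := hpq H; rewrite !hH !eqxx [j == i]eq_sym (negPf ij) subr0 sub0r opprK in e.
have : ((p == i) + (q == j))%N%:R = (2 + (p == j) + (q == i))%N%:R :> K.
  apply/eqP; rewrite -subr_eq0 !natrD.
  rewrite (_ : _ - _ = (p == i)%:R - (p == j)%:R - ((q == i)%:R - (q == j)%:R) - 2%:R); last by ring.
  by rewrite e subrr.
move/eqP; rewrite eqr_nat.
case: (eqVneq p i) => [->|_]; case: (eqVneq q j) => [->|_] //.
all: by case: (_ == _); case: (_ == _).
Qed.

(** Differences of two diagonal entries are pairwise different functionals,
    so a root vector has only one nonzero entry. *)
Lemma root_space_entry (a : dual h) X : a <> 0 -> X <> 0 -> root_space s a X ->
  exists i j x, [/\ i != j, forall H, a H = wt i H - wt j H & G X = x *: delta_mx i j].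
Proof.
move=> a0 X0 [hX ha].
have entry H p q : (wt p H - wt q H - (a H : K)) * G X p q = 0.
  have := G_lie_entry H p q hX; rewrite ha (repZ rG) // mxE => e.
  by rewrite mulrBl -e subrr.
have [[i j] hij] : exists ij : 'I_n * 'I_n, G X ij.1 ij.2 != 0.
  apply/existsP; apply: contraT; rewrite negb_exists => /forallP h0.
  case: X0; apply: Ginj => //; apply/matrixP => p q.
  by rewrite (eqP (negbNE (h0 (p, q)))) mxE.
have ha' p q : G X p q != 0 -> forall H, (a H : K) = wt p H - wt q H.
  move=> hpq H; have /eqP := entry H p q; rewrite mulf_eq0 (negPf hpq) orbF.
  by rewrite subr_eq0 eq_sym => /eqP.
have ij : i != j.
  apply/negP => /eqP e; apply: a0; apply/lfunP => H.
  by rewrite zero_lfunE (ha' _ _ hij) /= e subrr.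
exists i, j, (G X i j); split=> //; first exact: ha'.
apply/matrixP => p q; rewrite !mxE.
case: (boolP ((p == i) && (q == j))) => [/andP[/eqP-> /eqP->]|hne]; first by rewrite mulr1.
rewrite mulr0; apply/eqP; apply: contraNT hne => hpq.
have [|-> ->] := @weight_pair_inj i j p q ij; last by rewrite !eqxx.
by move=> H; rewrite -(ha' _ _ hpq) (ha' _ _ hij).
Qed.

(** The coroot is the bracket of two root vectors, which are multiples of
    matrix units. The last conclusion serves to reduce to the bracketed root
    vectors in [line_of_tuple]. *)
Lemma coroot_entry (a : dual h) H : is_coroot s a H ->
  exists i j, [/\ i != j, forall H', a H' = wt i H' - wt j H',
    (forall k, wt k H = (k == i)%:R - (k == j)%:R) &
    forall X Y, root_space s (- a) X -> root_space s (- a) Y -> Y <> 0 ->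
      exists x, X = x *: Y].
Proof.
case=> a2 [X [Y [rX rY hH]]].
have a0 : a <> 0.
  by move=> a0; move: a2; rewrite a0 zero_lfunE => /esym/eqP; rewrite (negPf two_neq0).
have na0 : - a <> 0 by move/eqP; rewrite oppr_eq0 => /eqP.
have H0 : vsval H <> 0.
  move=> H0; move: a2; rewrite (_ : H = 0) ?linear0; last exact: val_inj.
  by move/esym/eqP; rewrite (negPf two_neq0).
have X0 : X <> 0 by move=> X0; apply: H0; rewrite hH X0 lie0l.
have Y0 : Y <> 0 by move=> Y0; apply: H0; rewrite hH Y0 lie0r.
have [i [j [x [ij ha GX]]]] := root_space_entry a0 X0 rX.
have neg_entry Z : root_space s (- a) Z -> exists z, G Z = z *: delta_mx j i.
  move=> rZ; case: (boolp.pselect (Z = 0)) => [->|Z0].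
    by exists 0; rewrite (rep0 rG) scale0r.
  have [p [q [z [pq hna GZ]]]] := root_space_entry na0 Z0 rZ.
  have [||<- <-] := @weight_pair_inj j i p q; first by rewrite eq_sym.
    by move=> H'; rewrite -hna opp_lfunE ha opprB.
  by exists z.
have [y GY] := neg_entry Y rY.
exists i, j; split=> //.
  have GH : G (vsval H) = (x * y) *: (delta_mx i i - delta_mx j j).
    rewrite hH rG.2 ?rX.1 ?rY.1 // GX GY /lie -!scalemxAl -!scalemxAr !scalerA.
    by rewrite !mul_delta_mx [y * x]mulrC scalerBr.
  have wtH k : wt k H = (x * y) * ((k == i)%:R - (k == j)%:R).
    by rewrite /wt GH !mxE !andbb.
  have xy : x * y = 1.
    move: a2; rewrite ha !wtH !eqxx [j == i]eq_sym (negPf ij) subr0 sub0r.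
    rewrite mulrN opprK mulr1 -mulr2n => e.
    by apply: (mulIf two_neq0); rewrite mul1r mulr_natr.
  by move=> k; rewrite wtH xy mul1r.
move=> Z W rZ rW W0; have [z GZ] := neg_entry Z rZ; have [w GW] := neg_entry W rW.
have w0 : w != 0.
  by apply/eqP => w0; apply: W0; apply: Ginj; rewrite ?rW.1 // GW w0 scale0r.
exists (z / w); apply/eqP; rewrite -subr_eq0; apply/eqP/Ginj.
  by rewrite memvB ?memvZ ?rZ.1 ?rW.1.
rewrite (repB rG) ?memvZ ?rZ.1 ?rW.1 // (repZ rG) ?rW.1 // GZ GW scalerA divfK //.
by rewrite subrr.
Qed.

(** Diagonal traceless matrices. *)
Lemma dim_cartan : (0 < n)%N -> \dim h = n.-1.
Proof.
move=> n0.
have linG : linear (fun X => G (projv s X)).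
  by move=> a X Y; rewrite linearP rG.1 // memv_proj.
pose f := linfun (mk_linear linG).
have fE X : X \in s -> f X = G X by move=> hX; rewrite /f lfunE /= projv_id.
have linS : linear (fun r : 'rV[K]_n => \sum_i r 0 i : K^o).
  move=> a x y; rewrite scaler_sumr -big_split; apply: eq_bigr => i _.
  by rewrite !mxE.
pose S := linfun (mk_linear linS).
have S0 : S <> 0.
  move/lfunP/(_ (delta_mx 0 (Ordinal n0))); rewrite zero_lfunE lfunE /=.
  rewrite (bigD1 (Ordinal n0)) //= mxE !eqxx big1 ?addr0 => [/eqP|i /negPf hi].
    by rewrite oner_eq0.
  by rewrite mxE hi andbF.
have dS : \dim (lker S) = n.-1.
  by rewrite dim_lker_form // dimvf dim_matrix; congr _.-1; apply: mul1n.
pose dg := linfun (@diag_mx K n).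
have e1 : (f @: h)%VS = (dg @: lker S)%VS.
  apply/vspaceP => A; apply/memv_imgP/memv_imgP => [[X hX ->]|[D]].
    have [hXs [D hD]] := (Gh X).1 hX; exists D; last by rewrite fE // hD lfunE.
    by rewrite memv_ker lfunE /= -mxtrace_diag -hD Gtr.
  rewrite memv_ker !lfunE /= => /eqP hD ->.
  have [|X [hX XE]] := Gim (A := diag_mx D); first by rewrite mxtrace_diag.
  by exists X; [apply/Gh; split=> //; exists D|rewrite fE].
rewrite -dS -(limg_dim_eq (f := f)) ?e1 ?limg_dim_eq //; last first.
  apply/vspaceP => X; rewrite memv_cap memv_ker memv0; apply/andP/eqP => [[hX]|->].
    have hXs := subvP hs _ hX.
    by rewrite fE // => /eqP; apply: Ginj.
  by rewrite mem0v linear0.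
apply/vspaceP => D; rewrite memv_cap !memv_ker memv0; apply/andP/eqP => [[_ /eqP hD]|->].
  apply/rowP => i; have := hD => /matrixP/(_ i i).
  by rewrite lfunE /= !mxE eqxx mulr1n.
by rewrite !linear0.
Qed.

End DiagonalModel.

(** * Tuples and one-dimensional top eigenspaces *)

Section ComplexTuple.
Variables (K : numClosedFieldType) (m : nat) (L t : {vspace 'M[K]_m}).
Hypothesis clL : lie_closed L.
Hypothesis cart : cartan_subalgebra L t.
Let ss := derived L.
Let h := (t :&: ss)%VS.
Hypothesis hred : forall X, X \in L -> exists S Z,
  [/\ S \in ss, Z \in lie_center L & X = S + Z].
Hypothesis hV : forall u : 'cV[K]_m,
  aspan (fun u => forall T, T \in t -> eigv (mulmx T) u) u.
Variables (l : nat) (alpha : l.-tuple (dual h)) (alphav : l.-tuple (subvs_of h)).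
Hypothesis hsimple : simple_roots ss alpha.
Hypothesis hco : forall i, is_coroot ss (tnth alpha i) (tnth alphav i).
Hypothesis hbour : bourbaki_labelling alpha alphav.
Variables (Ess : subvs_of h) (E' : 'M[K]_m).
Hypothesis hE01 : forall i, tnth alpha i Ess = 0 \/ tnth alpha i Ess = 1.
Hypothesis hE'c : E' \in lie_center L.
Variables (d : nat) (U : 'M[K]_m -> 'M[K]_d).
Hypothesis rU : is_rep L U.
Hypothesis irrU : irreducible_rep L U.
Variables (c : K) (mu mu_star : dual h).
Hypothesis hUE' : U E' = c%:M.
Hypothesis hmu : is_highest_weight ss alpha U mu.
Hypothesis hmus : is_highest_weight ss alpha (dual_rep U) mu_star.
Hypothesis hlevel : (mu Ess : K) + mu_star Ess = 1.

Let E := vsval Ess + E'.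
Let tor := cart.1.

Lemma bourbaki_integral i j :
  exists z : int, tnth alpha i (tnth alphav j) = z%:~R.
Proof. by case: hbour => X [_ _ hX]; exists (cartan_integer X i.+1 j.+1). Qed.

Lemma E'_L : E' \in L. Proof. by have /centerP[] := hE'c. Qed.

Lemma E_L : E \in L. Proof. by rewrite memvD ?(hmem_L clL) ?E'_L. Qed.

Lemma lie_E X : X \in L -> lie E X = lie (vsval Ess) X.
Proof. by move=> hX; rewrite lieDl (center_zero_eig hE'c) ?addr0. Qed.

Lemma UE : U E = U (vsval Ess) + c%:M.
Proof. by rewrite (repD rU) ?(hmem_L clL) ?E'_L // hUE'. Qed.

Lemma spectrum_U : forall u : 'cV[K]_d, aspan (fun w => exists k : nat,
  U E *m w = ((mu Ess : K) + c - k%:R) *: w) u.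
Proof.
apply: (hw_spectrum clL tor hV hsimple hco bourbaki_integral rU irrU hE01 E'_L) => //.
by move=> X; apply: center_zero_eig.
Qed.

Lemma spectrum_dual : forall u : 'cV[K]_d, aspan (fun w => exists k : nat,
  - (U E)^T *m w = ((mu_star Ess : K) - c - k%:R) *: w) u.
Proof.
apply: (hw_spectrum clL tor hV hsimple hco bourbaki_integral (dual_rep_is_rep rU)
  (irreducible_dual irrU) hE01 E'_L) => //.
  by move=> X; apply: center_zero_eig.
by rewrite /dual_rep hUE' tr_scalar_mx; apply/matrixP => i j; rewrite !mxE mulNrn.
Qed.

(** The kernel is an ideal; if it were everything, [E_ss] would act by 0 and
    both weights would vanish on it. *)
Lemma U_inj : simple_lie ss -> forall X, X \in ss -> U X = 0 -> X = 0.
Proof.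
case=> _ hs.
have sL := ss_sub clL.
have Plin : lin_pred (fun X => X \in ss /\ U X = 0).
  split; first by rewrite mem0v (rep0 rU).
  move=> a X Y [hX eX] [hY eY]; rewrite memvD ?memvZ // rU.1 ?sL //.
  by rewrite eX eY scaler0 addr0.
have [I hI] := vspace_of_pred Plin.
have [||I0|Is] := hs I.
- by apply/subvP => X /hI[].
- move=> X Y hX /hI[hY eY]; apply/hI; split; first by apply: in_derived; apply: sL.
  by rewrite rU.2 ?sL // eY lie0r.
- move=> X hX eX; apply/eqP; rewrite -memv0 -I0; exact/hI.
have hU0 X : X \in ss -> U X = 0 by rewrite -{1}Is => /hI[].
have mu0 : (mu Ess : K) = 0.
  case: hmu => v [/eqP v0 hv _]; have := hv Ess; rewrite hU0 ?hmem_ss // mul0mx.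
  by move/esym/eqP; rewrite scaler_eq0 (negPf v0) orbF => /eqP.
have mus0 : (mu_star Ess : K) = 0.
  case: hmus => v [/eqP v0 hv _]; have := hv Ess; rewrite /dual_rep hU0 ?hmem_ss //.
  rewrite trmx0 oppr0 mul0mx.
  by move/esym/eqP; rewrite scaler_eq0 (negPf v0) orbF => /eqP.
by move: hlevel; rewrite mu0 mus0 addr0 => /esym/eqP; rewrite oner_eq0.
Qed.

Hypothesis hc : c = 3%:R / 2%:R - (mu Ess : K).

Lemma half_eq : (3%:R / 2%:R : K) - 1 = 1 / 2%:R.
Proof. by field. Qed.

(** Here [mu(E_ss) + c = 3/2] and [mu_star(E_ss) - c = 1 - 3/2]. *)
Lemma two_step : (U E - (3%:R / 2%:R)%:M) *m (U E - (1 / 2%:R)%:M) = 0.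
Proof.
rewrite -half_eq; apply: two_step_of => u.
  apply: aspan_mono (spectrum_U u) => w [k hw]; exists k.
  by rewrite hw hc; congr (_ *: _); ring.
apply: aspan_mono (spectrum_dual u) => w [k hw]; exists k; rewrite hw.
congr (_ *: _); rewrite hc; congr (_ - _).
have -> : (mu_star Ess : K) = 1 - mu Ess by rewrite -hlevel addrC addKr.
by ring.
Qed.

(** [U E - 1/2] is idempotent by [two_step], and of rank one. *)
Lemma top_projection : \rank (U E - (1 / 2%:R)%:M) = 1%N ->
  exists (v : 'cV[K]_d) (xi : 'rV[K]_d), U E = (1 / 2%:R)%:M + v *m xi /\ xi *m v = 1%:M.
Proof.
move=> r1; have [v [xi vxi]] := rank1_factor r1; exists v, xi.
split; first by rewrite -vxi addrC subrK.
have e : U E - (3%:R / 2%:R)%:M = v *m xi - 1%:M.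
  rewrite -vxi -addrA -opprD -raddfD /=; congr (_ - _%:M); rewrite -half_eq; ring.
have := two_step; rewrite e vxi.
rewrite mulmxBl mul1mx => /eqP; rewrite subr_eq0 => /eqP pp.
have vxi0 : v *m xi != 0 by rewrite -mxrank_eq0 -vxi r1.
have : ((xi *m v) 0 0 - 1) *: (v *m xi) = 0.
  rewrite scalerBl scale1r -[X in _ - X]pp mulmxA -[v *m xi *m v]mulmxA.
  by rewrite {2}[xi *m v]mx11_scalar mul_mx_scalar -scalemxAl subrr.
move/eqP; rewrite scaler_eq0 (negPf vxi0) orbF subr_eq0 => /eqP xv.
by rewrite [xi *m v]mx11_scalar xv.
Qed.

Lemma U_sl : \rank (U E - (1 / 2%:R)%:M) = 1%N ->
  forall A, \tr A = 0 -> exists X, X \in ss /\ U X = A.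
Proof.
move=> /top_projection[v [xi [hE xv]]] A.
exact: (sl_image clL rU irrU E_L hE xv).
Qed.

Lemma U_trace X : X \in ss -> \tr (U X) = 0.
Proof.
move=> hX; suff : X \in L /\ \tr (U X) = 0 by case.
apply: (derived_ind (g := L) (P := fun X => X \in L /\ \tr (U X) = 0)) hX.
  split; first by rewrite mem0v (rep0 rU) linear0.
  move=> a Y Z [hY tY] [hZ tZ]; rewrite memvD ?memvZ // rU.1 //.
  by rewrite linearP /= tY tZ mulr0 addr0.
move=> Y Z hY hZ; rewrite clL // (rep_lie rU) // /lie linearB /= mxtrace_mulC.
by rewrite subrr.
Qed.

(** Change of basis to the one of [cartan_diagonal]. *)
Lemma diag_model n (F : 'M[K]_m -> 'M[K]_n) : (0 < n)%N -> is_rep ss F ->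
  (forall X, X \in ss -> F X = 0 -> X = 0) ->
  (forall X, X \in ss -> \tr (F X) = 0) ->
  (forall A, \tr A = 0 -> exists X, X \in ss /\ F X = A) ->
  exists (B : 'M[K]_n) (G : 'M[K]_m -> 'M[K]_n), B \in unitmx /\
   (forall X, G X = invmx B *m F X *m B) /\
   [/\ is_rep ss G, forall X, X \in ss -> G X = 0 -> X = 0,
    forall X, X \in ss -> \tr (G X) = 0,
    forall A, \tr A = 0 -> exists X, X \in ss /\ G X = A &
    forall X, X \in h <-> X \in ss /\ exists D, G X = diag_mx D].
Proof.
move=> n0 rF Finj Ftr Fim.
have [B [uB [hB _]]] := cartan_diagonal clL cart hred n0 rF Finj Fim.
pose G X := invmx B *m F X *m B.
exists B, G; split=> //; split=> //; split.
- split=> [a X Y hX hY|X Y hX hY]; rewrite /G.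
    by rewrite rF.1 // mulmxDr mulmxDl -scalemxAr -scalemxAl.
  by rewrite rF.2 // /lie mulmxBr mulmxBl !mulmxA !mulmxK.
- move=> X hX GX; apply: Finj => //.
  have : B *m G X *m invmx B = F X by rewrite /G !mulmxA mulmxV // mul1mx mulmxK.
  by rewrite GX mulmx0 mul0mx.
- by move=> X hX; rewrite /G mxtrace_mulC mulmxA mulmxV // mul1mx Ftr.
- move=> A tA; have [|X [hX XE]] := Fim (B *m A *m invmx B).
    by rewrite mxtrace_mulC mulmxA mulVmx // mul1mx.
  by exists X; split=> //; rewrite /G XE !mulmxA mulVmx // mul1mx mulmxKV.
move=> X; rewrite hB; split=> -[hX [D hD]]; split=> //; exists D.
  by rewrite /G -mulmxA hD mulKmx.
by rewrite -hD /G !mulmxA mulmxV // mul1mx.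
Qed.

(** In the diagonal model [U E - 1/2] is the projection on one coordinate
    [i0], so a simple root [e_i - e_j] takes on [E_ss] the value 1, -1 or 0
    according to whether [i = i0], [j = i0] or neither. The value -1 is
    excluded, and some simple root has to start at [i0], as otherwise [E_ss]
    would be 0; this is the situation of [chain_end]. The trace of [E_ss]
    determines [c]. *)
Lemma tuple_of_line : simple_lie ss -> \rank (U E - (1 / 2%:R)%:M) = 1%N ->
  (1 < d)%N ->
  [/\ lie_iso ss (sl K d), l = d.-1,
      exists k, (k = 1%N \/ k = l) /\
        is_dual_basis_elt alpha k Ess /\ is_fundamental_weight alphav k mu &
      c = (d.-1 + 3)%:R / (2 * (d.-1 + 1))%:R].
Proof.
move=> hsim r1 d1.
have d0 : (0 < d)%N := ltnW d1.
have sL := ss_sub clL.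
have Uinj := U_inj hsim.
have Uim := U_sl r1.
have rUs : is_rep ss U.
  by split=> [a X Y hX hY|X Y hX hY]; [apply: rU.1|apply: rU.2]; apply: sL.
have [B [G [uB [GX [rG Ginj Gtr Gim Gh]]]]] := diag_model d0 rUs Uinj U_trace Uim.
have hss : (h <= ss)%VS by apply: capvSr.
pose w := wt (h := h) G.
have GE : invmx B *m U E *m B = diag_mx (\row_i (w i Ess + c)).
  rewrite UE mulmxDr mulmxDl -GX (G_wt Gh).
  rewrite mul_mx_scalar -scalemxAl mulVmx // scalemx1.
  by apply/matrixP => i j; rewrite !mxE -mulrnDl.
pose e i := w i Ess + c - 1 / 2%:R.
have Ge : invmx B *m (U E - (1 / 2%:R)%:M) *m B = diag_mx (\row_i e i).
  rewrite mulmxBr mulmxBl GE mul_mx_scalar -scalemxAl mulVmx // scalemx1.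
  by apply/matrixP => i j; rewrite !mxE -mulrnBl.
have e01 i : e i = 0 \/ e i = 1.
  have := two_step => /(congr1 (fun A => invmx B *m A *m B)).
  rewrite mulmx0 mul0mx => e0.
  have {}e0 : (invmx B *m (U E - (3%:R / 2%:R)%:M) *m B) *m diag_mx (\row_i e i) = 0.
    by rewrite -Ge -[RHS]e0 !mulmxA mulmxK.
  have Ge3 : invmx B *m (U E - (3%:R / 2%:R)%:M) *m B = diag_mx (\row_i (e i - 1)).
    rewrite mulmxBr mulmxBl GE mul_mx_scalar -scalemxAl mulVmx // scalemx1.
    apply/matrixP => a b; rewrite !mxE -mulrnBl; congr (_ *+ _).
    by rewrite /e -half_eq; ring.
  move: e0; rewrite Ge3 mul_diag_mx => /matrixP/(_ i i).
  rewrite !mxE eqxx mulr1n => /eqP; rewrite mulf_eq0 subr_eq0.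
  by case/orP => /eqP; [right|left].
have rk : \rank (diag_mx (\row_i e i)) = 1%N.
  rewrite -Ge mxrankMfree ?row_free_unit //.
  by rewrite -mxrank_tr trmx_mul mxrankMfree ?row_free_unit ?unitmx_tr ?unitmx_inv // mxrank_tr.
have [i0 he] : exists i0, forall i, e i = (i == i0)%:R.
  have tre : (\sum_i e i) = 1.
    have := top_projection r1 => -[v [xi [hvx xv]]].
    have : \tr (diag_mx (\row_i e i)) = 1.
      rewrite -Ge mxtrace_mulC mulmxA mulmxV // mul1mx hvx addrC addKr.
      by rewrite mxtrace_mulC xv /mxtrace big_ord1 mxE.
    by rewrite mxtrace_diag => <-; apply: eq_bigr => i _; rewrite mxE.
  have [i0 hi0] : exists i0, e i0 = 1.
    apply: contrapT => /forallNP h0; move: tre; rewrite big1.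
      by move/esym/eqP; rewrite oner_eq0.
    by move=> i _; case: (e01 i) => // /h0.
  exists i0 => i; case: eqVneq => [->//|ii0].
  case: (e01 i) => // ei1; move: tre.
  rewrite (bigD1 i0) //= (bigD1 i) //= hi0 ei1 addrA.
  have ge0 : 0 <= \sum_(j < d | (j != i0) && (j != i)) e j.
    by apply: sumr_ge0 => j _; case: (e01 j) => ->.
  move=> he1; have : (2%:R : K) <= 1 by rewrite -[X in _ <= X]he1 lerDl.
  by rewrite (ler_nat K 2 1).
have wE i : w i Ess = (i == i0)%:R + 1 / 2%:R - c by rewrite -he /e; ring.
have hroots p : exists ij : 'I_d * 'I_d, [/\ ij.1 != ij.2,
    forall H', tnth alpha p H' = w ij.1 H' - w ij.2 H' &
    forall k, w k (tnth alphav p) = (k == ij.1)%:R - (k == ij.2)%:R].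
  have [i [j [ij ha hw _]]] := coroot_entry hss rG Ginj Gim Gh (hco p).
  by exists (i, j).
have [ij hij] := boolp.choice hroots.
have aE p : tnth alpha p Ess = ((ij p).1 == i0)%:R - ((ij p).2 == i0)%:R :> K.
  by have [_ -> _] := hij p; rewrite !wE; ring.
have hj0 p : (ij p).2 != i0.
  have [hne _ _] := hij p; apply/negP => /eqP e2.
  move: hne (aE p); rewrite e2 eqxx => /negPf ->; rewrite sub0r.
  case: (hE01 p) => -> /eqP.
    by rewrite eq_sym oppr_eq0 oner_eq0.
  by rewrite -subr_eq0 opprK -[1 + 1]/(2%:R) pnatr_eq0.
have aE' p : tnth alpha p Ess = ((ij p).1 == i0)%:R :> K.
  by rewrite aE (negPf (hj0 p)) subr0.
have dl : l = d.-1.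
  rewrite -(dim_cartan hss rG Ginj Gtr Gim Gh d0).
  case: hsimple => _ hb _; rewrite -(size_basis hb) dimvf.
  exact: (muln1 (\dim h)).
have hp0 : exists p, (ij p).1 = i0.
  apply: contrapT => /forallNP hn.
  have aE0 p : tnth alpha p Ess = 0.
    by rewrite [LHS]aE'; case: eqP => // /hn.
  have [j hj] : exists j : 'I_d, j != i0.
    exists (if i0 == Ordinal d0 then Ordinal d1 else Ordinal d0).
    by case: (eqVneq i0 (Ordinal d0)) => [->//|]; rewrite eq_sym.
  have lin : linear (fun H : subvs_of h => w i0 H - w j H : K^o).
    move=> a H H'; rewrite /w !(wt_linear hss rG) /GRing.scale /=; ring.
  pose f := linfun (mk_linear lin).
  have f1 : f Ess = 1.
    rewrite lfunE; change (w i0 Ess - w j Ess = 1 :> K).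
    rewrite !wE eqxx (negPf hj) -[true%:R]/(1 : K) -[false%:R]/(0 : K); ring.
  case: hsimple => _ hb _.
  have := coord_basis hb (memvf f) => fE.
  move: f1; rewrite fE sum_lfunE big1 => [/esym/eqP|p _]; first by rewrite oner_eq0.
  by rewrite scale_lfunE -tnth_nth aE0 scaler0.
case: (hbour) => X [Xval Xrk XC].
have [||k [hk1 hk2]] := @chain_end l d ij X i0 _ Xval Xrk _ hj0 hp0.
- by move=> p; have [] := hij p.
- move=> p q; apply: (@intr_inj K); rewrite -XC.
  have [_ -> _] := hij p; have [_ _ hw] := hij q.
  rewrite !hw /pairing !natz !(intrD, intrB) -!pmulrn; ring.
split=> //.
- exact: (lie_iso_sl clL rU Uinj Uim).
- exists k; split=> //; split=> p.
    by rewrite [LHS]aE' hk2.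
  case: (hmu) => v [v0 hv _].
  pose x := invmx B *m v.
  have x0 : x <> 0.
    by move=> x0; apply: v0; rewrite -[v](mulKVmx uB) -/x x0 mulmx0.
  have hx H i : w i H * x i 0 = (mu H : K) * x i 0.
    have : G (vsval H) *m x = (mu H : K) *: x.
      by rewrite GX /x mulmxA mulmxK // -mulmxA hv -scalemxAr.
    by rewrite (G_wt Gh) mul_diag_mx => /matrixP/(_ i 0); rewrite !mxE.
  have [i hi] : exists i, x i 0 != 0.
    apply/existsP; apply: contraT; rewrite negb_exists => /forallP h0.
    by case: x0; apply/colP => i; rewrite (eqP (negbNE (h0 i))) mxE.
  have hmuw H : (mu H : K) = w i H by apply/esym/(mulIf hi)/hx.
  have ii0 : i = i0.
    apply/eqP; have := wE i; rewrite -hmuw.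
    case: eqVneq => // _ hmuE; exfalso.
    have /eqP : (1 : K) = 0.
      rewrite (_ : 1 = (mu Ess : K) - (0 + 1 / 2%:R - c)); first by rewrite hmuE subrr.
      by rewrite hc; field.
    by rewrite oner_eq0.
  rewrite [LHS]hmuw ii0; have [_ _ ->] := hij p.
  by rewrite [i0 == _]eq_sym [i0 == _]eq_sym (negPf (hj0 p)) subr0 hk2.
have : \sum_i w i Ess = 0.
  rewrite -[RHS](Gtr _ (hmem_ss Ess)) (G_wt Gh) mxtrace_diag.
  by apply: eq_bigr => i _; rewrite mxE.
under eq_bigr do rewrite wE.
rewrite sumrB big_split /= !sumr_const card_ord (bigD1 i0) //= eqxx big1 => [|i /negPf->] //.
rewrite addr0 => hs0.
have dn : d%:R = d.-1%:R + 1 :> K by rewrite natr1 prednK.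
have hd0 : (d%:R : K) != 0 by rewrite pnatr_eq0 -lt0n.
rewrite natrM !natrD -dn.
apply: (mulIf hd0); rewrite (_ : c * d%:R = 1 + d%:R / 2%:R); last first.
  move/eqP: hs0; rewrite subr_eq0 => /eqP e2.
  by rewrite mulr_natr -e2 -[_ / _ *+ d]mulr_natr mul1r mulrC.
by rewrite -[d.-1%:R](addrK 1) -dn; field; rewrite hd0.
Qed.

(** The lemma of Schur. *)
Lemma center_scalar Z : Z \in lie_center L -> exists a, U Z = a%:M.
Proof.
move=> hZ; have [hZL hZc] := (centerP _ _).1 hZ.
have [a [u [u0 hu]]] := eigenvector_exists irrU (U Z).
exists a.
have H : forall w : 'cV[K]_d, U Z *m w = a *: w.
  apply: (submodule_full irrU _ _ u0) => //.
    split=> [|b x y hx hy]; first by rewrite mulmx0 scaler0.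
    by rewrite mulmxDr -scalemxAr hx hy scalerDr !scalerA mulrC.
  move=> X w hX hw; rewrite (rep_lie_act rU) // hw -scalemxAr hZc // (rep0 rU).
  by rewrite mul0mx addr0.
apply/matrixP => i j; have := H (delta_mx j 0); rewrite -colE => /matrixP/(_ i 0).
by rewrite !mxE => ->; rewrite eqxx andbT mulr_natr.
Qed.

(** The eigenvalue of [U E] drops from 3/2 by the degree of a negative root
    vector. Degree 2 and more leave the spectrum {3/2, 1/2}. In degree 0 the
    root vector is generated by simple ones, and [mu] vanishes on their
    coroots, so by [sl2_hw] they kill the highest weight vector [v]. Thus [v]
    and the [Y v] with [Y] of degree -1 span a submodule. *)
Lemma line_of_tuple n k : (0 < n)%N -> lie_iso ss (sl K n) ->
  is_dual_basis_elt alpha k Ess -> is_fundamental_weight alphav k mu ->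
  \rank (U E - (1 / 2%:R)%:M) = 1%N.
Proof.
move=> n0 [f [flie fker fim]] hdb hfw.
have sL := ss_sub clL.
have rF : is_rep ss f by split=> [a X Y hX hY|X Y]; [rewrite linearP|apply: flie].
have Finj X : X \in ss -> f X = 0 -> X = 0.
  move=> hX fX; apply/eqP; rewrite -memv0 -fker memv_cap hX memv_ker fX eqxx //.
have Ftr X : X \in ss -> \tr (f X) = 0.
  by move=> hX; have := memv_img f hX; rewrite fim memv_ker lfunE /= => /eqP.
have Fim A : \tr A = 0 -> exists X, X \in ss /\ f X = A.
  move=> tA; have : A \in sl K n by rewrite memv_ker lfunE /= tA.
  by rewrite -fim => /memv_imgP [X hX ->]; exists X.
have [B [G [uB [GX [rG Ginj Gtr Gim Gh]]]]] := diag_model n0 rF Finj Ftr Fim.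
have hss : (h <= ss)%VS by apply: capvSr.
have [v [v0 [hvw hvp]]] := highest_vectorP clL hV hco bourbaki_integral rU hmu.
have vE : U E *m v = (3%:R / 2%:R) *: v.
  by rewrite UE mulmxDl hvw mul_scalar_mx -scalerDl hc; congr (_ *: _); ring.
have zero_wt Z : Z \in L -> (forall H : subvs_of h, lie (vsval H) Z = 0) ->
    exists a, U Z *m v = a *: v.
  move=> hZ hZ0; have [S [C [hS hC ZE]]] := hred hZ.
  have [hCL hCc] := (centerP _ _).1 hC.
  have [a Ca] := center_scalar hC.
  have hSh : S \in h.
    apply: (centralizer_cartan hss rG Gim Gh hS) => H.
    have := hZ0 H; rewrite ZE lieDr (lieC _ C) hCc ?(hmem_L clL) // oppr0 addr0 //.
  have := hvw (Subvs hSh) => /= hSv.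
  exists ((mu (Subvs hSh) : K) + a).
  have hSL := sL _ hS.
  by rewrite ZE (repD rU) // mulmxDl hSv Ca mul_scalar_mx scalerDl.
(* The negatives of the simple roots, so that [generated_by_simple] applies to
   negative root vectors. *)
pose nalpha := [tuple - tnth alpha i | i < l].
pose nalphav := [tuple - tnth alphav i | i < l].
have ncomb k' : comb nalpha k' = - comb alpha k'.
  rewrite /comb -sumrN; apply: eq_bigr => i _.
  by rewrite tnth_mktuple mulNrn.
have nco i : is_coroot ss (tnth nalpha i) (tnth nalphav i).
  have [a2 [X [Y [rX rY hH]]]] := hco i; rewrite !tnth_mktuple; split.
    by rewrite opp_lfunE linearN opprK.
  by exists Y, X; rewrite opprK; split=> //; rewrite linearN /= hH lieC opprK.
have nint i j : exists z : int, tnth nalpha i (tnth nalphav j) = z%:~R.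
  have [z hz] := bourbaki_integral i j; exists z; rewrite !tnth_mktuple.
  by rewrite opp_lfunE linearN opprK.
have low0 i Y : tnth alpha i Ess = 0 -> root_space ss (- tnth alpha i) Y -> U Y *m v = 0.
  move=> ai0 rY.
  have [p [q [pq ha hw hone]]] := coroot_entry hss rG Ginj Gim Gh (hco i).
  have [a2 [X [Y1 [rX rY1 hH]]]] := hco i.
  have Y10 : Y1 <> 0.
    move=> Y0; move: a2; rewrite (_ : tnth alphav i = 0) ?linear0.
      by move/esym/eqP; rewrite (negPf (two_neq0 K)).
    by apply: val_inj; rewrite /= hH Y0 lie0r.
  have [x ->] := hone _ _ rY rY1 Y10.
  have hX := sL _ rX.1; have hY1 := sL _ rY1.1.
  rewrite (repZ rU) // -scalemxAl.
  suff -> : U Y1 *m v = 0 by rewrite scaler0.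
  apply/eqP/negPn/negP => u0.
  have muH : (mu (tnth alphav i) : K) = 0.
    by rewrite hfw -hdb ai0.
  have Hv : U (vsval (tnth alphav i)) *m v = 0 by rewrite hvw muH scale0r.
  have Xv : U X *m v = 0.
    pose k1 j := (j == i : nat).
    have k1E : comb alpha k1 = tnth alpha i.
      rewrite /comb (bigD1 i) //= /k1 eqxx mulr1n big1 ?addr0 // => j /negPf->.
      by rewrite mulr0n.
    apply: (hvp k1); rewrite k1E //.
    move=> a0; move: a2; rewrite a0 zero_lfunE => /esym/eqP.
    by rewrite (negPf (two_neq0 K)).
  have HL := hmem_L clL (tnth alphav i).
  have [] := @sl2_hw K _ (@mulmx K d d 1 (U X)) (@mulmx K d d 1 (U Y1))
     (@mulmx K d d 1 (U (vsval (tnth alphav i)))) _ _ (- 2%:R) (U Y1 *m v) u0.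
  - move=> w /=; rewrite (rep_lie_act rU) // rY1.2 opp_lfunE a2 (repZ rU) //.
    by rewrite scaleNr mulNmx -scalemxAl.
  - by move=> w; rewrite /= (rep_lie_act rU) // addrC addKr hH.
  - by rewrite /= (rep_lie_act rU) // Xv mulmx0 add0r -hH Hv.
  - rewrite /= (rep_lie_act rU) // Hv mulmx0 add0r rY1.2 opp_lfunE a2 (repZ rU) //.
    by rewrite -scalemxAl.
  move=> j /eqP; rewrite eq_sym -subr_eq0 opprK -natrD pnatr_eq0.
  by rewrite addn2.
have eigE2 (w : 'cV[K]_d) (x : K) : U E *m w = x *: w -> x != 3%:R / 2%:R -> x != 1 / 2%:R -> w = 0.
  move=> hw x3 x1.
  have : (U E - (3%:R / 2%:R)%:M) *m (U E - (1 / 2%:R)%:M) *m w = 0.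
    by rewrite two_step mul0mx.
  have hm b : (U E - b%:M) *m w = (x - b) *: w.
    by rewrite mulmxBl hw mul_scalar_mx -scalerBl.
  rewrite -mulmxA hm -scalemxAr hm scalerA => /eqP; rewrite scaler_eq0.
  by rewrite mulf_eq0 !subr_eq0 (negPf x3) (negPf x1) /= => /eqP.
pose P w := exists (a : K) Y, [/\ Y \in L, lie E Y = - Y & w = a *: v + U Y *m v].
have Plin : lin_pred P.
  split; first by exists 0, 0; rewrite mem0v lie0r oppr0 scale0r (rep0 rU) mul0mx addr0.
  move=> b w1 w2 [a1 [Y1 [h1 e1 ->]]] [a2 [Y2 [h2 e2 ->]]].
  exists (b * a1 + a2), (b *: Y1 + Y2); split.
  - by rewrite memvD ?memvZ.
  - by rewrite lieDr lieZr e1 e2 scalerN opprD.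
  by rewrite rU.1 // mulmxDl -scalemxAl scalerDr scalerA scalerDl addrACA.
have claimA Z : Z \in L -> P (U Z *m v).
  move=> hZ; suff : Z \in L /\ P (U Z *m v) by case.
  apply: (aspan_sub (P := fun Z => Z \in L /\ P (U Z *m v)) _ _
              (simple_decomp clL tor hsimple hZ)).
    exact: rep_act_lin.
  move=> {hZ}Z [hZ hw]; split=> //.
  case: hw => [/(zero_wt _ hZ) [a ->]|[k' [k'0 [hk|hk]]]].
  - exists a, 0; rewrite mem0v lie0r oppr0 (rep0 rU) mul0mx addr0 //.
  - by rewrite (hvp k') //; case: Plin.
  pose nn := (\sum_i if (tnth alpha i Ess : K) == 1%R then k' i else 0)%N.
  have hn : comb alpha k' Ess = nn%:R :> K.
    rewrite combE /nn natr_sum; apply: eq_bigr => i _.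
    case: (hE01 i) => ->; first by rewrite eq_sym oner_eq0 mul0rn.
    by rewrite eqxx.
  have EZ : lie E Z = - (nn%:R *: Z).
    by rewrite lie_E // hk.2 opp_lfunE hn scaleNr.
  have EZv : U E *m (U Z *m v) = (3%:R / 2%:R - nn%:R) *: (U Z *m v).
    rewrite (rep_lie_act rU) ?E_L // vE EZ (repN rU) ?memvZ // (repZ rU) //.
    by rewrite -scalemxAr mulNmx -scalemxAl -scalerBl.
  case: (posnP nn) => [nn0|nnp].
    rewrite (_ : U Z *m v = 0); first by case: Plin.
    rewrite -ncomb in hk.
    apply: (generated_by_simple clL hV nco nint rU _ _ hk).
      move=> i ki Y; rewrite tnth_mktuple; apply: low0.
      case: (hE01 i) => // ai1; exfalso.
      move: nn0; rewrite /nn (bigD1 i) //= ai1 eqxx => /eqP.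
      by rewrite addn_eq0 => /andP[/eqP ki0]; rewrite ki0 in ki.
    by rewrite ncomb => /eqP; rewrite oppr_eq0 => /eqP.
  case: (ltngtP nn 1) => [|nn2|nn1]; first by rewrite ltnS leqNgt nnp.
    rewrite (eigE2 _ _ EZv); first by case: Plin.
      by rewrite -subr_eq0 addrAC subrr sub0r oppr_eq0 pnatr_eq0 -lt0n.
    rewrite -half_eq (inj_eq (addrI _)) (inj_eq oppr_inj) (eqr_nat K nn 1).
    by rewrite gtn_eqF.
  exists 0, Z; rewrite scale0r add0r EZ nn1 scale1r; split=> //.
have Pall : forall w : 'cV[K]_d, P w.
  apply: (submodule_full irrU Plin _ v0); last first.
    exists 1, 0; rewrite mem0v lie0r oppr0 (rep0 rU) mul0mx addr0 scale1r //.
  have Yv Y (w : 'cV[K]_d) x : Y \in L -> lie E Y = - Y -> U E *m w = x *: w ->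
      U E *m (U Y *m w) = (x - 1) *: (U Y *m w).
    move=> hY eY hw; rewrite (rep_lie_act rU) ?E_L // hw eY (repN rU) //.
    by rewrite -scalemxAr mulNmx scalerBl scale1r.
  have YY Y Y' : Y \in L -> lie E Y = - Y -> Y' \in L -> lie E Y' = - Y' ->
     U Y *m (U Y' *m v) = 0.
    move=> hY eY hY' eY'.
    have e2 := Yv _ _ _ hY eY (Yv _ _ _ hY' eY' vE).
    apply: (eigE2 _ _ e2).
      by rewrite -subr_eq0 (_ : _ - _ = - 2%:R) ?oppr_eq0 ?pnatr_eq0 //; ring.
    by rewrite -half_eq -subr_eq0 addrAC subrr sub0r oppr_eq0 oner_eq0.
  move=> Z w hZ [a [Y [hY eY ->]]]; rewrite mulmxDr -scalemxAr.
  apply: (lin_predD Plin); first by apply: (lin_predZ _ Plin); apply: claimA.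
  rewrite (rep_lie_act rU) //; apply: (lin_predD Plin); last by apply/claimA/clL.
  have [b [Y' [hY' eY' ->]]] := claimA Z hZ.
  rewrite mulmxDr -scalemxAr YY // addr0.
  exists 0, (b *: Y); rewrite memvZ // lieZr eY scalerN scale0r add0r (repZ rU) //.
  by rewrite -scalemxAl.
have line w : exists a : K, (U E - (1 / 2%:R)%:M) *m w = a *: v.
  have [a [Y [hY eY ->]]] := Pall w; exists a.
  rewrite mulmxDr -scalemxAr !mulmxBl vE !mul_scalar_mx -scalerBl.
  rewrite (rep_lie_act rU) ?E_L // vE eY (repN rU) // -scalemxAr mulNmx.
  move: (U Y *m v) => y; by apply/colP => i; rewrite !mxE; field.
have [a ha] := boolp.choice (fun j : 'I_d => line (delta_mx j 0)).
have piE : U E - (1 / 2%:R)%:M = v *m (\row_j a j).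
  apply/matrixP => i j; have := ha j; rewrite -colE => /matrixP/(_ i 0).
  by rewrite mxE => ->; rewrite !mxE big_ord1 !mxE mulrC.
apply/eqP; rewrite eqn_leq; apply/andP; split.
  by rewrite piE (leq_trans (mxrankM_maxr _ _)) ?rank_leq_row.
rewrite lt0n mxrank_eq0; apply/eqP => p0; apply: v0.
have : (U E - (1 / 2%:R)%:M) *m v = 0 by rewrite p0 mul0mx.
rewrite mulmxBl vE mul_scalar_mx -scalerBl -half_eq opprB addrC subrK scale1r //.
Qed.

End ComplexTuple.

(** * Real and complex matrices *)

Section Complexification.
Variable R : realType.
Local Notation C := R[i].
Local Open Scope complex_scope.

Lemma conjE (z : C) : Num.conj z = conjc z. Proof. by []. Qed.

Definition mxRe m n (Z : 'M[C]_(m, n)) : 'M[R]_(m, n) := map_mx (@complex.Re R) Z.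
Definition mxIm m n (Z : 'M[C]_(m, n)) : 'M[R]_(m, n) := map_mx (@complex.Im R) Z.

Section Mx.
Variables (m n : nat).
Implicit Types (X Y : 'M[R]_(m, n)) (Z W : 'M[C]_(m, n)).

Lemma mxC_decomp Z : Z = mxC (mxRe Z) + ('i : C) *: mxC (mxIm Z).
Proof. by apply/matrixP => i j; rewrite !mxE [LHS]complexE. Qed.

Lemma mxCD X Y : mxC (X + Y) = mxC X + mxC Y.
Proof. exact: map_mxD. Qed.
Lemma mxCN X : mxC (- X) = - mxC X.
Proof. exact: map_mxN. Qed.
Lemma mxCB X Y : mxC (X - Y) = mxC X - mxC Y.
Proof. exact: map_mxB. Qed.
Lemma mxC0 : mxC (0 : 'M[R]_(m, n)) = 0.
Proof. exact: map_mx0. Qed.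
Lemma mxCZ a X : mxC (a *: X) = a%:C *: mxC X.
Proof. exact: map_mxZ. Qed.
Lemma mxRe_mxC X : mxRe (mxC X) = X.
Proof. by apply/matrixP => i j; rewrite !mxE. Qed.
Lemma mxIm_mxC X : mxIm (mxC X) = 0.
Proof. by apply/matrixP => i j; rewrite !mxE. Qed.
Lemma mxC_inj X Y : mxC X = mxC Y -> X = Y.
Proof. by move/(congr1 (@mxRe _ _)); rewrite !mxRe_mxC. Qed.
Lemma mxReD Z W : mxRe (Z + W) = mxRe Z + mxRe W.
Proof. by apply/matrixP => i j; rewrite !mxE; case: (Z i j); case: (W i j). Qed.
Lemma mxImD Z W : mxIm (Z + W) = mxIm Z + mxIm W.
Proof. by apply/matrixP => i j; rewrite !mxE; case: (Z i j); case: (W i j). Qed.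
Lemma mxReZ a Z : mxRe (a *: Z) = complex.Re a *: mxRe Z - complex.Im a *: mxIm Z.
Proof. by apply/matrixP => i j; rewrite !mxE; case: (Z i j); case: a. Qed.
Lemma mxImZ a Z : mxIm (a *: Z) = complex.Re a *: mxIm Z + complex.Im a *: mxRe Z.
Proof. by apply/matrixP => i j; rewrite !mxE; case: (Z i j); case: a. Qed.
Lemma mx_conj_decomp Z : mx_conj Z = mxC (mxRe Z) - ('i : C) *: mxC (mxIm Z).
Proof.
apply/matrixP => i j; rewrite !mxE; case: (Z i j) => a b; rewrite conjE /=.
by apply/eqP; rewrite eq_complex /= !(mul0r, mulr0, mul1r, subr0, addr0, add0r, oppr0, sub0r) !eqxx.
Qed.
Lemma mx_conjD Z W : mx_conj (Z + W) = mx_conj Z + mx_conj W.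
Proof. exact: map_mxD. Qed.
Lemma mx_conjZ a Z : mx_conj (a *: Z) = Num.conj a *: mx_conj Z.
Proof. exact: map_mxZ. Qed.
Lemma mx_conj_mxC X : mx_conj (mxC X) = mxC X.
Proof. by apply/matrixP => i j; rewrite !mxE conjE conjc_real. Qed.
Lemma mxC_of_conj Z : mx_conj Z = Z -> mxC (mxRe Z) = Z.
Proof.
move=> cZ; apply/matrixP => i j; have /matrixP/(_ i j) := cZ; rewrite !mxE conjE.
case: (Z i j) => x y /eqP; rewrite eq_complex /= => /andP[_ /eqP y0].
by apply/eqP; rewrite eq_complex /= eqxx /=; apply/eqP; lra.
Qed.
Lemma mx_conjK Z : mx_conj (mx_conj Z) = Z.
Proof. by apply/matrixP => i j; rewrite !mxE conjCK. Qed.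

End Mx.

Lemma mxCM m n p (X : 'M[R]_(m, n)) (Y : 'M[R]_(n, p)) : mxC (X *m Y) = mxC X *m mxC Y.
Proof. exact: map_mxM. Qed.
Lemma mxC_tr m n (X : 'M[R]_(m, n)) : mxC X^T = (mxC X)^T.
Proof. by apply/matrixP => i j; rewrite !mxE. Qed.
Lemma mxC_scalar n (a : R) : mxC (a%:M : 'M[R]_n) = (a%:C)%:M.
Proof. exact: map_scalar_mx. Qed.
Lemma mx_conjM m n p (X : 'M[C]_(m, n)) (Y : 'M[C]_(n, p)) :
  mx_conj (X *m Y) = mx_conj X *m mx_conj Y.
Proof. exact: map_mxM. Qed.
Lemma mx_conj_tr m n (X : 'M[C]_(m, n)) : mx_conj X^T = (mx_conj X)^T.
Proof. by apply/matrixP => i j; rewrite !mxE. Qed.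

Lemma mxC_lie m (X Y : 'M[R]_m) : mxC (lie X Y) = lie (mxC X) (mxC Y).
Proof. by rewrite /lie mxCB !mxCM. Qed.

Lemma complexify_rep_id m (Z : 'M[C]_m) : complexify_rep id Z = Z.
Proof. exact/esym/mxC_decomp. Qed.

Section Alg.
Variables (m : nat) (g : {vspace 'M[R]_m}).

Lemma mxC_complexify X : X \in g -> mxC X \in complexify g.
Proof.
apply: (vbasis_ind (P := fun X => mxC X \in complexify g)) => [|Y hY].
  split; first by rewrite mxC0 mem0v.
  by move=> a X1 X2 h1 h2; rewrite mxCD mxCZ memvD ?memvZ.
by rewrite /complexify memv_span // map_f.
Qed.

Lemma complexifyP Z : Z \in complexify g <-> mxRe Z \in g /\ mxIm Z \in g.
Proof.
split=> [|[h1 h2]]; last first.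
  by rewrite [Z]mxC_decomp memvD ?memvZ // mxC_complexify.
apply: (span_ind (P := fun Z => mxRe Z \in g /\ mxIm Z \in g)).
  split.
    by rewrite -(mxC0 m m) mxRe_mxC mxIm_mxC mem0v.
  move=> a Z1 Z2 [r1 i1] [r2 i2]; rewrite mxReD mxImD mxReZ mxImZ.
  by split; rewrite memvD // ?memvB ?memvD ?memvZ.
move=> W /mapP[X hX ->]; rewrite mxRe_mxC mxIm_mxC mem0v; split=> //.
exact: vbasis_mem.
Qed.

End Alg.

Section Alg2.
Variable m : nat.

Lemma lie_mxC_decomp (Z W : 'M[C]_m) : lie Z W =
  mxC (lie (mxRe Z) (mxRe W) - lie (mxIm Z) (mxIm W)) +
  ('i : C) *: mxC (lie (mxRe Z) (mxIm W) + lie (mxIm Z) (mxRe W)).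
Proof.
rewrite {1}[Z]mxC_decomp {1}[W]mxC_decomp.
rewrite (mxCB (lie _ _) (lie _ _)) (mxCD (lie _ _) (lie _ _)).
rewrite lieDl !lieDr !lieZl !lieZr -!mxC_lie scalerA -expr2 sqr_i scaleN1r.
rewrite (scalerDr _ (mxC (lie _ _))) -!addrA; congr (_ + _).
by rewrite [LHS]addrA [RHS]addrC.
Qed.

Lemma mxRe_comb p q (X Y : 'M[R]_(p, q)) : mxRe (mxC X + ('i : C) *: mxC Y) = X.
Proof. by rewrite mxReD mxReZ !mxRe_mxC mxIm_mxC /= scale0r scaler0 subrr addr0. Qed.
Lemma mxIm_comb p q (X Y : 'M[R]_(p, q)) : mxIm (mxC X + ('i : C) *: mxC Y) = Y.
Proof. by rewrite mxImD mxImZ !mxRe_mxC !mxIm_mxC /= scaler0 scale1r !add0r. Qed.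

Lemma complexify_closed (g : {vspace 'M[R]_m}) : lie_closed g -> lie_closed (complexify g).
Proof.
move=> hg Z W /complexifyP[z1 z2] /complexifyP[w1 w2]; apply/complexifyP.
rewrite lie_mxC_decomp mxRe_comb mxIm_comb.
by split; [rewrite memvB ?hg|rewrite memvD ?hg].
Qed.

Lemma derived_complexify (g : {vspace 'M[R]_m}) : derived (complexify g) = complexify (derived g).
Proof.
apply/vspaceP => Z; apply/idP/idP.
  apply: (derived_ind (P := fun Z => Z \in complexify (derived g))).
    exact: memv_lin.
  move=> X Y /complexifyP[x1 x2] /complexifyP[y1 y2]; apply/complexifyP.
  rewrite lie_mxC_decomp mxRe_comb mxIm_comb.
  by split; [rewrite memvB ?in_derived|rewrite memvD ?in_derived].
move=> /complexifyP [h1 h2]; rewrite [Z]mxC_decomp.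
have H X : X \in derived g -> mxC X \in derived (complexify g).
  apply: (derived_ind (P := fun X => mxC X \in derived (complexify g))).
    split; first by rewrite mxC0 mem0v.
    by move=> a X1 X2 e1 e2; rewrite mxCD mxCZ memvD ?memvZ.
  by move=> Y1 Y2 e1 e2; rewrite mxC_lie in_derived ?mxC_complexify.
by rewrite memvD ?memvZ ?H.
Qed.

Lemma center_complexify (g : {vspace 'M[R]_m}) Z : Z \in lie_center g -> mxC Z \in lie_center (complexify g).
Proof.
move=> /centerP[hZ hc]; apply/centerP; split; first exact: mxC_complexify.
move=> W /complexifyP[w1 w2]; rewrite lie_mxC_decomp mxRe_mxC mxIm_mxC.
by rewrite !hc // !lie0l subrr addr0 mxC0 scaler0 addr0.
Qed.

End Alg2.
End Complexification.

(** * Derivatives of matrix curves *)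

Section MatrixDerivative.
Variable R : realType.
Local Open Scope classical_set_scope.

Definition mxder m n (f : R -> 'M[R]_(m, n)) (D : 'M[R]_(m, n)) :=
  forall i j, is_derive (0 : R) 1 (fun t => f t i j) (D i j).

Lemma mxder_cst m n (A : 'M[R]_(m, n)) : mxder (fun=> A) 0.
Proof. by move=> i j; rewrite mxE; apply: is_derive_cst. Qed.

Lemma mxderD m n (f g : R -> 'M[R]_(m, n)) A B :
  mxder f A -> mxder g B -> mxder (fun t => f t + g t) (A + B).
Proof.
move=> hf hg i j; rewrite mxE (_ : (fun _ => _) = (fun t => f t i j) + (fun t => g t i j)).
  exact: (is_deriveD (hf i j) (hg i j)).
by apply/funext => t; rewrite mxE.
Qed.

Lemma mxder_unique m n (f : R -> 'M[R]_(m, n)) D D' : mxder f D -> mxder f D' -> D = D'.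
Proof.
move=> h1 h2; apply/matrixP => i j.
by have [_ <-] := h1 i j; have [_ <-] := h2 i j.
Qed.

Lemma mxder_sum m n (I : Type) (r : seq I) (f : I -> R -> 'M[R]_(m, n)) D :
  (forall i, mxder (f i) (D i)) -> mxder (fun t => \sum_(i <- r) f i t) (\sum_(i <- r) D i).
Proof.
move=> h i j; elim: r => [|k r IH].
  rewrite big_nil mxE (_ : (fun _ => _) = cst 0); first exact: is_derive_cst.
  by apply/funext => t; rewrite big_nil mxE.
rewrite big_cons mxE (_ : (fun _ => _) = (fun t => f k t i j) + (fun t => (\sum_(i <- r) f i t) i j)).
  exact: (is_deriveD (h k i j) IH).
by apply/funext => t; rewrite big_cons mxE.
Qed.

Lemma mxder_scale m n (f : R -> R) d (A : 'M[R]_(m, n)) :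
  is_derive (0 : R) 1 f d -> mxder (fun t => f t *: A) (d *: A).
Proof.
move=> h i j; rewrite mxE (_ : (fun _ => _) = (A i j) \*: f).
  by rewrite mulrC; apply: is_deriveZ.
by apply/funext => t; rewrite mxE mulrC.
Qed.

Lemma mxder_lin m n p q (f : R -> 'M[R]_(m, n)) D (F : {linear 'M[R]_(m, n) -> 'M[R]_(p, q)}) :
  mxder f D -> mxder (fun t => F (f t)) (F D).
Proof.
move=> h; rewrite (matrix_sum_delta D) linear_sum.
rewrite (_ : (fun t => _) = fun t => \sum_i F (\sum_j f t i j *: delta_mx i j)); last first.
  by apply/funext => t; rewrite -linear_sum -matrix_sum_delta.
apply: mxder_sum => i; rewrite linear_sum.
rewrite (_ : (fun t => _) = fun t => \sum_j f t i j *: F (delta_mx i j)); last first.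
  by apply/funext => t; rewrite linear_sum; apply: eq_bigr => j _; rewrite linearZ.
by apply: mxder_sum => j; rewrite linearZ; apply: mxder_scale.
Qed.

Lemma mxderM m n p (f : R -> 'M[R]_(m, n)) (g : R -> 'M[R]_(n, p)) A B :
  mxder f A -> mxder g B -> mxder (fun t => f t *m g t) (A *m g 0 + f 0 *m B).
Proof.
move=> hf hg i j.
rewrite (_ : (fun _ => _) = fun t => \sum_k (f t i k * g t k j)); last first.
  by apply/funext => t; rewrite mxE.
rewrite !mxE -big_split /=.
elim: (index_enum _) => [|k r IH].
  rewrite big_nil (_ : (fun _ => _) = cst 0); first exact: is_derive_cst.
  by apply/funext => t; rewrite big_nil.
rewrite big_cons (_ : (fun _ => _) = (fun t => f t i k * g t k j) + (fun t => \sum_(k <- r) f t i k * g t k j)).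
  apply: is_deriveD.
  apply: (is_derive_eq (is_deriveM (hf i k) (hg k j))).
  by rewrite /GRing.scale /= addrC [A i k * _]mulrC.
by apply/funext => t; rewrite big_cons.
Qed.

Lemma mxder_tr m n (f : R -> 'M[R]_(m, n)) D : mxder f D -> mxder (fun t => (f t)^T) D^T.
Proof.
move=> h i j; rewrite mxE (_ : (fun _ => _) = fun t => f t j i) //.
by apply/funext => t; rewrite mxE.
Qed.

End MatrixDerivative.

(** * The Lie algebra of a Hodge representation *)

Section HodgeGroup.
Variables (R : realType) (m : nat).
Local Notation C := R[i].
Local Open Scope complex_scope.
Variables (n : int) (Q : 'M[R]_m) (G : set 'M[R]_m) (phi : R[i] -> 'M[R]_m).
Hypothesis hG : group_hodge_rep n Q G phi.
Variable g : {vspace 'M[R]_m}.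
Hypothesis hg : forall X, X \in g <-> lie_algebra_of G X.

Let Gmul x y : G x -> G y -> G (x *m y).
Proof. by case: (ghr_reductive hG) => [[_ _ h _] _]; apply: h. Qed.

Let Ginv x : G x -> G (invmx x).
Proof. by case: (ghr_reductive hG) => [[_ _ _ h] _]; apply: h. Qed.

Let Qunit : Q \in unitmx := ghr_nondegenerate hG.

Lemma G_unit x : G x -> x \in unitmx.
Proof. by case: (ghr_reductive hG) => [[[S hS] _ _ _] _] /hS []. Qed.

(** Differentiate the invariance of [Q]. *)
Lemma lie_skew X : X \in g -> X^T *m Q + Q *m X = 0.
Proof.
move/hg => [ga [hga ga0 hd]].
have h1 : mxder (fun t => (ga t)^T *m Q *m ga t) (X^T *m Q + Q *m X).
  have h := mxderM (mxderM (mxder_tr hd) (mxder_cst Q)) hd.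
  by move: h; rewrite ga0 trmx1 mulmx0 addr0 mul1mx mulmx1.
apply: (mxder_unique h1).
rewrite (_ : (fun t => _) = fun=> Q); first exact: mxder_cst.
by apply/funext => t; apply: (ghr_isometry hG).
Qed.

Lemma Ad_stable x Y : G x -> Y \in g -> x *m Y *m invmx x \in g.
Proof.
move=> hx /hg [ga [hga ga0 hd]]; apply/hg.
exists (fun t => x *m ga t *m invmx x); split.
- by move=> t; apply: Gmul; [apply: Gmul|apply: Ginv].
- by rewrite ga0 mulmx1 mulmxV ?G_unit.
have h := mxderM (mxderM (mxder_cst x) hd) (mxder_cst (invmx x)).
by move: h; rewrite mul0mx add0r mulmx0 addr0.
Qed.

(** The curve [Ad(gamma(t)) Y] stays in the subspace [g], so its velocity
    [[X, Y]] does too. The inverse of [gamma(t)] is written with [Q] and the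
    transpose, so that no derivative of an inverse is needed. *)
Lemma lie_algebra_closed : lie_closed g.
Proof.
move=> X Y hX hY.
have [ga [hga ga0 hd]] := (hg X).1 hX.
pose A t := ga t *m Y *m (invmx Q *m (ga t)^T *m Q).
have hA t : A t \in g.
  have -> : A t = ga t *m Y *m invmx (ga t).
    have e : invmx Q *m (ga t)^T *m Q *m ga t = 1%:M.
      by rewrite -!mulmxA [(ga t)^T *m _]mulmxA (ghr_isometry hG) // mulVmx.
    congr (_ *m _); rewrite -[LHS](mulmxK (G_unit (hga t))) e mul1mx //.
  exact: Ad_stable.
have hdA : mxder A (X *m Y + Y *m (invmx Q *m X^T *m Q)).
  have h := mxderM (mxderM hd (mxder_cst Y))
     (mxderM (mxderM (mxder_cst (invmx Q)) (mxder_tr hd)) (mxder_cst Q)).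
  move: h; rewrite ga0 trmx1 !mul0mx !mulmx0 !add0r !addr0 !mulmx1 mul1mx.
  by rewrite mulVmx // mulmx1.
have e : invmx Q *m X^T *m Q = - X.
  have /eqP := lie_skew hX; rewrite addr_eq0 => /eqP e.
  by rewrite -mulmxA e mulmxN mulKmx.
rewrite e mulmxN in hdA.
(* This map vanishes on the curve, hence on its velocity. *)
have linp : linear (fun Z : 'M[R]_m => Z - projv g Z).
  by move=> a Z W; rewrite linearP scalerBr opprD addrACA.
pose p := mk_linear linp.
have hp Z : p Z = Z - projv g Z by [].
have h1 := mxder_lin p hdA.
have h2 : mxder (fun t => p (A t)) 0.
  rewrite (_ : (fun t => _) = fun=> 0); first exact: mxder_cst.
  by apply/funext => t; rewrite hp projv_id ?hA // subrr.
have := mxder_unique h1 h2; rewrite hp => /eqP; rewrite subr_eq0 => /eqP.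
by rewrite /lie => ->; apply: memv_proj.
Qed.

End HodgeGroup.

(** * Hermitian adjoints and positive definite matrices *)

Section PositiveDefinite.
Variable R : realType.
Local Notation C := R[i].

Definition adj m n (A : 'M[C]_(m, n)) : 'M[C]_(n, m) := (mx_conj A)^T.

Lemma adjM m n p (A : 'M[C]_(m, n)) (B : 'M[C]_(n, p)) : adj (A *m B) = adj B *m adj A.
Proof. by rewrite /adj mx_conjM trmx_mul. Qed.
Lemma adjZ m n (a : C) (A : 'M[C]_(m, n)) : adj (a *: A) = Num.conj a *: adj A.
Proof. by rewrite /adj mx_conjZ linearZ. Qed.
Lemma adj_mxC m n (A : 'M[R]_(m, n)) : adj (mxC A) = (mxC A)^T.
Proof. by rewrite /adj mx_conj_mxC. Qed.
Lemma adjK m n (A : 'M[C]_(m, n)) : adj (adj A) = A.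
Proof. by rewrite /adj mx_conj_tr mx_conjK trmxK. Qed.
Lemma adjE m n (A : 'M[C]_(m, n)) : adj A = map_mx Num.conj A^T.
Proof. by apply/matrixP => i j; rewrite !mxE. Qed.
Lemma adj_unit n (A : 'M[C]_n) : A \in unitmx -> adj A \in unitmx.
Proof. by move=> uA; rewrite /adj unitmx_tr map_unitmx. Qed.
Lemma adj_inv n (A : 'M[C]_n) : adj (invmx A) = invmx (adj A).
Proof. by rewrite /adj -trmx_inv /mx_conj map_invmx. Qed.
Lemma adj1 n : adj (1%:M : 'M[C]_n) = 1%:M.
Proof. by rewrite /adj /mx_conj map_mx1 trmx1. Qed.

(** Spectral theorem and square roots of the eigenvalues. *)
Lemma posdef_factor n (A : 'M[C]_n) : adj A = A ->
  (forall v : 'cV[C]_n, v <> 0 -> 0 < (adj v *m A *m v) 0 0) ->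
  exists T : 'M[C]_n, T \in unitmx /\ A = adj T *m T.
Proof.
move=> hA hpos.
have nA : A \is normalmx.
  by apply/normalmxP; rewrite -adjE hA.
have AE := orthomx_spectralP nA.
set P := spectralmx A in AE; set D := spectral_diag A in AE.
have uP : P \in unitmx := spectral_unit A.
have Pi : invmx P = adj P.
  by rewrite adjE invmx_unitary ?spectral_unitarymx.
have Dpos i : 0 < D 0 i.
  have aPi : adj (invmx P) = P by rewrite Pi adjK.
  have := hpos (invmx P *m delta_mx i 0); rewrite adjM aPi.
  rewrite {1}AE !mulmxA mulmxK // -!mulmxA mulKVmx // mulmxA.
  rewrite mul_mx_diag mxE (bigD1 i) //= big1 => [|j ji].
    rewrite !mxE !eqxx /= conjC1 mul1r mulr1 addr0; apply.
    move/(congr1 (mulmx P)); rewrite mulKVmx // mulmx0 => /matrixP/(_ i 0)/eqP.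
    by rewrite !mxE !eqxx oner_eq0.
  by rewrite !mxE (negPf ji) /= mulr0.
pose S := diag_mx (\row_i sqrtC (D 0 i)).
have SS : adj S *m S = diag_mx D.
  apply/matrixP => i j; rewrite mul_mx_diag !mxE.
  case: (eqVneq j i) => [->|ji]; last by rewrite !mulr0n conjC0 mul0r.
  rewrite !mulr1n (CrealP _); first by rewrite -expr2 sqrtCK.
  by rewrite ger0_real // sqrtC_ge0 ltW.
exists (S *m P); split; last first.
  by rewrite adjM -Pi mulmxA -(mulmxA (invmx P) (adj S) S) SS; exact: AE.
rewrite unitmx_mul uP andbT unitmxE det_diag unitfE.
by apply/prodf_neq0 => i _; rewrite mxE sqrtC_eq0 gt_eqF.
Qed.

Lemma trace_adj_pos n (N : 'M[C]_n) : N <> 0 -> 0 < \tr (N *m adj N).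
Proof.
move=> /eqP N0.
have [[i j] hij] : exists ij : 'I_n * 'I_n, N ij.1 ij.2 != 0.
  apply/existsP; apply: contraNT N0; rewrite negb_exists => /forallP h0.
  by apply/eqP/matrixP => p q; rewrite (eqP (negbNE (h0 (p, q)))) mxE.
rewrite /mxtrace (bigD1 i) //= ltr_wpDr //.
  apply: sumr_ge0 => k _; rewrite mxE; apply: sumr_ge0 => l _.
  by rewrite !mxE mul_conjC_ge0.
rewrite mxE (bigD1 j) //= ltr_wpDr //.
  by apply: sumr_ge0 => l _; rewrite !mxE mul_conjC_ge0.
by rewrite !mxE mul_conjC_gt0.
Qed.

End PositiveDefinite.

(** * Reductivity from the polarization *)

Section Star.
Variables (K : fieldType) (m : nat) (S : 'M[K]_m).
Hypothesis (uS : S \in unitmx) (sS : S^T = S).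

(** The adjoint for the bilinear form with matrix [S]. *)
Definition star (X : 'M[K]_m) := invmx S *m X^T *m S.

Lemma starK X : star (star X) = X.
Proof.
rewrite /star !trmx_mul trmxK trmx_inv sS !mulmxA mulVmx // mul1mx.
by rewrite mulmxKV.
Qed.

Lemma star_lie X Y : star (lie X Y) = lie (star Y) (star X).
Proof.
rewrite /star /lie linearB /= !trmx_mul mulmxBr mulmxBl !mulmxA.
by rewrite !(mulmxK uS).
Qed.
End Star.

Section Reductive.
Variables (R : realType) (m : nat).
Local Notation C := R[i].
Local Open Scope complex_scope.
Variables (n : int) (Q : 'M[R]_m) (G : set 'M[R]_m) (phi : R[i] -> 'M[R]_m).
Hypothesis hG : group_hodge_rep n Q G phi.
Variable g : {vspace 'M[R]_m}.
Hypothesis hg : forall X, X \in g <-> lie_algebra_of G X.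

Let P := phi 'i.
Let S := Q *m P.

Lemma norm_i : `|('i : C)| = 1.
Proof. by rewrite normc_def /= expr0n expr1n add0r sqrtr1. Qed.

Lemma phi_i_in_group : G P.
Proof. by case: (ghr_hom hG) => h _ _; apply: h; apply: norm_i. Qed.

Lemma phi_i_sq : P *m P = ((-1) ^ n)%:M.
Proof.
case: (ghr_hom hG) => _ h _.
rewrite -(h _ _ norm_i norm_i) (_ : ('i : C) * 'i = -1); first exact: (ghr_weight hG).
by rewrite -expr2 sqr_i.
Qed.

Lemma signK (K : fieldType) (k : int) : (-1 : K) ^ k * (-1) ^ k = 1.
Proof. by rewrite -exprzMl ?unitrN1 // mulrNN mulr1 exp1rz. Qed.

(** By the parity of [Q] and [phi(i)^2 = (-1)^n]. With [S_factor] the form is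
    positive definite, so that conjugation by [phi(i)] is a Cartan
    involution. *)
Lemma S_sym : S^T = S.
Proof.
have uP := G_unit hG phi_i_in_group.
have h1 : P^T *m Q *m P = Q := ghr_isometry hG phi_i_in_group.
have h2 := phi_i_sq; have h3 := ghr_parity hG.
have h4 : P^T *m Q = Q *m invmx P by rewrite -[in RHS]h1 mulmxK.
have h5 : invmx P = (-1) ^ n *: P.
  have e : (1%:M : 'M[R]_m) = ((-1) ^ n)%:M *m (P *m P) by rewrite h2 -scalar_mxM signK.
  by rewrite -[LHS]mul1mx e -mulmxA mulmxK // mul_scalar_mx.
rewrite /S trmx_mul {1}h3 linearZ /= trmxK -scalemxAr h4 h5 -scalemxAr scalerA.
by rewrite signK scale1r.
Qed.

Let uP : P \in unitmx := G_unit hG phi_i_in_group.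

Lemma S_unit : S \in unitmx.
Proof. by rewrite unitmx_mul (ghr_nondegenerate hG) uP. Qed.

Lemma S_factor : exists T : 'M[C]_m, T \in unitmx /\ mxC S = adj T *m T.
Proof.
apply: posdef_factor => [|v v0].
  by rewrite /adj mx_conj_mxC -mxC_tr S_sym.
have cv0 : mx_conj v <> 0.
  by move/(congr1 (@mx_conj _ _ _)); rewrite mx_conjK /mx_conj map_mx0.
have := ghr_positivity hG cv0; rewrite mx_conjK /bilin.
by rewrite /adj /S mxCM !mulmxA.
Qed.

Let cartan_inv (X : 'M[R]_m) := star S X.

(** By the invariance of [Q]. It follows that the adjoint for [S] preserves
    [g]. *)
Lemma cartan_invE X : X \in g -> cartan_inv X = - (invmx P *m X *m P).
Proof.
move=> hX; have /eqP := lie_skew hG hg hX; rewrite addr_eq0 => /eqP e.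
rewrite /cartan_inv /star /S -mulmxA [X^T *m _]mulmxA e mulNmx mulmxN.
congr (- _); apply: (can_inj (mulKmx S_unit)); rewrite mulKVmx ?S_unit //.
by rewrite /S -!mulmxA mulKVmx.
Qed.

Lemma cartan_inv_g X : X \in g -> cartan_inv X \in g.
Proof.
move=> hX; rewrite [cartan_inv X]cartan_invE // memvN.
have gPi : G (invmx P) by case: (ghr_reductive hG) => [[_ _ _ h] _]; apply/h/phi_i_in_group.
by have := Ad_stable hG hg gPi hX; rewrite invmxK.
Qed.

Lemma cartan_inv_pos X : X <> 0 -> \tr (X *m cartan_inv X) <> 0.
Proof.
move=> X0; have [T [uT ST]] := S_factor.
have N0 : T *m mxC X *m invmx T <> 0.
  move/(congr1 (fun Z => invmx T *m (Z *m T))); rewrite mulmxKV // mulKmx //.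
  by rewrite mul0mx mulmx0 -(mxC0 R m m) => /mxC_inj.
have h := trace_adj_pos N0; move=> t0.
move: h; rewrite !adjM.
have -> : \tr (T *m mxC X *m invmx T *m (adj (invmx T) *m (adj (mxC X) *m adj T))) =
   \tr (mxC (X *m cartan_inv X)).
  rewrite !mulmxA mxtrace_mulC !mulmxA -[adj T *m T]ST -!mulmxA.
  have -> : invmx T *m (adj (invmx T) *m (adj (mxC X))) = mxC (invmx S) *m adj (mxC X).
    rewrite mulmxA /mxC map_invmx -[map_mx _ S]/(mxC S) ST adj_inv.
    congr (_ *m _); apply: (can_inj (mulKmx uT)); rewrite mulKVmx //.
    by apply: (can_inj (mulKmx (adj_unit uT))); rewrite mulmxV ?adj_unit // mulmxA mulmxV // unitmx_mul adj_unit.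
  rewrite -mxtrace_mulC -!mulmxA /cartan_inv /star !mxCM.
  by rewrite /adj mx_conj_mxC mxC_tr !mulmxA.
by rewrite -[mxC _]/(map_mx _ _) trace_map_mx t0 raddf0 ltxx.
Qed.

(** For the positive definite form [tr(X star(Y))] the orthogonal of the
    derived algebra in [g] is central: if [Z] is orthogonal to brackets then
    [tr([Z, Y] star([Z, Y]))] is [tr(Z star(W))] for a bracket [W]. *)
Lemma reductive_decomp X : X \in g ->
  exists A Z, [/\ A \in derived g, Z \in lie_center g & X = A + Z].
Proof.
have clg := lie_algebra_closed hG hg.
have /subvP dg := derived_sub clg.
pose b := vbasis (derived g).
have linL : linear (fun X : 'M[R]_m => \sum_i \tr (X *m cartan_inv (tnth b i)) *: tnth b i).
  move=> a Y Z; rewrite scaler_sumr -big_split; apply: eq_bigr => i _.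
  by rewrite mulmxDl -scalemxAl mxtraceD mxtraceZ scalerDl scalerA.
pose F := linfun (mk_linear linL).
have FE Y : F Y = \sum_i \tr (Y *m cartan_inv (tnth b i)) *: tnth b i by rewrite lfunE.
have F0 Y : F Y = 0 -> forall A, A \in derived g -> \tr (Y *m cartan_inv A) = 0.
  move=> FY A; apply: (vbasis_ind (P := fun A => \tr (Y *m cartan_inv A) = 0)).
    split=> [|a A1 A2 e1 e2]; first by rewrite /cartan_inv /star trmx0 mulmx0 mul0mx mulmx0 mxtrace0.
    rewrite /cartan_inv /star linearP /= mulmxDr mulmxDl -scalemxAr -scalemxAl mulmxDr -scalemxAr.
    by rewrite mxtraceD mxtraceZ e1 e2 mulr0 addr0.
  move=> B /tnthP[i ->]; have := basis_free (vbasisP (derived g)) => /freeP.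
  move/(_ (fun i => \tr (Y *m cartan_inv (tnth b i)))); apply.
  by rewrite -[RHS]FY FE; apply: eq_bigr => j _; rewrite -tnth_nth.
pose W := (g :&: lker F)%VS.
have Wc Z : Z \in W -> Z \in lie_center g.
  rewrite memv_cap memv_ker => /andP[hZ /eqP FZ]; apply/centerP; split=> // Y hY.
  apply: contrapT => /cartan_inv_pos; apply.
  have hD : lie (cartan_inv Y) (cartan_inv (lie Z Y)) \in g.
    exact: clg (cartan_inv_g hY) (cartan_inv_g (clg _ _ hZ hY)).
  have := F0 _ FZ (cartan_inv (lie Y (cartan_inv (lie Z Y)))).
  rewrite /cartan_inv (starK S_unit S_sym) (star_lie S_unit) (starK S_unit S_sym) => h.
  have := h (in_derived (clg _ _ hZ hY) (cartan_inv_g hY)).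
  move: (star S _) => A e; rewrite -[RHS]e /lie.
  rewrite mulmxBl mulmxBr !raddfB /= !mulmxA; congr (_ - _).
  by rewrite -[Y *m Z *m A]mulmxA mxtrace_mulC.
have : (g <= derived g + W)%VS.
  have h1 := limg_ker_dim F g.
  have h2 : (\dim (F @: g) <= \dim (derived g))%N.
    apply: dimvS; apply/subvP => _ /memv_imgP[Y _ ->]; rewrite FE.
    by apply: memv_suml => i _; rewrite memvZ // vbasis_mem // mem_tnth.
  have h3 : (derived g :&: W = 0)%VS.
    apply/eqP; rewrite -subv0; apply/subvP => A; rewrite memv_cap => /andP[hA].
    rewrite memv_cap memv_ker => /andP[_ /eqP FA]; rewrite memv0.
    by apply/eqP; apply: contrapT => /cartan_inv_pos; apply; apply: F0.
  have h4 := dimv_sum_cap (derived g) W; rewrite h3 dimv0 addn0 in h4.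
  have h5 : (derived g + W <= g)%VS by rewrite subv_add (derived_sub clg) capvSl.
  suff /eqP -> : (derived g + W)%VS == g by [].
  by rewrite eqEdim h5 h4 -h1 addnC leq_add2r.
move/subvP => h /h /memv_addP [A hA [Z hZ ->]].
by exists A, Z; split=> //; apply: Wc.
Qed.

Lemma complexify_decomp X : X \in complexify g ->
  exists A Z, [/\ A \in derived (complexify g), Z \in lie_center (complexify g)
    & X = A + Z].
Proof.
move=> /complexifyP[/reductive_decomp [A [Z [hA hZ eR]]]].
move=> /reductive_decomp [B [W [hB hW eI]]].
exists (mxC A + ('i : C) *: mxC B), (mxC Z + ('i : C) *: mxC W); split.
- by rewrite derived_complexify memvD ?memvZ ?mxC_complexify.
- by rewrite memvD ?memvZ ?center_complexify.
- by rewrite [LHS]mxC_decomp eR eI !mxCD scalerDr addrACA.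
Qed.

End Reductive.

(** * Joint eigenvectors under isomorphism *)

Section Transport.
Variables (K : fieldType) (m : nat) (L : {vspace 'M[K]_m}).

Definition joint_eig d (t : {vspace 'M[K]_m}) (rho : 'M[K]_m -> 'M[K]_d) :=
  forall u : 'cV[K]_d, aspan (fun u => forall T, T \in t -> eigv (mulmx (rho T)) u) u.

Lemma joint_eig_iso d e (t : {vspace 'M[K]_m}) (rho : 'M[K]_m -> 'M[K]_d)
    (rho' : 'M[K]_m -> 'M[K]_e) : (t <= L)%VS ->
  rep_iso L rho' rho -> joint_eig t rho -> joint_eig t rho'.
Proof.
move=> /subvP tL [P [P' [h1 h2 h]]] hj u.
have -> : u = P' *m (P *m u) by rewrite mulmxA h2 mul1mx.
elim: (hj (P *m u)) => [|x y hx _ IH]; first by rewrite mulmx0; apply: aspan0.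
rewrite mulmxDr; apply: aspanD => // T hT; have [a ha] := hx T hT; exists a.
rewrite -[LHS]mul1mx -h2 -!mulmxA (mulmxA P) h ?tL // -mulmxA (mulmxA P) h1 mul1mx.
by rewrite ha scalemxAr.
Qed.

Lemma joint_eig_sum d e (t : {vspace 'M[K]_m}) (rho : 'M[K]_m -> 'M[K]_d)
    (rho' : 'M[K]_m -> 'M[K]_e) :
  joint_eig t rho -> joint_eig t rho' -> joint_eig t (sum_rep rho rho').
Proof.
move=> h h' u; rewrite -[u]vsubmxK -[usubmx u]addr0 -[dsubmx u]add0r -add_col_mx.
apply: aspan_add.
  elim: (h (usubmx u)) => [|x y hx _ IH]; first by rewrite col_mx0; apply: aspan0.
  rewrite -[0 : 'cV_e]addr0 -add_col_mx; apply: aspanD => // T hT.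
  have [a ha] := hx T hT; exists a.
  by rewrite /sum_rep mul_block_col !mulmx0 !mul0mx !addr0 ha scale_col_mx scaler0.
elim: (h' (dsubmx u)) => [|x y hx _ IH]; first by rewrite col_mx0; apply: aspan0.
rewrite -[0 : 'cV_d]addr0 -add_col_mx; apply: aspanD => // T hT.
have [a ha] := hx T hT; exists a.
by rewrite /sum_rep mul_block_col !mulmx0 !mul0mx !add0r ha scale_col_mx scaler0.
Qed.

End Transport.

(** * Hodge numbers as multiplicities of eigenvalues *)

Section Multiplicities.
Variable K : numFieldType.

(** The geometric multiplicity of the eigenvalue [x]. *)
Definition nul d (M : 'M[K]_d) (x : K) := \rank (eigenspace M^T x).

Lemma nulE d (M : 'M[K]_d) x : nul M x = (d - \rank (M - x%:M)%R)%N.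
Proof.
by rewrite /nul /eigenspace mxrank_ker -{1}(tr_scalar_mx d x) -linearB /= mxrank_tr.
Qed.

Lemma nul_conj d e (M : 'M[K]_d) (N : 'M[K]_e) (P : 'M[K]_(e, d)) (P' : 'M[K]_(d, e)) x :
  P *m P' = 1%:M -> P' *m P = 1%:M -> P *m M = N *m P -> nul M x = nul N x.
Proof.
move=> h1 h2 h.
have de : d = e by apply/eqP; rewrite eqn_leq (mulmx1_min h1) (mulmx1_min h2).
rewrite !nulE; suff -> : \rank (M - x%:M) = \rank (N - x%:M) by rewrite {1}de.
have e1 : P *m (M - x%:M) = (N - x%:M) *m P.
  by rewrite mulmxBr mulmxBl h mul_scalar_mx mul_mx_scalar.
apply/eqP; rewrite eqn_leq; apply/andP; split.
  rewrite -[M - _]mul1mx -h2 -mulmxA e1.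
  by rewrite (leq_trans (mxrankM_maxr _ _)) ?mxrankM_maxl.
rewrite -[N - _]mulmx1 -h1 mulmxA -e1.
by rewrite (leq_trans (mxrankM_maxl _ _)) ?mxrankM_maxr.
Qed.

Lemma nul_block d e (M : 'M[K]_d) (N : 'M[K]_e) x :
  nul (block_mx M 0 0 N) x = (nul M x + nul N x)%N.
Proof.
rewrite !nulE scalar_mx_block opp_block_mx add_block_mx !oppr0 !addr0.
rewrite rank_diag_block_mx.
have := rank_leq_row (M - x%:M); have := rank_leq_row (N - x%:M); lia.
Qed.

Lemma nul_dual d (M : 'M[K]_d) x : nul (- M^T) x = nul M (- x).
Proof.
rewrite !nulE; congr (_ - _)%N.
have -> : - M^T - x%:M = - (M - (- x)%:M)^T.
  by rewrite (raddfN (@scalar_mx K d)) /= opprK linearD /= tr_scalar_mx opprD.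
by rewrite mxrank_opp mxrank_tr.
Qed.

Lemma nul_gt0 d (M : 'M[K]_d) x (v : 'cV[K]_d) : v <> 0 -> M *m v = x *: v -> (0 < nul M x)%N.
Proof.
move=> v0 hv; rewrite nulE subn_gt0 ltn_neqAle rank_leq_row andbT.
apply/negP => hr; apply: v0.
have uM : M - x%:M \in unitmx by rewrite -row_free_unit.
apply: (can_inj (mulKmx uM)); rewrite mulmxBl hv mul_scalar_mx subrr mulmx0 //.
Qed.

(** If [x] is none of the eigenvalues then [M - x] is onto. *)
Lemma nul_eq0 d (M : 'M[K]_d) (P : K -> Prop) x :
  (forall u : 'cV[K]_d, aspan (fun w => exists a, P a /\ M *m w = a *: w) u) ->
  ~ P x -> nul M x = 0%N.
Proof.
move=> h hx.
have surj u : exists w : 'cV[K]_d, (M - x%:M) *m w = u.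
  have Plin : lin_pred (fun u => exists w : 'cV[K]_d, (M - x%:M) *m w = u).
    split=> [|a _ _ [w1 <-] [w2 <-]]; first by exists 0; rewrite mulmx0.
    by exists (a *: w1 + w2); rewrite mulmxDr -scalemxAr.
  apply: (aspan_sub Plin _ (h u)) => w [a [Pa hw]].
  have ax : a - x != 0 by rewrite subr_eq0; apply/eqP => ax; apply: hx; rewrite -ax.
  exists ((a - x)^-1 *: w); rewrite -scalemxAr mulmxBl hw mul_scalar_mx -scalerBl.
  by rewrite scalerA mulVf ?scale1r.
have [W hW] := boolp.choice (fun j : 'I_d => surj (delta_mx j 0)).
have : (M - x%:M) *m (\matrix_(i, j) W j i 0) = 1%:M.
  apply/matrixP => i j; rewrite !mxE -[RHS](_ : delta_mx j 0 i (0 : 'I_1) = _).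
    by rewrite -hW !mxE; apply: eq_bigr => k _; rewrite !mxE.
  by rewrite !mxE eqxx andbT.
by move=> /mulmx1_unit[]; rewrite -row_full_unit -col_leq_rank nulE => hr _; lia.
Qed.

Lemma nul_directP d (M : 'M[K]_d) x0 x1 x2 x3 : uniq [:: x0; x1; x2; x3] ->
  let V x := eigenspace M^T x in
  \rank (V x0 + V x1 + V x2 + V x3)%MS = (nul M x0 + nul M x1 + nul M x2 + nul M x3)%N.
Proof.
move=> hu V; pose a_ (i : 'I_4) := tnth [tuple x0; x1; x2; x3] i.
have inj : {in predT &, injective a_}.
  move=> i j _ _; rewrite /a_ !(tnth_nth 0) => /eqP.
  by rewrite nth_uniq // => /eqP /val_inj.
have /mxdirectP /= := mxdirect_sum_eigenspace M^T inj.
rewrite !big_ord_recl !big_ord0 Monoid.mulm1 addn0 !Monoid.mulmA /=.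
by rewrite /a_ !(tnth_nth 0).
Qed.

Lemma nul_level_uniq : uniq [:: (3%:R / 2%:R); (1 / 2%:R); - (1 / 2%:R); - (3%:R / 2%:R) : K].
Proof.
have ne k (a b : K) : a - b = k.+1%:R -> a != b by rewrite -subr_eq0 => ->; rewrite pnatr_eq0.
rewrite /= !inE !negb_or !andbT -!andbA; apply/and5P; split.
- by apply: (ne 0); field.
- by apply: (ne 1); field.
- by apply: (ne 2); field.
- by apply: (ne 0); field.
by apply/andP; split; [apply: (ne 1)|apply: (ne 0)]; field.
Qed.

Lemma hodge_numbersP d (M : 'M[K]_d) h0 h1 h2 h3 : hodge_numbers M h0 h1 h2 h3 <->
  [/\ nul M (3%:R / 2%:R) = h0, nul M (1 / 2%:R) = h1, nul M (- (1 / 2%:R)) = h2,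
      nul M (- (3%:R / 2%:R)) = h3 & (h0 + h1 + h2 + h3)%N = d].
Proof.
rewrite /hodge_numbers /= -!/(nul _ _).
have := nul_directP M nul_level_uniq; move=> /=; set S := (_ + _ + _ + _)%MS => hS.
split=> -[e0 e1 e2 e3 e]; split=> //.
  by rewrite -e0 -e1 -e2 -e3 -hS e mxrank1.
have fS : row_full S by rewrite /row_full hS e0 e1 e2 e3 e.
by apply/eqmxP; rewrite submx1 submx_full.
Qed.

Lemma nul_two_step d (M : 'M[K]_d) :
  (M - (3%:R / 2%:R)%:M) *m (M - (1 / 2%:R)%:M) = 0 ->
  [/\ (nul M (3%:R / 2%:R) + nul M (1 / 2%:R))%N = d,
      nul M (- (1 / 2%:R)) = 0%N & nul M (- (3%:R / 2%:R)) = 0%N].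
Proof.
move=> h0; have := mxrank_mul_min (M - (3%:R / 2%:R)%:M) (M - (1 / 2%:R)%:M).
have := nul_directP M nul_level_uniq => /=; set S := (_ + _ + _ + _)%MS => hS.
have := rank_leq_row S; rewrite hS h0 mxrank0 !nulE.
have := rank_leq_row (M - (3%:R / 2%:R)%:M); have := rank_leq_row (M - (1 / 2%:R)%:M).
move: (\rank (M - (1 / 2%:R)%:M)) (\rank (M - (3%:R / 2%:R)%:M))
  (\rank (M - (- (1 / 2%:R))%:M)) (\rank (M - (- (3%:R / 2%:R))%:M)) => p q k j.
by move=> ? ? ? ?; split; lia.
Qed.

End Multiplicities.

(** * Hodge numbers and tuples *)

Section Datum.
Variables (R : realType) (D : hodge_datum R).
Local Notation C := R[i].
Local Open Scope complex_scope.

Let L := complexify (hd_g D).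
Let ss := hd_ss D.
Let U := @hd_U R D.
Let E := hd_E D.
Let d := hd_d D.

Lemma datum_group : exists n Q G phi, [/\ @group_hodge_rep R (hd_m D) n Q G phi,
  (forall X, X \in hd_g D <-> lie_algebra_of G X) & is_grading_element phi (hd_E D)].
Proof. by have [n [Q [G [phi h]]]] := hd_hodge D; exists n, Q, G, phi. Qed.

Lemma datum_closed : lie_closed (hd_g D).
Proof. by have [n [Q [G [phi [h1 h2 _]]]]] := datum_group; exact: (lie_algebra_closed h1 h2). Qed.

Lemma datum_clL : lie_closed L.
Proof. exact: complexify_closed datum_closed. Qed.

Lemma datum_red X : X \in L -> exists S Z,
  [/\ S \in ss, Z \in lie_center L & X = S + Z].
Proof. by have [n [Q [G [phi [h1 h2 _]]]]] := datum_group; apply: complexify_decomp h1 _ h2 X. Qed.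

(** The Cartan subalgebra acts diagonalizably on [U] and on its dual, hence
    on [V_C]. *)
Lemma datum_joint : joint_eig (hd_t D) (id : 'M[C]_(hd_m D) -> 'M[C]_(hd_m D)).
Proof.
have tor := (hd_cartan D).1; have tL : (hd_t D <= L)%VS by case: tor.
have hU := toral_rep (hd_U_rep D) (hd_U_irreducible D) tor.
have hU' := toral_rep (dual_rep_is_rep (hd_U_rep D))
  (irreducible_dual (hd_U_irreducible D)) tor.
have eq1 (rho : 'M[C]_(hd_m D) -> 'M[C]_(hd_m D)) : (forall Z, rho Z = Z) ->
    joint_eig (hd_t D) rho -> joint_eig (hd_t D) id.
  by move=> e h u; apply: aspan_mono (h u) => w hw T hT; have := hw T hT; rewrite e.
apply: (eq1 (complexify_rep id)); first exact: complexify_rep_id.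
move: (hd_U_type D); case: (hd_tau D) => -[hi _]; apply: (joint_eig_iso tL hi) => //;
  exact: joint_eig_sum.
Qed.

Lemma datum_level : simple_level_one D ->
  (hd_mu D (hd_Ess D) : C) + hd_mu_star D (hd_Ess D) = 1.
Proof. by case=> _; rewrite add_lfunE. Qed.

Lemma datum_E_L : E \in L.
Proof.
rewrite /E hd_E_split; apply: (E_L datum_clL (t := hd_t D)); exact: hd_E'_center.
Qed.

Lemma datum_spectrum (u : 'cV[C]_d) : aspan (fun w => exists k : nat,
  U E *m w = ((hd_mu D (hd_Ess D) : C) + ratr (hd_c D) - k%:R) *: w) u.
Proof.
rewrite /E hd_E_split.
exact: (spectrum_U datum_clL (hd_cartan D) datum_joint (hd_simple_roots D) (@hd_coroots R D)
  (hd_bourbaki D) (@hd_alpha_Ess R D) (hd_E'_center D) (hd_U_rep D) (hd_U_irreducible D)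
  (hd_E'_U D) (hd_mu_highest D)).
Qed.

Lemma datum_spectrum_dual (u : 'cV[C]_d) : aspan (fun w => exists k : nat,
  - (U E)^T *m w = ((hd_mu_star D (hd_Ess D) : C) - ratr (hd_c D) - k%:R) *: w) u.
Proof.
rewrite /E hd_E_split.
exact: (spectrum_dual datum_clL (hd_cartan D) datum_joint (hd_simple_roots D) (@hd_coroots R D)
  (hd_bourbaki D) (@hd_alpha_Ess R D) (hd_E'_center D) (hd_U_rep D) (hd_U_irreducible D)
  (hd_E'_U D) (hd_mu_star_highest D)).
Qed.

Lemma datum_UE : U E = U (vsval (hd_Ess D)) + (ratr (hd_c D))%:M.
Proof.
rewrite /E hd_E_split; exact: (UE datum_clL _ (hd_E'_center D) (hd_U_rep D) (hd_E'_U D)).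
Qed.

Lemma top_weight : (0 < nul (U E) ((hd_mu D (hd_Ess D) : C) + ratr (hd_c D)))%N.
Proof.
have [v [v0 hv _]] := hd_mu_highest D; apply: (nul_gt0 v0).
by rewrite datum_UE mulmxDl hv mul_scalar_mx -scalerDl.
Qed.

Lemma top_weight_dual : (0 < nul (dual_rep U E) ((hd_mu_star D (hd_Ess D) : C) - ratr (hd_c D)))%N.
Proof.
have [v [v0 hv _]] := hd_mu_star_highest D; apply: (nul_gt0 v0).
rewrite /dual_rep datum_UE linearD /= tr_scalar_mx opprD mulmxDl.
by rewrite -/(dual_rep U (vsval (hd_Ess D))) hv mulNmx mul_scalar_mx -scalerBl.
Qed.

Hypothesis hD : simple_level_one D.

(** Here [c = 0] and [U] is self-dual. The top eigenvalues [mu(E_ss)] and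
    [mu_star(E_ss)] of [U] and of its dual differ by natural numbers in both
    directions, so they are equal to 1/2. *)
Lemma noncomplex_nul : hd_tau D <> ComplexType -> nul E (3%:R / 2%:R) = 0%N.
Proof.
move=> htau.
have hc0 : hd_c D = 0.
  by move: htau (hd_c_normalized D); case: (hd_tau D).
have iso : rep_iso L U (dual_rep U).
  by move: htau (hd_U_type D); case: (hd_tau D) => // _ [].
have [P [P' [P1 P2 hP]]] := iso.
have nE x : nul (U E) x = nul (dual_rep U E) x by apply: (nul_conj x P1 P2 (hP _ datum_E_L)).
have hUs x : (0 < nul (U E) x)%N -> exists k : nat, x = (hd_mu D (hd_Ess D) : C) - k%:R.
  move=> hx; apply: contrapT => hk; move: hx.
  rewrite (nul_eq0 (P := fun x => exists k : nat, x = (hd_mu D (hd_Ess D) : C) - k%:R)) //.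
  move=> u; apply: aspan_mono (datum_spectrum u) => w [k hw].
  eexists; split; last exact: hw.
  by exists k; rewrite hc0 rmorph0 addr0.
have hUd x : (0 < nul (dual_rep U E) x)%N -> exists k : nat, x = (hd_mu_star D (hd_Ess D) : C) - k%:R.
  move=> hx; apply: contrapT => hk; move: hx.
  rewrite (nul_eq0 (P := fun x => exists k : nat, x = (hd_mu_star D (hd_Ess D) : C) - k%:R)) //.
  move=> u; apply: aspan_mono (datum_spectrum_dual u) => w [k hw].
  eexists; split; last exact: hw.
  by exists k; rewrite hc0 rmorph0 subr0.
have := top_weight; rewrite nE => /hUd [k hk].
have := top_weight_dual; rewrite -nE => /hUs [j hj].
have hl := datum_level hD.
rewrite hc0 rmorph0 addr0 in hk; rewrite hc0 rmorph0 subr0 in hj.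
have mu_half : (hd_mu D (hd_Ess D) : C) = 1 / 2%:R.
  have : (k + j)%N%:R = 0 :> C by rewrite natrD; move: hk; rewrite hj => hk; move/eqP: hk; rewrite -subr_eq0 => /eqP hk; rewrite -[RHS]hk; ring.
  move/eqP; rewrite pnatr_eq0 addn_eq0 => /andP[/eqP k0 /eqP j0].
  rewrite j0 subr0 in hj; rewrite hj in hl.
  have two : 2%:R != 0 :> C by rewrite pnatr_eq0.
  by apply: (mulIf two); rewrite mul1r mulVf // mulr_natr mulr2n hl.
have nU0 : nul (U E) (3%:R / 2%:R) = 0%N.
  apply/eqP; rewrite -leqn0 leqNgt; apply/negP => hh.
  have [k1] := hUs _ hh; rewrite mu_half.
  move/eqP; rewrite -subr_eq0 (_ : _ - _ = k1.+1%:R) ?pnatr_eq0 //.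
  by rewrite -natr1; field.
move: htau (hd_U_type D); case: (hd_tau D) => // _ [[Q [Q' [Q1 Q2 hQ]]] _].
  have e := nul_conj (3%:R / 2%:R) Q1 Q2 (hQ _ datum_E_L).
  by rewrite complexify_rep_id in e; apply: etrans e nU0.
have := nul_conj (3%:R / 2%:R) Q1 Q2 (hQ _ datum_E_L).
by rewrite complexify_rep_id nul_block -nE nU0.
Qed.

Section Complex.
Hypothesis htau : hd_tau D = ComplexType.

Lemma datum_c : ratr (hd_c D) = 3%:R / 2%:R - (hd_mu D (hd_Ess D) : C).
Proof. by have := hd_c_normalized D; rewrite htau. Qed.

(** [V_C] is the sum of [U] and its dual. *)
Lemma complex_nul x : nul E x = (nul (U E) x + nul (U E) (- x))%N.
Proof.
move: (hd_U_type D); rewrite htau => -[[Q [Q' [Q1 Q2 hQ]]] _].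
have := nul_conj x Q1 Q2 (hQ _ datum_E_L).
by rewrite complexify_rep_id nul_block /dual_rep nul_dual.
Qed.

Lemma complex_two_step : (U E - (3%:R / 2%:R)%:M) *m (U E - (1 / 2%:R)%:M) = 0.
Proof.
rewrite /E hd_E_split.
exact: (two_step datum_clL (hd_cartan D) datum_joint (hd_simple_roots D) (@hd_coroots R D)
  (hd_bourbaki D) (@hd_alpha_Ess R D) (hd_E'_center D) (hd_U_rep D) (hd_U_irreducible D)
  (hd_E'_U D) (hd_mu_highest D) (hd_mu_star_highest D) (datum_level hD) datum_c).
Qed.

Lemma complex_tuple_of_line : \rank (U E - (1 / 2%:R)%:M) = 1%N ->
  (1 < d)%N ->
  [/\ lie_iso ss (sl C d), hd_rank D = d.-1,
      exists k, (k = 1%N \/ k = hd_rank D) /\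
        is_dual_basis_elt (hd_alpha D) k (hd_Ess D) /\
        is_fundamental_weight (hd_alphav D) k (hd_mu D) &
      ratr (hd_c D) = (d.-1 + 3)%:R / (2 * (d.-1 + 1))%:R :> C].
Proof.
rewrite /E hd_E_split.
exact: (tuple_of_line datum_clL (hd_cartan D) datum_red datum_joint (hd_simple_roots D) (@hd_coroots R D)
  (hd_bourbaki D) (@hd_alpha_Ess R D) (hd_E'_center D) (hd_U_rep D) (hd_U_irreducible D)
  (hd_E'_U D) (hd_mu_highest D) (hd_mu_star_highest D) (datum_level hD) datum_c hD.1).
Qed.

Lemma complex_line_of_tuple r k : has_sl_tuple D r k -> \rank (U E - (1 / 2%:R)%:M) = 1%N.
Proof.
case=> hiso hdb hfw _; move: hiso hdb hfw.
rewrite /E hd_E_split.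
exact: (line_of_tuple datum_clL (hd_cartan D) datum_red datum_joint (hd_simple_roots D) (@hd_coroots R D)
  (hd_bourbaki D) (@hd_alpha_Ess R D) (hd_E'_center D) (hd_U_rep D) (hd_U_irreducible D)
  (hd_E'_U D) (hd_mu_highest D) (hd_mu_star_highest D) (datum_level hD) datum_c (ltn0Sn r)).
Qed.

Lemma complex_top_projection : \rank (U E - (1 / 2%:R)%:M) = 1%N ->
  exists (v : 'cV[C]_d) (xi : 'rV[C]_d), U E = (1 / 2%:R)%:M + v *m xi /\ xi *m v = 1%:M.
Proof.
rewrite /E hd_E_split.
exact: (top_projection datum_clL (hd_cartan D) datum_joint (hd_simple_roots D) (@hd_coroots R D)
  (hd_bourbaki D) (@hd_alpha_Ess R D) (hd_E'_center D) (hd_U_rep D) (hd_U_irreducible D)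
  (hd_E'_U D) (hd_mu_highest D) (hd_mu_star_highest D) (datum_level hD) datum_c).
Qed.

Lemma complex_U_sl : \rank (U E - (1 / 2%:R)%:M) = 1%N ->
  forall A, \tr A = 0 -> exists X, X \in ss /\ U X = A.
Proof.
rewrite /E hd_E_split.
exact: (U_sl datum_clL (hd_cartan D) datum_joint (hd_simple_roots D) (@hd_coroots R D)
  (hd_bourbaki D) (@hd_alpha_Ess R D) (hd_E'_center D) (hd_U_rep D) (hd_U_irreducible D)
  (hd_E'_U D) (hd_mu_highest D) (hd_mu_star_highest D) (datum_level hD) datum_c).
Qed.

Lemma complex_inj X : X \in ss -> U X = 0 -> X = 0.
Proof.
exact: (U_inj datum_clL (hd_U_rep D) (hd_mu_highest D) (hd_mu_star_highest D) (datum_level hD) hD.1).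
Qed.

(** Otherwise the faithful representation [U] would kill all brackets. *)
Lemma complex_d_gt1 : (1 < d)%N.
Proof.
rewrite ltnNge; apply/negP => d1.
have d1' : d = 1%N by apply/eqP; rewrite eqn_leq d1 (hd_U_irreducible D).1.
have [[X [Y [hX hY hXY]]] _] := hD.1.
have hss Z : Z \in ss -> Z \in L by apply: ss_sub; apply: datum_clL.
apply: hXY; apply: complex_inj; first by apply: in_derived; apply: hss.
rewrite /U (hd_U_rep D).2 ?hss //.
have comm k (A B : 'M[C]_k) : k = 1%N -> lie A B = 0.
  move=> k1; subst k.
  by rewrite /lie [A]mx11_scalar [B]mx11_scalar -!scalar_mxM mulrC subrr.
exact: comm d1'.
Qed.

Lemma complex_d r k : has_sl_tuple D r k -> d = r.+1.
Proof.
move=> h; have [h1 _ _ _] := complex_tuple_of_line (complex_line_of_tuple h) complex_d_gt1.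
have [h2 _ _ _] := h; move: h1; have := complex_d_gt1; case: (d) => // d' _ h1.
by rewrite (lie_iso_sl_inj h1 h2).
Qed.

Lemma complex_mult r : \rank (U E - (1 / 2%:R)%:M) = 1%N -> d = r.+1 ->
  [/\ nul (U E) (3%:R / 2%:R) = 1%N, nul (U E) (1 / 2%:R) = r,
      nul (U E) (- (1 / 2%:R)) = 0%N & nul (U E) (- (3%:R / 2%:R)) = 0%N].
Proof.
move=> h1 hd; have [h2 h3 h4] := nul_two_step complex_two_step.
have e : nul (U E) (1 / 2%:R) = r by rewrite nulE h1 -/d hd subn1.
by split=> //; apply: (@addIn r); rewrite -{1}e h2 add1n; exact: hd.
Qed.

Lemma complex_hodge_numbers r : \rank (U E - (1 / 2%:R)%:M) = 1%N -> d = r.+1 ->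
  [/\ hodge_numbers E 1 r r 1, hodge_numbers (U E) 1 r 0 0 &
      hodge_numbers (dual_rep U E) 0 0 r 1].
Proof.
move=> h1 hd; have [a1 a2 a3 a4] := complex_mult h1 hd.
have dm : (d + d)%N = hd_m D.
  move: (hd_U_type D); rewrite htau => -[[P [P' [/mulmx1_min p1 /mulmx1_min p2 _]]] _].
  by apply/eqP; rewrite eqn_leq p1 p2.
split; apply/hodge_numbersP.
- by rewrite !complex_nul !opprK a1 a2 a3 a4 ?addn0 ?add0n; split=> //; apply: etrans dm; rewrite hd; lia.
- by rewrite a1 a2 a3 a4 -/d hd; split=> //; lia.
- by rewrite /dual_rep !nul_dual !opprK a1 a2 a3 a4 -/d hd; split=> //; lia.
Qed.

End Complex.

(** In the other types [c = 0]. *)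
Lemma tuple_complex r k : has_sl_tuple D r k -> hd_tau D = ComplexType.
Proof.
case=> _ _ _ hc; move: (hd_c_normalized D); case: (hd_tau D) => //; rewrite hc => /eqP;
  by rewrite mulf_eq0 invr_eq0 !pnatr_eq0 muln_eq0 !addn_eq0 /= ?andbF.
Qed.

Lemma tuple_of_hodge_numbers a : (0 < a)%N -> hodge_numbers E 1 a a 1 ->
  exists r, (1 <= r)%N /\ (has_sl_tuple D r 1 \/ has_sl_tuple D r r).
Proof.
move=> a0 /hodge_numbersP [h1 h2 h3 h4 hm].
have htau : hd_tau D = ComplexType.
  by apply: contrapT => /noncomplex_nul; rewrite h1.
have [t1 t2 t3] := nul_two_step (complex_two_step htau).
have r1 : \rank (U E - (1 / 2%:R)%:M) = 1%N.
  move: h1; rewrite complex_nul // t3 addn0 => n1; move: t1; rewrite n1 nulE -/d.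
  have := rank_leq_row (U E - (1 / 2%:R)%:M); rewrite -/d.
  by move: (\rank _) => k; lia.
have d1 := complex_d_gt1.
have [i1 i2 [k [hk [i3 i4]]] i5] := complex_tuple_of_line htau r1 d1.
exists d.-1; have dE : d = d.-1.+1 by rewrite prednK // ltnW.
split; first by rewrite -ltnS -dE.
have hc : hd_c D = (d.-1 + 3)%:R / (2 * (d.-1 + 1))%:R.
  by apply: (fmorph_inj (@ratr C)); apply: (etrans i5); rewrite fmorph_div /= !ratr_nat.
by rewrite i2 in hk; case: hk => hk; [left|right]; rewrite hk in i3 i4; split; rewrite // -dE.
Qed.

Lemma hodge_numbers_of_tuple r k : has_sl_tuple D r k ->
  [/\ hodge_numbers E 1 r r 1, hodge_numbers (U E) 1 r 0 0 &
      hodge_numbers (dual_rep U E) 0 0 r 1].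
Proof.
move=> h; have htau := tuple_complex h.
by apply: complex_hodge_numbers => //; [apply: complex_line_of_tuple h|apply: complex_d h].
Qed.

End Datum.

(** * The grading element and the circle *)

Section Grading.
Variable R : realType.
Local Notation C := R[i].
Local Open Scope complex_scope.

Definition cis (x : R) : C := cos x +i* sin x.

Lemma cisD x y : cis (x + y) = cis x * cis y.
Proof. by rewrite /cis cosD sinD; apply/eqP; rewrite eq_complex /=; apply/andP; split; apply/eqP; ring. Qed.

Lemma cis0 : cis 0 = 1.
Proof. by rewrite /cis cos0 sin0. Qed.

Lemma cis_neq0 x : cis x != 0.
Proof.
apply/eqP => h; have := cisD x (- x); rewrite subrr h mul0r cis0 => /eqP.
by rewrite oner_eq0.
Qed.

Lemma cisX x (k : int) : cis x ^ k = cis (k%:~R * x).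
Proof.
have hn (j : nat) : cis x ^+ j = cis (j%:R * x).
  elim: j => [|j IH]; first by rewrite expr0 mul0r cis0.
  by rewrite exprS IH -cisD -natr1 mulrDl mul1r addrC.
case: k => j; first by rewrite -pmulrn -hn.
rewrite NegzE -exprnN hn -[LHS]mul1r; apply: (canLR (mulfK (cis_neq0 _))).
by rewrite -cisD -cis0 mulrNz -pmulrn mulNr addNr.
Qed.

Lemma norm_cis x : `|cis x| = 1.
Proof. by rewrite /cis normc_def /= cos2Dsin2 sqrtr1. Qed.

Lemma derive_scale_at0 (a : R) : is_derive (0 : R) 1 (fun t => a * t) a.
Proof. by apply: (is_derive_eq (is_deriveZ a (is_derive_id _ _))); rewrite /GRing.scale /= mulr1. Qed.

Lemma derive_cos_at0 (a : R) : is_derive (0 : R) 1 (fun t => cos (a * t)) 0.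
Proof.
have h := @is_derive1_comp R cos (fun t => a * t) 0 _ _ (is_derive_cos _) (derive_scale_at0 a).
by apply: (is_derive_eq h); rewrite mulr0 sin0 oppr0 mul0r.
Qed.

Lemma derive_sin_at0 (a : R) : is_derive (0 : R) 1 (fun t => sin (a * t)) a.
Proof.
have h := @is_derive1_comp R sin (fun t => a * t) 0 _ _ (is_derive_sin _) (derive_scale_at0 a).
by apply: (is_derive_eq h); rewrite mulr0 cos0 mul1r.
Qed.

Lemma mxRe_mulC m n p (X : 'M[R]_(m, n)) (Z : 'M[C]_(n, p)) : mxRe (mxC X *m Z) = X *m mxRe Z.
Proof.
rewrite {1}[Z]mxC_decomp mulmxDr -scalemxAr -!mxCM.
by rewrite mxReD mxReZ !mxRe_mxC mxIm_mxC /= scale0r scaler0 subrr addr0.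
Qed.

Lemma mxIm_mulC m n p (X : 'M[R]_(m, n)) (Z : 'M[C]_(n, p)) : mxIm (mxC X *m Z) = X *m mxIm Z.
Proof.
rewrite {1}[Z]mxC_decomp mulmxDr -scalemxAr -!mxCM.
by rewrite mxImD mxImZ !mxRe_mxC !mxIm_mxC /= scaler0 scale1r !add0r.
Qed.

Section Piece.
Variables (m : nat) (phi : C -> 'M[R]_m) (E : 'M[C]_m).
Hypothesis hE : is_grading_element phi E.

(** Differentiate [phi(z) w = z^(p-q) w] along the circle, separately in the
    real and imaginary part of [w]. *)
Lemma hodge_piece_eig p q (w : 'cV[C]_m) : hodge_piece phi p q w ->
  E *m w = ((p - q)%:~R / 2%:R) *: w.
Proof.
case: hE => L [hL ->] hw; set k := p - q in hw *.
pose tpi : R := 2%:R * pi.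
have phiE t : mxC (phi (cis (tpi * t))) *m w = cis (k%:~R * tpi * t) *: w.
  by rewrite hw ?norm_cis // cisX mulrA.
have hd : mxder (fun t => phi (cis (tpi * t))) L by [].
have hr : L *m mxRe w = - (k%:~R * tpi) *: mxIm w.
  have h1 := mxderM hd (mxder_cst (mxRe w)); rewrite mulmx0 addr0 in h1.
  apply: (mxder_unique h1).
  rewrite (_ : (fun t => _) = fun t => cos (k%:~R * tpi * t) *: mxRe w + - sin (k%:~R * tpi * t) *: mxIm w).
    rewrite -[- _ *: _]add0r -[X in X + _](scale0r (mxRe w)).
    exact: (mxderD (mxder_scale _ (derive_cos_at0 _)) (mxder_scale _ (is_deriveN (derive_sin_at0 _)))).
  by apply/funext => t; rewrite -mxRe_mulC phiE mxReZ /= scaleNr.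
have hi : L *m mxIm w = (k%:~R * tpi) *: mxRe w.
  have h1 := mxderM hd (mxder_cst (mxIm w)); rewrite mulmx0 addr0 in h1.
  apply: (mxder_unique h1).
  rewrite (_ : (fun t => _) = fun t => cos (k%:~R * tpi * t) *: mxIm w + sin (k%:~R * tpi * t) *: mxRe w).
    rewrite -[_ *: mxRe w]add0r -[X in X + _](scale0r (mxIm w)).
    exact: (mxderD (mxder_scale _ (derive_cos_at0 _)) (mxder_scale _ (derive_sin_at0 _))).
  by apply/funext => t; rewrite -mxIm_mulC phiE mxImZ.
have Lw : mxC L *m w = (('i : C) * (k%:~R * tpi)%:C) *: w.
  rewrite {1}[w]mxC_decomp mulmxDr -scalemxAr -!mxCM hr hi !mxCZ.
  rewrite {3}[w]mxC_decomp scalerDr !scalerA addrC; congr (_ + _).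
  rewrite (_ : (- (k%:~R * tpi))%:C = - (k%:~R * tpi)%:C) ?raddfN //.
  by rewrite mulrAC -expr2 sqr_i mulN1r.
rewrite -scalemxAl Lw scalerA; congr (_ *: _).
have ek : (k%:~R * tpi)%:C = k%:~R * (2%:R * (pi : R)%:C) :> C.
  by rewrite !rmorphM /= rmorph_int rmorph_nat.
have pi0 : (pi : R)%:C != 0 :> C by rewrite eq_complex /= eqxx andbT gt_eqF // pi_gt0.
have i0 : ('i : C) != 0 by rewrite -normr_eq0 norm_i oner_eq0.
have aux (x y c : C) : x != 0 -> y != 0 ->
    (4%:R * x * y)^-1 * (y * (c * (2%:R * x))) = c / 2%:R.
  by move=> x0 y0; field; rewrite y0.
by rewrite ek; apply: aux.
Qed.

Variables (n : int) (Q : 'M[R]_m) (G : set 'M[R]_m).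
Hypothesis hG : group_hodge_rep n Q G phi.

(** Decompose [v] in Hodge pieces; the pieces with a different [p] have other
    eigenvalues. *)
Lemma grading_power (k : int) (v : 'cV[C]_m) z : E *m v = (k%:~R / 2%:R) *: v ->
  `|z| = 1 -> mxC (phi z) *m v = z ^ k *: v.
Proof.
move=> hv hz; have [s [w [hw vE]]] := ghr_decomposition hG v.
have wE p : E *m w p = ((p - (n - p))%:~R / 2%:R) *: w p by apply/hodge_piece_eig/hw.
pose x p := w p *+ count_mem p s.
have vx : v = \sum_(p <- undup s) x p.
  by rewrite vE -big_undup_iterop_count; apply: eq_bigr.
have two : 2%:R != 0 :> C by rewrite pnatr_eq0.
have inj : injective (fun p : int => ((p - (n - p))%:~R / 2%:R : C)).
  by move=> p q /(mulIf (invr_neq0 two)) /intr_inj; lia.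
have xE p : E *m x p = ((p - (n - p))%:~R / 2%:R) *: x p.
  by rewrite /x -scaler_nat -scalemxAr wE !scalerA mulrC.
have hx p : p \in undup s -> E *m x p = (k%:~R / 2%:R) *: x p.
  apply: (eigen_components (P := fun x => E *m x = (k%:~R / 2%:R) *: x) (f := mulmx E)
    (lam := fun p : int => ((p - (n - p))%:~R / 2%:R : C))).
  - split=> [|a y y' h h']; first by rewrite mulmx0 scaler0.
    by rewrite mulmxDr -scalemxAr h h' scalerDr !scalerA mulrC.
  - by move=> y /= hy; rewrite {1}hy -scalemxAr.
  - by rewrite map_inj_uniq ?undup_uniq.
  - by move=> q _; apply: xE.
  - by rewrite -vx.
rewrite vx mulmx_sumr scaler_sumr big_seq [RHS]big_seq; apply: eq_bigr => p ps.
have := hx p ps; rewrite xE => /eqP; rewrite -subr_eq0 -scalerBl scaler_eq0.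
case/orP => [|/eqP ->]; last by rewrite mulmx0 scaler0.
rewrite subr_eq0 => /eqP /(mulIf (invr_neq0 two)) /intr_inj <-.
by rewrite /x -scaler_nat -scalemxAr (hw p z hz) !scalerA mulrC.
Qed.

End Piece.
End Grading.

(** * Hermitian forms of signature (1, r) *)

Section Signature.
Variable R : realType.
Local Notation C := R[i].

Lemma rank1_complement (K : fieldType) r (v : 'cV[K]_(1 + r)) (xi : 'rV[K]_(1 + r)) :
  xi *m v = 1%:M -> exists (W : 'M[K]_(1 + r, r)) (H : 'M[K]_(1 + r)),
    [/\ xi *m W = 0, row_mx v W *m H = 1%:M & H *m row_mx v W = 1%:M].
Proof.
move=> xv.
have uH := row_ebase_unit xi; set Hi := row_ebase xi in uH.
have xiE : xi *m invmx Hi = (col_ebase xi 0 0) *: pid_mx (\rank xi).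
  rewrite -{1}[xi]mulmx_ebase mulmxK // {1}[col_ebase xi]mx11_scalar mul_scalar_mx //.
have r1 : \rank xi = 1%N.
  apply/eqP; rewrite eqn_leq rank_leq_row lt0n mxrank_eq0; apply: contraTneq isT => x0.
  by have := xv; rewrite x0 mul0mx => /matrixP/(_ 0 0)/eqP; rewrite !mxE eq_sym oner_eq0.
pose W := rsubmx (invmx Hi); pose D := dsubmx Hi.
have xW : xi *m W = 0.
  have : xi *m invmx Hi = row_mx (xi *m lsubmx (invmx Hi)) (xi *m rsubmx (invmx Hi)).
    by rewrite -mul_mx_row hsubmxK.
  rewrite xiE r1 => e; have := congr1 rsubmx e; rewrite row_mxKr /W => <-.
  by apply/matrixP => i j; rewrite (ord1 i) !mxE /= mulr0.
have DW : D *m W = 1%:M.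
  have : Hi *m invmx Hi = 1%:M by rewrite mulmxV.
  rewrite -{1}[Hi]vsubmxK -[invmx Hi]hsubmxK mul_col_row => /(congr1 drsubmx).
  by rewrite block_mxKdr scalar_mx_block block_mxKdr.
have HG : col_mx xi (D *m (1%:M - v *m xi)) *m row_mx v W = 1%:M.
  rewrite mul_col_row xv xW -!mulmxA !mulmxBl !mul1mx -!mulmxA xv xW mulmx0 mulmx1.
  by rewrite subrr subr0 mulmx0 DW scalar_mx_block.
exists W, (col_mx xi (D *m (1%:M - v *m xi))); split=> //.
exact: mulmx1C.
Qed.

(** Gram-Schmidt in two blocks: the line of [v], and the orthogonal [ker xi],
    where minus the form is positive definite. *)
Lemma signature_basis d r (B : 'M[C]_d) (v : 'cV[C]_d) (xi : 'rV[C]_d) :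
  d = r.+1 -> xi *m v = 1%:M -> adj B = B -> 0 < (adj v *m B *m v) 0 0 ->
  (forall w : 'cV[C]_d, xi *m w = 0 -> w <> 0 -> (adj w *m B *m w) 0 0 < 0) ->
  (forall w : 'cV[C]_d, xi *m w = 0 -> adj v *m B *m w = 0) ->
  exists (F : 'M[C]_(1 + r, d)) (Fi : 'M[C]_(d, 1 + r)),
    [/\ F *m Fi = 1%:M, Fi *m F = 1%:M & adj F *m su_form R 1 r *m F = B].
Proof.
move=> dr; subst d; rewrite -[r.+1]/(1 + r)%N in B v xi * => xv hB vp wn vw.
have [W [H [xW GH HG]]] := rank1_complement xv.
have WE (u : 'cV[C]_r) : xi *m (W *m u) = 0 by rewrite mulmxA xW mul0mx.
have vW : adj v *m B *m W = 0.
  apply/matrixP => i j; have := vw (W *m delta_mx j 0) (WE _).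
  by rewrite mulmxA -colE => /matrixP/(_ i 0); rewrite !mxE.
pose A := - (adj W *m B *m W).
have [|u u0|T [uT AT]] := @posdef_factor R r A.
- by rewrite /A /adj /mx_conj map_mxN linearN /= -!/(adj _) !adjM hB adjK mulmxA.
- have /(wn _ (WE u)) : W *m u <> 0.
    move=> Wu0; apply: u0.
    have : H *m (row_mx v W *m col_mx 0 u) = 0 by rewrite mul_row_col mulmx0 add0r Wu0 mulmx0.
    by rewrite mulmxA HG mul1mx => /(congr1 dsubmx); rewrite col_mxKd linear0.
  have -> : adj u *m A *m u = - (adj (W *m u) *m B *m (W *m u)).
    by rewrite adjM /A mulmxN mulNmx !mulmxA.
  by rewrite [X in _ -> _ < X]mxE oppr_gt0.
pose b := (adj v *m B *m v) 0 0.
pose D : 'M[C]_(1 + r) := block_mx (sqrtC b)%:M 0 0 T.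
have b0 : b != 0 by rewrite gt_eqF.
have uD : D \in unitmx.
  by rewrite unitmxE det_ublock unitrM -!unitmxE uT andbT unitmxE det_scalar1 unitfE sqrtC_eq0.
have GBG : adj (row_mx v W) *m B *m row_mx v W = adj D *m su_form R 1 r *m D.
  have -> : adj (row_mx v W) = col_mx (adj v) (adj W).
    by rewrite /adj /mx_conj map_row_mx tr_row_mx.
  have -> : adj D = block_mx (sqrtC b)%:M 0 0 (adj T).
    rewrite /adj /mx_conj map_block_mx tr_block_mx !map_mx0 !trmx0 map_scalar_mx tr_scalar_mx /=.
    by congr (block_mx _%:M 0 0 _); apply/CrealP; rewrite ger0_real // sqrtC_ge0 ltW.
  rewrite mul_col_mx mul_col_row /su_form !mulmx_block !(mulmx0, mul0mx, mulmx1, addr0, add0r).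
  rewrite mulmxN mulNmx mulmx1 -AT opprK; congr block_mx.
  - by rewrite -scalar_mxM -expr2 sqrtCK [LHS]mx11_scalar.
  - exact: vW.
  - have -> : adj W *m B *m v = adj (adj v *m B *m W) by rewrite !adjM hB adjK mulmxA.
    by rewrite vW /adj /mx_conj map_mx0 trmx0.
exists (D *m H), (row_mx v W *m invmx D); split.
- by rewrite -mulmxA (mulmxA H) HG mul1mx mulmxV.
- by rewrite -mulmxA (mulmxA (invmx D)) mulVmx // mul1mx.
- rewrite adjM -!mulmxA [su_form R 1 r *m _]mulmxA (mulmxA (adj D)) (mulmxA (adj D)) -GBG.
  rewrite -!mulmxA GH mulmx1 mulmxA -adjM GH adj1 mul1mx //.
Qed.
End Signature.

(** * The real form su(1, r) *)

Section SpecialUnitary.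
Variables (R : realType) (D : hodge_datum R).
Local Notation C := R[i].
Local Open Scope complex_scope.
Hypothesis hD : simple_level_one D.
Variables (r k : nat).
Hypothesis htup : has_sl_tuple D r k.

Let L := complexify (hd_g D).
Let ss := hd_ss D.
Let U := @hd_U R D.
Let E := hd_E D.
Let d := hd_d D.
Let htau := tuple_complex htup.
Let rk1 := complex_line_of_tuple hD htau htup.

Lemma ss_complexify : ss = complexify (derived (hd_g D)).
Proof. exact: derived_complexify. Qed.

(** The inclusion of the summand [U] in [V_C]. *)
Lemma embedding : exists (J : 'M[C]_(hd_m D, d)) (J' : 'M[C]_(d, hd_m D)),
  J' *m J = 1%:M /\ forall X, X \in L -> X *m J = J *m U X.
Proof.
move: (hd_U_type D); rewrite htau => -[[P [P' [P1 P2 hP]]] _].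
exists (P' *m col_mx 1%:M 0), (row_mx 1%:M 0 *m P); split.
  by rewrite -mulmxA (mulmxA P) P1 mul1mx mul_row_col mulmx1 mulmx0 addr0.
move=> X hX; have := hP X hX; rewrite complexify_rep_id /sum_rep => e.
have eX : X = P' *m block_mx (U X) 0 0 (dual_rep U X) *m P.
  by rewrite -mulmxA -e mulmxA P2 mul1mx.
rewrite {1}eX -!mulmxA (mulmxA P) P1 mul1mx; congr (_ *m _).
rewrite mul_block_col mul_col_mx !mulmx1 !mulmx0 !mul0mx mul1mx.
by congr col_mx; rewrite ?addr0.
Qed.

(** The form is [-i Q(conj(u), w)] on [U]. The polarization makes it positive
    on the 3/2-eigenspace, where [phi(i)] acts as [i^3 = -i], and negative on
    the 1/2-eigenspace, where it acts as [i]. *)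
Lemma hermitian_model : exists (F : 'M[C]_(1 + r, d)) (Fi : 'M[C]_(d, 1 + r)),
  [/\ F *m Fi = 1%:M, Fi *m F = 1%:M &
    forall X, X \in hd_g D -> let B := adj F *m su_form R 1 r *m F in
      adj (U (mxC X)) *m B + B *m U (mxC X) = 0].
Proof.
have [J [J' [JJ hJ]]] := embedding.
have [n [Q [G [phi [hG hg hE]]]]] := datum_group D.
have [v [xi [UE1 xv]]] := complex_top_projection hD htau rk1.
rewrite -/U -/E in UE1.
pose B := - ('i%C : C) *: (adj J *m mxC Q *m J).
have phiJ (u : 'cV[C]_d) (q : int) : U E *m u = (q%:~R / 2%:R) *: u ->
    mxC (phi 'i%C) *m (J *m u) = ('i%C : C) ^ q *: (J *m u).
  move=> hu; apply: (grading_power hE hG); last exact: norm_i.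
  by rewrite mulmxA hJ ?datum_E_L // -mulmxA hu -scalemxAr.
have two : 2%:R != 0 :> C by rewrite pnatr_eq0.
have Uv : U E *m v = (3%:R / 2%:R) *: v.
  rewrite UE1 mulmxDl mul_scalar_mx -mulmxA xv mulmx1 -[X in _ + X]scale1r -scalerDl.
  by congr (_ *: _); field.
have Uw (w : 'cV[C]_d) : xi *m w = 0 -> U E *m w = (1%:~R / 2%:R) *: w.
  by move=> hw; rewrite UE1 mulmxDl mul_scalar_mx -mulmxA hw mulmx0 addr0.
have i3 : ('i%C : C) ^ 3%:Z = - 'i%C by rewrite -[LHS]/('i%C ^+ 3) exprSr sqr_i mulN1r.
have Jv : mxC (phi 'i%C) *m (J *m v) = - ('i%C : C) *: (J *m v).
  by rewrite -i3; apply: phiJ.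
have Jw (w : 'cV[C]_d) : xi *m w = 0 -> mxC (phi 'i%C) *m (J *m w) = ('i%C : C) *: (J *m w).
  by move=> /Uw /phiJ; rewrite expr1z.
have v0 : v <> 0.
  move=> v0; move: xv; rewrite v0 mulmx0 => /matrixP/(_ 0 0)/eqP.
  by rewrite !mxE eq_sym oner_eq0.
have J0 (u : 'cV[C]_d) : u <> 0 -> J *m u <> 0.
  by move=> u0 h; apply: u0; rewrite -[u]mul1mx -JJ -mulmxA h mulmx0.
have s1 : (-1) ^ n = -1 :> R.
  have h : mxC (phi (-1)) *m (J *m v) = (-1) ^ 3%:Z *: (J *m v).
    apply: (grading_power hE hG); last by rewrite normrN1.
    by rewrite mulmxA hJ ?datum_E_L // -mulmxA Uv -scalemxAr.
  move: h; rewrite (ghr_weight hG) mxC_scalar mul_scalar_mx => /eqP.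
  rewrite -subr_eq0 -scalerBl scaler_eq0 => /orP[|/eqP/(J0 _ v0)//].
  rewrite subr_eq0 => /eqP h; have := congr1 (@complex.Re R) h.
  by rewrite -[(-1) ^ 3%:Z]/((-1) ^+ 3) exprSr sqrrN expr1n mul1r /=.
have QT : (mxC Q)^T = - mxC Q.
  by rewrite -mxC_tr {2}(ghr_parity hG) s1 scaleN1r mxCN opprK.
have ci : Num.conj (- 'i%C : C) = 'i%C.
  by apply/eqP; rewrite conjE eq_complex /= !oppr0 opprK !eqxx.
have adjQ : adj (mxC Q) = - mxC Q by rewrite adj_mxC.
have hB : adj B = B.
  rewrite /B adjZ !adjM adjK adjQ mulNmx mulmxN mulmxA ci.
  by rewrite scalerN scaleNr.
have formB (u w : 'cV[C]_d) : adj u *m B *m w = - ('i%C : C) *: (adj (J *m u) *m mxC Q *m (J *m w)).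
  by rewrite /B -scalemxAr -scalemxAl adjM !mulmxA.
have pos (u : 'cV[C]_d) : u <> 0 ->
    0 < (adj (J *m u) *m mxC Q *m (mxC (phi 'i%C) *m (J *m u))) 0 0.
  move=> /J0 u0; have h0 : mx_conj (J *m u) <> 0.
    by move=> h; apply: u0; rewrite -[LHS]mx_conjK h /mx_conj map_mx0.
  by have := ghr_positivity hG h0; rewrite mx_conjK.
have [|w hw w0|w hw|F [Fi [FF FiF FB]]] := signature_basis (complex_d hD htau htup) xv hB.
- by have := pos v v0; rewrite Jv -scalemxAr formB.
- by have := pos w w0; rewrite Jw // -scalemxAr formB scaleNr [X in _ -> X < _]mxE oppr_lt0.
- rewrite formB.
  have hphi : (mxC (phi 'i%C))^T *m mxC Q *m mxC (phi 'i%C) = mxC Q.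
    by rewrite -mxC_tr -!mxCM (ghr_isometry hG (phi_i_in_group hG)).
  have e : adj (J *m v) *m mxC Q *m (J *m w) = - (adj (J *m v) *m mxC Q *m (J *m w)).
    rewrite -{1}hphi -[(mxC (phi 'i%C))^T]/(mxC (phi 'i%C))^T.
    have -> : adj (J *m v) *m ((mxC (phi 'i%C))^T *m mxC Q *m mxC (phi 'i%C)) *m (J *m w)
      = adj (mxC (phi 'i%C) *m (J *m v)) *m mxC Q *m (mxC (phi 'i%C) *m (J *m w)).
      by rewrite [adj (mxC _ *m _)]adjM adj_mxC !mulmxA.
    rewrite Jv Jw // adjZ ci -!scalemxAl -scalemxAr scalerA.
    by rewrite -expr2 sqr_i scaleN1r.
  have : 2%:R *: (adj (J *m v) *m mxC Q *m (J *m w)) = 0.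
    by rewrite scaler_nat mulr2n {1}e addNr.
  by move/eqP; rewrite scaler_eq0 (negPf two) => /eqP ->; rewrite scaler0.
exists F, Fi; split=> // X hX; rewrite /= FB /B -scalemxAr -scalemxAl -scalerDr.
have XL := mxC_complexify hX.
rewrite !mulmxA -adjM -hJ // -[adj J *m _ *m J *m _]mulmxA -hJ //.
rewrite adjM adj_mxC -mxC_tr -!mulmxA -mulmxDr !mulmxA -mulmxDl -!mxCM -mxCD.
by rewrite (lie_skew hG hg hX) mxC0 mul0mx mulmx0 scaler0.
Qed.

Lemma su_form_sq p q : su_form R p q *m su_form R p q = 1%:M.
Proof.
rewrite /su_form mulmx_block !(mulmx0, mul0mx, mulmx1, addr0, add0r) mulmxN mulmx1 opprK.
by rewrite scalar_mx_block.
Qed.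

Lemma model_in_su p q (F : 'M[C]_(p + q, d)) (Fi : 'M[C]_(d, p + q)) X :
  F *m Fi = 1%:M -> Fi *m F = 1%:M ->
  (forall X, X \in hd_g D -> let B := adj F *m su_form R p q *m F in
    adj (U (mxC X)) *m B + B *m U (mxC X) = 0) ->
  X \in derived (hd_g D) -> in_su (F *m U (mxC X) *m Fi).
Proof.
move=> FF FiF /= hskew hX.
have /subvP dg := derived_sub (@datum_closed R D).
have aFF : adj Fi *m adj F = 1%:M by rewrite -adjM FF adj1.
split; last first.
  rewrite mxtrace_mulC mulmxA FiF mul1mx.
  apply: (U_trace (@datum_clL R D) (hd_U_rep D)).
  by rewrite -/(hd_ss D) -/ss ss_complexify mxC_complexify.
rewrite -/(adj _) !adjM.
have := congr1 (fun M => adj Fi *m M *m Fi) (hskew X (dg _ hX)).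
rewrite /= mulmx0 mul0mx mulmxDr mulmxDl => e; rewrite -[RHS]e; congr (_ + _).
  by rewrite !mulmxA -!(mulmxA _ F Fi) FF mulmx1.
by rewrite !mulmxA aFF mul1mx.
Qed.

(** Onto: an element [W] of the complexification whose image is skew for the
    form is [X + i Y] with [X] and [Y] in the real algebra; then [i Y] has a
    skew image, so [Y] is both skew and self-adjoint, hence 0. *)
Lemma iso_su_model p q (F : 'M[C]_(p + q, d)) (Fi : 'M[C]_(d, p + q)) :
  F *m Fi = 1%:M -> Fi *m F = 1%:M ->
  (forall X, X \in hd_g D -> let B := adj F *m su_form R p q *m F in
    adj (U (mxC X)) *m B + B *m U (mxC X) = 0) ->
  iso_su (derived (hd_g D)) p q.
Proof.
move=> FF FiF /= hskew; set I := su_form R p q in hskew *.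
have /subvP dg := derived_sub (@datum_closed R D).
have dL X : X \in derived (hd_g D) -> mxC X \in L by move=> hX; apply: mxC_complexify; apply: dg.
have dS X : X \in derived (hd_g D) -> mxC X \in ss.
  by move=> hX; rewrite ss_complexify mxC_complexify.
have aFF : adj Fi *m adj F = 1%:M by rewrite -adjM FF adj1.
have aFiF : adj F *m adj Fi = 1%:M by rewrite -adjM FiF adj1.
have rU := hd_U_rep D.
exists (fun X => F *m U (mxC X) *m Fi); split.
- move=> a X Y hX hY; rewrite mxCD mxCZ /U rU.1 ?dL //.
  by rewrite mulmxDr mulmxDl -scalemxAr -scalemxAl.
- move=> X Y hX hY; rewrite mxC_lie /U rU.2 ?dL // /lie mulmxBr mulmxBl.
  move: (@hd_U R D (mxC X)) (@hd_U R D (mxC Y)) => u w.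
  by rewrite !mulmxA -!(mulmxA _ Fi F) FiF !mulmx1.
- move=> X hX h0; have U0 : U (mxC X) = 0.
    rewrite -[LHS]mul1mx -FiF -[LHS]mulmx1 -FiF !mulmxA -(mulmxA Fi) -(mulmxA Fi).
    by rewrite h0 mulmx0 mul0mx.
  have := complex_inj hD (dS _ hX) U0; rewrite -(mxC0 R); exact: mxC_inj.
move=> Z; split=> [[hZ tZ]|[X hX <-]]; last exact: model_in_su.
have tA : \tr (Fi *m Z *m F) = 0 by rewrite mxtrace_mulC mulmxA FF mul1mx.
have [W [hW UW]] := complex_U_sl hD htau rk1 tA.
rewrite -/U in UW.
move: hW; rewrite -/ss ss_complexify => /complexifyP [hX hY].
set X := mxRe W in hX; set Y := mxIm W in hY.
have UWE : U W = U (mxC X) + ('i%C : C) *: U (mxC Y).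
  rewrite [in LHS](mxC_decomp W) /U (repD rU) ?memvZ ?dL //.
  by rewrite (repZ rU) ?dL.
set B := adj F *m I *m F in hskew.
have hZB : adj (U W) *m B + B *m U W = 0.
  have := congr1 (fun M => adj F *m M *m F) hZ; rewrite -/(adj _) -/I /= mulmx0 mul0mx mulmxDr mulmxDl => e.
  rewrite -[RHS]e UW !adjM /B; congr (_ + _).
    by rewrite !mulmxA -!(mulmxA _ (adj Fi) (adj F)) aFF mulmx1.
  by rewrite !mulmxA -!(mulmxA _ F Fi) FF mulmx1.
have ci : Num.conj ('i%C : C) = - 'i%C.
  by apply/eqP; rewrite conjE eq_complex /= oppr0 !eqxx.
have BY : B *m U (mxC Y) = 0.
  have hx := hskew X (dg _ hX); have /eqP := hskew Y (dg _ hY); rewrite addr_eq0 => /eqP hy.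
  have two : (2%:R * 'i%C : C) != 0.
    by rewrite mulf_neq0 ?pnatr_eq0 // -normr_eq0 norm_i oner_eq0.
  apply/eqP; rewrite -(inj_eq (scalerI two)) scaler0; apply/eqP.
  rewrite -[RHS]hZB UWE.
  have -> : adj (U (mxC X) + ('i%C : C) *: U (mxC Y)) = adj (U (mxC X)) - ('i%C : C) *: adj (U (mxC Y)).
    by rewrite /adj mx_conjD linearD /= -!/(adj _) adjZ ci scaleNr.
  rewrite mulmxDl mulmxDr addrACA hx add0r mulNmx -scalemxAl hy scalerN opprK -scalemxAr.
  by rewrite -scalerA scaler_nat mulr2n.
have UY : U (mxC Y) = 0.
  have := congr1 (fun M => Fi *m I *m adj Fi *m M) BY; rewrite mulmx0 /B !mulmxA.
  rewrite -(mulmxA _ (adj Fi) (adj F)) aFF mulmx1 -(mulmxA _ I I) su_form_sq mulmx1.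
  by rewrite FiF mul1mx.
exists X => //; move: UWE; rewrite UY scaler0 addr0 UW => <-.
by rewrite !mulmxA FF mul1mx -mulmxA FF mulmx1.
Qed.

Lemma iso_su_1r : iso_su (derived (hd_g D)) 1 r.
Proof. by have [F [Fi [h1 h2 h3]]] := hermitian_model; exact: iso_su_model h1 h2 h3. Qed.

(** Exchange the blocks, and change the sign of the form. *)
Lemma iso_su_r1 : iso_su (derived (hd_g D)) r 1.
Proof.
have [F [Fi [h1 h2 h3]]] := hermitian_model.
pose T : 'M[C]_(r + 1, 1 + r) := block_mx 0 1%:M 1%:M 0.
pose T' : 'M[C]_(1 + r, r + 1) := block_mx 0 1%:M 1%:M 0.
have TT : T *m T' = 1%:M.
  rewrite mulmx_block !(mulmx0, mul0mx, mulmx1, addr0, add0r) scalar_mx_block //.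
have TT' : T' *m T = 1%:M.
  rewrite mulmx_block !(mulmx0, mul0mx, mulmx1, addr0, add0r) scalar_mx_block //.
have Tsu : adj T *m su_form R r 1 *m T = - su_form R 1 r.
  have -> : adj T = T'.
    by rewrite /adj /mx_conj map_block_mx tr_block_mx !map_mx0 !trmx0 !map_mx1 !trmx1.
  rewrite /T /T' /su_form !mulmx_block !(mulmx0, mul0mx, mulmx1, mul1mx, addr0, add0r).
  by rewrite opp_block_mx !oppr0 opprK.
apply: (@iso_su_model r 1 (T *m F) (Fi *m T')).
- by rewrite -mulmxA (mulmxA F) h1 mul1mx.
- by rewrite -mulmxA (mulmxA T') TT' mul1mx.
move=> X hX /=; have -> : adj (T *m F) *m su_form R r 1 *m (T *m F) = - (adj F *m su_form R 1 r *m F).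
  by rewrite -mulNmx -mulmxN -Tsu adjM !mulmxA.
by rewrite mulmxN mulNmx -opprD h3 ?oppr0.
Qed.

End SpecialUnitary.

(** * The type over the semisimple part for r > 1 *)

Section Types.
Variables (R : realType) (D : hodge_datum R).
Local Notation C := R[i].
Local Open Scope complex_scope.
Hypothesis hD : simple_level_one D.
Variables (r k : nat).
Hypothesis htup : has_sl_tuple D r k.

Let L := complexify (hd_g D).
Let ss := hd_ss D.
Let U := @hd_U R D.
Let E := hd_E D.
Let d := hd_d D.
Let htau := tuple_complex htup.
Let rk1 := complex_line_of_tuple hD htau htup.
Let c : C := (r + 3)%:R / (2 * (r + 1))%:R.

Lemma tuple_c : ratr (hd_c D) = c.
Proof. by case: htup => _ _ _ ->; rewrite fmorph_div /= !ratr_nat. Qed.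

Lemma ss_L X : X \in ss -> X \in L.
Proof. exact: (ss_sub (@datum_clL R D)). Qed.

Lemma Ess_ss : vsval (hd_Ess D) \in ss.
Proof. exact: hmem_ss. Qed.

Lemma U_irreducible_ss : irreducible_rep ss U.
Proof.
apply: sl_irreducible; first by case: (hd_U_irreducible D).
exact: complex_U_sl.
Qed.

Lemma U_Ess_two_step : exists (v : 'cV[C]_d) (xi : 'rV[C]_d),
  [/\ U (vsval (hd_Ess D)) = (1 / 2%:R - c)%:M + v *m xi, xi *m v = 1%:M & v <> 0].
Proof.
have [v [xi [UE1 xv]]] := complex_top_projection hD htau rk1; exists v, xi; split=> //.
  have := datum_UE D; rewrite UE1 tuple_c => e.
  by rewrite -[LHS](addrK c%:M) -e addrAC raddfB.
move=> v0; move: xv; rewrite v0 mulmx0 => /matrixP/(_ 0 0)/eqP.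
by rewrite !mxE eq_sym oner_eq0.
Qed.

Lemma rank1_components n (M : 'M[C]_n) (s : C) (v : 'cV[C]_n) (xi : 'rV[C]_n) (u : 'cV[C]_n) :
  M = s%:M + v *m xi -> xi *m v = 1%:M ->
  exists u1 u2 : 'cV[C]_n, [/\ u = u1 + u2, M *m u1 = (s + 1) *: u1 & M *m u2 = s *: u2].
Proof.
move=> e xv; exists (v *m (xi *m u)), (u - v *m (xi *m u)); rewrite e.
split; first by rewrite addrC subrK.
  rewrite mulmxDl mul_scalar_mx -mulmxA (mulmxA xi) xv mul1mx.
  by rewrite scalerDl scale1r.
rewrite mulmxDl mul_scalar_mx -[v *m xi *m _]mulmxA mulmxBr (mulmxA xi v) xv mul1mx subrr mulmx0 addr0 //.
Qed.

Lemma rank1_nul n (M : 'M[C]_n) (s x : C) (v : 'cV[C]_n) (xi : 'rV[C]_n) :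
  M = s%:M + v *m xi -> xi *m v = 1%:M -> x != s + 1 -> x != s -> nul M x = 0%N.
Proof.
move=> e xv h1 h2; apply: (nul_eq0 (P := fun x => x = s + 1 \/ x = s)) => [u|].
  have [u1 [u2 [-> e1 e2]]] := rank1_components u e xv.
  apply: aspan_add; apply: aspan1; first by exists (s + 1); split=> //; left.
  by exists s; split=> //; right.
by case=> /eqP; apply/negP.
Qed.

Let s : C := - (r.+1%:R)^-1.

Lemma Ess_scalar : 1 / 2%:R - c = s.
Proof.
have r1 : r%:R + 1 != 0 :> C by rewrite natr1 pnatr_eq0.
rewrite /s /c natrM !natrD -natr1; field.
by rewrite addrC.
Qed.

Lemma s_mul : s * r.+1%:R = -1.
Proof. by rewrite /s mulNr mulVf ?pnatr_eq0. Qed.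

Lemma s_neq (a b : C) n : (a - b) * r.+1%:R = n.+1%:R -> a != b.
Proof.
move=> h; rewrite -subr_eq0; apply: contra_eq_neq h => /= ->.
by rewrite mul0r eq_sym pnatr_eq0.
Qed.

(** The eigenvalues of [E_ss] on [U] are [s + 1] and [s] with [s = -1/(r+1)];
    for [r = 1] they are symmetric. *)
Lemma s_uniq : (1 < r)%N -> uniq [:: s + 1; s; - (s + 1); - s].
Proof.
move=> r1; have rE : r = (r - 2).+2 by lia.
have m := s_mul.
rewrite /= !inE !negb_or !andbT -!andbA; apply/and5P; split.
- by apply: (s_neq (n := r)); rewrite addrC addKr mul1r.
- apply: (s_neq (n := (r - 2).*2.+1.+2)); rewrite opprK !mulrDl m mul1r.
  by rewrite -!natr1 [in LHS]rE -muln2 natrM -!natr1; ring.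
- apply: (s_neq (n := (r - 2))); rewrite opprK !mulrDl m mul1r.
  by rewrite [in LHS]rE -!natr1; ring.
- apply: (s_neq (n := (r - 2))); rewrite opprK !mulrDl m mul1r.
  by rewrite [in LHS]rE -!natr1; ring.
apply/andP; split.
- rewrite eq_sym; apply: (s_neq (n := 1)); rewrite mulrBl mulNr m -natr1; ring.
- rewrite eq_sym; by apply: (s_neq (n := r)); rewrite [- - (s + 1)]opprK addKr mul1r.
Qed.

(** A subspace [W] stable under the derived algebra has a complexification
    stable under [E_ss], so it contains the components of its elements in the
    four eigenspaces of [E_ss]. On each of them the centre acts by a scalar,
    since it lies in [U] or in its dual; so [W] is stable under [g_R]. *)
Lemma derived_irreducible : (1 < r)%N -> irreducible_rep (derived (hd_g D)) id.
Proof.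
move=> r1; split; first by case: (hd_irreducible D).
move=> W hW; apply: (hd_irreducible D).2 => X w hX hw.
have [n [Q [G [phi [hG hg _]]]]] := datum_group D.
have [A [Z [hA hZ ->]]] := reductive_decomp hG hg hX.
rewrite mulmxDl memvD //; first exact: hW.
pose P (y : 'cV[C]_(hd_m D)) := mxRe y \in W /\ mxIm y \in W.
have Plin : lin_pred P.
  split; first by rewrite /P -(mxC0 R) mxRe_mxC mxIm_mxC mem0v.
  move=> a y y' [p1 p2] [q1 q2]; rewrite /P mxReD mxImD mxReZ mxImZ.
  by split; rewrite memvD ?memvB ?memvD ?memvZ.
have Pss T y : T \in ss -> P y -> P (T *m y).
  rewrite /ss (ss_complexify D) => /complexifyP[t1 t2] [p1 p2].
  have hr B : B \in derived (hd_g D) -> P (mxC B *m y).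
    by move=> hB; rewrite /P mxRe_mulC mxIm_mulC; split; apply: hW.
  rewrite [T]mxC_decomp mulmxDl -scalemxAl.
  by apply: (lin_predD Plin); [|apply: (lin_predZ _ Plin)]; apply: hr.
suff : P (mxC Z *m mxC w) by case; rewrite mxRe_mulC mxRe_mxC.
have Pw : P (mxC w) by rewrite /P mxRe_mxC mxIm_mxC mem0v.
have hZL := center_complexify hZ.
have ZL : mxC Z \in L by have /centerP[] := hZL.
have [a Ua] := center_scalar (hd_U_rep D) (hd_U_irreducible D) hZL.
rewrite -/U in Ua.
have [v [xi [e xv v0]]] := U_Ess_two_step; rewrite Ess_scalar in e.
have e' : (U (vsval (hd_Ess D)))^T = s%:M + xi^T *m v^T.
  by rewrite e linearD /= tr_scalar_mx trmx_mul.
have xv' : v^T *m xi^T = 1%:M by rewrite -trmx_mul xv trmx1.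
move: (hd_U_type D); rewrite htau => -[[P0 [P1 [hP1 hP2 hP]]] _].
set y := mxC w in Pw *; set T := vsval (hd_Ess D) in e e'.
have TL : T \in L by apply/ss_L/Ess_ss.
have PZ B : B \in L -> forall z, B *m (P1 *m z) = P1 *m (sum_rep U (dual_rep U) B *m z).
  move=> hB z; have := hP B hB; rewrite complexify_rep_id => h.
  by rewrite -[LHS]mul1mx -hP2 -!mulmxA (mulmxA P0) h -mulmxA (mulmxA P0) hP1 mul1mx.
have [u1 [u2 [uE h1 h2]]] := rank1_components (usubmx (P0 *m y)) e xv.
have [u3 [u4 [uE' h3 h4]]] := rank1_components (dsubmx (P0 *m y)) e' xv'.
pose x i : 'cV[C]_(hd_m D) := nth 0 [:: P1 *m col_mx u1 0; P1 *m col_mx u2 0; P1 *m col_mx 0 u3; P1 *m col_mx 0 u4] i.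
pose lam i := nth 0 [:: s + 1; s; - (s + 1); - s] i.
have yE : y = \sum_(i <- iota 0 4) x i.
  rewrite /= !big_cons big_nil addr0 /x /= -!mulmxDr !add_col_mx !addr0 !add0r -uE -uE'.
  by rewrite vsubmxK mulmxA hP2 mul1mx.
have sumE B (w1 w2 : 'cV[C]_d) : sum_rep U (dual_rep U) B *m col_mx w1 w2 =
    col_mx (U B *m w1) (- ((U B)^T *m w2)).
  by rewrite /sum_rep mul_block_col !mul0mx addr0 add0r /dual_rep mulNmx.
have xT i : i \in iota 0 4 -> T *m x i = lam i *: x i.
  rewrite mem_iota /x /lam => i4; rewrite -[_ *m _]/(T *m nth 0 _ i).
  case: i i4 => [|[|[|[|//]]]] _ /=; rewrite PZ // sumE ?mulmx0 ?oppr0 ?h1 ?h2 ?h3 ?h4;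
  by rewrite scalemxAr scale_col_mx ?scaler0 ?scaleNr.
have xP : forall i, i \in iota 0 4 -> P (x i).
  apply: (eigen_components (f := mulmx T) (lam := lam) Plin _ _ xT).
  - by move=> z; apply: Pss; apply: Ess_ss.
  - exact: s_uniq.
  - by rewrite -yE.
have xZ i : i \in iota 0 4 -> exists b, mxC Z *m x i = b *: x i.
  rewrite mem_iota /x => i4.
  by case: i i4 => [|[|[|[|//]]]] _ /=; [exists a|exists a|exists (- a)|exists (- a)];
    rewrite PZ // sumE Ua ?tr_scalar_mx !mul_scalar_mx ?scaler0 ?oppr0
      scalemxAr scale_col_mx ?scaler0 ?scaleNr.
rewrite yE mulmx_sumr big_seq; apply: lin_pred_sum => // i hi.
have [b ->] := xZ i hi; apply: lin_predZ => //; exact: xP.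
Qed.

Lemma complex_type : has_type (hd_g D) id U ComplexType.
Proof. by rewrite -htau; apply: hd_U_type. Qed.

(** [s + 1] is an eigenvalue of [E_ss] on [U] and not on its dual. *)
Lemma not_self_dual_ss : (1 < r)%N -> ~ rep_iso ss U (dual_rep U).
Proof.
move=> r1 [P [P' [P1 P2 hP]]].
have [v [xi [e xv v0]]] := U_Ess_two_step; rewrite Ess_scalar in e.
have h := nul_conj (s + 1) P1 P2 (hP _ Ess_ss).
have h1 : (0 < nul (U (vsval (hd_Ess D))) (s + 1))%N.
  apply: (nul_gt0 v0); rewrite e mulmxDl mul_scalar_mx -mulmxA xv mulmx1.
  by rewrite scalerDl scale1r.
have := s_uniq r1; rewrite /= !inE !negb_or => /and4P[/and3P[_ h2 _] /andP[h3 _] _ _].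
have z : nul (U (vsval (hd_Ess D))) (- (s + 1)) = 0%N.
  by apply: (rank1_nul e xv); rewrite eq_sym.
by move: h1; rewrite h /dual_rep nul_dual z.
Qed.

Lemma ss_type_complex : (1 < r)%N -> has_type_wrt (derived (hd_g D)) U ComplexType.
Proof.
move=> r1; exists (hd_m D), id; split.
- by split.
- exact: derived_irreducible.
have [[P [P' [P1 P2 hP]]] _] := complex_type.
rewrite /has_type -(ss_complexify D); split; last exact: not_self_dual_ss.
by exists P, P'; split=> // X hX; apply: hP; apply: ss_L.
Qed.

End Types.

(** * The type over the semisimple part for r = 1 *)

Section RealType.
Variables (R : realType) (D : hodge_datum R).
Local Notation C := R[i].
Local Open Scope complex_scope.
Hypothesis hD : simple_level_one D.
Variable k : nat.
Hypothesis htup : has_sl_tuple D 1 k.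

Let L := complexify (hd_g D).
Let ss := hd_ss D.
Let U := @hd_U R D.
Let d := hd_d D.

Lemma ord2_cases (P : 'I_2 -> Prop) : P 0 -> P 1 -> forall i, P i.
Proof.
move=> p0 p1 [[|[|//]] hi].
  by rewrite (_ : Ordinal hi = 0) //; apply: val_inj.
by rewrite (_ : Ordinal hi = 1) //; apply: val_inj.
Qed.

(** Conjugation by this matrix turns [su(1,1)] into [sl(2, R)]: complex
    conjugation of [cayley] exchanges the two coordinates, as it does for the
    elements of [su(1,1)]. *)
Definition cayley : 'M[C]_2 := \matrix_(i, j)
  if j == 0 then 1 else if i == 0 then 'i%C else - 'i%C.

Definition swap2 : 'M[C]_2 := \matrix_(i, j) (i != j)%:R.

Definition cayley_inv : 'M[C]_2 := \matrix_(i, j)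
  (if i == 0 then 1 / 2%:R else if j == 0 then - 'i%C / 2%:R else 'i%C / 2%:R).

Lemma mx2P (A B : 'M[C]_2) : A 0 0 = B 0 0 -> A 0 1 = B 0 1 -> A 1 0 = B 1 0 ->
  A 1 1 = B 1 1 -> A = B.
Proof. by move=> h1 h2 h3 h4; apply/matrixP; elim/ord2_cases; elim/ord2_cases. Qed.

Lemma mul2E m n (A : 'M[C]_(m, 2)) (B : 'M[C]_(2, n)) i j :
  (A *m B) i j = A i 0 * B 0 j + A i 1 * B 1 j.
Proof. by rewrite mxE !big_ord_recl big_ord0 addr0; congr (_ + A i _ * B _ j); apply: val_inj. Qed.

Let two : 2%:R != 0 :> C. Proof. by rewrite pnatr_eq0. Qed.
Let ii : 'i%C * 'i%C = -1 :> C. Proof. by rewrite -expr2 sqr_i. Qed.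
Let ci : Num.conj ('i%C : C) = - 'i%C.
Proof. by apply/eqP; rewrite conjE eq_complex /= oppr0 !eqxx. Qed.
Let cni : Num.conj (- 'i%C : C) = 'i%C.
Proof. by apply/eqP; rewrite conjE eq_complex /= !oppr0 opprK !eqxx. Qed.
Let c2 : Num.conj (2%:R : C) = 2%:R. Proof. exact: conjC_nat. Qed.

Lemma cayleyK : cayley_inv *m cayley = 1%:M.
Proof.
apply: mx2P; rewrite mul2E !mxE /=.
- by rewrite !mulr1 mulr1n; field.
- by rewrite mulr0n mulrN subrr.
- by rewrite mulr0n !mulr1 mulNr addNr.
- by rewrite mulr1n mulrN !mulNr mulrAC ii -opprD mulNr -opprD opprK; field.
Qed.

Lemma cayley_conj : mx_conj cayley = swap2 *m cayley.
Proof.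
by apply: mx2P; rewrite mul2E !mxE /= ?conjC1 ?ci ?cni ?mul0r ?mul1r ?add0r ?addr0.
Qed.

Lemma cayley_inv_conj : mx_conj cayley_inv = cayley_inv *m swap2.
Proof.
have h1 : Num.conj (1 / 2%:R : C) = 1 / 2%:R by rewrite rmorphM /= fmorphV /= c2 rmorph1.
have h2 : Num.conj ('i%C / 2%:R : C) = - 'i%C / 2%:R by rewrite rmorphM /= fmorphV /= c2 ci.
have h3 : Num.conj (- 'i%C / 2%:R : C) = 'i%C / 2%:R by rewrite rmorphM /= fmorphV /= c2 cni.
apply: mx2P; rewrite mul2E !mxE /= ?h1 ?h2 ?h3 ?mulr0n ?mulr1n.
- by rewrite mulr0 mulr1 add0r.
- by rewrite mulr0 mulr1 addr0.
- by rewrite mulr0 mulr1 add0r.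
- by rewrite mulr0 mulr1 addr0.
Qed.

Lemma su11_conj (Z : 'M[C]_2) : @in_su R 1 1 Z -> mx_conj Z = swap2 *m Z *m swap2.
Proof.
case=> hZ tZ.
have t : Z 1 1 = - Z 0 0.
  apply/eqP; rewrite -addr_eq0 addrC; apply/eqP; rewrite -[RHS]tZ.
  by rewrite /mxtrace !big_ord_recl big_ord0 addr0; congr (_ + Z _ _); apply: val_inj.
have E0 : (0 : 'I_(1 + 1)) = lshift 1 (0 : 'I_1) by apply: val_inj.
have E1 : (1 : 'I_(1 + 1)) = rshift 1 (0 : 'I_1) by apply: val_inj.
have e00 : su_form R 1 1 0 0 = 1 by rewrite E0 block_mxEul mxE.
have e01 : su_form R 1 1 0 1 = 0 by rewrite E0 E1 block_mxEur mxE.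
have e10 : su_form R 1 1 1 0 = 0 by rewrite E0 E1 block_mxEdl mxE.
have e11 : su_form R 1 1 1 1 = -1 by rewrite E1 block_mxEdr !mxE.
have en i j : ((mx_conj Z)^T *m su_form R 1 1) i j + (su_form R 1 1 *m Z) i j = 0.
  by have /matrixP/(_ i j) := hZ; rewrite mxE [RHS]mxE.
have c00 : Num.conj (Z 0 0) = - Z 0 0.
  have := en 0 0; rewrite !mul2E e00 e10 e01 !mxE mulr1 mulr0 addr0 mul1r mul0r addr0.
  by move/eqP; rewrite addr_eq0 => /eqP.
have c10 : Num.conj (Z 1 0) = Z 0 1.
  have := en 0 1; rewrite !mul2E e00 e11 e01 !mxE mulr0 mulrN1 add0r mul1r mul0r addr0.
  by move/eqP; rewrite addrC subr_eq0 => /eqP.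
have c01 : Num.conj (Z 0 1) = Z 1 0 by rewrite -c10 conjCK.
have c11 : Num.conj (Z 1 1) = Z 0 0 by rewrite t rmorphN /= c00 opprK.
by apply: mx2P; rewrite !mul2E !mxE /= ?c00 ?c01 ?c10 ?c11 ?t !(mul0r, mul1r, mulr0, mulr1, addr0, add0r).
Qed.

Lemma cayley_real (Z : 'M[C]_2) : @in_su R 1 1 Z ->
  mxC (mxRe (cayley_inv *m Z *m cayley)) = cayley_inv *m Z *m cayley.
Proof.
move=> hZ; set M := _ *m _ *m _.
have SS : swap2 *m swap2 = 1%:M.
  by apply: mx2P; rewrite mul2E !mxE /= !(mul0r, mul1r, mulr0, mulr1, addr0, add0r).
have cM : mx_conj M = M.
  rewrite /M !mx_conjM cayley_conj cayley_inv_conj (su11_conj hZ).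
  by rewrite !mulmxA -!(mulmxA _ swap2 swap2) SS !mulmx1.
exact: mxC_of_conj.
Qed.

(** The determinant form on a plane is invariant. *)
Lemma sl2_self_dual : exists J J' : 'M[C]_2, [/\ J *m J' = 1%:M, J' *m J = 1%:M &
  forall A, \tr A = 0 -> J *m A = - A^T *m J].
Proof.
pose J : 'M[C]_2 := \matrix_(i, j) (if i == j then 0 else if i == 0 then 1 else -1).
exists J, (- J).
have JJ : J *m J = - 1%:M.
  by apply: mx2P; rewrite mul2E !mxE /= !(mul0r, mul1r, mulr0, mulr1, addr0, add0r, mulN1r) ?oppr0.
split; [by rewrite mulmxN JJ opprK|by rewrite mulNmx JJ opprK|move=> A tA].
have t : A 1 1 = - A 0 0.
  apply/eqP; rewrite -addr_eq0 addrC; apply/eqP; rewrite -[RHS]tA.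
  by rewrite /mxtrace !big_ord_recl big_ord0 addr0; congr (_ + A _ _); apply: val_inj.
apply: mx2P; rewrite !mul2E !mxE /= !(mul0r, mul1r, mulr0, mulr1, addr0, add0r, mulN1r, mulrN1) ?t ?opprK //.
Qed.

(** By the Cayley transform [U] has a real form, of dimension 2, which is
    irreducible because [U] is. *)
Lemma ss_type_real : has_type_wrt (derived (hd_g D)) U RealType.
Proof.
have [F [Fi [FF FiF hskew]]] := hermitian_model hD htup.
have [A [Ai [AAi AiA AE]]] : exists (A : 'M[C]_(2, d)) (Ai : 'M[C]_(d, 2)),
    [/\ A *m Ai = 1%:M, Ai *m A = 1%:M &
      forall Z, cayley_inv *m (F *m Z *m Fi) *m cayley = A *m Z *m Ai].
  have cK : cayley *m cayley_inv = 1%:M by apply: mulmx1C; apply: cayleyK.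
  exists (cayley_inv *m F), (Fi *m cayley); split.
  - by rewrite -mulmxA (mulmxA F) FF mul1mx cayleyK.
  - by rewrite -mulmxA (mulmxA cayley) cK mul1mx FiF.
  - by move=> Z; rewrite !mulmxA.
have /subvP dg := derived_sub (@datum_closed R D).
have dL X : X \in derived (hd_g D) -> mxC X \in L.
  by move=> hX; apply: mxC_complexify; apply: dg.
have rU := hd_U_rep D.
pose sigma X := mxRe (A *m U (mxC X) *m Ai).
have sE X : X \in derived (hd_g D) -> mxC (sigma X) = A *m U (mxC X) *m Ai.
  move=> hX; have h := model_in_su FF FiF hskew hX.
  by have := cayley_real h; rewrite AE.
have rs : is_rep (derived (hd_g D)) sigma.
  split=> [a X Y hX hY|X Y hX hY]; apply: (@mxC_inj R).
    have hZ : a *: X + Y \in derived (hd_g D) by rewrite memvD ?memvZ.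
    rewrite (sE _ hZ) (mxCD (a *: sigma X)) (mxCZ a (sigma X)) (sE _ hX) (sE _ hY).
    rewrite (mxCD (a *: X)) (mxCZ a X) /U rU.1 ?dL //.
    by rewrite mulmxDr mulmxDl -scalemxAr -scalemxAl.
  have hXY : lie X Y \in derived (hd_g D) by apply: in_derived; apply: dg.
  rewrite (sE _ hXY) (mxC_lie X Y) (mxC_lie (sigma X)) (sE _ hX) (sE _ hY) /U rU.2 ?dL //.
  move: (@hd_U R D (mxC X)) (@hd_U R D (mxC Y)) => u w; rewrite /lie mulmxBr mulmxBl.
  by rewrite !mulmxA -!(mulmxA _ Ai A) AiA !mulmx1.
have csE Z : Z \in ss -> complexify_rep sigma Z = A *m U Z *m Ai.
  rewrite /ss ss_complexify => /complexifyP[h1 h2].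
  rewrite /complexify_rep -!/(mxRe _) -!/(mxIm _) !sE //.
  rewrite {3}[Z]mxC_decomp /U (repD rU) ?memvZ ?dL // (repZ rU) ?dL //.
  by rewrite mulmxDr mulmxDl -scalemxAr -scalemxAl.
have isoU : rep_iso ss (complexify_rep sigma) U.
  exists Ai, A; split=> // X hX; rewrite csE // !mulmxA.
  by rewrite AiA mul1mx.
have AU Z : Z \in ss -> A *m U Z = (A *m U Z *m Ai) *m A by rewrite -[RHS]mulmxA AiA mulmx1.
exists 2%N, sigma; split=> //; last first.
  split; first by rewrite -ss_complexify.
  rewrite -ss_complexify.
  have [J [J' [J1 J2 hJ]]] := sl2_self_dual.
  exists (A^T *m J *m A), (Ai *m J' *m Ai^T); split.
  - rewrite -!mulmxA (mulmxA A) AAi mul1mx (mulmxA J) J1 mul1mx.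
    by rewrite -trmx_mul AiA trmx1.
  - rewrite -!mulmxA (mulmxA Ai^T) -trmx_mul AAi trmx1 mul1mx (mulmxA J') J2 mul1mx.
    exact: AiA.
  - move=> X hX; rewrite -[LHS]mulmxA AU //; set M := A *m U X *m Ai.
    have tM : \tr M = 0.
      rewrite /M mxtrace_mulC mulmxA AiA mul1mx.
      exact: (U_trace (@datum_clL R D) rU hX).
    rewrite (mulmxA (A^T *m J) M A) -(mulmxA A^T J M) hJ // /M /dual_rep !trmx_mul !(mulmxN, mulNmx) !mulmxA.
    by rewrite -trmx_mul AiA trmx1 mul1mx.
split=> // W hW; case: (eqVneq W 0%VS) => [->|W0]; [by left|right].
have [w hw w0] : exists2 w, w \in W & w <> 0.
  by exists (vpick W); [apply: memv_pick|apply/eqP; rewrite vpick0].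
pose P (u : 'cV[C]_d) := mxRe (A *m u) \in W /\ mxIm (A *m u) \in W.
have Plin : lin_pred P.
  split; first by rewrite /P mulmx0 -(mxC0 R) mxRe_mxC mxIm_mxC mem0v.
  move=> a y y' [p1 p2] [q1 q2]; rewrite /P mulmxDr -scalemxAr mxReD mxImD mxReZ mxImZ.
  by split; rewrite memvD ?memvB ?memvD ?memvZ.
have PW (x : 'cV[R]_2) : P (Ai *m mxC x) <-> x \in W.
  by rewrite /P mulmxA AAi mul1mx mxRe_mxC mxIm_mxC mem0v; split=> [[]|].
have Pall : forall u, P u.
  apply: (submodule_full (U_irreducible_ss hD htup) Plin _ (v := Ai *m mxC w)).
  - move=> Z u hZ [p1 p2].
    have hr B : B \in derived (hd_g D) -> P (U (mxC B) *m u).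
      move=> hB; have hBs : mxC B \in ss by rewrite /ss ss_complexify mxC_complexify.
      rewrite /P mulmxA (AU _ hBs) -(sE _ hB) -mulmxA.
      by rewrite mxRe_mulC mxIm_mulC; split; apply: hW.
    move: hZ; rewrite ss_complexify => /complexifyP[h1 h2].
    rewrite {1}[Z]mxC_decomp (repD rU) ?memvZ ?dL // (repZ rU) ?dL // mulmxDl -scalemxAl.
    by apply: (lin_predD Plin); [|apply: (lin_predZ _ Plin)]; apply: hr.
  - move=> h; apply: w0; have := congr1 (mulmx A) h; rewrite mulmx0 mulmxA AAi mul1mx -(mxC0 R).
    exact: mxC_inj.
  - exact/PW.
by apply/vspaceP => x; rewrite memvf; apply/PW/Pall.
Qed.

End RealType.

(** * Lie algebras isomorphic to gl(r+1) *)

Section MatrixUnits.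
Variables (K : fieldType) (n : nat).

Lemma mx_unit_ind (P : 'M[K]_n -> Prop) : lin_pred P -> (forall i j, P (delta_mx i j)) ->
  forall A, P A.
Proof.
move=> hP h A; rewrite (matrix_sum_delta A).
by apply: lin_pred_sum => // i _; apply: lin_pred_sum => // j _; apply: lin_predZ.
Qed.

Lemma lie_delta (i j p q : 'I_n) : lie (delta_mx i j) (delta_mx p q) =
  delta_mx i q *+ (j == p) - delta_mx p j *+ (q == i) :> 'M[K]_n.
Proof. by rewrite /lie !mul_delta_mx_cond. Qed.

Lemma trace_delta (i j : 'I_n) : \tr (delta_mx i j : 'M[K]_n) = (i == j)%:R.
Proof.
rewrite /mxtrace; case: (eqVneq i j) => [->|ij].
  by rewrite (bigD1 j) //= mxE !eqxx big1 ?addr0 // => k /negPf kj; rewrite mxE kj.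
rewrite big1 // => k _; rewrite mxE; case: eqP => // ->.
by rewrite (negPf ij).
Qed.

End MatrixUnits.

Section GlModel.
Variables (K : numClosedFieldType) (m r : nat).
Hypothesis r0 : (0 < r)%N.
Variables (L t : {vspace 'M[K]_m}) (U : 'M[K]_m -> 'M[K]_r.+1).
Hypothesis clL : lie_closed L.
Hypothesis rU : is_rep L U.
Hypothesis Uinj : forall Z, Z \in L -> U Z = 0 -> Z = 0.
Hypothesis Uonto : forall A, exists Z, Z \in L /\ U Z = A.
Hypothesis ht : forall Z, Z \in t <-> Z \in L /\ exists D, U Z = diag_mx D.

Let ss := derived L.
Let h := (t :&: ss)%VS.

Lemma gl_eq X Y : X \in L -> Y \in L -> U X = U Y -> X = Y.
Proof.
move=> hX hY e; apply/eqP; rewrite -subr_eq0; apply/eqP/Uinj; first by rewrite memvB.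
by rewrite (repB rU) // e subrr.
Qed.

Lemma gl_inverse : exists V : 'M[K]_r.+1 -> 'M[K]_m,
  [/\ forall A, V A \in L, forall A, U (V A) = A,
      forall Z, Z \in L -> V (U Z) = Z &
      forall a A B, V (a *: A + B) = a *: V A + V B].
Proof.
have [V hV] := boolp.choice Uonto; exists V.
have VL A : V A \in L by case: (hV A).
have UV A : U (V A) = A by case: (hV A).
split=> // [Z hZ|a A B]; first by apply: gl_eq.
by apply: gl_eq; rewrite ?memvD ?memvZ // UV rU.1 // !UV.
Qed.

Lemma gl_lie_diag T X i j : T \in t -> X \in L ->
  U (lie T X) i j = (U T i i - U T j j) * U X i j.
Proof.
move=> /ht [hT [D hD]] hX; rewrite rU.2 // hD /lie mul_diag_mx mul_mx_diag !mxE !eqxx !mulr1n.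
by rewrite mulrBl [_ * D 0 j]mulrC.
Qed.

(** A matrix that commutes with all diagonal ones is diagonal. *)
Lemma gl_cartan : cartan_subalgebra L t.
Proof.
have [V [VL UV VU Vlin]] := gl_inverse.
have tL : (t <= L)%VS by apply/subvP => Z /ht[].
have /subvP tL' := tL.
split; first split=> // [X Y hX hY|X hX].
- apply: Uinj; first by apply: clL; apply: tL'.
  apply/matrixP => i j; rewrite gl_lie_diag ?tL' // mxE.
  have /ht[_ [D ->]] := hY; rewrite !mxE.
  by case: eqVneq => [->|_]; rewrite ?subrr ?mul0r // mulr0n mulr0.
- apply: aspan_ad_diag => Y hY; rewrite -(VU Y hY).
  have Qlin : lin_pred (aspan (fun Z => Z \in L /\ eigv (lie X) Z)).
    apply: aspan_lin => a Z [hZ [b hb]]; split; first by rewrite memvZ.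
    by exists b; rewrite lieZr hb !scalerA mulrC.
  apply: (mx_unit_ind (P := fun A => aspan (fun Z => Z \in L /\ eigv (lie X) Z) (V A))).
    split; last by move=> a A B hA hB; rewrite Vlin; case: Qlin => _; apply.
    by have := Vlin 0 0 0; rewrite !scale0r !add0r => e; rewrite -[V 0]VU // UV (_ : V 0 = 0);
       [apply: aspan0|apply: Uinj].
  move=> i j; apply: aspan1; split=> //; exists (U X i i - U X j j).
  have XL := tL' _ hX; apply: gl_eq; [exact: clL|exact: memvZ|].
  apply/matrixP => p q; rewrite gl_lie_diag // (repZ rU) // UV !mxE.
  by case: (eqVneq p i) => [->|_]; case: (eqVneq q j) => [->|_]; rewrite /= ?mulr0.
move=> h' th' [/subvP h'L h'ab _]; apply/eqP; rewrite eqEsubv th' andbT.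
apply/subvP => X hX; apply/ht; split; first exact: h'L.
have hT i : V (delta_mx i i) \in t.
  apply/ht; split=> //; exists (delta_mx 0 i); rewrite UV; apply/matrixP => p q; rewrite !mxE eqxx /=.
  by case: (eqVneq p q) => [->|pq]; [rewrite mulr1n andbb|rewrite mulr0n; case: (eqVneq p i) => // pi; rewrite -pi eq_sym (negPf pq)].
exists (\row_i U X i i); apply/matrixP => i j; rewrite !mxE.
case: (eqVneq i j) => [->|ij]; first by rewrite mulr1n.
have := gl_lie_diag i j (hT i) (h'L _ hX).
rewrite (h'ab _ _ (subvP th' _ (hT i)) hX) (rep0 rU) mxE UV !mxE !eqxx /= [j == i]eq_sym (negPf ij) subr0 mul1r.
by move=> <-; rewrite mulr0n.
Qed.

(** A traceless matrix is a combination of brackets of matrix units. *)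
Lemma gl_derived Z : Z \in ss <-> Z \in L /\ \tr (U Z) = 0.
Proof.
split=> [hZ|[hZ tZ]].
  by split; [apply: (ss_sub clL)|apply: (U_trace clL rU)].
have [V [VL UV VU Vlin]] := gl_inverse.
have V0 : V 0 = 0 by apply: Uinj.
have slin : lin_pred (fun A => V (A - \tr A *: delta_mx 0 0) \in ss).
  split=> [|a A B hA hB]; first by rewrite mxtrace0 scale0r subr0 V0 mem0v.
  rewrite mxtraceD mxtraceZ (_ : _ - _ = a *: (A - \tr A *: delta_mx 0 0) + (B - \tr B *: delta_mx 0 0)).
    by rewrite Vlin memvD ?memvZ.
  by rewrite scalerDl scalerBr scalerA opprD addrACA.
have hbr A B : V (lie A B) \in ss.
  rewrite (_ : V _ = lie (V A) (V B)); first by apply: in_derived.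
  by apply: gl_eq; rewrite ?clL // UV rU.2 // !UV.
have := mx_unit_ind slin _ (U Z); rewrite tZ scale0r subr0 VU //; apply.
move=> i j; rewrite trace_delta; case: (eqVneq i j) => [->|ij].
  rewrite scale1r; case: (eqVneq j 0) => [->|j0]; first by rewrite subrr V0 mem0v.
  by have := hbr (delta_mx j 0) (delta_mx 0 j); rewrite lie_delta !eqxx !mulr1n.
rewrite scale0r subr0; have := hbr (delta_mx i i) (delta_mx i j).
by rewrite lie_delta eqxx [j == i]eq_sym (negPf ij) mulr1n mulr0n subr0.
Qed.

Lemma gl_center Z : Z \in L -> (exists a, U Z = a%:M) -> Z \in lie_center L.
Proof.
move=> hZ [a ha]; apply/centerP; split=> // X hX; apply: Uinj; first exact: clL.
by rewrite rU.2 // ha /lie mul_scalar_mx mul_mx_scalar subrr.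
Qed.

Lemma gl_sub_ss X : X \in ss -> X \in L. Proof. exact: (ss_sub clL). Qed.

Lemma gl_rep_ss : is_rep ss U.
Proof. by split=> [a X Y|X Y] /gl_sub_ss hX /gl_sub_ss hY; [apply: rU.1|apply: rU.2]. Qed.

Lemma gl_inj_ss X : X \in ss -> U X = 0 -> X = 0.
Proof. by move=> /gl_sub_ss; apply: Uinj. Qed.

Lemma gl_tr_ss X : X \in ss -> \tr (U X) = 0.
Proof. by case/gl_derived. Qed.

Lemma gl_im_ss A : \tr A = 0 -> exists X, X \in ss /\ U X = A.
Proof. by have [Z [hZ ZA]] := Uonto A; exists Z; split=> //; apply/gl_derived; rewrite ZA. Qed.

Lemma gl_hP X : X \in h <-> X \in ss /\ exists D, U X = diag_mx D.
Proof.
rewrite memv_cap; split=> [/andP[/ht[_ hD] ->] //|[hX hD]].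
by rewrite hX andbT; apply/ht; split=> //; apply: gl_sub_ss.
Qed.

(** A nonzero ideal contains a matrix unit: two brackets with [e_ji] isolate
    an off-diagonal entry, and for a diagonal element one bracket gives an
    off-diagonal unit. From there brackets reach all the units. *)
Lemma gl_simple : simple_lie ss.
Proof.
have [V [VL UV VU Vlin]] := gl_inverse.
have V0 : V 0 = 0 by apply: Uinj.
pose o : 'I_r.+1 := lift ord0 (Ordinal r0).
have o0 : o != 0 by [].
have Vs i j : i != j -> V (delta_mx i j) \in ss.
  by move=> ij; apply/gl_derived; rewrite UV trace_delta (negPf ij).
have hbr A B : V (lie A B) = lie (V A) (V B).
  by apply: gl_eq; rewrite ?clL // UV rU.2 // !UV.
split.
  exists (V (delta_mx 0 o)), (V (delta_mx o 0)); rewrite !Vs // 1?eq_sym //; split=> //.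
  rewrite -hbr => /(congr1 U); rewrite UV (rep0 rU) lie_delta !eqxx !mulr1n => /matrixP/(_ 0 0).
  by rewrite !mxE !eqxx /= subr0 => /eqP; rewrite oner_eq0.
move=> I Is hI; case: (eqVneq I 0%VS) => [->|I0]; [by left|right].
pose J A := V A \in I.
have Jlin : lin_pred J.
  by split; rewrite /J ?V0 ?mem0v // => a A B hA hB; rewrite Vlin memvD ?memvZ.
have Jbr i j A : i != j -> J A -> J (lie (delta_mx i j) A).
  by move=> ij hA; rewrite /J hbr; apply: hI => //; apply: Vs.
have two : (2%:R : K) != 0 by rewrite pnatr_eq0.
have unit_of A i j : i != j -> J A -> A i j != 0 -> J (delta_mx j i).
  move=> ij hA aij.
  have ji : j != i by rewrite eq_sym.
  have := Jbr _ _ _ ji (Jbr _ _ _ ji hA).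
  have -> : lie (delta_mx j i) (lie (delta_mx j i) A) = (- (2%:R * A i j)) *: delta_mx j i.
    have EE : delta_mx j i *m delta_mx j i = 0 :> 'M[K]_r.+1.
      by rewrite mul_delta_mx_cond (negPf ij) mulr0n.
    have EAE : delta_mx j i *m A *m delta_mx j i = A i j *: delta_mx j i.
      apply/matrixP => p q; rewrite [LHS]mxE (bigD1 j) //= big1 => [|k kj]; last first.
        by rewrite [delta_mx j i k q]mxE (negPf kj) mulr0.
      rewrite addr0 [X in X * _]mxE (bigD1 i) //= big1 => [|k ki]; last first.
        by rewrite mxE (negPf ki) andbF mul0r.
      rewrite addr0 !mxE !eqxx andbT /=.
      by case: (p == j); case: (q == i); rewrite /= ?mulr0 ?mul0r ?mul1r ?mulr1.
    rewrite /lie mulmxBr mulmxBl !mulmxA EE mul0mx sub0r EAE -!mulmxA EE mulmx0 subr0.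
    by rewrite scaleNr mulrDl !mul1r scalerDl opprD.
  move=> /(lin_predZ (- (2%:R * A i j))^-1 Jlin); rewrite scalerA mulVf ?scale1r //.
  by rewrite oppr_eq0 mulf_neq0.
have [p [q [pq hpq]]] : exists p q, p != q /\ J (delta_mx p q).
  have hX := memv_pick I; set X := vpick I in hX.
  have XL : X \in L by apply/gl_sub_ss/(subvP Is).
  have JX : J (U X) by rewrite /J VU.
  case: (boolp.pselect (exists ij : 'I_r.+1 * 'I_r.+1, ij.1 != ij.2 /\ U X ij.1 ij.2 != 0)).
    by case=> -[i j] /= [ij aij]; exists j, i; split; [rewrite eq_sym|apply: (unit_of (U X))].
  move/forallNP => hoff.
  have hd i j : i != j -> U X i j = 0.
    move=> ij; apply/eqP/negPn/negP => h0; exact: (hoff (i, j)).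
  have [i hi] : exists i, U X i i != U X 0 0.
    apply: contrapT => /forallNP hall.
    have sc : U X = (U X 0 0)%:M.
      apply/matrixP => i j; rewrite !mxE; case: (eqVneq i j) => [->|ij]; last by rewrite hd // mulr0n.
      by rewrite mulr1n; apply/eqP/negPn/negP/hall.
    have := gl_tr_ss (subvP Is _ hX); rewrite sc mxtrace_scalar => /eqP.
    rewrite -mulr_natr mulf_eq0 pnatr_eq0 orbF => /eqP x0.
    by move: I0; rewrite -vpick0 -/X (Uinj XL) ?eqxx // sc x0 raddf0.
  have i0 : i != 0 by apply: contra_neq hi => ->.
  exists i, 0; split=> //; have := Jbr _ _ _ i0 JX.
  have -> : lie (delta_mx i 0) (U X) = (U X 0 0 - U X i i) *: delta_mx i 0.
    apply/matrixP => a b; rewrite !mxE (bigD1 0) //= big1 => [|k k0]; last by rewrite !mxE (negPf k0) andbF mul0r.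
    rewrite (bigD1 i) //= big1 => [|k ki]; last by rewrite !mxE (negPf ki) mulr0.
    rewrite !mxE !eqxx !addr0 /= andbT.
    case: (eqVneq a i) => [->|ai]; case: (eqVneq b 0) => [->|b0] /=; rewrite ?mul1r ?mulr1 ?mul0r ?mulr0 ?subr0 ?sub0r //.
    - by rewrite hd 1?eq_sym // subr0.
    - by rewrite hd // oppr0.
  move=> /(lin_predZ (U X 0 0 - U X i i)^-1 Jlin); rewrite scalerA mulVf ?scale1r //.
  by rewrite subr_eq0 eq_sym.
have step p' q' : p' != q' -> J (delta_mx p' q') -> forall i, i != q' -> forall j, j != i -> J (delta_mx i j).
  move=> pq' hpq' i iq j ji.
  have hiq : J (delta_mx i q').
    case: (eqVneq i p') => [->//|ip].
    have := Jbr _ _ _ ip hpq'.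
    by rewrite lie_delta eqxx [q' == i]eq_sym (negPf iq) mulr1n mulr0n subr0.
  case: (eqVneq j q') => [->//|jq].
  have qj : q' != j by rewrite eq_sym.
  have := lin_predN Jlin (Jbr _ _ _ qj hiq).
  by rewrite lie_delta eqxx (negPf ji) mulr0n mulr1n sub0r opprK.
have Jall i j : i != j -> J (delta_mx i j).
  move=> ij; case: (eqVneq i q) => [iq|iq]; last by apply: (step p q) => //; rewrite eq_sym.
  have qp : q != p by rewrite eq_sym.
  have hqp : J (delta_mx q p) by apply: (unit_of (delta_mx p q)); rewrite ?mxE ?eqxx ?oner_eq0.
  by apply: (step q p) => //; rewrite ?iq // eq_sym -?iq.
have slin : lin_pred (fun A => J (A - \tr A *: delta_mx 0 0)).
  split=> [|a A B hA hB]; first by rewrite mxtrace0 scale0r subr0; case: Jlin.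
  rewrite mxtraceD mxtraceZ (_ : _ - _ = a *: (A - \tr A *: delta_mx 0 0) + (B - \tr B *: delta_mx 0 0)).
    by case: Jlin => _; apply.
  by rewrite scalerDl scalerBr scalerA opprD addrACA.
apply/eqP; rewrite eqEsubv Is /=; apply/subvP => Z /[dup] hZ /gl_derived [ZL tZ].
have : forall A, J (A - \tr A *: delta_mx 0 0).
  apply: (mx_unit_ind slin) => i j; rewrite trace_delta.
  case: (eqVneq i j) => [->|ij]; last by rewrite scale0r subr0; apply: Jall.
  rewrite scale1r; case: (eqVneq j 0) => [->|j0]; first by rewrite subrr; case: Jlin.
  have j0' : 0 != j by rewrite eq_sym.
  by have := Jbr _ _ _ j0 (Jall _ _ j0'); rewrite lie_delta !eqxx !mulr1n.
by move/(_ (U Z)); rewrite tZ scale0r subr0 /J VU.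
Qed.

Lemma gl_iso : lie_iso ss (sl K r.+1).
Proof. by apply: (lie_iso_sl clL rU gl_inj_ss) => A tA; apply: gl_im_ss. Qed.

End GlModel.

(** * Simple roots and highest weights of sl(r+1) *)

Section SlRoots.
Variables (K : numClosedFieldType) (m r : nat) (s h : {vspace 'M[K]_m}).
Hypothesis hs : (h <= s)%VS.
Variable G : 'M[K]_m -> 'M[K]_r.+1.
Hypothesis rG : is_rep s G.
Hypothesis Ginj : forall X, X \in s -> G X = 0 -> X = 0.
Hypothesis Gtr : forall X, X \in s -> \tr (G X) = 0.
Hypothesis Gim : forall A, \tr A = 0 -> exists X, X \in s /\ G X = A.
Hypothesis Gh : forall X, X \in h <-> X \in s /\ exists D, G X = diag_mx D.
Hypothesis hcl : lie_closed s.
Variable rv : bool.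

Definition eps (i : 'I_r.+1) : dual h := linfun (mk_linear (wt_linear hs rG i)).

Lemma epsE i H : eps i H = wt G i H :> K.
Proof. by rewrite lfunE. Qed.

Definition lo (i : 'I_r) : 'I_r.+1 := widen_ord (leqnSn r) i.
Definition hi (i : 'I_r) : 'I_r.+1 := lift ord0 i.

Lemma lo_hi i : lo i != hi i.
Proof. by rewrite -val_eqE /= /bump /= add1n neq_ltn ltnSn. Qed.

(** Reversing the order of the simple roots of type A gives again a Bourbaki
    labelling; this exchanges the two families. *)
Definition label (i : 'I_r) : 'I_r := if rv then rev_ord i else i.

Lemma labelK : involutive label.
Proof. by rewrite /label; case: rv => // i; rewrite rev_ordK. Qed.

Definition sl_root (i j : 'I_r.+1) : dual h := eps i - eps j.

Lemma sl_rootE i j H : sl_root i j H = wt G i H - wt G j H :> K.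
Proof. by rewrite /sl_root add_lfunE opp_lfunE !epsE. Qed.

Definition sl_alpha : r.-tuple (dual h) := [tuple sl_root (lo (label i)) (hi (label i)) | i < r].

Lemma sl_alphaE i H : tnth sl_alpha i H = wt G (lo (label i)) H - wt G (hi (label i)) H :> K.
Proof. by rewrite tnth_mktuple sl_rootE. Qed.

Lemma diag_element (D : 'rV[K]_r.+1) : \sum_i D 0 i = 0 -> exists H : subvs_of h, forall i, wt G i H = D 0 i.
Proof.
move=> D0; have [|X [hX XE]] := Gim (A := diag_mx D); first by rewrite mxtrace_diag.
have Xh : X \in h by apply/Gh; split=> //; exists D.
by exists (vsproj h X) => i; rewrite /wt vsprojK // XE !mxE eqxx mulr1n.
Qed.

Lemma sl_root_space i j X : i != j ->
  (root_space s (sl_root i j) X <-> X \in s /\ exists x, G X = x *: delta_mx i j).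
Proof.
move=> ij; split=> [hX|[hX [x XE]]].
  case: (eqVneq X 0) => [->|/eqP X0].
    by rewrite mem0v; split=> //; exists 0; rewrite (rep0 rG) scale0r.
  have a0 : sl_root i j <> 0.
    move=> a0; have [H hH] := test_element Gim Gh ij.
    have := sl_rootE i j H; rewrite a0 zero_lfunE !hH !eqxx (negPf ij) [j == i]eq_sym (negPf ij).
    by rewrite subr0 sub0r opprK => /eqP; rewrite eq_sym -mulr2n pnatr_eq0.
  have [p [q [x [pq hpq XE]]]] := root_space_entry hs rG Ginj Gim Gh a0 X0 hX.
  have [|pi qj] := weight_pair_inj Gim Gh (p := p) (q := q) ij.
    by move=> H; rewrite -hpq sl_rootE.
  by split; [case: hX|exists x; rewrite XE pi qj].
split=> // H; apply/eqP; rewrite -subr_eq0; apply/eqP; have Hs := vsval_s hs H.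
apply: Ginj; first by rewrite memvB ?memvZ ?hcl.
rewrite (repB rG) ?memvZ ?hcl // (repZ rG) //; apply/matrixP => p q.
rewrite !mxE (G_lie_entry hs rG Gh) // sl_rootE XE !mxE.
by case: (eqVneq p i) => [->|_]; case: (eqVneq q j) => [->|_]; rewrite /= ?mulr0 subrr.
Qed.

Lemma sl_root_unit i j : i != j -> exists X, [/\ X \in s, X <> 0, G X = delta_mx i j &
  root_space s (sl_root i j) X].
Proof.
move=> ij; have [|X [hX XE]] := Gim (A := delta_mx i j); first by rewrite trace_delta (negPf ij).
exists X; split=> //.
  move=> X0; move: XE; rewrite X0 (rep0 rG) => /matrixP/(_ i j)/eqP.
  by rewrite !mxE !eqxx eq_sym oner_eq0.
by apply/sl_root_space => //; split=> //; exists 1; rewrite scale1r.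
Qed.

Lemma sl_root_neq0 i j : i != j -> sl_root i j <> 0.
Proof.
move=> ij a0; have [H hH] := test_element Gim Gh ij.
have := sl_rootE i j H; rewrite a0 zero_lfunE !hH !eqxx (negPf ij) [j == i]eq_sym (negPf ij).
by rewrite subr0 sub0r opprK => /eqP; rewrite eq_sym -mulr2n pnatr_eq0.
Qed.

Lemma sl_rootN i j : - sl_root i j = sl_root j i.
Proof. by rewrite /sl_root opprB. Qed.

(** The diagonal matrix with [j + 1] entries 1 followed by zeros, made
    traceless. *)
Lemma fundamental_coweight (j : 'I_r) : exists H : subvs_of h,
  forall i, tnth sl_alpha i H = (label i == j)%:R.
Proof.
have n0 : (r.+1)%:R != 0 :> K by rewrite pnatr_eq0.
pose f (i : 'I_r.+1) : K := (i <= j)%N%:R.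
have [|H hH] := @diag_element (\row_i (f i - (\sum_k f k) / r.+1%:R)).
  under eq_bigr do rewrite mxE.
  by rewrite sumrB sumr_const card_ord -[_ / _ *+ _]mulr_natr divfK // subrr.
exists H => i; rewrite sl_alphaE !hH !mxE opprB addrA subrK /f /= /bump /= add1n.
rewrite ltn_neqAle val_eqE; case: eqP => [->|_] /=; first by rewrite leqnn subr0.
by rewrite subrr.
Qed.

(** Telescoping: [e_i - e_j] is the sum of the consecutive differences
    between [i] and [j]. *)
Lemma sum_interval (V : zmodType) (f : nat -> V) (i j : nat) : (i <= j <= r)%N ->
  \sum_(p < r) (f p - f p.+1) *+ ((i <= p) && (p < j))%N = f i - f j.
Proof.
move=> /andP[ij jr].
pose g p := if (p <= i)%N then f i else if (j <= p)%N then f j else f p.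
have gE (p : 'I_r) : (f p - f p.+1) *+ ((i <= p) && (p < j))%N = - (g p.+1 - g p).
  rewrite opprB /g; case: (ltngtP p i) => [pi|ip|pi] /=.
  - by rewrite subrr.
  - case: (ltnP p j) => pj /=.
      by case: (ltngtP j p.+1) => [|_|<-]; rewrite ?mulr1n //; lia.
    by rewrite leqW ?subrr.
  - rewrite pi; case: (ltngtP i j) => [lij|lij|lij]; last by rewrite -lij leqW // subrr.
      rewrite mulr1n; case: (ltngtP j i.+1) => [|_|<-] //; lia.
    lia.
rewrite (eq_bigr _ (fun p _ => gE p)) sumrN -(big_mkord xpredT (fun p => g p.+1 - g p)).
rewrite telescope_sumr // opprB /g /=; congr (_ - _).
case: ifP => [ri|_]; first by congr f; lia.
by rewrite jr.
Qed.

Lemma label_bij : bijective label. Proof. exact: inv_bij labelK. Qed.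

Lemma sl_simple_roots : simple_roots s sl_alpha.
Proof.
split.
- move=> i; rewrite tnth_mktuple; split; first exact/sl_root_neq0/lo_hi.
  by have [X [_ X0 _ hX]] := sl_root_unit (lo_hi (label i)); exists X.
- rewrite basisEfree; apply/and3P; split; [|exact: subvf|]; last first.
    rewrite size_tuple dimvf; have -> : dim (dual h) = r => //.
    have -> : dim (dual h) = \dim h := muln1 (\dim h).
    exact: (dim_cartan hs rG Ginj Gtr Gim Gh (ltn0Sn r)).
  apply/freeP => c hc i.
  have [H hH] := fundamental_coweight (label i).
  move: (sl_alpha) hH hc => al hH hc.
  have := congr1 (fun a : dual h => a H : K) hc; rewrite zero_lfunE sum_lfunE.
  rewrite (bigD1 i) //= big1 => [|j ji].
    rewrite addr0 scale_lfunE -tnth_nth hH eqxx /GRing.scale /= mulr1; apply.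
  rewrite scale_lfunE -tnth_nth hH (inj_eq (bij_inj label_bij)) (negPf ji).
  by rewrite scaler0.
move=> b [b0 [X [X0 hX]]].
have [i [j [x [ij hb _]]]] := root_space_entry hs rG Ginj Gim Gh b0 X0 hX.
have bE : b = sl_root i j.
  by apply/lfunP => H; rewrite [RHS]sl_rootE [LHS]hb.
have pos (p q : 'I_r.+1) : (p < q)%N -> sl_root p q =
    \sum_k tnth sl_alpha k *+ ((p <= label k) && (label k < q))%N.
  move=> pq; under eq_bigr do rewrite tnth_mktuple.
  rewrite (reindex label) /=; last exact: onW_bij label_bij.
  under eq_bigr do rewrite labelK.
  have := @sum_interval _ (fun n => eps (inord n)) p q; rewrite (ltnW pq) -ltnS ltn_ord => /(_ isT).
  rewrite !inord_val /sl_root => <-; apply: eq_bigr => k _; congr ((eps _ - eps _) *+ _).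
    by apply: val_inj; rewrite /= inordK // ltnS ltnW.
  by apply: val_inj; rewrite /= inordK ?ltnS.
case: (ltngtP i j) => [lt|lt|e]; last by move: ij; rewrite (val_inj e) eqxx.
  by exists (fun k => ((i <= label k) && (label k < j))%N); left; rewrite bE pos.
exists (fun k => ((j <= label k) && (label k < i))%N); right.
by rewrite -pos // sl_rootN.
Qed.

Variable alphav : r.-tuple (subvs_of h).
Hypothesis hav : forall i k, wt G k (tnth alphav i) =
  (k == lo (label i))%:R - (k == hi (label i))%:R.

Lemma sl_coroots i : is_coroot s (tnth sl_alpha i) (tnth alphav i).
Proof.
have pq := lo_hi (label i); have qp : hi (label i) != lo (label i) by rewrite eq_sym.
split.
  by rewrite sl_alphaE !hav !eqxx (negPf pq) (negPf qp) subr0 sub0r opprK.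
have [X [Xs X0 XE hX]] := sl_root_unit pq; have [Y [Ys Y0 YE hY]] := sl_root_unit qp.
exists X, Y; rewrite tnth_mktuple sl_rootN; split=> //.
apply/eqP; rewrite -subr_eq0; apply/eqP/Ginj; first by rewrite memvB ?hcl ?vsval_s.
have Hs := vsval_s hs (tnth alphav i).
rewrite (repB rG) ?hcl // rG.2 // XE YE lie_delta !eqxx !mulr1n (G_wt Gh).
apply/matrixP => a b; rewrite !mxE hav; case: (eqVneq a b) => [->|ab].
  by rewrite !andbb mulr1n subrr.
rewrite mulr0n sub0r; case: (eqVneq a (lo (label i))) => [e|_]; case: (eqVneq a (hi (label i))) => [e'|_];
  rewrite /= -?e -?e' ?[b == a]eq_sym ?(negPf ab) ?subrr ?oppr0 //.
Qed.

Lemma cartan_integer_A (i j : nat) : cartan_integer (TypeA r) i.+1 j.+1 =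
  (i == j)%:R + (i == j)%:R - (i == j.+1)%:R - (j == i.+1)%:R.
Proof.
rewrite /cartan_integer eqSS; case: (ltngtP i j) => ij /=; last by rewrite ij; case: eqP => //; lia.
  rewrite (minn_idPl _) ?ltnS 1?ltnW // (maxn_idPr _) ?ltnS 1?ltnW //= eqSS.
  by case: eqP => _; case: eqP => // e; lia.
rewrite (minn_idPr _) ?ltnS 1?ltnW // (maxn_idPl _) ?ltnS 1?ltnW //= eqSS.
by case: eqP => _; case: eqP => // e; lia.
Qed.

Lemma sl_bourbaki : (0 < r)%N -> bourbaki_labelling sl_alpha alphav.
Proof.
move=> r0; exists (TypeA r); split=> // i j; rewrite sl_alphaE !hav cartan_integer_A.
rewrite -!(inj_eq val_inj) /= /bump /= !add1n.
have lE (k : 'I_r) : (label k : nat) = if rv then (r - k.+1)%N else k by rewrite /label; case: rv.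
have e0 : (label i == label j :> nat) = (i == j :> nat).
  by rewrite !(inj_eq val_inj) (inj_eq (bij_inj label_bij)).
have e1 : (label i == (label j).+1 :> nat) = (if rv then (j == i.+1 :> nat) else (i == j.+1 :> nat)).
  rewrite !lE; have := ltn_ord i; have := ltn_ord j; case: rv => // hj hi'.
  by apply/eqP/eqP; lia.
have e2 : ((label i).+1 == label j :> nat) = (if rv then (i == j.+1 :> nat) else (j == i.+1 :> nat)).
  rewrite !lE; have := ltn_ord i; have := ltn_ord j; case: rv => // hj hi'.
  by apply/eqP/eqP; lia.
rewrite eqSS !e0 e1 e2 !(rmorphB, rmorphD) /= !rmorph_nat.
by case: rv; ring.
Qed.

Lemma eps_highest_weight : is_highest_weight s sl_alpha G (eps 0).
Proof.
exists (delta_mx 0 0); split.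
- by move=> /matrixP/(_ 0 0)/eqP; rewrite !mxE eqxx oner_eq0.
- move=> H; rewrite (G_wt Gh) epsE; apply/matrixP => i j; rewrite mul_diag_mx !mxE.
  by case: eqVneq => [->|]; rewrite ?mulr0.
move=> i X; rewrite tnth_mktuple => /sl_root_space [|_ [x ->]]; first exact: lo_hi.
by rewrite -scalemxAl mul_delta_mx_cond scaler0.
Qed.

Lemma eps_max_highest_weight : is_highest_weight s sl_alpha (dual_rep G) (- eps ord_max).
Proof.
exists (delta_mx ord_max 0); split.
- by move=> /matrixP/(_ ord_max 0)/eqP; rewrite !mxE !eqxx oner_eq0.
- move=> H; rewrite /dual_rep (G_wt Gh) opp_lfunE epsE tr_diag_mx mulNmx scaleNr; congr (- _).
  apply/matrixP => i j; rewrite mul_diag_mx !mxE.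
  by case: eqVneq => [->|]; rewrite ?mulr0.
move=> i X; rewrite tnth_mktuple => /sl_root_space [|_ [x XE]]; first exact: lo_hi.
rewrite /dual_rep XE linearZ /= trmx_delta mulNmx -scalemxAl mul_delta_mx_cond.
by rewrite -val_eqE /= ltn_eqF ?ltn_ord // mulr0n scaler0 oppr0.
Qed.

End SlRoots.

(** * Realification of complex matrices *)

Section Realification.
Variables (R : realType) (n : nat).
Local Notation C := R[i].
Local Open Scope complex_scope.
Implicit Types A B : 'M[C]_n.

Lemma mxRe_mul A B : mxRe (A *m B) = mxRe A *m mxRe B - mxIm A *m mxIm B.
Proof.
rewrite {1}[A]mxC_decomp mulmxDl -scalemxAl mxReD mxReZ /= scale0r scale1r add0r.
by rewrite mxRe_mulC mxIm_mulC.
Qed.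

Lemma mxIm_mul A B : mxIm (A *m B) = mxRe A *m mxIm B + mxIm A *m mxRe B.
Proof.
rewrite {1}[A]mxC_decomp mulmxDl -scalemxAl mxImD mxImZ /= scale0r scale1r add0r.
by rewrite mxRe_mulC mxIm_mulC.
Qed.

(** The complex matrix [A] as a real operator on the real and imaginary
    parts. *)
Definition c2r A : 'M[R]_(n + n) := block_mx (mxRe A) (- mxIm A) (mxIm A) (mxRe A).

Lemma c2rM A B : c2r (A *m B) = c2r A *m c2r B.
Proof.
rewrite /c2r mulmx_block mxRe_mul mxIm_mul !(mulmxN, mulNmx).
by congr block_mx; rewrite ?opprD // addrC.
Qed.

Lemma c2rD A B : c2r (A + B) = c2r A + c2r B.
Proof. by rewrite /c2r mxReD mxImD add_block_mx opprD. Qed.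

Lemma c2rZ (a : R) A : c2r (a%:C *: A) = a *: c2r A.
Proof.
rewrite /c2r mxReZ mxImZ /= !scale0r subr0 addr0 scale_block_mx scalerN //.
Qed.

Lemma mxRe_scalar (a : C) : mxRe (a%:M : 'M[C]_n) = (complex.Re a)%:M.
Proof. by apply/matrixP => i j; rewrite !mxE; case: (_ == _); rewrite ?mulr1n ?mulr0n. Qed.
Lemma mxIm_scalar (a : C) : mxIm (a%:M : 'M[C]_n) = (complex.Im a)%:M.
Proof. by apply/matrixP => i j; rewrite !mxE; case: (_ == _); rewrite ?mulr1n ?mulr0n. Qed.

Lemma c2r_real (a : R) : c2r (a%:C)%:M = a%:M.
Proof. by rewrite /c2r mxRe_scalar mxIm_scalar /= raddf0 oppr0 scalar_mx_block. Qed.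

Lemma c2r1 : c2r 1%:M = 1%:M.
Proof. exact: (c2r_real 1). Qed.

Lemma c2rN A : c2r (- A) = - c2r A.
Proof. by rewrite -scaleN1r (_ : -1 = (-1)%:C) ?c2rZ ?scaleN1r // rmorphN1. Qed.

Lemma c2r_tr A : (c2r A)^T = c2r (adj A).
Proof.
rewrite /c2r tr_block_mx linearN /=; congr block_mx; apply/matrixP => i j;
  by rewrite !mxE conjE; case: (A _ _) => x y //=; rewrite opprK.
Qed.

Lemma c2r_inj A B : c2r A = c2r B -> A = B.
Proof.
move/eq_block_mx => [e1 _ e2 _].
by rewrite [A]mxC_decomp [B]mxC_decomp e1 e2.
Qed.

Definition cplx : 'M[R]_(n + n) := c2r ('i%C)%:M.

Lemma cplxE : cplx = block_mx 0 (- 1%:M) 1%:M 0.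
Proof. by rewrite /cplx /c2r mxRe_scalar mxIm_scalar /= raddf0. Qed.

Lemma commutes_cplx (F : fieldType) (Z : 'M[F]_(n + n)) :
  Z *m block_mx 0 (- 1%:M) 1%:M 0 = block_mx 0 (- 1%:M) 1%:M 0 *m Z <->
  ursubmx Z = - dlsubmx Z /\ drsubmx Z = ulsubmx Z.
Proof.
have [a [b [c [d ->]]]] : exists a b c d, Z = block_mx a b c d.
  by exists (ulsubmx Z), (ursubmx Z), (dlsubmx Z), (drsubmx Z); rewrite submxK.
rewrite block_mxKul block_mxKur block_mxKdl block_mxKdr.
rewrite !mulmx_block !(mulmx0, mul0mx, mulmx1, mul1mx, mulmxN, mulNmx, addr0, add0r).
by split=> [/eq_block_mx [e1 _ e2 _] //|[-> ->]].
Qed.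

Lemma c2r_of_commutes X : X *m cplx = cplx *m X ->
  X = c2r (mxC (ulsubmx X) + 'i%C *: mxC (dlsubmx X)).
Proof.
rewrite cplxE => /commutes_cplx [e1 e2].
by rewrite /c2r mxRe_comb mxIm_comb -e1 -{2}e2 submxK.
Qed.

Lemma c2r_commutes A : c2r A *m cplx = cplx *m c2r A.
Proof. by rewrite /cplx -!c2rM mul_scalar_mx mul_mx_scalar. Qed.

End Realification.

(** * Symmetric nilpotent matrices *)

Section SymmetricNilpotent.
Variable R : realType.

Lemma tr_mul_eq0 n (M : 'M[R]_n) : M^T *m M = 0 -> M = 0.
Proof.
move=> h; apply/matrixP => i j; have /matrixP/(_ j j) := h; rewrite !mxE.
move/psumr_eq0P => /= e; apply/eqP; rewrite -sqrf_eq0 expr2; apply/eqP.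
have := e _ i isT; rewrite mxE; apply=> // k _.
by rewrite mxE -expr2 sqr_ge0.
Qed.

Lemma iter_mulmx_tr n (M : 'M[R]_n) k : M^T = M -> (iter k (mulmx M) 1%:M)^T = iter k (mulmx M) 1%:M.
Proof.
move=> hM; have comm j : iter j (mulmx M) 1%:M *m M = M *m iter j (mulmx M) 1%:M.
  by elim: j => [|j IH] /=; rewrite ?mul1mx ?mulmx1 // -mulmxA IH.
by elim: k => [|k IH] /=; rewrite ?trmx1 // trmx_mul IH hM comm.
Qed.

Lemma iter_mulmxD n (M : 'M[R]_n) j k : iter j (mulmx M) 1%:M *m iter k (mulmx M) 1%:M = iter (j + k) (mulmx M) 1%:M.
Proof. by elim: j => [|j IH] /=; rewrite ?mul1mx // -mulmxA IH. Qed.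

(** If [M^(k+2) = 0] then [M^(k+1)] times its transpose, a power of exponent
    at least [k + 2], is 0, so [M^(k+1) = 0]. *)
Lemma symmetric_nilpotent n (M : 'M[R]_n) k : M^T = M -> iter k (mulmx M) 1%:M = 0 -> M = 0.
Proof.
move=> hM; elim: k => [|[|k] IH] h.
- by rewrite -[M]mulmx1 -[1%:M]/(iter 0 (mulmx M) 1%:M) h mulmx0.
- by move: h; rewrite /= mulmx1.
apply: IH; apply: tr_mul_eq0; rewrite iter_mulmx_tr // iter_mulmxD addSn -addnS addnC.
by rewrite -iter_mulmxD h mul0mx.
Qed.

End SymmetricNilpotent.

(** * The unitary group U(1, r) *)

Section UnitaryGroup.
Variables (R : realType) (r : nat).
Local Notation C := R[i].
Local Open Scope complex_scope.
Let n := r.+1.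
Let m := (n + n)%N.

Definition sgn_row : 'rV[C]_n := \row_i (if i == 0 then 1 else -1).
Definition herm : 'M[C]_n := diag_mx sgn_row.
(** The real polarization; it corresponds to [i] times the Hermitian form,
    which makes it alternating. *)
Definition polar : 'M[R]_m := c2r ('i%C *: herm).
(** The weights 3 and 1 produce the Hodge numbers (1, r, r, 1). *)
Definition circle_mx (z : C) : 'M[C]_n := diag_mx (\row_i z ^+ (if i == 0 then 3 else 1)).
Definition circle (z : C) : 'M[R]_m := c2r (circle_mx z).
Definition unitary_group : set 'M[R]_m :=
  fun X => X *m cplx R n = cplx R n *m X /\ X^T *m polar *m X = polar.

Lemma herm_sq : herm *m herm = 1%:M.
Proof.
rewrite /herm mul_diag_mx; apply/matrixP => i j; rewrite !mxE.
by case: (eqVneq i j) => [->|]; rewrite ?mulr0 //; case: eqP; rewrite !mulr1n ?mulrNN mulr1.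
Qed.

Lemma adj_herm : adj herm = herm.
Proof.
apply/matrixP => i j; rewrite !mxE; case: (eqVneq i j) => [->|]; last by rewrite !mulr0n rmorph0.
by rewrite !mulr1n; case: eqP => _; rewrite ?rmorphN rmorph1.
Qed.

Lemma circle_mxM z w : circle_mx (z * w) = circle_mx z *m circle_mx w.
Proof.
rewrite /circle_mx mul_diag_mx; apply/matrixP => i j; rewrite !mxE.
by case: (eqVneq i j) => [->|]; rewrite ?mulr0 // !mulr1n exprMn.
Qed.

(** So the positivity of the polarization is that of the standard Hermitian
    norm. *)
Lemma polar_circle_i : polar *m circle 'i%C = 1%:M.
Proof.
rewrite /polar /circle -c2rM -(c2r1 R n); congr c2r.
have ii : 'i%C * 'i%C = -1 :> C by rewrite -expr2 sqr_i.
apply/matrixP => i j; rewrite -scalemxAl mul_diag_mx !mxE.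
case: (eqVneq i j) => [->|]; rewrite ?mulr0 // !mulr1n; case: eqP => _.
  by rewrite mul1r -exprS (exprM _ 2 2) !expr2 ii mulrNN mulr1.
by rewrite expr1 mulN1r mulrN ii opprK.
Qed.

Lemma polar_tr : polar^T = - polar.
Proof.
rewrite /polar c2r_tr adjZ adj_herm -c2rN -scaleNr; congr (c2r (_ *: _)).
by apply/eqP; rewrite conjE eq_complex /= oppr0 !eqxx.
Qed.

Lemma polar_unit : polar \in unitmx.
Proof. by have [] := mulmx1_unit polar_circle_i. Qed.

Lemma polar_isometry : polar^T *m polar = 1%:M.
Proof.
rewrite polar_tr mulNmx /polar -c2rM -scalemxAl -scalemxAr herm_sq scalerA -expr2 sqr_i.
by rewrite scaleN1r c2rN opprK c2r1.
Qed.

Lemma unitary_c2r A : unitary_group (c2r A) <-> adj A *m herm *m A = herm.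
Proof.
split=> [[_]|h].
  rewrite c2r_tr /polar -!c2rM => /c2r_inj; rewrite -!scalemxAr -scalemxAl.
  by move/scalerI; apply; rewrite -normr_eq0 norm_i oner_eq0.
split; first exact: c2r_commutes.
by rewrite c2r_tr /polar -!c2rM -!scalemxAr -scalemxAl h.
Qed.

Lemma unitary_invertible X : unitary_group X -> X \in unitmx.
Proof.
case=> _ h; have := polar_unit; rewrite -h !unitmx_mul => /andP[_ ->] //.
Qed.

Lemma unitary1 : unitary_group 1%:M.
Proof. by split; rewrite ?mulmx1 ?mul1mx // trmx1 mul1mx. Qed.

Lemma unitaryM X Y : unitary_group X -> unitary_group Y -> unitary_group (X *m Y).
Proof.
case=> c1 h1 [c2 h2]; split; first by rewrite -mulmxA c2 mulmxA c1 mulmxA.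
by rewrite trmx_mul -!mulmxA (mulmxA X^T) (mulmxA _ X) h1 mulmxA h2.
Qed.

Lemma unitaryV X : unitary_group X -> unitary_group (invmx X).
Proof.
move=> hX; have uX := unitary_invertible hX; case: hX => c h; split.
  by apply: (can_inj (mulKmx uX)); rewrite !mulmxA mulmxV // mul1mx c mulmxK.
by rewrite -[in LHS]h trmx_inv !mulmxA mulVmx ?unitmx_tr // mul1mx mulmxK.
Qed.

Lemma unitary_polar : unitary_group polar.
Proof. by split; [apply: c2r_commutes|rewrite polar_isometry mul1mx]. Qed.

End UnitaryGroup.

Import numFieldNormedType.Exports.

(** * Cayley curves *)

Section CayleyCurve.
Variables (R : realType) (m : nat).
Local Open Scope classical_set_scope.

Lemma mxderZ (f : R -> R) d (F : R -> 'M[R]_m) A : is_derive (0 : R) 1 f d -> mxder F A ->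
  mxder (fun t => f t *: F t) (d *: F 0 + f 0 *: A).
Proof.
move=> hf hF i j; rewrite (_ : (fun _ => _) = f * (fun t => F t i j)); last first.
  by apply/funext => t; rewrite mxE.
apply: (is_derive_eq (is_deriveM hf (hF i j))).
by rewrite /GRing.scale /= !mxE addrC [F 0 i j * _]mulrC.
Qed.

(** The curve [(1 - tX/2)^(-1) (1 + tX/2)] with velocity [X] at 0. Where the
    inverse does not exist the constant 1 is used, which only matters away
    from 0. The derivative is computed after clearing the denominator, a
    polynomial in [t]. *)
Lemma cayley_curve (X : 'M[R]_m) : exists gamma : R -> 'M[R]_m,
  [/\ gamma 0 = 1%:M, mxder gamma X &
    forall t, gamma t = 1%:M \/
      let Y := (t / 2%:R) *: X in
      1%:M - Y \in unitmx /\ gamma t = invmx (1%:M - Y) *m (1%:M + Y)].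
Proof.
pose Y t := (t / 2%:R) *: X; pose B t := 1%:M + Y t; pose M t := 1%:M - Y t.
pose Mp : 'M[{poly R}]_m := 1%:M - 'X *: map_mx polyC (2%:R^-1 *: X).
have ME t : map_mx (horner_eval t) Mp = M t.
  rewrite /Mp map_mxB map_mx1; congr (_ - _).
  by apply/matrixP => i j; rewrite !mxE /= /horner_eval ?hornerE.
pose q := \det Mp.
have qE t : q.[t] = \det (M t) by rewrite -ME det_map_mx.
have q0 : q.[0] = 1 by rewrite qE /M /Y mul0r scale0r subr0 det1.
have adjE t : \adj (M t) = map_mx (horner_eval t) (\adj Mp) by rewrite -ME map_mx_adj.
have hY : mxder Y (2%:R^-1 *: X).
  apply: (@mxder_scale R m m (fun t => t / 2%:R) 2%:R^-1 X).
  rewrite (_ : (fun _ => _) = (fun t => 2%:R^-1 * t)); first exact: derive_scale_at0.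
  by apply/funext => t; rewrite mulrC.
have Y0 : Y 0 = 0 by rewrite /Y mul0r scale0r.
have hB : mxder B (2%:R^-1 *: X).
  by have := mxderD (mxder_cst 1%:M) hY; rewrite add0r.
have hM : mxder M (- (2%:R^-1 *: X)).
  have := mxderD (mxder_cst 1%:M) (mxder_lin (-%R : {linear 'M[R]_m -> 'M[R]_m}) hY).
  by rewrite add0r.
pose N t := \adj (M t) *m B t.
have [D hN] : exists D, mxder N D.
  have hadj : mxder (fun t => \adj (M t)) (\matrix_(i, j) ((\adj Mp) i j)^`().[0]).
    move=> i j; rewrite mxE (_ : (fun _ => _) = horner ((\adj Mp) i j)); first exact: is_derive_poly.
    by apply/funext => t; rewrite adjE mxE.
  by eexists; apply: mxderM hadj hB.
have adj1 : \adj (M 0) = 1%:M.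
  have M0 : M 0 = 1%:M by rewrite /M Y0 subr0.
  by have := mul_adj_mx (M 0); rewrite {2}M0 mulmx1 -qE q0.
have N0 : N 0 = 1%:M by rewrite /N adj1 /B Y0 addr0 mulmx1.
have hq : is_derive (0 : R) 1 (horner q) q^`().[0] by apply: is_derive_poly.
(* The product rule in [M N = q B], where [q] is the determinant of [M]. *)
have DE : D = X + q^`().[0] *: 1%:M.
  have h1 := mxderM hM hN; have h2 := mxderZ hq hB.
  have e : (fun t => M t *m N t) = (fun t => q.[t] *: B t).
    by apply/funext => t; rewrite /N mulmxA mul_mx_adj mul_scalar_mx qE.
  rewrite e in h1; have := mxder_unique h1 h2.
  rewrite N0 q0 /M /B Y0 subr0 addr0 mulmx1 mul1mx scale1r => /eqP.
  rewrite addrC subr_eq => /eqP ->; rewrite -addrA -scalerDl.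
  have -> : 2%:R^-1 + 2%:R^-1 = 1 :> R by field.
  by rewrite scale1r addrC.
pose Cv t := q.[t]^-1 *: N t.
have hC : mxder Cv X.
  have qn : q.[0] != 0 by rewrite q0 oner_eq0.
  have := mxderZ (is_deriveV qn hq) hN.
  rewrite N0 DE q0 expr1n invr1 scale1r scaleN1r scaleNr addrC.
  by rewrite addrK.
have near0 : \forall t \near (0 : R), q.[t] != 0.
  have cq : (horner q) x @[x --> (0 : R)] --> q.[0] := @continuous_horner R q 0.
  have qn : q.[0] != 0 by rewrite q0 oner_eq0.
  exact: (cvgr_neq0 q.[0] cq qn).
exists (fun t => if q.[t] == 0 then 1%:M else Cv t); split.
- by rewrite q0 oner_eq0 /Cv q0 invr1 scale1r N0.
- move=> i j; apply: (near_eq_is_derive _ (hC i j)).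
  by apply: filterS near0 => t /negPf ->.
move=> t; case: eqP => [_|/eqP qt]; [by left|right].
have uM : M t \in unitmx by rewrite unitmxE -qE unitfE.
split=> //; apply: (can_inj (mulKmx uM)); rewrite mulKVmx //.
by rewrite /Cv -scalemxAr /N mulmxA mul_mx_adj mul_scalar_mx -qE scalerA mulVf // scale1r.
Qed.

End CayleyCurve.

(** * U(1, r) as a reductive algebraic group *)

Section UnitaryHodge.
Variables (R : realType) (r : nat).
Local Notation C := R[i].
Local Open Scope complex_scope.
Local Open Scope classical_set_scope.
Let n := r.+1.
Let m := (n + n)%N.
Let J : 'M[R]_m := cplx R n.
Let Q : 'M[R]_m := polar R r.
Let G := unitary_group (R := R) (r := r).

Definition unitary_lie (X : 'M[R]_m) := X *m J = J *m X /\ X^T *m Q + Q *m X = 0.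

(** Differentiate the two equations of the group. Conversely, the Cayley
    curve of a skew element is unitary. *)
Lemma lie_algebra_unitary X : lie_algebra_of G X <-> unitary_lie X.
Proof.
split=> [[ga [hga ga0 hd]]|[cX sX]].
  split.
    have h1 := mxderM hd (mxder_cst J); have h2 := mxderM (mxder_cst J) hd.
    rewrite mulmx0 addr0 in h1; rewrite mul0mx add0r in h2.
    apply: (mxder_unique h1); rewrite (_ : (fun t => _) = fun t => J *m ga t) //.
    by apply/funext => t; case: (hga t).
  have h1 : mxder (fun t => (ga t)^T *m Q *m ga t) (X^T *m Q + Q *m X).
    have h := mxderM (mxderM (mxder_tr hd) (mxder_cst Q)) hd.
    by move: h; rewrite ga0 trmx1 mulmx0 addr0 mul1mx mulmx1.
  apply: (mxder_unique h1).
  rewrite (_ : (fun t => _) = fun=> Q); first exact: mxder_cst.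
  by apply/funext => t; case: (hga t).
have [ga [ga0 hd hga]] := cayley_curve X; exists ga; split=> // t.
case: (hga t) => [->|[]]; first exact: unitary1.
set Y := _ *: X => ua ->; set a := 1%:M - Y in ua *; set b := 1%:M + Y.
have cY : Y *m J = J *m Y by rewrite /Y -scalemxAl cX scalemxAr.
have ca : a *m J = J *m a by rewrite /a mulmxBl mulmxBr cY mul1mx mulmx1.
have cb : b *m J = J *m b by rewrite /b mulmxDl mulmxDr cY mul1mx mulmx1.
have sY : Y^T *m Q = - (Q *m Y).
  by apply/eqP; rewrite -addr_eq0 /Y linearZ /= -scalemxAl -scalemxAr -scalerDr sX scaler0.
have aQ : a^T *m Q = Q *m b.
  by rewrite /a /b linearB /= trmx1 mulmxBl mul1mx sY opprK mulmxDr mulmx1.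
have bQ : b^T *m Q = Q *m a.
  by rewrite /a /b linearD /= trmx1 mulmxDl mul1mx sY mulmxBr mulmx1.
have ab : invmx a *m b = b *m invmx a.
  apply: (can_inj (mulKmx ua)); rewrite mulKVmx // !mulmxA.
  rewrite (_ : a *m b = b *m a) ?mulmxK //.
  rewrite /a /b; move: (Y) => Y0; rewrite mulmxBl mul1mx mulmxDr mulmx1.
  by rewrite [RHS]mulmxBr mulmx1 mulmxDl mul1mx.
split.
  by apply: (can_inj (mulKmx ua)); rewrite !mulmxA mulmxV // mul1mx cb ca mulmxK.
rewrite {1}ab trmx_mul -!mulmxA (mulmxA b^T) bQ -!mulmxA (mulmxA a) mulmxV // mul1mx.
by rewrite -aQ mulmxA -trmx_mul mulmxV // trmx1 mul1mx.
Qed.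

Import (canonicals, coercions) mpoly.

Lemma unitary_algebraic : algebraic_group G.
Proof.
split; [|exact: unitary1|exact: unitaryM|exact: unitaryV].
pose MP : comNzRingType := mpoly.mpoly (m * m) R.
pose X : 'M[MP]_m := \matrix_(i, j) mpoly.mpolyX R (mpoly.mnm1 (mxvec_index i j)).
pose K (A : 'M[R]_m) : 'M[MP]_m := map_mx (@mpoly.mpolyC (m * m) R) A.
(* The entries of [g J - J g] and [g^T Q g - Q], as polynomials in those of [g]. *)
pose P1 := X *m K J - K J *m X; pose P2 := X^T *m K Q *m X - K Q.
exists (fun p => exists i j, p = P1 i j \/ p = P2 i j) => g.
pose ev : {rmorphism MP -> R} := mpoly.meval (fun k => mxvec g 0 k).
have evX : map_mx ev X = g.
  by apply/matrixP => i j; rewrite !mxE /ev /= mpoly.mevalXU mxvecE.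
have evK A : map_mx ev (K A) = A.
  by apply/matrixP => i j; rewrite !mxE /ev /= mpoly.mevalC.
have e1 : map_mx ev P1 = g *m J - J *m g by rewrite map_mxB !map_mxM evX !evK.
have e2 : map_mx ev P2 = g^T *m Q *m g - Q.
  by rewrite map_mxB !map_mxM -map_trmx evX !evK.
split=> [hg|[ug hp]].
  split; first exact: unitary_invertible hg.
  case: hg => h1 h2; move=> p [i [j [->|->]]].
    have := congr1 (fun A : 'M[R]_m => A i j) e1; rewrite h1 subrr !mxE; exact.
  have := congr1 (fun A : 'M[R]_m => A i j) e2; rewrite h2 subrr !mxE; exact.
split; apply/eqP; rewrite -subr_eq0.
  rewrite -e1; apply/eqP/matrixP => i j; rewrite [LHS]mxE [RHS]mxE; apply: hp.
  by exists i, j; left.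
rewrite -e2; apply/eqP/matrixP => i j; rewrite [LHS]mxE [RHS]mxE; apply: hp.
by exists i, j; right.
Qed.

(** [Q] is itself in the group, so the transpose of [M] is conjugate, inside
    the group, to the inverse of [M]. *)
Lemma unitary_tr M : G M -> M^T = Q *m invmx M *m invmx Q.
Proof.
move=> GM; have uM := unitary_invertible GM; have [_ h] := GM.
apply: (can_inj (mulmxK (polar_unit R r))).
by rewrite mulmxKV ?polar_unit // -[X in _ = X *m _]h mulmxK.
Qed.

(** [A = M - 1] is nilpotent and commutes with its transpose, so [A^T A] is
    symmetric and nilpotent. *)
Lemma orthogonal_unipotent (M : 'M[R]_m) k : M^T *m M = 1%:M ->
  iter k (mulmx (M - 1%:M)) 1%:M = 0 -> M = 1%:M.
Proof.
move=> oM hk; apply/eqP; rewrite -subr_eq0; apply/eqP/tr_mul_eq0.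
have oM' : M *m M^T = 1%:M by exact: mulmx1C.
set A := M - 1%:M in hk *.
have cA : A^T *m A = A *m A^T.
  have -> : A^T = M^T - 1%:M by rewrite /A linearB /= trmx1.
  by rewrite /A !mulmxBl !mulmxBr oM oM' !mulmx1 !mul1mx !opprB addrACA [RHS]addrACA [- M^T + _]addrC.
apply: (@symmetric_nilpotent R m _ k); first by rewrite trmx_mul trmxK.
have e j : iter j (mulmx (A^T *m A)) 1%:M = iter j (mulmx A^T) 1%:M *m iter j (mulmx A) 1%:M.
  elim: j => [|j IH] /=; first by rewrite mulmx1.
  rewrite IH !mulmxA; congr (_ *m _); rewrite -!mulmxA; congr (_ *m _).
  elim: j {IH} => [|j IH] /=; first by rewrite mulmx1 mul1mx.
  by rewrite mulmxA -cA -mulmxA IH mulmxA.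
by rewrite e hk mulmx0.
Qed.

(** A normal unipotent subgroup [N] is stable under transposition by
    [unitary_tr]. So for [M] in [N] the symmetric matrix [M^T M] is
    unipotent, hence 1, and [M] is orthogonal and unipotent. *)
Lemma unitary_reductive : reductive_group G.
Proof.
split=> [|N [_ N1 NM NV] /= NG Nnorm Nuni]; first exact: unitary_algebraic.
rewrite eqEsubset; split=> [M hM|_ ->] //=.
have GM := NG _ hM.
have hT : N M^T by rewrite unitary_tr //; apply: Nnorm (unitary_polar R r) (NV _ hM).
have [k hk] := Nuni _ (NM _ _ hT hM).
have [k' hk'] := Nuni _ hM.
apply: (orthogonal_unipotent _ hk').
apply/eqP; rewrite -subr_eq0; apply/eqP; apply: symmetric_nilpotent hk.
by rewrite linearB /= trmx_mul trmxK trmx1.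
Qed.

End UnitaryHodge.

(** * The circle in U(1, r) *)

Section Circle.
Variables (R : realType) (r : nat).
Local Notation C := R[i].
Local Open Scope complex_scope.
Let n := r.+1.
Let m := (n + n)%N.

(** The basis of eigenvectors of the complex structure: vectors [(a, -ia)],
    on which [c2r A] acts as [A], followed by vectors [(a, ia)], on which it
    acts as the conjugate of [A]. *)
Definition hol_mx : 'M[C]_m := block_mx 1%:M 1%:M (- 'i%C)%:M ('i%C)%:M.
Definition hol_inv : 'M[C]_m :=
  2%:R^-1 *: block_mx 1%:M ('i%C)%:M 1%:M (- 'i%C)%:M.

Lemma hol_invK : hol_inv *m hol_mx = 1%:M.
Proof.
have ii : 'i%C * 'i%C = -1 :> C by rewrite -expr2 sqr_i.
rewrite /hol_inv /hol_mx -scalemxAl mulmx_block !mul1mx -!scalar_mxM !(mulrN, mulNr) ii !opprK.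
rewrite -!raddfD /= subrr raddf0 -scalar_mx_block scale_scalar_mx; congr _%:M.
by field.
Qed.

Lemma hol_mxK : hol_mx *m hol_inv = 1%:M.
Proof. exact: mulmx1C hol_invK. Qed.

Lemma c2r_hol A : mxC (c2r A) *m hol_mx = hol_mx *m block_mx A 0 0 (mx_conj A).
Proof.
rewrite [block_mx A _ _ _](_ : _ = block_mx (mxC (mxRe A) + ('i : C) *: mxC (mxIm A)) 0 0
  (mxC (mxRe A) - ('i : C) *: mxC (mxIm A))); last by rewrite -mx_conj_decomp -mxC_decomp.
rewrite /c2r /hol_mx /mxC map_block_mx -!/(mxC _) mxCN !mulmx_block !(mulmx0, addr0, add0r).
rewrite !mulmx1 !mul1mx !mul_mx_scalar !mul_scalar_mx.
have gen (x : C) X Y : x * x = -1 ->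
    block_mx (X + - x *: - Y) (X + x *: - Y) (Y + - x *: X) (Y + x *: X) =
    block_mx (X + x *: Y) (X - x *: Y) (- x *: (X + x *: Y)) (x *: (X - x *: Y)) :> 'M[C]_m.
  move=> xx; rewrite !scaleNr !scalerN !scalerBr !scalerDr !scalerA xx !scaleN1r !opprK.
  by congr block_mx; rewrite ?opprD ?opprK addrC.
by apply: gen; rewrite -expr2 sqr_i.
Qed.

Definition polyfun (f : C -> R) := exists P : {poly {poly R}},
  forall z, `|z| = 1 -> f z = P.[(complex.Im z)%:P].[complex.Re z].

Lemma polyfun_cst a : polyfun (fun=> a).
Proof. by exists a%:P%:P => z _; rewrite !hornerC. Qed.

Lemma polyfunN f : polyfun f -> polyfun (fun z => - f z).
Proof. by case=> P hP; exists (- P) => z hz; rewrite !hornerN hP. Qed.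

Lemma polyfun_exp k : polyfun (fun z => complex.Re (z ^+ k)) /\ polyfun (fun z => complex.Im (z ^+ k)).
Proof.
elim: k => [|k [[P hP] [Q hQ]]]; first by split; apply: polyfun_cst.
have mulE (x y : C) : complex.Re (x * y) = complex.Re x * complex.Re y - complex.Im x * complex.Im y
  /\ complex.Im (x * y) = complex.Re x * complex.Im y + complex.Im x * complex.Re y.
  by case: x y => a b [c d].
split; [exists ('X%:P * P - 'X * Q)|exists ('X%:P * Q + 'X * P)] => z hz;
  rewrite exprS ?(mulE _ _).1 ?(mulE _ _).2 hP // hQ // !(hornerD, hornerN, hornerM, hornerC, hornerX) //.
Qed.

Lemma circle_poly i j : polyfun (fun z => circle r z i j).
Proof.
have hRe a b : polyfun (fun z => mxRe (circle_mx r z) a b).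
  have [h _] := polyfun_exp (if b == 0 then 3 else 1).
  case: (eqVneq a b) => ab; last first.
    case: (polyfun_cst 0) => P hP; exists P => z hz; rewrite -hP // !mxE (negPf ab) mulr0n //.
  by case: h => P hP; exists P => z hz; rewrite -hP // !mxE ab eqxx mulr1n.
have hIm a b : polyfun (fun z => mxIm (circle_mx r z) a b).
  have [_ h] := polyfun_exp (if b == 0 then 3 else 1).
  case: (eqVneq a b) => ab; last first.
    case: (polyfun_cst 0) => P hP; exists P => z hz; rewrite -hP // !mxE (negPf ab) mulr0n //.
  by case: h => P hP; exists P => z hz; rewrite -hP // !mxE ab eqxx mulr1n.
rewrite -(splitK i) -(splitK j); case: (fintype.split i) => a; case: (fintype.split j) => b /=.
- case: (hRe a b) => P hP; exists P => z hz; rewrite -hP // /circle /c2r block_mxEul //.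
- case: (polyfunN (hIm a b)) => P hP; exists P => z hz; rewrite -hP // /circle /c2r block_mxEur [LHS]mxE //.
- case: (hIm a b) => P hP; exists P => z hz; rewrite -hP // /circle /c2r block_mxEdl //.
- case: (hRe a b) => P hP; exists P => z hz; rewrite -hP // /circle /c2r block_mxEdr //.
Qed.

Lemma norm1_neq0 (z : C) : `|z| = 1 -> z != 0.
Proof. by move=> hz; rewrite -normr_eq0 hz oner_eq0. Qed.

Lemma conj_norm1 (z : C) : `|z| = 1 -> Num.conj z = z^-1.
Proof. by move=> hz; rewrite invC_norm hz expr1n invr1 mul1r. Qed.

Lemma circle_unitary z : `|z| = 1 -> unitary_group (R := R) (circle r z).
Proof.
move=> hz; apply/unitary_c2r; rewrite /adj /mx_conj /circle_mx map_diag_mx tr_diag_mx.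
rewrite /herm -mulmxA !mul_diag_mx; apply/matrixP => i j; rewrite !mxE.
case: (eqVneq i j) => [->|]; rewrite ?mulr0 // !mulr1n.
rewrite rmorphXn /= conj_norm1 // mulrCA exprVn mulVf ?mulr1 //.
by rewrite expf_neq0 // norm1_neq0.
Qed.

Lemma circle_hom_circle : circle_hom (unitary_group (R := R) (r := r)) (circle r).
Proof.
split; [exact: circle_unitary| |exact: circle_poly].
by move=> z w _ _; rewrite /circle circle_mxM c2rM.
Qed.

Lemma circle_opp1 : circle r (-1 : C) = ((-1) ^ 3%:Z)%:M.
Proof.
rewrite -[(-1) ^ 3%:Z]/((-1) ^+ 3) -c2r_real /circle; congr c2r.
apply/matrixP => i j; rewrite !mxE rmorphXn rmorphN1; congr (_ *+ _).
by case: eqP => _; rewrite // expr1 (exprD _ 2 1) sqrrN expr1n mul1r.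
Qed.

Lemma circle_piece_holo (p : int) (a : 'cV[C]_n) : (forall z, circle_mx r z *m a = z ^ (p - (3 - p)) *: a) ->
  hodge_piece (circle r) p (3 - p) (hol_mx *m col_mx a 0).
Proof.
move=> h z hz; rewrite mulmxA c2r_hol -mulmxA mul_block_col !mulmx0 !addr0 mul0mx h.
by rewrite scalemxAr scale_col_mx scaler0.
Qed.

Lemma circle_piece_anti (p : int) (a : 'cV[C]_n) : (forall z, circle_mx r z *m a = z ^ ((3 - p) - p) *: a) ->
  hodge_piece (circle r) p (3 - p) (hol_mx *m col_mx 0 a).
Proof.
move=> h z hz; rewrite mulmxA c2r_hol -mulmxA mul_block_col !mulmx0 !add0r mul0mx.
have -> : mx_conj (circle_mx r z) = circle_mx r z^-1.
  rewrite /mx_conj /circle_mx map_diag_mx; congr diag_mx; apply/rowP => i; rewrite !mxE.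
  by rewrite rmorphXn /= conj_norm1.
by rewrite h scalemxAr scale_col_mx scaler0 exprz_inv opprB.
Qed.

(** On the vectors [(a, -ia)] the circle acts with [z^3] and [z], that is [p
    = 3, 2]; on the vectors [(a, ia)] with the conjugates, that is [p = 0,
    1]. *)
Lemma circle_decomposition (v : 'cV[C]_m) : exists (s : seq int) (w : int -> 'cV[C]_m),
  (forall p, hodge_piece (circle r) p (3 - p) (w p)) /\ v = \sum_(p <- s) w p.
Proof.
pose a := usubmx (hol_inv *m v); pose b := dsubmx (hol_inv *m v).
pose e : 'M[C]_n := delta_mx 0 0.
have he z : circle_mx r z *m e = z ^+ 3 *: e.
  apply/matrixP => i j; rewrite mul_diag_mx !mxE.
  by case: (eqVneq i 0) => i0; rewrite /= ?mulr0.
have he' z : circle_mx r z *m (1%:M - e) = z *: (1%:M - e).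
  apply/matrixP => i j; rewrite mul_diag_mx !mxE.
  case: (eqVneq i 0) => //= ->.
  by rewrite [0 == j]eq_sym; case: (j == 0); rewrite subrr !mulr0.
pose w (p : int) : 'cV[C]_m :=
  if p == 3 then hol_mx *m col_mx (e *m a) 0 else
  if p == 2 then hol_mx *m col_mx ((1%:M - e) *m a) 0 else
  if p == 1 then hol_mx *m col_mx 0 ((1%:M - e) *m b) else
  if p == 0 then hol_mx *m col_mx 0 (e *m b) else 0.
exists [:: 3; 2; 1; 0], w; split=> [p|].
  rewrite /w; case: (eqVneq p 3) => [->|_].
    by apply: (@circle_piece_holo 3) => z; rewrite (_ : 3 - (3 - 3) = 3%:Z) // [LHS]mulmxA he scalemxAl.
  case: (eqVneq p 2) => [->|_].
    by apply: (@circle_piece_holo 2) => z; rewrite [LHS]mulmxA he' scalemxAl.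
  case: (eqVneq p 1) => [->|_].
    by apply: (@circle_piece_anti 1) => z; rewrite [LHS]mulmxA he' scalemxAl.
  case: (eqVneq p 0) => [->|_].
    by apply: (@circle_piece_anti 0) => z; rewrite (_ : 3 - 0 - 0 = 3%:Z) // [LHS]mulmxA he scalemxAl.
  by move=> z _; rewrite mulmx0 scaler0.
have sum4 (H : 'M[C]_m) (a1 a2 b1 b2 : 'cV[C]_n) : H *m col_mx a1 0 + (H *m col_mx a2 0 +
    (H *m col_mx 0 b1 + H *m col_mx 0 b2)) = H *m col_mx (a1 + a2) (b1 + b2).
  by rewrite -!mulmxDr !add_col_mx !add0r !addr0.
have -> : \sum_(p <- [:: 3; 2; 1; 0]) w p = w 3 + (w 2 + (w 1 + w 0)).
  move: w => w'; by rewrite !big_cons big_nil addr0.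
rewrite (sum4 _ (e *m a) ((1%:M - e) *m a) ((1%:M - e) *m b) (e *m b)).
rewrite -!mulmxDl [e + _]addrC !subrK !mul1mx.
by rewrite vsubmxK mulmxA hol_mxK mul1mx.
Qed.

(** Invariance gives [Q(u, v) = z^k Q(u, v)] with [k <> 0]; take [z] with
    [z^k = -1]. *)
Lemma circle_orthogonality (p q x y : int) (u v : 'cV[C]_m) :
  p + q = 3 -> x + y = 3 -> hodge_piece (circle r) p q u -> hodge_piece (circle r) x y v ->
  ~ (q = x /\ p = y) -> bilin (polar R r) u v = 0.
Proof.
move=> pq xy hu hv hne; pose k := (p - q) + (x - y).
have k0 : k%:~R != 0 :> R by rewrite intr_eq0; apply/eqP => k0; apply: hne; lia.
pose z := cis (pi / k%:~R : R).
have hz : `|z| = 1 by exact: norm_cis.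
have zk : z ^ k = -1.
  by rewrite cisX mulrC divfK // /cis cospi sinpi; apply/eqP; rewrite eq_complex /= oppr0 !eqxx.
have e : bilin (polar R r) u v = z ^ k * bilin (polar R r) u v.
  have [_ h] := circle_unitary hz.
  rewrite {1}/bilin -{1}h !mxCM mxC_tr -!mulmxA hv // !mulmxA -trmx_mul hu //.
  have -> : (z ^ (p - q) *: u)^T = z ^ (p - q) *: u^T by rewrite linearZ.
  rewrite -scalemxAr -!scalemxAl scalerA mxE [_ * z ^ _]mulrC -expfzDr ?norm1_neq0 //.
have : 2%:R * bilin (polar R r) u v = 0.
  by rewrite mulr_natl mulr2n {1}e zk mulN1r addNr.
by move/eqP; rewrite mulf_eq0 pnatr_eq0 => /eqP.
Qed.

Lemma circle_positivity (v : 'cV[C]_m) : v <> 0 ->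
  0 < bilin (polar R r) v (mxC (circle r 'i%C) *m mx_conj v).
Proof.
move=> v0; rewrite /bilin -!mulmxA (mulmxA (mxC (polar R r))) -mxCM polar_circle_i mxC_scalar mul1mx.
rewrite mxE lt_neqAle eq_sym; have h i : 0 <= v^T 0 i * (mx_conj v) i 0.
  by rewrite !mxE -normCK exprn_ge0.
rewrite sumr_ge0 // andbT; apply: contra_notN v0 => /eqP/psumr_eq0P h0.
apply/matrixP => i j; rewrite (ord1 j) mxE; have := h0 (fun i _ => h i) i isT.
by rewrite !mxE -normCK => /eqP; rewrite sqrf_eq0 normr_eq0 => /eqP.
Qed.

Lemma circle_nonconstant : exists z w : C, [/\ `|z| = 1, `|w| = 1 & circle r z <> circle r w].
Proof.
exists 1, (-1); split; [exact: normr1|exact: normrN1|].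
have e (z : C) : circle_mx r z 0 0 = z ^+ 3 by rewrite /circle_mx mxE mxE.
have e3 : (-1 : C) ^+ 3 = -1 by rewrite -signr_odd expr1.
move=> h; have h' : circle_mx r (1 : C) = circle_mx r (-1) := c2r_inj h.
have eq3 : (1 : C) ^+ 3 = (-1) ^+ 3 :=
  etrans (esym (e 1)) (etrans (congr1 (fun A : 'M[C]_n => A 0 0) h') (e (-1))).
have /eqP : (1 : C) = -1 := etrans (esym (expr1n C 3)) (etrans eq3 e3).
by rewrite -addr_eq0 -mulr2n pnatr_eq0.
Qed.

Lemma circle_hodge_rep : group_hodge_rep 3 (polar R r) (unitary_group (R := R) (r := r)) (circle r).
Proof.
split.
- exact: unitary_reductive.
- exact: polar_unit.
- by rewrite polar_tr -[(-1) ^ 3]/((-1) ^+ 3) (exprD _ 2 1) sqrrN expr1n mul1r expr1 scaleN1r opprK.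
- by move=> g [].
- exact: circle_hom_circle.
- exact: circle_nonconstant.
- exact: circle_opp1.
- exact: circle_decomposition.
- exact: circle_orthogonality.
- exact: circle_positivity.
Qed.

Definition hodge_wt (i : 'I_n) : nat := if i == 0 then 3 else 1.

Definition circle_velocity : 'M[R]_m :=
  c2r (diag_mx (\row_i ('i%C * ((hodge_wt i)%:R * (2%:R * pi) : R)%:C))).

Definition grading : 'M[C]_m := (4%:R * (pi : R)%:C * 'i%C)^-1 *: mxC circle_velocity.

Lemma circle_grading : is_grading_element (circle r) grading.
Proof.
exists circle_velocity; split=> // i j.
pose a (k : 'I_n) : R := (hodge_wt k)%:R * (2%:R * pi).
have E t (k l : 'I_n) : circle_mx r (cis (2%:R * pi * t)) k l = cis (a k * t) *+ (k == l).
  rewrite !mxE; congr (_ *+ _); rewrite -/(hodge_wt k) -[_ ^+ _]/(cis _ ^ (hodge_wt k)%:Z) cisX.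
  by rewrite -pmulrn mulrA.
have Ev (k l : 'I_n) : diag_mx (\row_i ('i%C * ((hodge_wt i)%:R * (2%:R * pi) : R)%:C)) k l = ('i%C * (a k)%:C) *+ (k == l).
  by rewrite !mxE.
have hRe (k l : 'I_n) : is_derive (0 : R) 1 (fun t => mxRe (circle_mx r (cis (2%:R * pi * t))) k l) 0.
  rewrite (_ : (fun t => _) = fun t => cos (a k * t) *+ (k == l)).
    case: (k == l); [exact: derive_cos_at0|exact: is_derive_cst].
  by apply/funext => t; rewrite mxE E; case: (k == l).
have hIm (k l : 'I_n) : is_derive (0 : R) 1 (fun t => mxIm (circle_mx r (cis (2%:R * pi * t))) k l) (a k *+ (k == l)).
  rewrite (_ : (fun t => _) = fun t => sin (a k * t) *+ (k == l)).
    case: (k == l); [exact: derive_sin_at0|exact: is_derive_cst].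
  by apply/funext => t; rewrite mxE E; case: (k == l).
have vRe (k l : 'I_n) : mxRe (diag_mx (\row_i ('i%C * ((hodge_wt i)%:R * (2%:R * pi) : R)%:C))) k l = 0.
  by rewrite mxE Ev; case: (k == l) => //=; rewrite mul0r mul1r subrr.
have vIm (k l : 'I_n) : mxIm (diag_mx (\row_i ('i%C * ((hodge_wt i)%:R * (2%:R * pi) : R)%:C))) k l = a k *+ (k == l).
  by rewrite mxE Ev; case: (k == l) => //=; rewrite mul0r mul1r add0r.
rewrite /circle_velocity -(splitK i) -(splitK j); case: (fintype.split i) => k; case: (fintype.split j) => l /=.
- rewrite /c2r block_mxEul vRe (_ : (fun t => _) = fun t => mxRe (circle_mx r (cis (2%:R * pi * t))) k l) //.
  by apply/funext => t; rewrite /circle /c2r block_mxEul.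
- rewrite /c2r block_mxEur [X in is_derive _ _ _ X]mxE vIm.
  rewrite (_ : (fun t => _) = fun t => - mxIm (circle_mx r (cis (2%:R * pi * t))) k l).
    exact: is_deriveN (hIm k l).
  by apply/funext => t; rewrite /circle /c2r block_mxEur mxE.
- rewrite /c2r block_mxEdl vIm (_ : (fun t => _) = fun t => mxIm (circle_mx r (cis (2%:R * pi * t))) k l) //.
  by apply/funext => t; rewrite /circle /c2r block_mxEdl.
- rewrite /c2r block_mxEdr vRe (_ : (fun t => _) = fun t => mxRe (circle_mx r (cis (2%:R * pi * t))) k l) //.
  by apply/funext => t; rewrite /circle /c2r block_mxEdr.
Qed.

End Circle.

(** * The Lie algebra u(1, r) and its complexification *)

Section UnitaryAlgebra.
Variables (R : realType) (r : nat).
Local Notation C := R[i].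
Local Open Scope complex_scope.
Let n := r.+1.
Let m := (n + n)%N.
Local Notation hm := (herm R r).
Variable g : {vspace 'M[R]_m}.
Hypothesis hg : forall X, X \in g <-> lie_algebra_of (unitary_group (R := R) (r := r)) X.
Let L := complexify g.

(** The Lie algebra [u(1, r)] as complex matrices. *)
Definition skew (A : 'M[C]_n) := adj A *m hm + hm *m A = 0.

Lemma c2r0 : c2r (0 : 'M[C]_n) = 0.
Proof. by rewrite -(subrr (0 : 'M[C]_n)) c2rD c2rN subrr. Qed.

Lemma unitary_c2rP A : c2r A \in g <-> skew A.
Proof.
apply: (iff_trans (hg _)); apply: (iff_trans (lie_algebra_unitary _)); split=> [[_]|h].
  rewrite c2r_tr /polar -!c2rM -c2rD -!scalemxAr -scalemxAl -scalerDr => h.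
  have : 'i%C *: (adj A *m hm + hm *m A) = 0.
    by apply: c2r_inj; rewrite h c2r0.
  by move/eqP; rewrite scaler_eq0 -normr_eq0 norm_i oner_eq0 => /eqP.
split; first exact: c2r_commutes.
rewrite c2r_tr /polar -!c2rM -c2rD -!scalemxAr -scalemxAl -scalerDr h scaler0; exact: c2r0.
Qed.

Lemma unitary_form X : X \in g -> exists A, X = c2r A /\ skew A.
Proof.
move=> hX; have /hg/lie_algebra_unitary[/c2r_of_commutes e _] := hX.
by eexists; split; [exact: e|apply/unitary_c2rP; rewrite -e].
Qed.

Lemma skew_conj A : skew A -> mx_conj A = - (hm *m A^T *m hm).
Proof.
move/eqP; rewrite addr_eq0 => /eqP h.
have : adj A = - (hm *m A *m hm) by rewrite -mulNmx -h -mulmxA herm_sq mulmx1.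
move/(congr1 trmx); rewrite /adj trmxK linearN /= !trmx_mul => ->.
by rewrite /herm tr_diag_mx mulmxA.
Qed.

(** [gl(r+1)] is the complexification of [u(1, r)]. *)
Lemma skew_decomp A : exists A1 A2, [/\ skew A1, skew A2 & A = A1 + 'i%C *: A2].
Proof.
have i2 : ('i%C : C) * 'i%C = -1 by rewrite -expr2 sqr_i.
have ci : Num.conj ('i%C : C) = - 'i%C.
  by apply/eqP; rewrite conjE eq_complex /= oppr0 !eqxx.
have c2 : Num.conj (2%:R^-1 : C) = 2%:R^-1 by rewrite fmorphV rmorph_nat.
(* [- B] is the conjugate of [A] for the real form, so [A1] and [i A2] are half
   the sum and half the difference of [A] and [- B]. *)
pose B := hm *m adj A *m hm.
have aB : adj B = hm *m A *m hm by rewrite /B !adjM adjK adj_herm mulmxA.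
have hB : hm *m B = adj A *m hm by rewrite /B !mulmxA herm_sq mul1mx.
have Bh : hm *m A *m hm *m hm = hm *m A by rewrite -mulmxA herm_sq mulmx1.
have adjD' (X Y : 'M[C]_n) : adj (X + Y) = adj X + adj Y by rewrite /adj mx_conjD linearD.
have adjN' (X : 'M[C]_n) : adj (- X) = - adj X by rewrite -scaleN1r adjZ rmorphN1 scaleN1r.
exists (2%:R^-1 *: (A - B)), ((- 'i%C * 2%:R^-1) *: (A + B)); split.
- rewrite /skew adjZ c2 adjD' adjN' aB -scalemxAl -scalemxAr -scalerDr.
  by rewrite mulmxBl Bh mulmxBr hB addrA subrK subrr scaler0.
- rewrite /skew adjZ rmorphM rmorphN /= ci c2 opprK adjD' aB -scalemxAl -scalemxAr mulNr scaleNr.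
  by rewrite -scalerBr mulmxDl Bh mulmxDr hB [hm *m A + _]addrC subrr scaler0.
rewrite scalerA mulrA mulrN i2 opprK mul1r -scalerDr [A + B]addrC addrA subrK.
by apply/matrixP => i j; rewrite !mxE; field.
Qed.

(** The matrix in the basis [hol_mx]. For elements of the complexified Lie
    algebra it has two diagonal blocks, and the first determines the second. *)
Definition holo (Z : 'M[C]_m) : 'M[C]_m := hol_inv R r *m Z *m hol_mx R r.
(** The standard representation of [gl(r+1)]. *)
Definition Uholo (Z : 'M[C]_m) : 'M[C]_n := ulsubmx (holo Z).

Lemma holoM Z W : holo (Z *m W) = holo Z *m holo W.
Proof.
by rewrite /holo -!mulmxA (mulmxA (hol_mx R r)) hol_mxK mul1mx.
Qed.

Lemma holoD Z W : holo (Z + W) = holo Z + holo W.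
Proof. by rewrite /holo mulmxDr mulmxDl. Qed.

Lemma holoZ a Z : holo (a *: Z) = a *: holo Z.
Proof. by rewrite /holo -scalemxAr -scalemxAl. Qed.

Lemma holo_inj Z W : holo Z = holo W -> Z = W.
Proof.
move=> e; have : hol_mx R r *m holo Z *m hol_inv R r = hol_mx R r *m holo W *m hol_inv R r by rewrite e.
by rewrite /holo !mulmxA hol_mxK !mul1mx -!mulmxA hol_mxK !mulmx1.
Qed.

Lemma holo_c2r A : holo (mxC (c2r A)) = block_mx A 0 0 (mx_conj A).
Proof. by rewrite /holo -mulmxA c2r_hol mulmxA hol_invK mul1mx. Qed.

Lemma UholoD Z W : Uholo (Z + W) = Uholo Z + Uholo W.
Proof. by rewrite /Uholo holoD; apply/matrixP => i j; rewrite !mxE. Qed.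

Lemma UholoZ a Z : Uholo (a *: Z) = a *: Uholo Z.
Proof. by rewrite /Uholo holoZ; apply/matrixP => i j; rewrite !mxE. Qed.

Lemma Uholo_c2r A : Uholo (mxC (c2r A)) = A.
Proof. by rewrite /Uholo holo_c2r block_mxKul. Qed.

Lemma holo_L Z : Z \in L -> holo Z = block_mx (Uholo Z) 0 0 (- (hm *m (Uholo Z)^T *m hm)).
Proof.
move/complexifyP=> [/unitary_form[A [eA sA]] /unitary_form[B [eB sB]]].
rewrite /Uholo [Z]mxC_decomp eA eB holoD holoZ !holo_c2r !skew_conj // scale_block_mx !scaler0.
rewrite add_block_mx !addr0 block_mxKul; congr block_mx.
by rewrite linearD linearZ /= mulmxDr mulmxDl -scalemxAr -scalemxAl opprD scalerN.
Qed.

Lemma Uholo_rep : is_rep L Uholo.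
Proof.
split=> [a X Y _ _|X Y hX hY]; first by rewrite UholoD UholoZ.
rewrite /lie {1}/Uholo (_ : holo (X *m Y - Y *m X) = holo X *m holo Y - holo Y *m holo X).
  have [A ->] : exists A, holo X = block_mx (Uholo X) 0 0 A by eexists; exact: holo_L.
  have [B ->] : exists B, holo Y = block_mx (Uholo Y) 0 0 B by eexists; exact: holo_L.
  move: (Uholo X) (Uholo Y) => X1 Y1.
  by rewrite !mulmx_block !mulmx0 !addr0 opp_block_mx add_block_mx block_mxKul.
by rewrite -scaleN1r holoD holoZ !holoM scaleN1r.
Qed.

Lemma Uholo_inj Z : Z \in L -> Uholo Z = 0 -> Z = 0.
Proof.
move=> /holo_L e U0; apply: holo_inj; rewrite e U0 trmx0 mulmx0 mul0mx oppr0.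
by rewrite /holo mulmx0 mul0mx block_mx0.
Qed.

Lemma Uholo_onto A : exists Z, Z \in L /\ Uholo Z = A.
Proof.
have [A1 [A2 [s1 s2 ->]]] := skew_decomp A.
exists (mxC (c2r A1) + 'i%C *: mxC (c2r A2)); split.
  by rewrite memvD ?memvZ // mxC_complexify //; apply/unitary_c2rP.
by rewrite UholoD UholoZ !Uholo_c2r.
Qed.

Lemma onto_transitive (K : fieldType) d (u v : 'cV[K]_d) : v <> 0 -> exists A : 'M[K]_d, A *m v = u.
Proof.
move=> /eqP v0; have [i hi] : exists i, v i 0 != 0.
  apply/existsP; apply: contraNT v0; rewrite negb_exists => /forallP h0.
  by apply/eqP/matrixP => p q; rewrite (ord1 q) (eqP (negbNE (h0 p))) mxE.
exists (u *m ((v i 0)^-1 *: delta_mx 0 i)); rewrite -mulmxA -scalemxAl -rowE.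
have -> : row i v = (v i 0)%:M by rewrite [LHS]mx11_scalar mxE.
by rewrite scale_scalar_mx mulVf // mulmx1.
Qed.

Lemma Uholo_irreducible : irreducible_rep L Uholo.
Proof.
split=> // W hW; case: (eqVneq W 0%VS) => [|W0]; [by left|right].
apply/eqP; rewrite eqEsubv subvf /=; apply/subvP => u _.
have [|A <-] := @onto_transitive C n u (vpick W); first by apply/eqP; rewrite vpick0.
have [Z [hZ <-]] := Uholo_onto A.
by apply: hW; rewrite ?memv_pick.
Qed.

(** The identity would act as minus itself. *)
Lemma Uholo_not_self_dual : ~ rep_iso L Uholo (dual_rep Uholo).
Proof.
move=> [P [P' [PP _ hP]]]; have [Z [hZ UZ]] := Uholo_onto 1%:M.
have := hP Z hZ; rewrite /dual_rep UZ trmx1 mulmx1 mulNmx mul1mx => /eqP.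
rewrite -addr_eq0 -mulr2n -scaler_nat scaler_eq0 pnatr_eq0 => /eqP P0.
move: PP; rewrite P0 mul0mx => /matrixP/(_ 0 0)/eqP.
by rewrite !mxE eqxx eq_sym oner_eq0.
Qed.

(** The two blocks of [holo] are the standard representation and, up to
    conjugation by the Hermitian form, its dual. *)
Lemma Uholo_type : has_type g id Uholo ComplexType.
Proof.
split; last exact: Uholo_not_self_dual.
have bb : block_mx 1%:M 0 0 hm *m block_mx 1%:M 0 0 hm = 1%:M :> 'M[C]_m.
  by rewrite mulmx_block !(mulmx0, mul0mx, addr0, add0r) mulmx1 herm_sq -scalar_mx_block.
exists (block_mx 1%:M 0 0 hm *m hol_inv R r), (hol_mx R r *m block_mx 1%:M 0 0 hm); split.
- by rewrite -mulmxA (mulmxA (hol_inv R r)) hol_invK mul1mx bb.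
- by rewrite mulmxA -(mulmxA (hol_mx R r)) bb mulmx1 hol_mxK.
move=> Z hZ; rewrite complexify_rep_id.
have heq : hol_inv R r *m Z = holo Z *m hol_inv R r by rewrite /holo -!mulmxA hol_mxK mulmx1.
rewrite -mulmxA heq mulmxA [RHS]mulmxA; congr (_ *m _).
have -> : holo Z = block_mx (Uholo Z) 0 0 (- (hm *m (Uholo Z)^T *m hm)) by exact: holo_L.
rewrite /sum_rep /dual_rep; move: (Uholo Z) => A; rewrite !mulmx_block !mulmx0 !mul0mx !addr0 !add0r.
by rewrite mulmx1 mul1mx mulmxN !mulmxA herm_sq mul1mx mulNmx.
Qed.

(** A real subspace stable under [u(1, r)] is complex, because [i] is in
    [u(1, r)], and then stable under all complex matrices. *)
Lemma unitary_irreducible : irreducible_rep g id.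
Proof.
split=> // W hW; case: (eqVneq W 0%VS) => [|W0]; [by left|right].
pose c2v (v : 'cV[C]_n) : 'cV[R]_m := col_mx (mxRe v) (mxIm v).
have c2v_on w : exists v, c2v v = w.
  exists (mxC (usubmx w) + 'i%C *: mxC (dsubmx w)).
  by rewrite /c2v mxRe_comb mxIm_comb vsubmxK.
have c2vD v w : c2v (v + w) = c2v v + c2v w by rewrite /c2v mxReD mxImD add_col_mx.
have c2vM A v : c2v (A *m v) = c2r A *m c2v v.
  rewrite /c2v /c2r mul_block_col {1 2}[A]mxC_decomp mulmxDl -scalemxAl mxReD mxImD mxReZ mxImZ /=.
  rewrite !mxRe_mulC !mxIm_mulC !scale0r !scale1r add0r add0r mulNmx addrC; congr col_mx; exact: addrC.
have sk A v : skew A -> c2v v \in W -> c2v (A *m v) \in W.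
  by move=> sA hv; rewrite c2vM; apply: hW => //; apply/unitary_c2rP.
have ski : skew (('i%C)%:M).
  rewrite /skew /adj /mx_conj map_scalar_mx tr_scalar_mx /= mul_scalar_mx mul_mx_scalar -scalerDl.
  rewrite (_ : _ + _ = 0) ?scale0r //.
  by apply/eqP; rewrite conjE eq_complex /= addr0 addNr !eqxx.
have all A v : c2v v \in W -> c2v (A *m v) \in W.
  move=> hv; have [A1 [A2 [s1 s2 ->]]] := skew_decomp A.
  rewrite mulmxDl -mul_scalar_mx -mulmxA c2vD memvD ?sk //.
apply/eqP; rewrite eqEsubv subvf /=; apply/subvP => u _.
have [v vE] := c2v_on (vpick W); have [w <-] := c2v_on u.
have [|A <-] := @onto_transitive C n w v; last by apply: all; rewrite vE memv_pick.
move=> v0; move/negP: W0; apply; rewrite -vpick0 -vE v0 /c2v.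
by apply/eqP; rewrite -[0 in RHS](vsubmxK 0); congr col_mx; apply/matrixP => i j; rewrite !mxE.
Qed.

(** A central element corresponds to a scalar matrix, which is skew exactly
    when it is imaginary. *)
Lemma unitary_center_dim : \dim (lie_center g) = 1%N.
Proof.
have J0 : cplx R n != 0.
  apply/eqP => /(congr1 dlsubmx); rewrite cplxE block_mxKdl => /matrixP/(_ 0 0)/eqP.
  by rewrite !mxE eqxx oner_eq0.
suff -> : lie_center g = <[cplx R n]>%VS by rewrite dim_vline J0.
apply/eqP; rewrite eqEsubv; apply/andP; split; apply/subvP => X.
  move=> hX; have /centerP[Xg _] := hX; have [A [XA sA]] := unitary_form Xg.
  have /centerP[_ hc] := center_complexify hX.
  have comm B : A *m B = B *m A.
    have [Z [hZ <-]] := Uholo_onto B; apply/eqP; rewrite -subr_eq0 -/(lie _ _).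
    rewrite -[A]Uholo_c2r -XA -Uholo_rep.2 ?mxC_complexify // hc //.
    by rewrite -[0](scale0r 0) UholoZ scale0r.
  have Aa : A = (A 0 0)%:M.
    apply/matrixP => i p; have /matrixP/(_ i 0) := comm (delta_mx p 0).
    rewrite -[p in RHS]/p !mxE (bigD1 p) //= big1 => [|k kp]; last by rewrite mxE (negPf kp) mulr0.
    rewrite (bigD1 0) //= big1 => [|k k0]; last by rewrite mxE (negPf k0) andbF mul0r.
    by rewrite !mxE !eqxx andbT mulr1 !addr0 => ->; case: (i == p); rewrite ?mul1r ?mul0r.
  have reA : complex.Re (A 0 0) = 0.
    move: sA; rewrite /skew {1 2}Aa /adj /mx_conj map_scalar_mx tr_scalar_mx /= mul_scalar_mx mul_mx_scalar.
    move/matrixP/(_ 0 0); rewrite -scalerDl !mxE eqxx !mulr1n mulr1 conjE; case: (A 0 0) => x y [/eqP].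
    by rewrite -mulr2n mulrn_eq0 => /eqP.
  apply/vlineP; exists (complex.Im (A 0 0)); rewrite XA /cplx -c2rZ scale_scalar_mx; congr c2r.
  rewrite {1}Aa; congr _%:M; move: reA; case: (A 0 0) => x y /= ->.
  by apply/eqP; rewrite eq_complex /= !mulr0 !mul0r subrr addr0 mulr1 !eqxx.
move=> /vlineP[a ->]; apply: memvZ; apply/centerP.
have ski : skew (('i%C)%:M).
  rewrite /skew /adj /mx_conj map_scalar_mx tr_scalar_mx /= mul_scalar_mx mul_mx_scalar -scalerDl.
  rewrite (_ : _ + _ = 0) ?scale0r //.
  by apply/eqP; rewrite conjE eq_complex /= addr0 addNr !eqxx.
split=> [|Y hY]; first exact/unitary_c2rP.
by have /hg/lie_algebra_unitary[cY _] := hY; rewrite /lie cY subrr.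
Qed.

End UnitaryAlgebra.

(** * Existence of both tuples *)

Section UnitaryDatum.
Variables (R : realType) (r : nat) (rv : bool).
Hypothesis r0 : (0 < r)%N.
Local Notation C := R[i].
Local Open Scope complex_scope.
Let n := r.+1.
Let m := (n + n)%N.
Local Notation U := (@Uholo R r).

Lemma Uholo_grading : U (grading R r) = diag_mx (\row_i ((hodge_wt i)%:R / 2%:R)).
Proof.
rewrite /grading UholoZ /circle_velocity Uholo_c2r; apply/matrixP => i j; rewrite !mxE.
have pi0 : (pi : R)%:C != 0 :> C by rewrite eq_complex /= eqxx andbT gt_eqF // pi_gt0.
have i0 : ('i%C : C) != 0 by rewrite -normr_eq0 norm_i oner_eq0.
have aux (x y c : C) : x != 0 -> y != 0 ->
    (4%:R * x * y)^-1 * (y * (c * (2%:R * x))) = c / 2%:R.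
  by move=> x0 y0; field; rewrite y0.
rewrite mulrnAr; congr (_ *+ _); rewrite !rmorphM /= !rmorph_nat; exact: aux.
Qed.

Definition sl_c : rat := (r + 3)%:R / (2 * (r + 1))%:R.

Lemma sl_c_neq0 : sl_c != 0.
Proof. by rewrite mulf_neq0 ?invr_neq0 // pnatr_eq0; lia. Qed.

(** This is why [c = (r+3)/(2(r+1))]: the matrix [E - c] has trace 0. *)
Lemma sl_c_trace : \sum_(i : 'I_n) ((hodge_wt i)%:R / 2%:R - ratr sl_c : C) = 0.
Proof.
rewrite sumrB sumr_const card_ord big_ord_recl /=.
rewrite (eq_bigr (fun=> 1 / 2%:R)) // sumr_const card_ord /hodge_wt /=.
have n0 : (r.+1)%:R != 0 :> C by rewrite pnatr_eq0.
rewrite /sl_c fmorph_div /= !rmorph_nat natrM natrD -[_ / _ *+ r.+1]mulr_natr -[_ *+ r]mulr_natr.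
rewrite (natrD _ r 1) -natr1 in n0 *.
by field.
Qed.

Lemma label_eq0 (i : 'I_r) :
  (label rv i == 0 :> nat) = (i.+1 == (if rv then r else 1)%N :> nat).
Proof. by rewrite /label; case: rv => //=; have := ltn_ord i; lia. Qed.

Lemma unitary_datum : exists D : hodge_datum R,
  simple_level_one D /\ has_sl_tuple D r (if rv then r else 1%N).
Proof.
have [g hg] : exists g : {vspace 'M[R]_m}, forall X, X \in g <-> lie_algebra_of (unitary_group (R := R) (r := r)) X.
  have [|g hg] := @vspace_of_pred R _ (fun X : 'M[R]_m => unitary_lie X).
    split=> [|a X Y [c1 s1] [c2 s2]]; first by split; rewrite ?mulmx0 ?mul0mx // trmx0 mul0mx addr0.
    split; first by rewrite mulmxDl mulmxDr -scalemxAl -scalemxAr c1 c2.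
    rewrite linearD linearZ /= mulmxDl mulmxDr -scalemxAl -scalemxAr addrACA -scalerDr s1 s2.
    by rewrite scaler0 addr0.
  by exists g => X; apply: (iff_trans (hg X)); apply: iff_sym; exact: lie_algebra_unitary.
pose L := complexify g.
have rU : is_rep L U := Uholo_rep hg.
have Uinj Z : Z \in L -> U Z = 0 -> Z = 0 := @Uholo_inj R r g hg Z.
have Uonto A : exists Z, Z \in L /\ U Z = A := @Uholo_onto R r g hg A.
have clL : lie_closed L := complexify_closed (lie_algebra_closed (circle_hodge_rep R r) hg).
have [t ht] : exists t : {vspace 'M[C]_m}, forall Z, Z \in t <-> Z \in L /\ exists D, U Z = diag_mx D.
  apply: vspace_of_pred; split=> [|a X Y [hX [D1 e1]] [hY [D2 e2]]].
    by split; [exact: mem0v|exists 0; rewrite (rep0 rU) linear0].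
  split; first by rewrite memvD ?memvZ.
  by exists (a *: D1 + D2); rewrite rU.1 // e1 e2 linearD linearZ.
pose E := grading R r.
have vg : circle_velocity R r \in g.
  apply/(unitary_c2rP hg); rewrite /skew /adj /mx_conj map_diag_mx tr_diag_mx /herm !mul_diag_mx.
  apply/matrixP => i j; rewrite !mxE; case: (eqVneq i j) => [->|]; last by rewrite !mulr0n !mulr0 addr0.
  rewrite !mulr1n [_ * ('i%C * _)]mulrC -mulrDl; set x : R := _ * _.
  rewrite (_ : _ + _ = 0) ?mul0r //.
  have conj_i (y : R) : conjc ('i%C * y%:C) + 'i%C * y%:C = 0.
    by apply/eqP; rewrite eq_complex /= !(mul0r, mulr0, mul1r, subrr, oppr0, addr0, add0r) addNr !eqxx.
  exact: conj_i.
have EL : E \in L by rewrite memvZ // mxC_complexify.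
have Et : E \in t by apply/ht; split=> //; eexists; exact: Uholo_grading.
have [E' [E'L UE']] := Uonto (ratr sl_c)%:M.
have E't : E' \in t by apply/ht; split=> //; exists (const_mx (ratr sl_c)); rewrite UE' diag_const_mx.
have E'c : E' \in lie_center L by apply: (gl_center clL rU Uinj E'L); exists (ratr sl_c).
pose ss := derived L; pose h := (t :&: ss)%VS.
have USS : U (E - E') = diag_mx (\row_i ((hodge_wt i)%:R / 2%:R - ratr sl_c)).
  rewrite (repB rU) // Uholo_grading UE' -diag_const_mx -linearB /=; congr diag_mx.
  by apply/rowP => i; rewrite !mxE.
have SSs : E - E' \in ss.
  apply/(gl_derived clL rU Uinj Uonto); split; first by rewrite memvB.
  by rewrite USS mxtrace_diag -[RHS]sl_c_trace; apply: eq_bigr => i _; rewrite mxE.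
have SSh : E - E' \in h by rewrite memv_cap SSs andbT memvB.
pose Ess : subvs_of h := vsproj h (E - E').
have EssE : vsval Ess = E - E' by rewrite /Ess vsprojK.
have wtE i : wt U i Ess = (hodge_wt i)%:R / 2%:R - ratr sl_c.
  by rewrite /wt EssE USS !mxE eqxx.
have hs : (h <= ss)%VS by exact: capvSr.
have rS : is_rep ss U := gl_rep_ss clL rU.
have Sinj := gl_inj_ss clL Uinj.
have Str := gl_tr_ss clL rU Uinj Uonto.
have Sim := gl_im_ss clL rU Uinj Uonto.
have hP := gl_hP clL ht.
have Scl : lie_closed ss := ss_closed clL.
pose alpha := sl_alpha hs rS rv.
have [av hav] : exists av : r.-tuple (subvs_of h), forall i k, wt U k (tnth av i) =
    (k == lo (label rv i))%:R - (k == hi (label rv i))%:R.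
  have [f hf] := boolp.choice (fun i => test_element Sim hP (lo_hi (label rv i))).
  by exists [tuple f i | i < r] => i k; rewrite tnth_mktuple; exact: hf.
have aE i : tnth alpha i Ess = (label rv i == 0 :> nat)%:R :> C.
  rewrite sl_alphaE !wtE /hodge_wt -!val_eqE /= opprB addrA subrK.
  by case: (nat_of_ord (label rv i) == 0) => /=; [field|rewrite subrr].
have muE : eps hs rS 0 Ess = 3%:R / 2%:R - ratr sl_c :> C by rewrite epsE wtE.
have mu'E : eps hs rS ord_max Ess = 1 / 2%:R - ratr sl_c :> C.
  by rewrite epsE wtE /hodge_wt -val_eqE /= gtn_eqF.
have pr1 : lie_hodge_rep g E.
  exists 3, (polar R r), (unitary_group (R := R) (r := r)), (circle r).
  by split; [exact: circle_hodge_rep|exact: hg|exact: circle_grading].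
have pr2 : forall i, tnth alpha i Ess = 0 \/ tnth alpha i Ess = 1.
  by move=> i; rewrite aE; case: eqP => _; [right|left].
have pr3 : ratr sl_c = 3%:R / 2%:R - (eps hs rS 0 Ess : C) by rewrite muE opprB addrC subrK.
have pr4 : \dim (lie_center g) = (sl_c != 0) by rewrite sl_c_neq0 (unitary_center_dim hg).
have pr5 : E = vsval Ess + E' by rewrite EssE subrK.
pose D := @HodgeDatum R m g E pr1 (unitary_irreducible hg) t (gl_cartan clL rU Uinj Uonto ht) Et
  Ess E' E'c pr5 r alpha av (sl_simple_roots hs rS Sinj Str Sim hP Scl rv)
  (sl_coroots hs rS Sinj Sim hP Scl hav) (sl_bourbaki hs rS hav r0) pr2 n U rU
  (Uholo_irreducible hg) ComplexType (Uholo_type hg) (eps hs rS 0) (- eps hs rS ord_max)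
  (eps_highest_weight hs rS Sinj Sim hP Scl rv) (eps_max_highest_weight hs rS Sinj Sim hP Scl rv)
  sl_c UE' pr3 pr4.
have labE (i : 'I_r) : (label rv i == 0 :> nat) = (i.+1 == (if rv then r else 1)%N :> nat).
  exact: label_eq0.
exists D; split; [split|split=> //].
- exact: (gl_simple r0 clL rU Uinj Uonto).
- rewrite /= add_lfunE opp_lfunE muE mu'E opprB addrA subrK.
  by field.
- exact: (gl_iso clL rU Uinj Uonto).
- by move=> j; rewrite /= aE labE.
- move=> j; rewrite /= epsE hav -labE -!val_eqE /= subr0 eq_sym.
  by [].
Qed.

End UnitaryDatum.

Lemma tuples_occur (R : realType) r : (1 <= r)%N ->
     (exists D : hodge_datum R, simple_level_one D /\ has_sl_tuple D r 1) /\
     (exists D : hodge_datum R, simple_level_one D /\ has_sl_tuple D r r).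
Proof. by move=> r0; split; [exact: (unitary_datum R false)|exact: (unitary_datum R true)]. Qed.

(** * The classification *)

Theorem proposition3p3 (R : realType) :
  (* the Hodge representations with h_phi = (1,a,a,1) are exactly those with
     tuple (1) or (2) *)
  (forall D : hodge_datum R, simple_level_one D ->
     (exists a : nat, (0 < a)%N /\ hodge_numbers (hd_E D) 1 a a 1) <->
     (exists r : nat, (1 <= r)%N /\ (has_sl_tuple D r 1 \/ has_sl_tuple D r r)))
  /\
  (* the description of family (1) *)
  (forall (D : hodge_datum R) (r : nat), simple_level_one D -> (1 <= r)%N ->
     has_sl_tuple D r 1 ->
     [/\ hodge_numbers (hd_E D) 1 r r 1,
         hodge_numbers (hd_U D (hd_E D)) 1 r 0 0,
         hodge_numbers (dual_rep (hd_U D) (hd_E D)) 0 0 r 1,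
         iso_su (derived (hd_g D)) 1 r &
         sl_tuple_types D r])
  /\
  (* the description of family (2) *)
  (forall (D : hodge_datum R) (r : nat), simple_level_one D -> (1 <= r)%N ->
     has_sl_tuple D r r ->
     [/\ hodge_numbers (hd_E D) 1 r r 1,
         iso_su (derived (hd_g D)) r 1 &
         sl_tuple_types D r])
  /\
  (* every tuple in the list occurs *)
  (forall r : nat, (1 <= r)%N ->
     (exists D : hodge_datum R, simple_level_one D /\ has_sl_tuple D r 1) /\
     (exists D : hodge_datum R, simple_level_one D /\ has_sl_tuple D r r)).
Proof.
have types (D : hodge_datum R) (r k : nat) : simple_level_one D -> (1 <= r)%N ->
    has_sl_tuple D r k -> sl_tuple_types D r.
  move=> hD r1 ht; split; first exact: complex_type ht.
  case: (ltngtP r 1) => [|r2|re]; first by rewrite ltnNge r1.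
    exact: (ss_type_complex hD ht).
  by rewrite re in ht; exact: (ss_type_real hD ht).
split; [|split; [|split]].
- move=> D hD; split=> [[a [a0 ha]]|[r [r1 ht]]]; first exact: tuple_of_hodge_numbers ha.
  exists r; split=> //.
  by case: ht => ht; case: (hodge_numbers_of_tuple hD ht).
- move=> D r hD r1 ht; have [h1 h2 h3] := hodge_numbers_of_tuple hD ht.
  by split=> //; [apply: iso_su_1r ht|apply: types ht].
- move=> D r hD r1 ht; have [h1 _ _] := hodge_numbers_of_tuple hD ht.
  by split=> //; [apply: iso_su_r1 ht|apply: types ht].
exact: tuples_occur.
Qed.
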